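(* Let $H$ be a logarithmic neighborhood of $-\infty$ of type $(a,k)$ contained in $\{\mathrm{Re}(w)\le -1\}$ and let $g\in E_0(H)$. The series $$I_1^{\Delta}(\mathcal Lg,e^{wt}):=\sum_{n=0}^{\infty}(-1)^{n+3}\int_{t_n}^{t_{n+1}}\varphi_{n+3}(t)\,w^{n+3}e^{wt}\,dt+\sum_{n=1}^{\infty}(-1)^{n+3}\varphi_{n+3}(t_n)\,w^{n+2}e^{wt_n},\qquad t_n=\frac{n-0.5}{k},$$ converges normally in a logarithmic neighborhood $H'$ of $-\infty$, and for every $w\in H'$ we have $$\mathcal L^{-1}\mathcal Lg(w)=\frac{1}{2i\pi}I_1^{\Delta}(\mathcal Lg,e^{wt}).$$
   Context: Notation. $\mathbb R^+=[0,\infty)$, $R(w_0,v)=\{w_0+tv:t\ge0\}$, $C_-(w_0,\theta)=w_0-\{w\in\mathbb C^*:|\mathrm{Arg}(w)|<\theta\}$. A neighborhood of $-\infty$ is a set $H\subset\mathbb C$ such that for every $\theta\in[0,\pi/2[$ there is $w_0\in H$ with $C_-(w_0,\theta)\subset H$, and such that $H=\bigcup_{w_0\in H\cap\mathbb R}C_-(w_0,\theta(w_0))$, where $\theta(w_0)\le\pi/2$ is the biggest angle with $C_-(w_0,\theta(w_0))\subset H$. Its border has the form $\{x+iy:x=\rho(|y|)\}$ with $\rho$ convex on $\mathbb R^+$. It is called logarithmic of type $(a,k)$, $a\in\mathbb R$, $k>0$, if $\rho(y)=a-k\log(y)$ for $y$ big enough; a neighborhood containing a logarithmic one is also regarded as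 logarithmic (by restriction). $E_0(H)$ is the space of bounded holomorphic functions on $H$ extending continuously to the border. Laplace transform. Fix a real base point $w_0\in H$. For $g\in E_0(H)$, $\mathcal Lg=\mathcal L_{w_0}g\in\mathcal O(\mathbb C\setminus\mathbb R^+)$ is defined by $\mathcal L_{w_0}g(p)=\int_{w_0}^{w_1}g(w)e^{-pw}dw+\int_{R(w_1,v)}g(w)e^{-pw}dw$ for any ray $R(w_1,v)\subset\overline H$ with $\mathrm{Re}(v)<0$, $\mathrm{Re}(pv)>0$ (independent of $w_1,v$). Inverse Laplace transform: $\mathcal L^{-1}h(w)=\frac{1}{2i\pi}\int_{\gamma_{\varepsilon,v}}h(p)e^{pw}dp$, where $\gamma_{\varepsilon,v}=R(-\varepsilon,v)\cup R(-\varepsilon,\bar v)$, $\varepsilon>0$, $\mathrm{Arg}(v)\in\,]0,\pi/2]$, oriented downwards (coming in along $R(-\varepsilon,v)$, going out along $R(-\varepsilon,\bar v)$); it does not depend on $\varepsilon,v$ and is defined on the union of the domains obtained by varying them. Primitives. For a function $h$ on $\mathbb C\setminus\mathbb R^+$ with exponential decay as $\mathrm{Re}(p)\to-\infty$, $Ih$ is its primitive tending to $0$ as $\mathrm{Re}(p)\to-\infty$; $I^n$ is the $n$-th iterate. The function $I^n\mathcal Lg$ extends continuously to the real interval $[0,(n-2)/k]$ from above and from below (from $\mathrm{Im}(p)>0$ and $\mathrm{Im}(p)<0$), the extensions being denoted $(I^n\mathcal Lg)^+$ and $(I^n\mathcal Lg)^-$. Put $\varphi_n(t)=(I^n\mathcal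 Lg)^-(t)-(I^n\mathcal Lg)^+(t)$ for $t\in[0,(n-2)/k]$, and $\varphi_n(t)=0$ for $t<0$ (where $I^n\mathcal Lg$ is holomorphic). *)

(* Defs.v *)
From Stdlib Require Import Reals Lra ClassicalEpsilon.
From Coquelicot Require Import Coquelicot.
Open Scope R_scope.
Open Scope C_scope.

Definition Cexp (z : C) : C :=
  (exp (Re z) * cos (Im z), exp (Re z) * sin (Im z))%R.

(* Principal argument, in ]-PI, PI]; only meaningful for z <> 0. *)
Definition Carg (z : C) : R :=
  if Rle_dec 0 (Im z) then acos (Re z / Cmod z) else (- acos (Re z / Cmod z))%R.

Definition closureC (A : C -> Prop) (z : C) : Prop :=
  forall U : C -> Prop, locally z U -> exists w, U w /\ A w.

Definition borderC (A : C -> Prop) (z : C) : Prop :=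
  closureC A z /\ closureC (fun w => ~ A w) z.

(* The complex plane minus [0, +oo[. *)
Definition slit (p : C) : Prop := ~ (Im p = 0%R /\ (0 <= Re p)%R).

(** * Neighborhoods of minus infinity *)

(* C_-(w0, theta); the vertex w0 is excluded. *)
Definition Cminus (w0 : C) (theta : R) (z : C) : Prop :=
  w0 - z <> 0 /\ (Rabs (Carg (w0 - z)) < theta)%R.

Definition incl (A B : C -> Prop) : Prop := forall z, A z -> B z.

Definition biggest_angle (H : C -> Prop) (w0 : C) (theta : R) : Prop :=
  (0 <= theta <= PI / 2)%R /\ incl (Cminus w0 theta) H /\
  forall theta', (0 <= theta' <= PI / 2)%R -> incl (Cminus w0 theta') H ->
    (theta' <= theta)%R.

Definition nbhd_minfty (H : C -> Prop) : Prop :=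
  (forall theta, (0 <= theta < PI / 2)%R ->
     exists w0, H w0 /\ incl (Cminus w0 theta) H) /\
  (forall z, H z <->
     exists (w0 : R) (theta : R),
       H w0 /\ biggest_angle H w0 theta /\ Cminus w0 theta z).

Definition convex_Rplus (rho : R -> R) : Prop :=
  forall x y s, (0 <= x)%R -> (0 <= y)%R -> (0 <= s <= 1)%R ->
    (rho (s * x + (1 - s) * y) <= s * rho x + (1 - s) * rho y)%R.

Definition exact_log_nbhd (a k : R) (H : C -> Prop) : Prop :=
  nbhd_minfty H /\ (0 < k)%R /\
  exists rho : R -> R,
    convex_Rplus rho /\
    (forall z, borderC H z <-> Re z = rho (Rabs (Im z))) /\
    exists Y, (0 < Y)%R /\
      forall y, (Y <= y)%R -> rho y = (a - k * ln y)%R.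

(* A neighborhood containing a logarithmic one counts as logarithmic too. *)
Definition log_nbhd (a k : R) (H : C -> Prop) : Prop :=
  nbhd_minfty H /\ exists H0, exact_log_nbhd a k H0 /\ incl H0 H.

(* Bounded holomorphic functions on H with a continuous extension to the border:
   the values of g on the border are those of the extension, and its values
   outside the closure of H are irrelevant. *)
Definition E0 (H : C -> Prop) (g : C -> C) : Prop :=
  (forall z, H z -> ex_derive (K := C_AbsRing) (V := C_NormedModule) g z) /\
  (exists M : R, forall z, H z -> (Cmod (g z) <= M)%R) /\
  (forall z, closureC H z ->
     filterlim g (within H (locally z)) (locally (g z))).

(** * Laplace transform *)

Definition seg_int (f : C -> C) (z1 z2 : C) : C :=
  RInt (V := C_R_CompleteNormedModule)
    (fun t => (z2 - z1) * f (z1 + RtoC t * (z2 - z1))) 0 1.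

(* l is the (improper, convergent) integral of f over the ray R(z, v),
   oriented from z to infinity. *)
Definition is_ray_int (f : C -> C) (z v l : C) : Prop :=
  is_RInt_gen (V := C_R_NormedModule)
    (fun t => v * f (z + RtoC t * v)) (at_point 0%R) (Rbar_locally p_infty) l.

(* The path from w0 to w1 is w0 -> Re w1 -> w1: it stays in the closure of H
   (which is invariant under translation to the left and under moving
   vertically towards the real axis), whereas the segment [w0, w1] need not. *)
Definition is_laplace (H : C -> Prop) (w0 : R) (g : C -> C) (p l : C) : Prop :=
  exists w1 v l2 : C,
    (forall t : R, (0 <= t)%R -> closureC H (w1 + RtoC t * v)) /\
    (Re v < 0)%R /\ (0 < Re (p * v))%R /\
    is_ray_int (fun w => g w * Cexp (- (p * w))) w1 v l2 /\
    l = seg_int (fun w => g w * Cexp (- (p * w))) w0 (RtoC (Re w1))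
        + seg_int (fun w => g w * Cexp (- (p * w))) (RtoC (Re w1)) w1
        + l2.

Definition laplace (H : C -> Prop) (w0 : R) (g : C -> C) (p : C) : C :=
  epsilon (inhabits (RtoC 0)) (is_laplace H w0 g p).

(** * Inverse Laplace transform *)

Definition is_gamma_int (eps : R) (v : C) (h : C -> C) (w l : C) : Prop :=
  exists lin lout : C,
    is_ray_int (fun p => h p * Cexp (p * w)) (RtoC (- eps)) v lin /\
    is_ray_int (fun p => h p * Cexp (p * w)) (RtoC (- eps)) (Cconj v) lout /\
    l = (lout - lin) / (2 * Ci * PI).

Definition gamma_adm (eps : R) (v : C) : Prop :=
  (0 < eps)%R /\ v <> 0 /\ (0 < Carg v <= PI / 2)%R.

(* w is in the union of the domains attached to the contours, and l is the
   common value of the integrals over all contours on which they converge. *)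
Definition is_inv_laplace (h : C -> C) (w l : C) : Prop :=
  (exists eps v, gamma_adm eps v /\ is_gamma_int eps v h w l) /\
  (forall eps v l', gamma_adm eps v -> is_gamma_int eps v h w l' -> l' = l).

(** * Primitives and their jump across the cut *)

Definition is_prim_minfty (h h1 : C -> C) : Prop :=
  (forall p, slit p ->
     is_derive (K := C_AbsRing) (V := C_NormedModule) h1 p (h p)) /\
  (forall e : R, (0 < e)%R -> exists A : R,
     forall p, slit p -> (Re p < A)%R -> (Cmod (h1 p) < e)%R).

Definition prim (h : C -> C) : C -> C :=
  epsilon (inhabits (fun _ : C => RtoC 0)) (is_prim_minfty h).

Definition prim_iter (n : nat) (h : C -> C) : C -> C := Nat.iter n prim h.

Definition bv_above (F : C -> C) (t : R) : C :=
  epsilon (inhabits (RtoC 0)) (fun l =>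
    filterlim F (within (fun p => (0 < Im p)%R) (locally (RtoC t))) (locally l)).

Definition bv_below (F : C -> C) (t : R) : C :=
  epsilon (inhabits (RtoC 0)) (fun l =>
    filterlim F (within (fun p => (Im p < 0)%R) (locally (RtoC t))) (locally l)).

(* The boundary values are only used for t <= (n-2)/k. *)
Definition phi (h : C -> C) (n : nat) (t : R) : C :=
  if Rlt_dec t 0 then 0
  else bv_below (prim_iter n h) t - bv_above (prim_iter n h) t.

(** * The series *)

Definition tn (k : R) (n : nat) : R := ((INR n - / 2) / k)%R.

Definition int_term (k : R) (h : C -> C) (n : nat) (w : C) : C :=
  RtoC (-1) ^ (n + 3) *
  RInt (V := C_R_CompleteNormedModule)
    (fun t => phi h (n + 3) t * w ^ (n + 3) * Cexp (w * RtoC t))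
    (tn k n) (tn k (S n)).

Definition jump_term (k : R) (h : C -> C) (n : nat) (w : C) : C :=
  RtoC (-1) ^ (n + 3) * phi h (n + 3) (tn k n) * w ^ (n + 2)
  * Cexp (w * RtoC (tn k n)).

Definition converges_normally (D : C -> Prop) (u : nat -> C -> C) : Prop :=
  exists M : nat -> R, ex_series M /\
    forall n w, D w -> (Cmod (u n w) <= M n)%R.

(* The second sum starts at n = 1. *)
Definition is_I1_Delta (k : R) (h : C -> C) (w s : C) : Prop :=
  exists s1 s2 : C,
    is_series (K := C_AbsRing) (V := C_NormedModule)
      (fun n => int_term k h n w) s1 /\
    is_series (K := C_AbsRing) (V := C_NormedModule)
      (fun n => jump_term k h (S n) w) s2 /\
    s = s1 + s2.

(* Main.v *)
(* Write c for the curve x = w0 - (k/2) ln(1 + sl^2 y^2); for sl large it lies in H. On either side of the cut the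
   Laplace transform is an integral over one branch of c, so I^n (L g) is the transform of g(z) (-z)^(-n); the decay
   |z|^(-n) compensates e^(-tz) for t < n/k, and phi_n(t) is the difference of the two branch integrals. With
   q_m(z) = g(z) (w/z)^m / (w - z) and Psi_m(t) the difference of the branch integrals of q_m(z) e^(t (w - z)), one has
   Psi_m' = (-1)^m w^m e^(tw) phi_m and Psi_(m+1) - Psi_m = (-1)^(m+1) w^m e^(tw) phi_(m+1); hence the two series
   together telescope to - Psi_3(0). Their terms decay geometrically where |w|^4 e^(Re w / (2k)) is small, which holds
   on a logarithmic neighborhood of type 16 k. Only Psi_3(0) needs another bound: Cauchy's theorem trades its kernel
   for a Poisson kernel.

   For the inverse transform, L g(p) e^(pw) has on each side of the cut an explicit primitive, a branch integral of
   q_0(z) e^(p (w - z)). If it tends to a limit l along a ray of direction v from p_1, then l = 0: its Laplace transform in the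
   ray parameter has the pole l/sigma at 0, but continues analytically along ]0, +oo[ to the integral of
   q_0(z) e^(p_1 (w - z)) / (sigma - v (w - z)), which is bounded there because v (w - z) stays away from [0, +oo[. So the
   ray integrals are values of the primitives at - eps, and their difference is the constant - Psi_3(0). *)

Require Import Defs.
From Stdlib Require Import Reals Lra Lia Psatz ClassicalEpsilon Factorial.
From Coquelicot Require Import Coquelicot.
Open Scope R_scope.
Open Scope C_scope.

(** * Complex-valued calculus *)

(** The whole proof lives on a budget of decay. On the branches e^(-tz) z^(-n) has size y^(kt - n),
    and absolute convergence asks for y^(-5/4); a Lipschitz estimate up to the cut costs one more
    power, and 1/4 pays for a margin 1/(4k) to the right of t. Hence the condition kt <= n - 5/2 on
    phi_n, which the t_n meet exactly: k t_(n+1) = (n + 3) - 5/2. Normal convergence wants bounds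
    uniform in w. At t_(j+1) = (2j + 1)/(2k) only indices m <= j + 4 <= 4 (2j + 1) occur, so |w|^m
    e^(t Re w) is at most the power 2j + 1 of |w|^4 e^(Re w / (2k)). On a neighborhood of type 16 k,
    |w|^4 uses up only half of that exponential. At t = 0 there is no exponential to pay for |w|^3,
    which singles out Psi_3(0). The value of the inverse transform is prescribed for every contour
    on which the integral converges, possibly only conditionally. Estimates on a well chosen contour
    therefore do not suffice: the limit of the primitive must be found from its mere existence. Two
    forms of that primitive are kept, one with kernel q_3 that reaches the real point - eps, and one
    with q_0 that is a single integral. *)

Lemma exp_le (x y : R) : (x <= y)%R -> (exp x <= exp y)%R.
Proof. intros [H| ->]; [left; now apply exp_increasing|apply Rle_refl]. Qed.

Lemma Cexp_add (z1 z2 : C) : Cexp (z1 + z2) = Cexp z1 * Cexp z2.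
Proof.
  destruct z1 as [x1 y1], z2 as [x2 y2].
  unfold Cexp, Cmult, Cplus, Re, Im; simpl. rewrite exp_plus, cos_plus, sin_plus.
  apply injective_projections; simpl; ring.
Qed.

Lemma Cexp_0 : Cexp 0 = 1.
Proof. unfold Cexp; simpl. rewrite exp_0, cos_0, sin_0. apply injective_projections; simpl; ring. Qed.

Lemma Cadd_sub (z y : C) : z + (y - z) = y.
Proof. ring. Qed.

Lemma Cadd_sub' (z h : C) : z + h - z = h.
Proof. ring. Qed.

Lemma Cmod_Cexp (z : C) : Cmod (Cexp z) = exp (Re z).
Proof.
  unfold Cmod, Cexp; simpl.
  replace (_ + _)%R with (exp (Re z) * exp (Re z) * ((sin (Im z))² + (cos (Im z))²))%R
    by (unfold Rsqr; ring).
  rewrite sin2_cos2, Rmult_1_r. apply sqrt_square, Rlt_le, exp_pos.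
Qed.

Lemma Im_le_Cmod (z : C) : (Rabs (Im z) <= Cmod z)%R.
Proof. eapply Rle_trans; [|apply Rmax_Cmod]. apply Rmax_r. Qed.

Lemma Cmod_le_Re_Im (z : C) : (Cmod z <= Rabs (Re z) + Rabs (Im z))%R.
Proof.
  replace z with (RtoC (Re z) + Ci * RtoC (Im z)) at 1.
  - eapply Rle_trans; [apply Cmod_triangle|].
    rewrite Cmod_mult, Cmod_Ci, !Cmod_R. lra.
  - destruct z; unfold RtoC, Ci, Cplus, Cmult; simpl; apply injective_projections; simpl; ring.
Qed.

Lemma Cmod_sub_sym (x y : C) : Cmod (x - y) = Cmod (y - x).
Proof. rewrite <- Cmod_opp. f_equal. ring. Qed.

Lemma Cmod_triangle_sub (x y z : C) : (Cmod (x - z) <= Cmod (x - y) + Cmod (y - z))%R.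
Proof. replace (x - z) with ((x - y) + (y - z)) by ring. apply Cmod_triangle. Qed.

Lemma Cmod_triangle4 (a b c d : C) :
  (Cmod (a + b + c + d) <= Cmod a + Cmod b + Cmod c + Cmod d)%R.
Proof.
  pose proof (Cmod_triangle (a + b + c) d). pose proof (Cmod_triangle (a + b) c).
  pose proof (Cmod_triangle a b). lra.
Qed.

Lemma Cmod_triangle_rev (x y : C) : (Cmod x - Cmod y <= Cmod (x - y))%R.
Proof. generalize (Cmod_triangle (x - y) y). replace (x - y + y) with x by ring. lra. Qed.

(** Continuity and derivatives are stated with [Cmod], because C carries several module structures
    whose derivatives are distinct terms ([C_R_NormedModule], [C_NormedModule],
    [AbsRing_NormedModule C_AbsRing]); all of them are reached from this one form. *)
Definition ccont (F : R -> C) (t : R) : Prop :=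
  forall e, (0 < e)%R -> exists d, (0 < d)%R /\
    forall t', (Rabs (t' - t) < d)%R -> (Cmod (F t' - F t) < e)%R.

Definition deriv_RC (F : R -> C) (t : R) (l : C) : Prop :=
  forall e, (0 < e)%R -> exists d, (0 < d)%R /\
    forall h, (Rabs h < d)%R -> (Cmod (F (t + h)%R - F t - RtoC h * l) <= e * Rabs h)%R.

Definition contCC (f : C -> C) (z : C) : Prop :=
  forall e, (0 < e)%R -> exists d, (0 < d)%R /\
    forall z', (Cmod (z' - z) < d)%R -> (Cmod (f z' - f z) < e)%R.

Definition deriv_CC (f : C -> C) (z l : C) : Prop :=
  forall e, (0 < e)%R -> exists d, (0 < d)%R /\
    forall h, (Cmod h < d)%R -> (Cmod (f (z + h)%C - f z - h * l) <= e * Cmod h)%R.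

Lemma ball_Cmod (x y : C) (e : R) : ball x e y -> (Cmod (y - x) < 2 * e)%R.
Proof.
  intros [H1 H2]. eapply Rle_lt_trans; [apply Cmod_le_Re_Im|].
  unfold ball in H1, H2; simpl in H1, H2; unfold AbsRing_ball, abs, minus, plus, opp in H1, H2; simpl in *.
  unfold Re, Im. simpl. lra.
Qed.

Lemma Cmod_ball (x y : C) (e : R) : (Cmod (y - x) < e)%R -> ball x e y.
Proof.
  intros H. apply C_NormedModule_mixin_compat1. exact H.
Qed.

Lemma locally_C_iff (z : C) (P : C -> Prop) :
  locally z P <-> exists d, (0 < d)%R /\ forall z', (Cmod (z' - z) < d)%R -> P z'.
Proof.
  split.
  - intros [d Hd]. exists d. split; [apply cond_pos|]. intros z' Hz'.
    apply Hd, Cmod_ball, Hz'.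
  - intros (d & Hd & H). exists (mkposreal (d / 2) (Rdiv_lt_0_compat _ _ Hd Rlt_0_2)).
    intros y Hy. apply H. apply ball_Cmod in Hy. simpl in Hy. lra.
Qed.

Lemma filterlim_C_iff {T} (F : (T -> Prop) -> Prop) {FF : Filter F} (f : T -> C) (l : C) :
  filterlim f F (locally l) <-> forall e, (0 < e)%R -> F (fun x => (Cmod (f x - l) < e)%R).
Proof.
  split.
  - intros H e He. specialize (H (fun y => (Cmod (y - l) < e)%R)). apply H.
    apply locally_C_iff. now exists e.
  - intros H P HP. apply locally_C_iff in HP as (d & Hd & HP).
    unfold filtermap. eapply filter_imp; [|apply (H d Hd)]. simpl; intros x Hx; auto.
Qed.

Lemma ccont_continuous (F : R -> C) t :
  ccont F t <-> continuous (T := R_UniformSpace) (U := C_UniformSpace) F t.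
Proof.
  split; intros H.
  - apply (filterlim_C_iff (locally t) F). intros e He. destruct (H e He) as (d & Hd & H').
    exists (mkposreal d Hd). intros y Hy. apply H'. exact Hy.
  - intros e He. apply (filterlim_C_iff (locally t) F) with (e := e) in H; [|exact He].
    destruct H as [d Hd]. exists d. split; [apply cond_pos|]. intros t' Ht'. apply Hd. exact Ht'.
Qed.

Lemma deriv_RC_is_derive (F : R -> C) t l :
  deriv_RC F t l -> is_derive (K := R_AbsRing) (V := C_R_NormedModule) F t l.
Proof.
  intros H. split; [apply is_linear_scal_l|].
  intros x Hx. apply (is_filter_lim_locally_unique (K := R_AbsRing) (V := R_NormedModule)) in Hx. subst x.
  intros e. destruct (H e (cond_pos e)) as (d & Hd & H').
  exists (mkposreal d Hd). intros y Hy.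
  specialize (H' (y - t)%R Hy). rewrite Rplus_minus in H'.
  unfold norm at 1; simpl. unfold prod_norm; simpl.
  change (Rabs (y - t)) with (norm (minus y t)) in H'.
  eapply Rle_trans; [|exact H']. apply Req_le.
  unfold Cmod. apply f_equal. unfold norm; simpl. unfold abs; simpl.
  rewrite !Rmult_1_r, <- !Rabs_mult. rewrite !Rabs_pos_eq by apply Rle_0_sqr.
  unfold minus, plus, opp, scal, mult; simpl. unfold prod_plus, prod_opp, prod_scal; simpl.
  unfold scal, plus, opp, mult; simpl. unfold mult; simpl. ring.
Qed.

Lemma is_derive_deriv_RC (F : R -> C) t l :
  is_derive (fun t => Re (F t)) t (Re l) -> is_derive (fun t => Im (F t)) t (Im l) ->
  deriv_RC F t l.
Proof.
  intros H1 H2 e He.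
  assert (Hp : (0 < e / 2)%R) by lra.
  destruct H1 as [_ H1]. destruct H2 as [_ H2].
  specialize (H1 t (fun P H => H) (mkposreal _ Hp)).
  specialize (H2 t (fun P H => H) (mkposreal _ Hp)).
  destruct (filter_and _ _ H1 H2) as [d Hd]. exists d. split; [apply cond_pos|].
  intros h Hh. destruct (Hd (t + h)%R) as [A1 A2].
  { unfold ball; simpl; unfold AbsRing_ball, abs, minus, plus, opp; simpl.
    replace (t + h + - t)%R with h by ring. exact Hh. }
  unfold norm, minus, plus, opp, scal, mult in A1, A2; simpl in A1, A2.
  unfold abs, mult in A1, A2; simpl in A1, A2.
  replace (t + h + - t)%R with h in * by ring.
  eapply Rle_trans; [apply Cmod_le_Re_Im|].
  replace (Re (F (t + h)%R - F t - RtoC h * l)) with (Re (F (t + h)%R) + - Re (F t) + - (h * Re l))%R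
    by (unfold Re; simpl; ring).
  replace (Im (F (t + h)%R - F t - RtoC h * l)) with (Im (F (t + h)%R) + - Im (F t) + - (h * Im l))%R
    by (unfold Im; simpl; ring).
  lra.
Qed.

Lemma deriv_CC_is_derive (f : C -> C) z l :
  is_derive (K := C_AbsRing) (V := C_NormedModule) f z l <-> deriv_CC f z l.
Proof.
  split.
  - intros [_ H] e He.
    specialize (H z (fun P H => H) (mkposreal _ He)).
    apply locally_C, locally_C_iff in H. destruct H as (d & Hd & H).
    exists d. split; auto. intros h Hh.
    specialize (H (z + h)). rewrite Cadd_sub' in H. specialize (H Hh). unfold norm, minus, plus, opp, scal, mult in H; simpl in H.
    unfold abs, mult in H; simpl in H.
    replace (z + h + - z) with h in H by ring. exact H.
  - intros H. split; [apply is_linear_scal_l|].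
    intros x Hx. apply (is_filter_lim_locally_unique (K := C_AbsRing) (V := AbsRing_NormedModule C_AbsRing)) in Hx. subst x.
    intros e. destruct (H e (cond_pos e)) as (d & Hd & H').
    apply locally_C, locally_C_iff. exists d. split; auto. intros y Hy.
    specialize (H' (y - z) Hy). rewrite Cadd_sub in H'.
    unfold norm, minus, plus, opp, scal, mult; simpl. unfold abs, mult; simpl. exact H'.
Qed.

Lemma deriv_CC_is_derive_abs (f : C -> C) z l :
  is_derive (K := C_AbsRing) (V := AbsRing_NormedModule C_AbsRing) f z l <-> deriv_CC f z l.
Proof.
  split.
  - intros [_ H] e He.
    specialize (H z (fun P H => H) (mkposreal _ He)).
    apply locally_C, locally_C_iff in H. destruct H as (d & Hd & H).
    exists d. split; auto. intros h Hh.
    specialize (H (z + h)). rewrite Cadd_sub' in H. specialize (H Hh). unfold norm, minus, plus, opp, scal, mult in H; simpl in H.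
    unfold abs, mult in H; simpl in H.
    replace (z + h + - z) with h in H by ring. exact H.
  - intros H. split; [apply is_linear_scal_l|].
    intros x Hx. apply (is_filter_lim_locally_unique (K := C_AbsRing) (V := AbsRing_NormedModule C_AbsRing)) in Hx. subst x.
    intros e. destruct (H e (cond_pos e)) as (d & Hd & H').
    apply locally_C, locally_C_iff. exists d. split; auto. intros y Hy.
    specialize (H' (y - z) Hy). rewrite Cadd_sub in H'.
    unfold norm, minus, plus, opp, scal, mult; simpl. unfold abs, mult; simpl. exact H'.
Qed.

Lemma deriv_RC_cont F t l : deriv_RC F t l -> ccont F t.
Proof.
  intros H e He. destruct (H 1%R Rlt_0_1) as (d & Hd & H').
  assert (HL : (0 < Cmod l + 1)%R) by (generalize (Cmod_ge_0 l); lra).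
  exists (Rmin d (e / (Cmod l + 1 + 1)))%R. split.
  - apply Rmin_glb_lt; [lra|]. apply Rdiv_lt_0_compat; lra.
  - intros t' Ht'. specialize (H' (t' - t)%R (Rlt_le_trans _ _ _ Ht' (Rmin_l _ _))).
    replace (t + (t' - t))%R with t' in H' by ring.
    pose proof (Rlt_le_trans _ _ _ Ht' (Rmin_r _ _)) as H2.
    apply (Rmult_lt_compat_r (Cmod l + 1 + 1)) in H2; [|lra].
    unfold Rdiv in H2. rewrite Rmult_assoc, Rinv_l, Rmult_1_r in H2 by lra.
    replace (F t' - F t) with ((F t' - F t - RtoC (t' - t) * l) + RtoC (t' - t) * l) by ring.
    eapply Rle_lt_trans; [apply Cmod_triangle|]. rewrite Cmod_mult, Cmod_R.
    generalize (Rabs_pos (t' - t)). nra.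
Qed.

Lemma deriv_CC_cont f z l : deriv_CC f z l -> contCC f z.
Proof.
  intros H e He. destruct (H 1%R Rlt_0_1) as (d & Hd & H').
  assert (HL : (0 < Cmod l + 1)%R) by (generalize (Cmod_ge_0 l); lra).
  exists (Rmin d (e / (Cmod l + 1 + 1)))%R. split.
  - apply Rmin_glb_lt; [lra|]. apply Rdiv_lt_0_compat; lra.
  - intros t' Ht'. specialize (H' (t' - z) (Rlt_le_trans _ _ _ Ht' (Rmin_l _ _))).
    replace (z + (t' - z)) with t' in H' by ring.
    pose proof (Rlt_le_trans _ _ _ Ht' (Rmin_r _ _)) as H2.
    apply (Rmult_lt_compat_r (Cmod l + 1 + 1)) in H2; [|lra].
    unfold Rdiv in H2. rewrite Rmult_assoc, Rinv_l, Rmult_1_r in H2 by lra.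
    replace (f t' - f z) with ((f t' - f z - (t' - z) * l) + (t' - z) * l) by ring.
    eapply Rle_lt_trans; [apply Cmod_triangle|]. rewrite Cmod_mult.
    generalize (Cmod_ge_0 (t' - z)). nra.
Qed.

Lemma ccont_const c t : ccont (fun _ => c) t.
Proof. intros e He. exists 1%R. split; [lra|]. intros. replace (c - c) with (RtoC 0) by ring. now rewrite Cmod_0. Qed.

Lemma ccont_RtoC r t : continuity_pt r t -> ccont (fun t => RtoC (r t)) t.
Proof.
  intros H e He. destruct (H e He) as (d & Hd & H'). exists d. split; auto.
  intros t' Ht'. rewrite <- RtoC_minus, Cmod_R.
  destruct (Req_dec t' t) as [->|Hn]; [rewrite Rminus_diag, Rabs_R0; lra|].
  apply H'. split; [split; [exact I|congruence]|exact Ht'].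
Qed.

Lemma ccont_plus F G t : ccont F t -> ccont G t -> ccont (fun t => F t + G t) t.
Proof.
  intros H1 H2 e He. destruct (H1 (e/2)%R) as (d1 & Hd1 & K1); [lra|].
  destruct (H2 (e/2)%R) as (d2 & Hd2 & K2); [lra|].
  exists (Rmin d1 d2). split; [now apply Rmin_glb_lt|]. intros t' Ht'.
  specialize (K1 t' (Rlt_le_trans _ _ _ Ht' (Rmin_l _ _))).
  specialize (K2 t' (Rlt_le_trans _ _ _ Ht' (Rmin_r _ _))).
  replace (F t' + G t' - (F t + G t)) with ((F t' - F t) + (G t' - G t)) by ring.
  eapply Rle_lt_trans; [apply Cmod_triangle|]. lra.
Qed.

Lemma ccont_mult F G t : ccont F t -> ccont G t -> ccont (fun t => F t * G t) t.
Proof.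
  intros H1 H2 e He.
  pose (A := (Cmod (F t) + Cmod (G t) + 1)%R).
  assert (HA : (1 <= A)%R) by (unfold A; generalize (Cmod_ge_0 (F t)) (Cmod_ge_0 (G t)); lra).
  pose (r := Rmin 1 (e / (2 * A))).
  assert (Hr : (0 < r)%R) by (apply Rmin_glb_lt; [lra|apply Rdiv_lt_0_compat; lra]).
  destruct (H1 r Hr) as (d1 & Hd1 & K1). destruct (H2 r Hr) as (d2 & Hd2 & K2).
  exists (Rmin d1 d2). split; [now apply Rmin_glb_lt|]. intros t' Ht'.
  specialize (K1 t' (Rlt_le_trans _ _ _ Ht' (Rmin_l _ _))).
  specialize (K2 t' (Rlt_le_trans _ _ _ Ht' (Rmin_r _ _))).
  replace (F t' * G t' - F t * G t)
    with ((F t' - F t) * (G t' - G t) + (F t' - F t) * G t + F t * (G t' - G t)) by ring.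
  eapply Rle_lt_trans; [apply Cmod_triangle|].
  eapply Rle_lt_trans; [apply Rplus_le_compat_r, Cmod_triangle|].
  rewrite !Cmod_mult.
  assert (R1 : (r <= 1)%R) by apply Rmin_l.
  assert (R2 : (r * (2 * A) <= e)%R).
  { eapply Rle_trans; [apply Rmult_le_compat_r; [lra|apply Rmin_r]|]. right. field. lra. }
  generalize (Cmod_ge_0 (F t)) (Cmod_ge_0 (G t)) (Cmod_ge_0 (F t' - F t)) (Cmod_ge_0 (G t' - G t)).
  intros. unfold A in *.
  assert (Cmod (F t' - F t) * Cmod (G t' - G t) <= r * 1)%R by (apply Rmult_le_compat; lra).
  assert (Cmod (F t' - F t) * Cmod (G t) <= r * Cmod (G t))%R by (apply Rmult_le_compat_r; lra).
  assert (Cmod (F t) * Cmod (G t' - G t) <= Cmod (F t) * r)%R by (apply Rmult_le_compat_l; lra).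
  nra.
Qed.

Lemma ccont_comp (f : C -> C) F t : ccont F t -> contCC f (F t) -> ccont (fun t => f (F t)) t.
Proof.
  intros H1 H2 e He. destruct (H2 e He) as (d & Hd & K). destruct (H1 d Hd) as (d' & Hd' & K').
  exists d'. split; auto.
Qed.

Lemma ccont_opp F t : ccont F t -> ccont (fun t => - F t) t.
Proof.
  intros H e He. destruct (H e He) as (d & Hd & K). exists d; split; auto. intros t' Ht'.
  replace (- F t' - - F t) with (- (F t' - F t)) by ring. rewrite Cmod_opp. auto.
Qed.

Lemma ccont_minus F G t : ccont F t -> ccont G t -> ccont (fun t => F t - G t) t.
Proof. intros. apply ccont_plus; auto. now apply ccont_opp. Qed.

Lemma contCC_inv (z : C) : z <> 0 -> contCC Cinv z.
Proof.
  intros Hz e He. pose proof (proj1 (Cmod_gt_0 z) Hz) as Hm.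
  exists (Rmin (Cmod z / 2) (e * (Cmod z * Cmod z / 2)))%R. split.
  { apply Rmin_glb_lt; [lra|]. apply Rmult_lt_0_compat; [lra|]. nra. }
  intros z' Hz'.
  pose proof (Rlt_le_trans _ _ _ Hz' (Rmin_l _ _)) as H1.
  pose proof (Rlt_le_trans _ _ _ Hz' (Rmin_r _ _)) as H2.
  assert (H3 : (Cmod z / 2 < Cmod z')%R).
  { generalize (Cmod_triangle_rev z z'). rewrite Cmod_sub_sym. lra. }
  assert (Hz0 : z' <> 0) by (apply Cmod_gt_0; lra).
  replace (/ z' - / z) with (- (z' - z) * / (z' * z)) by (field; auto).
  rewrite Cmod_mult, Cmod_opp, Cmod_inv by (apply Cmult_neq_0; auto).
  rewrite Cmod_mult. apply (Rmult_lt_reg_r (Cmod z' * Cmod z)); [apply Rmult_lt_0_compat; lra|].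
  rewrite Rmult_assoc, Rinv_l, Rmult_1_r by (apply Rgt_not_eq, Rmult_lt_0_compat; lra).
  apply Rlt_le_trans with (1 := H2). apply Rmult_le_compat_l; [lra|]. nra.
Qed.

Lemma ccont_inv F t : ccont F t -> F t <> 0 -> ccont (fun t => / F t) t.
Proof. intros. apply (ccont_comp Cinv); auto. now apply contCC_inv. Qed.

Lemma ccont_pow F n t : ccont F t -> ccont (fun t => F t ^ n) t.
Proof. intros H. induction n; simpl. apply ccont_const. now apply ccont_mult. Qed.

Lemma ccont_ext F G t : (forall t, F t = G t) -> ccont F t -> ccont G t.
Proof. intros E H e He. destruct (H e He) as (d & Hd & K). exists d; split; auto. intros. rewrite <- !E. auto. Qed.

Lemma ccont_Re F t : ccont F t -> continuity_pt (fun t => Re (F t)) t.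
Proof.
  intros H e He. destruct (H e He) as (d & Hd & K). exists d. split; auto.
  intros x [_ Hx]. eapply Rle_lt_trans; [|apply (K x Hx)].
  unfold R_met, R_dist; simpl. unfold R_dist. change (Rabs (Re (F x - F t)) <= Cmod (F x - F t))%R.
  apply re_le_Cmod.
Qed.

Lemma deriv_RC_ext F G t l : (forall t, F t = G t) -> deriv_RC F t l -> deriv_RC G t l.
Proof. intros E H e He. destruct (H e He) as (d & Hd & K). exists d; split; auto. intros. rewrite <- !E. auto. Qed.

Lemma deriv_RC_plus F G t l m : deriv_RC F t l -> deriv_RC G t m -> deriv_RC (fun t => F t + G t) t (l + m).
Proof.
  intros H1 H2 e He. destruct (H1 (e/2)%R) as (d1 & Hd1 & K1); [lra|].
  destruct (H2 (e/2)%R) as (d2 & Hd2 & K2); [lra|].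
  exists (Rmin d1 d2). split; [now apply Rmin_glb_lt|]. intros t' Ht'.
  specialize (K1 t' (Rlt_le_trans _ _ _ Ht' (Rmin_l _ _))).
  specialize (K2 t' (Rlt_le_trans _ _ _ Ht' (Rmin_r _ _))).
  match goal with |- (Cmod ?X <= _)%R => replace X with
    ((F (t + t')%R - F t - RtoC t' * l) + (G (t + t')%R - G t - RtoC t' * m)) by ring end.
  eapply Rle_trans; [apply Cmod_triangle|]. lra.
Qed.

Lemma deriv_RC_scal c F t l : deriv_RC F t l -> deriv_RC (fun t => c * F t) t (c * l).
Proof.
  intros H e He. assert (HL : (0 < Cmod c + 1)%R) by (generalize (Cmod_ge_0 c); lra).
  destruct (H (e / (Cmod c + 1))%R) as (d & Hd & K); [apply Rdiv_lt_0_compat; lra|].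
  exists d; split; auto. intros h Hh. specialize (K h Hh).
  match goal with |- (Cmod ?X <= _)%R => replace X with
    (c * (F (t + h)%R - F t - RtoC h * l)) by ring end.
  rewrite Cmod_mult.
  apply Rle_trans with (Cmod c * (e / (Cmod c + 1) * Rabs h))%R.
  { apply Rmult_le_compat_l; auto. apply Cmod_ge_0. }
  apply Rle_trans with ((Cmod c + 1) * (e / (Cmod c + 1) * Rabs h))%R.
  { apply Rmult_le_compat_r; [|lra]. apply Rmult_le_pos; [|apply Rabs_pos].
    apply Rlt_le, Rdiv_lt_0_compat; lra. }
  right. field. lra.
Qed.

Lemma deriv_RC_mult F G t l m : deriv_RC F t l -> deriv_RC G t m ->
  deriv_RC (fun t => F t * G t) t (l * G t + F t * m).
Proof.
  intros H1 H2 e He.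
  pose proof (deriv_RC_cont _ _ _ H1) as C1.
  pose (A := (Cmod (F t) + Cmod (G t) + Cmod m + 1)%R).
  assert (HA : (1 <= A)%R) by (unfold A; generalize (Cmod_ge_0 (F t)) (Cmod_ge_0 (G t)) (Cmod_ge_0 m); lra).
  pose (r := Rmin 1 (e / (4 * A))).
  assert (Hr : (0 < r)%R) by (apply Rmin_glb_lt; [lra|apply Rdiv_lt_0_compat; lra]).
  assert (R1 : (r <= 1)%R) by apply Rmin_l.
  assert (R2 : (r * (4 * A) <= e)%R).
  { eapply Rle_trans; [apply Rmult_le_compat_r; [lra|apply Rmin_r]|]. right. field. lra. }
  destruct (H1 r Hr) as (d1 & Hd1 & K1). destruct (H2 r Hr) as (d2 & Hd2 & K2).
  destruct (C1 r Hr) as (d3 & Hd3 & K3).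
  exists (Rmin d1 (Rmin d2 d3)). split; [repeat apply Rmin_glb_lt; auto|]. intros h Hh.
  pose proof (Rlt_le_trans _ _ _ Hh (Rmin_l _ _)) as h1.
  pose proof (Rlt_le_trans _ _ _ Hh (Rmin_r _ _)) as h23.
  pose proof (Rlt_le_trans _ _ _ h23 (Rmin_l _ _)) as h2.
  pose proof (Rlt_le_trans _ _ _ h23 (Rmin_r _ _)) as h3.
  specialize (K1 h h1). specialize (K2 h h2). specialize (K3 (t + h)%R).
  replace (t + h - t)%R with h in K3 by ring. specialize (K3 h3).
  match goal with |- (Cmod ?X <= _)%R => replace X with
    ((F (t + h)%R - F t - RtoC h * l) * G t + F t * (G (t + h)%R - G t - RtoC h * m)
     + (F (t + h)%R - F t) * (G (t + h)%R - G t - RtoC h * m)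
     + (F (t + h)%R - F t) * (RtoC h * m)) by ring end.
  eapply Rle_trans; [apply Cmod_triangle4|].
  rewrite !Cmod_mult, Cmod_R.
  pose proof (Cmod_ge_0 (F t)). pose proof (Cmod_ge_0 (G t)). pose proof (Cmod_ge_0 m).
  pose proof (Cmod_ge_0 (F (t + h)%R - F t - RtoC h * l)).
  pose proof (Cmod_ge_0 (G (t + h)%R - G t - RtoC h * m)).
  pose proof (Cmod_ge_0 (F (t + h)%R - F t)). pose proof (Rabs_pos h).
  assert (E1 : (Cmod (F (t + h)%R - F t - RtoC h * l) * Cmod (G t) <= r * Rabs h * Cmod (G t))%R)
    by (apply Rmult_le_compat_r; lra).
  assert (E2 : (Cmod (F t) * Cmod (G (t + h)%R - G t - RtoC h * m) <= Cmod (F t) * (r * Rabs h))%R)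
    by (apply Rmult_le_compat_l; lra).
  assert (E3 : (Cmod (F (t + h)%R - F t) * Cmod (G (t + h)%R - G t - RtoC h * m) <= 1 * (r * Rabs h))%R)
    by (apply Rmult_le_compat; lra).
  assert (E4 : (Cmod (F (t + h)%R - F t) * (Rabs h * Cmod m) <= r * (Rabs h * Cmod m))%R).
  { apply Rmult_le_compat_r; [|lra]. nra. }
  assert (E5 : (r * A * Rabs h <= e * Rabs h)%R) by (apply Rmult_le_compat_r; nra).
  unfold A in E5. nra.
Qed.

Lemma deriv_RC_comp (f : C -> C) F t l m : deriv_RC F t l -> deriv_CC f (F t) m ->
  deriv_RC (fun t => f (F t)) t (l * m).
Proof.
  intros H1 H2 e He.
  pose (A := (Cmod l + Cmod m + 1)%R).
  assert (HA : (1 <= A)%R) by (unfold A; generalize (Cmod_ge_0 l) (Cmod_ge_0 m); lra).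
  pose (r := Rmin 1 (e / (4 * A))).
  assert (Hr : (0 < r)%R) by (apply Rmin_glb_lt; [lra|apply Rdiv_lt_0_compat; lra]).
  assert (R1 : (r <= 1)%R) by apply Rmin_l.
  assert (R2 : (r * (4 * A) <= e)%R).
  { eapply Rle_trans; [apply Rmult_le_compat_r; [lra|apply Rmin_r]|]. right. field. lra. }
  destruct (H1 r Hr) as (d1 & Hd1 & K1). destruct (H2 r Hr) as (d2 & Hd2 & K2).
  destruct (deriv_RC_cont _ _ _ H1 d2 Hd2) as (d3 & Hd3 & K3).
  exists (Rmin d1 d3). split; [now apply Rmin_glb_lt|]. intros h Hh.
  specialize (K1 h (Rlt_le_trans _ _ _ Hh (Rmin_l _ _))).
  specialize (K3 (t + h)%R). replace (t + h - t)%R with h in K3 by ring.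
  specialize (K3 (Rlt_le_trans _ _ _ Hh (Rmin_r _ _))).
  specialize (K2 _ K3). replace (F t + (F (t + h)%R - F t)) with (F (t + h)%R) in K2 by ring.
  match goal with |- (Cmod ?X <= _)%R => replace X with
    ((f (F (t + h)%R) - f (F t) - (F (t + h)%R - F t) * m) + (F (t + h)%R - F t - RtoC h * l) * m) by ring end.
  eapply Rle_trans; [apply Cmod_triangle|]. rewrite Cmod_mult.
  pose proof (Cmod_ge_0 l). pose proof (Cmod_ge_0 m). pose proof (Rabs_pos h).
  assert (E : (Cmod (F (t + h)%R - F t) <= (1 + Cmod l) * Rabs h)%R).
  { replace (F (t + h)%R - F t) with ((F (t + h)%R - F t - RtoC h * l) + RtoC h * l) by ring.
    eapply Rle_trans; [apply Cmod_triangle|]. rewrite Cmod_mult, Cmod_R. nra. }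
  assert (E1 : (Cmod (F (t + h)%R - F t - RtoC h * l) * Cmod m <= r * Rabs h * Cmod m)%R)
    by (apply Rmult_le_compat_r; lra).
  assert (E2 : (r * Cmod (F (t + h)%R - F t) <= r * ((1 + Cmod l) * Rabs h))%R)
    by (apply Rmult_le_compat_l; lra).
  assert (E5 : (r * A * Rabs h <= e * Rabs h)%R) by (apply Rmult_le_compat_r; nra).
  unfold A in E5. nra.
Qed.

Lemma deriv_RC_id_mult (c d : C) t : deriv_RC (fun t => c + RtoC t * d) t d.
Proof.
  intros e He. exists 1%R. split; [lra|]. intros h _.
  rewrite RtoC_plus. match goal with |- (Cmod ?X <= _)%R => replace X with (RtoC 0) by ring end.
  rewrite Cmod_0. apply Rmult_le_pos; [lra|apply Rabs_pos].
Qed.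

(** The increment is projected on its own direction: with u the conjugate of F b - F a, the real
    mean value theorem for Re (u F) gives |F b - F a|^2 <= |F b - F a| K (b - a). *)
Lemma mvt_RC (F dF : R -> C) (a b K : R) : (a <= b)%R ->
  (forall t, (a <= t <= b)%R -> deriv_RC F t (dF t)) ->
  (forall t, (a <= t <= b)%R -> (Cmod (dF t) <= K)%R) ->
  (Cmod (F b - F a) <= K * (b - a))%R.
Proof.
  intros Hab HD HK.
  destruct (Req_dec a b) as [->|Hne].
  { replace (F b - F b) with (RtoC 0) by ring. rewrite Cmod_0. lra. }
  destruct (Ceq_dec (F b - F a) 0) as [E|E].
  { rewrite E, Cmod_0. apply Rmult_le_pos; [|lra].
    eapply Rle_trans; [apply Cmod_ge_0|apply (HK a)]; lra. }
  pose (u := Cconj (F b - F a)).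
  assert (Hm : (0 < Cmod (F b - F a))%R) by now apply Cmod_gt_0.
  assert (HDr : forall t, (a <= t <= b)%R ->
    is_derive (fun t => Re (u * F t)) t (Re (u * dF t))).
  { intros t Ht. pose proof (deriv_RC_scal u _ _ _ (HD t Ht)) as H.
    split; [apply is_linear_scal_l|].
    intros x Hx. apply (is_filter_lim_locally_unique (K := R_AbsRing) (V := R_NormedModule)) in Hx. subst x.
    intros e. destruct (H e (cond_pos e)) as (d & Hd & H').
    exists (mkposreal d Hd). intros y Hy.
    specialize (H' (y - t)%R Hy). rewrite Rplus_minus in H'.
    change (norm (minus y t)) with (Rabs (y - t)).
    eapply Rle_trans; [|exact H']. eapply Rle_trans; [|apply re_le_Cmod].
    right. change (norm ?x) with (Rabs x). f_equal.
    unfold minus, plus, opp, scal, mult; simpl. unfold mult; simpl. ring. }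
  destruct (MVT_gen (fun t => Re (u * F t)) a b (fun t => Re (u * dF t))) as (c & Hc & Ec).
  - intros x Hx. rewrite Rmin_left, Rmax_right in Hx by lra. apply HDr; lra.
  - intros x Hx. rewrite Rmin_left, Rmax_right in Hx by lra.
    apply ccont_Re. apply ccont_mult; [apply ccont_const|]. eapply deriv_RC_cont, HD; lra.
  - rewrite Rmin_left, Rmax_right in Hc by lra.
    assert (E2 : (Re (u * F b) - Re (u * F a) = Cmod (F b - F a) * Cmod (F b - F a))%R).
    { replace (Cmod (F b - F a) * Cmod (F b - F a))%R with (Cmod (F b - F a) ^ 2)%R by ring.
      rewrite Cmod2_alt. unfold u. simpl. unfold Re, Im; simpl. ring. }
    rewrite E2 in Ec.
    assert (E3 : (Re (u * dF c) <= Cmod (F b - F a) * K)%R).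
    { eapply Rle_trans; [apply Rle_abs|]. eapply Rle_trans; [apply re_le_Cmod|].
      rewrite Cmod_mult. unfold u. rewrite Cmod_conj. apply Rmult_le_compat_l; [lra|]. apply HK; lra. }
    apply (Rmult_le_reg_l (Cmod (F b - F a))); auto. nra.
Qed.

Lemma deriv_Cexp_line (z : C) (s : R) : deriv_RC (fun s => Cexp (RtoC s * z)) s (z * Cexp (RtoC s * z)).
Proof.
  destruct z as [x y].
  assert (E : forall s, RtoC s * (x, y) = ((s * x)%R, (s * y)%R)).
  { intros. apply injective_projections; simpl; ring. }
  apply is_derive_deriv_RC.
  - apply (is_derive_ext (fun s => (exp (s * x) * cos (s * y))%R)).
    { intros. rewrite E. reflexivity. }
    auto_derive; auto. rewrite E. unfold Cexp, Re, Im; simpl. unfold Re, Im; simpl. ring.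
  - apply (is_derive_ext (fun s => (exp (s * x) * sin (s * y))%R)).
    { intros. rewrite E. reflexivity. }
    auto_derive; auto. rewrite E. unfold Cexp, Re, Im; simpl. unfold Re, Im; simpl. ring.
Qed.

Lemma exp_line_le (x s : R) : (0 <= s <= 1)%R -> (exp (s * x) <= Rmax 1 (exp x))%R.
Proof.
  intros Hs. destruct (Rle_dec 0 x).
  - eapply Rle_trans; [|apply Rmax_r]. destruct (Req_dec (s * x) x) as [->|]; [lra|].
    left; apply exp_increasing; nra.
  - eapply Rle_trans; [|apply Rmax_l]. rewrite <- exp_0.
    destruct (Req_dec (s * x) 0) as [->|]; [lra|]. left; apply exp_increasing; nra.
Qed.

(** Global bounds, with the factor max(1, e^(Re z)) in place of a smallness condition: they are
    applied to z = - (p' - p) c(t), which is unbounded along the curve however close p' is to p. *)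
Lemma Cexp_bound1 (z : C) : (Cmod (Cexp z - 1) <= Cmod z * Rmax 1 (exp (Re z)))%R.
Proof.
  pose proof (mvt_RC (fun s => Cexp (RtoC s * z)) (fun s => z * Cexp (RtoC s * z)) 0 1
    (Cmod z * Rmax 1 (exp (Re z))) Rle_0_1) as H.
  cbv beta in H. rewrite Cmult_1_l, Cmult_0_l, Cexp_0, Rminus_0_r, Rmult_1_r in H. apply H.
  - intros. apply deriv_Cexp_line.
  - intros t Ht. rewrite Cmod_mult, Cmod_Cexp. apply Rmult_le_compat_l; [apply Cmod_ge_0|].
    rewrite re_scal_l. now apply exp_line_le.
Qed.

Lemma Cexp_bound2 (z : C) : (Cmod (Cexp z - 1 - z) <= Cmod z ^ 2 * Rmax 1 (exp (Re z)))%R.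
Proof.
  pose proof (mvt_RC (fun s => Cexp (RtoC s * z) + (0 + RtoC s * - z))
    (fun s => z * Cexp (RtoC s * z) + - z) 0 1
    (Cmod z ^ 2 * Rmax 1 (exp (Re z))) Rle_0_1) as H.
  cbv beta in H. rewrite !Cmult_1_l, !Cmult_0_l, Cexp_0, Rminus_0_r, Rmult_1_r in H.
  eapply Rle_trans; [|apply H].
  - right. f_equal. ring.
  - intros. apply deriv_RC_plus; [apply deriv_Cexp_line|apply deriv_RC_id_mult].
  - intros t Ht. replace (z * Cexp (RtoC t * z) + - z) with (z * (Cexp (RtoC t * z) - 1)) by ring.
    rewrite Cmod_mult. eapply Rle_trans; [apply Rmult_le_compat_l; [apply Cmod_ge_0|apply Cexp_bound1]|].
    rewrite Cmod_mult, Cmod_R, re_scal_l, (Rabs_pos_eq t) by lra.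
    pose proof (exp_line_le (Re z) t Ht).
    assert (Rmax 1 (exp (t * Re z)) <= Rmax 1 (exp (Re z)))%R by (apply Rmax_lub; auto; apply Rmax_l).
    assert (1 <= Rmax 1 (exp (t * Re z)))%R by apply Rmax_l.
    pose proof (Cmod_ge_0 z).
    apply Rle_trans with (Cmod z * (1 * Cmod z * Rmax 1 (exp (Re z))))%R; [|right; ring].
    apply Rmult_le_compat_l; auto.
    apply Rmult_le_compat; try nra.
Qed.
(** A quadratic remainder is what [Cexp_bound2] leaves after integration against a dominated
    integrand, so this criterion serves for every differentiation under the integral sign. *)
Lemma quad_deriv_CC (f : C -> C) (z l : C) (r K : R) : (0 < r)%R ->
  (forall h, (Cmod h < r)%R -> (Cmod (f (z + h)%C - f z - h * l) <= K * Cmod h ^ 2)%R) -> deriv_CC f z l.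
Proof.
  intros Hr HK e He. set (K' := (Rabs K + 1)%R). assert (HK' : (0 < K')%R) by (unfold K'; generalize (Rabs_pos K); lra).
  exists (Rmin r (e / K')). split; [apply Rmin_glb_lt; auto; apply Rdiv_lt_0_compat; lra|].
  intros h Hh. eapply Rle_trans; [apply HK; eapply Rlt_le_trans; [apply Hh|apply Rmin_l]|].
  pose proof (Rlt_le_trans _ _ _ Hh (Rmin_r _ _)) as H2. apply (Rmult_lt_compat_l K') in H2; auto.
  replace (K' * (e / K'))%R with e in H2 by (field; lra).
  pose proof (Cmod_ge_0 h). pose proof (Rle_abs K). simpl. rewrite Rmult_1_r, <- Rmult_assoc.
  apply Rmult_le_compat_r; auto. unfold K' in H2. nra.
Qed.

Lemma quad_deriv_RC (f : R -> C) (z : R) (l : C) (r K : R) : (0 < r)%R ->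
  (forall h, (Rabs h < r)%R -> (Cmod (f (z + h)%R - f z - RtoC h * l) <= K * Rabs h ^ 2)%R) -> deriv_RC f z l.
Proof.
  intros Hr HK e He. set (K' := (Rabs K + 1)%R). assert (HK' : (0 < K')%R) by (unfold K'; generalize (Rabs_pos K); lra).
  exists (Rmin r (e / K')). split; [apply Rmin_glb_lt; auto; apply Rdiv_lt_0_compat; lra|].
  intros h Hh. eapply Rle_trans; [apply HK; eapply Rlt_le_trans; [apply Hh|apply Rmin_l]|].
  pose proof (Rlt_le_trans _ _ _ Hh (Rmin_r _ _)) as H2. apply (Rmult_lt_compat_l K') in H2; auto.
  replace (K' * (e / K'))%R with e in H2 by (field; lra).
  pose proof (Rabs_pos h). pose proof (Rle_abs K). simpl. rewrite Rmult_1_r, <- Rmult_assoc.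
  apply Rmult_le_compat_r; auto. unfold K' in H2. nra.
Qed.

Lemma deriv_CC_ext_loc f g z l r : (0 < r)%R -> (forall z', (Cmod (z' - z) < r)%R -> f z' = g z') -> deriv_CC f z l -> deriv_CC g z l.
Proof.
  intros Hr E Hf e He. destruct (Hf e He) as (d & Hd & K). exists (Rmin d r). split; [now apply Rmin_glb_lt|].
  intros h Hh. rewrite <- !E.
  - apply K. eapply Rlt_le_trans; [apply Hh|apply Rmin_l].
  - replace (z - z) with (RtoC 0) by ring. now rewrite Cmod_0.
  - rewrite Cadd_sub'. eapply Rlt_le_trans; [apply Hh|apply Rmin_r].
Qed.

Lemma deriv_CC_mult f g z l m : deriv_CC f z l -> deriv_CC g z m -> deriv_CC (fun z => f z * g z) z (l * g z + f z * m).
Proof.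
  intros Hf Hg.
  apply deriv_CC_is_derive_abs in Hf. apply deriv_CC_is_derive_abs in Hg. apply deriv_CC_is_derive_abs.
  apply (is_derive_mult (K := C_AbsRing) f g z l m); auto. intros; apply Cmult_comm.
Qed.

Lemma deriv_CC_plus f1 f2 z l m : deriv_CC f1 z l -> deriv_CC f2 z m -> deriv_CC (fun z => f1 z + f2 z) z (l + m).
Proof.
  intros H1 H2. apply deriv_CC_is_derive in H1. apply deriv_CC_is_derive in H2. apply deriv_CC_is_derive.
  apply (is_derive_plus (K := C_AbsRing) (V := C_NormedModule) f1 f2 z l m H1 H2).
Qed.

Lemma deriv_CC_const (c z : C) : deriv_CC (fun _ => c) z 0.
Proof.
  intros e He. exists 1%R. split; [lra|]. intros h _.
  match goal with |- (Cmod ?X <= _)%R => replace X with (RtoC 0) by ring end. rewrite Cmod_0.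
  apply Rmult_le_pos; [lra|apply Cmod_ge_0].
Qed.

Lemma deriv_CC_scal (c : C) f z l : deriv_CC f z l -> deriv_CC (fun z => c * f z) z (c * l).
Proof.
  intros H1. replace (c * l) with (0 * f z + c * l) by ring. apply (deriv_CC_mult (fun _ => c) f); auto. apply deriv_CC_const.
Qed.

Lemma deriv_Cexp_lin (w p : C) : deriv_CC (fun p => Cexp (p * w)) p (w * Cexp (p * w)).
Proof.
  apply (quad_deriv_CC _ _ _ 1 (exp (Re (p * w)) * (Cmod w ^ 2 * exp (Cmod w)))); [lra|].
  intros h Hh. replace ((p + h) * w) with (p * w + h * w) by ring. rewrite Cexp_add.
  match goal with |- (Cmod ?X <= _)%R => replace X with (Cexp (p * w) * (Cexp (h * w) - 1 - h * w)) by ring end.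
  rewrite Cmod_mult, Cmod_Cexp, Rmult_assoc. apply Rmult_le_compat_l; [apply Rlt_le, exp_pos|].
  eapply Rle_trans; [apply Cexp_bound2|]. rewrite Cmod_mult, Rpow_mult_distr.
  replace (Cmod w ^ 2 * exp (Cmod w) * Cmod h ^ 2)%R with (Cmod h ^ 2 * Cmod w ^ 2 * exp (Cmod w))%R by ring.
  apply Rmult_le_compat_l. { apply Rmult_le_pos; apply pow2_ge_0. }
  pose proof (Cmod_ge_0 w). pose proof (Cmod_ge_0 h). apply Rmax_lub.
  - pose proof (exp_ineq1_le (Cmod w)). lra.
  - apply exp_le. eapply Rle_trans; [apply Rle_abs|]. eapply Rle_trans; [apply re_le_Cmod|]. rewrite Cmod_mult. nra.
Qed.

Lemma deriv_Cexp (z : C) : deriv_CC Cexp z (Cexp z).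
Proof.
  pose proof (deriv_Cexp_lin 1 z) as D. rewrite Cmult_1_l, Cmult_1_r in D.
  refine (deriv_CC_ext_loc _ _ _ _ 1 Rlt_0_1 _ D). intros. now rewrite Cmult_1_r.
Qed.

Lemma contCC_Cexp z : contCC Cexp z.
Proof. eapply deriv_CC_cont, deriv_Cexp. Qed.

Lemma ccont_Cexp F t : ccont F t -> ccont (fun t => Cexp (F t)) t.
Proof. intros. apply (ccont_comp Cexp); auto. apply contCC_Cexp. Qed.

(** * Complex integrals and dominated improper integrals *)

Definition CInt (F : R -> C) (a b : R) : C := RInt (V := C_R_CompleteNormedModule) F a b.
Definition is_CInt (F : R -> C) (a b : R) (l : C) : Prop := is_RInt (V := C_R_NormedModule) F a b l.

Lemma is_CInt_unique F a b l : is_CInt F a b l -> CInt F a b = l.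
Proof. intros H. apply (is_RInt_unique (V := C_R_CompleteNormedModule)). exact H. Qed.

Lemma CInt_correct F a b : (forall t, (Rmin a b <= t <= Rmax a b)%R -> ccont F t) -> is_CInt F a b (CInt F a b).
Proof.
  intros H. apply (RInt_correct (V := C_R_CompleteNormedModule)).
  apply (ex_RInt_continuous (V := C_R_CompleteNormedModule)).
  intros z Hz. apply (proj1 (ccont_continuous F z)), H, Hz.
Qed.

Lemma CInt_correct_le F a b : (a <= b)%R -> (forall t, (a <= t <= b)%R -> ccont F t) -> is_CInt F a b (CInt F a b).
Proof. intros Hab H. apply CInt_correct. now rewrite Rmin_left, Rmax_right by lra. Qed.

Lemma is_CInt_ext F G a b l : (forall t, (Rmin a b < t < Rmax a b)%R -> F t = G t) -> is_CInt F a b l -> is_CInt G a b l.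
Proof. apply (is_RInt_ext (V := C_R_NormedModule)). Qed.

Lemma CInt_ext F G a b : (forall t, (Rmin a b < t < Rmax a b)%R -> F t = G t) -> CInt F a b = CInt G a b.
Proof. apply (RInt_ext (V := C_R_CompleteNormedModule)). Qed.

Lemma is_CInt_plus F G a b l m : is_CInt F a b l -> is_CInt G a b m -> is_CInt (fun t => F t + G t) a b (l + m).
Proof. apply (is_RInt_plus (V := C_R_NormedModule)). Qed.

Lemma is_CInt_Chasles F a b c l m : is_CInt F a b l -> is_CInt F b c m -> is_CInt F a c (l + m).
Proof. apply (is_RInt_Chasles (V := C_R_NormedModule)). Qed.

Lemma is_CInt_swap F a b l : is_CInt F b a l -> is_CInt F a b (- l).
Proof. apply (is_RInt_swap (V := C_R_NormedModule)). Qed.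

Lemma is_CInt_scal c F a b l : is_CInt F a b l -> is_CInt (fun t => c * F t) a b (c * l).
Proof.
  intros H. destruct c as [x y].
  pose proof (is_RInt_fct_extend_fst (U := R_NormedModule) (V := R_NormedModule) F a b l H) as H1.
  pose proof (is_RInt_fct_extend_snd (U := R_NormedModule) (V := R_NormedModule) F a b l H) as H2.
  apply (is_RInt_fct_extend_pair (U := R_NormedModule) (V := R_NormedModule)
    (fun t => (x, y) * F t) a b).
  - apply (is_RInt_minus (V := R_NormedModule) (fun t => x * fst (F t))%R (fun t => y * snd (F t))%R);
      apply (is_RInt_scal (V := R_NormedModule)); assumption.
  - apply (is_RInt_plus (V := R_NormedModule) (fun t => x * snd (F t))%R (fun t => y * fst (F t))%R);
      apply (is_RInt_scal (V := R_NormedModule)); assumption.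
Qed.

Lemma is_CInt_norm F (g : R -> R) a b l lg : (a <= b)%R ->
  (forall t, (a <= t <= b)%R -> (Cmod (F t) <= g t)%R) ->
  is_CInt F a b l -> is_RInt g a b lg -> (Cmod l <= lg)%R.
Proof.
  intros Hab H1 H2 H3. rewrite Cmod_norm.
  assert (E : forall z : C, norm (K := R_AbsRing) (V := C_R_NormedModule) z = Cmod z).
  { intros z. unfold norm; simpl. unfold prod_norm, Cmod; simpl.
    f_equal. unfold norm; simpl. unfold abs; simpl.
    rewrite !Rmult_1_r, <- !Rabs_mult, !Rabs_pos_eq by apply Rle_0_sqr. reflexivity. }
  rewrite <- Cmod_norm, <- E.
  apply (norm_RInt_le (V := C_R_NormedModule) F g a b l lg Hab); auto.
  intros x Hx. rewrite E. auto.
Qed.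

Lemma CInt_bound F a b K : (a <= b)%R -> (forall t, (a <= t <= b)%R -> ccont F t) ->
  (forall t, (a <= t <= b)%R -> (Cmod (F t) <= K)%R) -> (Cmod (CInt F a b) <= K * (b - a))%R.
Proof.
  intros Hab Hc HK. apply (is_CInt_norm F (fun _ => K) a b); auto.
  - now apply CInt_correct_le.
  - rewrite Rmult_comm. apply (is_RInt_const (V := R_NormedModule)).
Qed.

Lemma CInt_FTC F f a b : (a <= b)%R -> (forall t, (a <= t <= b)%R -> deriv_RC F t (f t)) ->
  (forall t, (a <= t <= b)%R -> ccont f t) -> is_CInt f a b (F b - F a).
Proof.
  intros Hab H1 H2.
  apply (is_RInt_derive (V := C_R_CompleteNormedModule) F f); rewrite Rmin_left, Rmax_right by lra; intros t Ht.
  - apply deriv_RC_is_derive. auto.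
  - apply (proj1 (ccont_continuous f t)). auto.
Qed.

Lemma CInt_scal c F a b : (forall t, (Rmin a b <= t <= Rmax a b)%R -> ccont F t) ->
  CInt (fun t => c * F t) a b = c * CInt F a b.
Proof. intros. apply is_CInt_unique, is_CInt_scal, CInt_correct; auto. Qed.

Lemma CInt_plus F G a b : (forall t, (Rmin a b <= t <= Rmax a b)%R -> ccont F t) ->
  (forall t, (Rmin a b <= t <= Rmax a b)%R -> ccont G t) ->
  CInt (fun t => F t + G t) a b = CInt F a b + CInt G a b.
Proof. intros. apply is_CInt_unique, is_CInt_plus; apply CInt_correct; auto. Qed.

Lemma CInt_Chasles_le F a b c : (a <= b <= c)%R -> (forall t, (a <= t <= c)%R -> ccont F t) ->
  CInt F a c = CInt F a b + CInt F b c.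
Proof. intros. apply is_CInt_unique. apply is_CInt_Chasles with b; apply CInt_correct_le; intuition; apply H0; lra. Qed.

Lemma CInt_swap F a b : (forall t, (Rmin a b <= t <= Rmax a b)%R -> ccont F t) -> CInt F b a = - CInt F a b.
Proof. intros. apply is_CInt_unique, is_CInt_swap. now apply CInt_correct. Qed.

Lemma CInt_point F a : CInt F a a = 0.
Proof. apply (RInt_point (V := C_R_CompleteNormedModule)). Qed.

Lemma CInt_const c a b : CInt (fun _ => c) a b = RtoC (b - a) * c.
Proof.
  unfold CInt. rewrite (RInt_const (V := C_R_CompleteNormedModule)).
  unfold scal; simpl. unfold prod_scal; simpl. unfold scal; simpl; unfold mult; simpl.
  apply injective_projections; simpl; ring.
Qed.

(** Made for rays that start at the real point - eps: there the primitive is only continuous from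
    one side, and its derivative is known in the open half plane alone. The part of the integral
    over a short [0, s] is bounded, the rest is the usual theorem on [s, T]. *)
Lemma CInt_FTC0 F f T : (0 <= T)%R -> (forall t, (0 < t <= T)%R -> deriv_RC F t (f t)) ->
  (forall t, (0 <= t <= T)%R -> ccont f t) ->
  (forall e, (0 < e)%R -> exists d, (0 < d)%R /\ forall t, (0 < t < d)%R -> (Cmod (F t - F 0%R) < e)%R) ->
  CInt f 0 T = F T - F 0%R.
Proof.
  intros HT HD Hc H0.
  destruct (Req_dec T 0) as [->|HT0]. { rewrite CInt_point. ring. }
  destruct (Ceq_dec (CInt f 0 T - (F T - F 0%R)) 0) as [E|E].
  { replace (CInt f 0 T) with ((CInt f 0 T - (F T - F 0%R)) + (F T - F 0%R)) by ring. rewrite E. ring. }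
  exfalso. apply Cmod_gt_0 in E. set (e := Cmod (CInt f 0 T - (F T - F 0%R))) in *.
  destruct (H0 (e / 3)%R) as (d1 & Hd1 & K1); [lra|].
  destruct (Hc 0%R ltac:(lra) 1%R ltac:(lra)) as (d2 & Hd2 & K2).
  set (B := (Cmod (f 0%R) + 1)%R).
  assert (HB : (0 < B)%R) by (unfold B; generalize (Cmod_ge_0 (f 0%R)); lra).
  pose (s := (Rmin T (Rmin d1 (Rmin d2 (e / (3 * B)))) / 2)%R).
  assert (Hs : (0 < s)%R). { apply Rdiv_lt_0_compat; [|lra]. repeat apply Rmin_glb_lt; try lra. apply Rdiv_lt_0_compat; lra. }
  assert (s1 : (s < T)%R). { unfold s. generalize (Rmin_l T (Rmin d1 (Rmin d2 (e / (3 * B))))). unfold s in Hs. lra. }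
  assert (s2 : (s < d1)%R). { unfold s. generalize (Rmin_r T (Rmin d1 (Rmin d2 (e / (3 * B))))) (Rmin_l d1 (Rmin d2 (e / (3 * B)))). unfold s in Hs. lra. }
  assert (s3 : (s < d2)%R). { unfold s. generalize (Rmin_r T (Rmin d1 (Rmin d2 (e / (3 * B))))) (Rmin_r d1 (Rmin d2 (e / (3 * B)))) (Rmin_l d2 (e / (3 * B))). unfold s in Hs. lra. }
  assert (s4 : (s < e / (3 * B))%R). { unfold s. generalize (Rmin_r T (Rmin d1 (Rmin d2 (e / (3 * B))))) (Rmin_r d1 (Rmin d2 (e / (3 * B)))) (Rmin_r d2 (e / (3 * B))). unfold s in Hs. lra. }
  assert (E1 : CInt f s T = F T - F s).
  { apply is_CInt_unique, CInt_FTC; [lra| |]; intros; [apply HD|apply Hc]; lra. }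
  assert (E2 : (Cmod (CInt f 0 s) <= B * (s - 0))%R).
  { apply CInt_bound; [lra| |]. intros; apply Hc; lra.
    intros t Ht. assert (Cmod (f t - f 0%R) < 1)%R. { apply K2. rewrite Rminus_0_r, Rabs_pos_eq; lra. }
    generalize (Cmod_triangle_rev (f t) (f 0%R)). unfold B. lra. }
  assert (E3 : CInt f 0 T - (F T - F 0%R) = CInt f 0 s + - (F s - F 0%R)).
  { rewrite (CInt_Chasles_le f 0 s T), E1; [ring|lra|auto]. }
  assert (E4 : (e <= Cmod (CInt f 0 s) + Cmod (F s - F 0%R))%R).
  { unfold e. rewrite E3. eapply Rle_trans; [apply Cmod_triangle|]. rewrite Cmod_opp. lra. }
  specialize (K1 s ltac:(lra)).
  apply (Rmult_lt_compat_l B) in s4; auto. replace (B * (e / (3 * B)))%R with (e / 3)%R in s4 by (field; lra).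
  lra.
Qed.

(* A weight with explicit primitive, comparable to x^(-5/4) at infinity, which dominates every integrand below. *)
Definition Dom (x : R) : R := (/ (1 + x * x) + x / (1 + x * x) * exp (- (ln (1 + x * x) / 8)))%R.
Definition Dprim (x : R) : R := (atan x - 4 * exp (- (ln (1 + x * x) / 8)))%R.

Lemma Dprim_derive (x : R) : is_derive Dprim x (Dom x).
Proof.
  unfold Dprim, Dom. auto_derive; [nra|]. unfold Rdiv. set (E := exp _). field. nra.
Qed.

Lemma Dom_cont x : continuity_pt Dom x.
Proof.
  apply derivable_continuous_pt. exists (Derive Dom x). apply is_derive_Reals, Derive_correct.
  unfold Dom. auto_derive. repeat split; try nra; apply Rgt_not_eq; nra.
Qed.

Lemma Dom_int a b : is_RInt Dom a b (Dprim b - Dprim a)%R.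
Proof.
  apply (is_RInt_derive (V := R_CompleteNormedModule) Dprim Dom).
  - intros; apply Dprim_derive.
  - intros. apply continuity_pt_filterlim, Dom_cont.
Qed.

Lemma Dom_pos x : (0 <= x)%R -> (0 < Dom x)%R.
Proof.
  intros Hx. unfold Dom. assert (0 < 1 + x * x)%R by nra.
  apply Rplus_lt_le_0_compat. now apply Rinv_0_lt_compat.
  apply Rmult_le_pos; [|apply Rlt_le, exp_pos]. apply Rmult_le_pos; auto. now apply Rlt_le, Rinv_0_lt_compat.
Qed.

(** The constant 6 is PI / 2 <= 2 from [atan] plus 4 from the second term; it is the factor 6 of
    every later bound on a dominated integral. *)
Lemma Dprim_bound x y : (0 <= x <= y)%R -> (0 <= Dprim y - Dprim x <= 6)%R.
Proof.
  intros H. split.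
  - destruct (MVT_gen Dprim x y Dom) as (c & Hc & E).
    + intros; apply Dprim_derive.
    + intros t _. apply derivable_continuous_pt. exists (Dom t). apply is_derive_Reals, Dprim_derive.
    + rewrite E. rewrite Rmin_left in Hc by lra.
      apply Rmult_le_pos; [|lra]. apply Rlt_le, Dom_pos. lra.
  - unfold Dprim. pose proof (proj2 (atan_bound y)). pose proof PI_4.
    assert (0 <= atan x)%R. { rewrite <- atan_0. destruct (Req_dec x 0) as [->|]; [lra|]. left; apply atan_increasing; lra. }
    pose proof (exp_pos (- (ln (1 + y * y) / 8))).
    assert (exp (- (ln (1 + x * x) / 8)) <= 1)%R.
    { assert (0 <= ln (1 + x * x))%R. { rewrite <- ln_1. apply ln_le; nra. }
      apply (Rle_trans _ (exp 0)); [apply exp_le; lra|rewrite exp_0; lra]. }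
    lra.
Qed.

Lemma Dprim_cauchy e : (0 < e)%R -> exists T, (0 <= T)%R /\ forall x y, (T <= x <= y)%R -> (Dprim y - Dprim x < e)%R.
Proof.
  intros He.
  destruct (completeness (fun v => exists x, (0 <= x)%R /\ v = Dprim x)) as (s & Hs1 & Hs2).
  - exists (6 + Dprim 0)%R. intros v (x & Hx & ->). generalize (Dprim_bound 0 x ltac:(lra)). lra.
  - exists (Dprim 0). exists 0%R. lra.
  - destruct (classic (exists x, (0 <= x)%R /\ (s - e < Dprim x)%R)) as [(x0 & Hx0 & Hx0')|N].
    + exists x0. split; auto. intros x y Hxy.
      assert (Dprim y <= s)%R by (apply Hs1; exists y; lra).
      generalize (Dprim_bound x0 x ltac:(lra)). lra.
    + exfalso. assert (s <= s - e)%R; [|lra]. apply Hs2. intros v (x & Hx & ->).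
      apply Rnot_lt_le. intros K. apply N. now exists x.
Qed.

(** * Improper integrals over [0, +oo[ *)

Definition is_II (F : R -> C) (l : C) : Prop :=
  forall e, (0 < e)%R -> exists T0, (0 <= T0)%R /\ forall T, (T0 <= T)%R -> (Cmod (CInt F 0 T - l) < e)%R.

Definition II (F : R -> C) : C := epsilon (inhabits (RtoC 0)) (is_II F).

Definition dominated (F : R -> C) (K : R) : Prop :=
  (forall t, (0 <= t)%R -> ccont F t) /\ forall t, (0 <= t)%R -> (Cmod (F t) <= K * Dom t)%R.

Lemma Cmod_small_eq (z : C) : (forall e, (0 < e)%R -> (Cmod z <= e)%R) -> z = 0.
Proof.
  intros H. apply Cmod_eq_0. generalize (Cmod_ge_0 z). intros [H0|H0]; auto.
  specialize (H (Cmod z / 2)%R). lra.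
Qed.

Lemma C_small_eq (z w : C) : (forall e, (0 < e)%R -> (Cmod (z - w) <= e)%R) -> z = w.
Proof.
  intros H. replace z with ((z - w) + w) by ring. rewrite (Cmod_small_eq (z - w)) by auto. ring.
Qed.

Lemma is_II_unique F l m : is_II F l -> is_II F m -> l = m.
Proof.
  intros H1 H2. apply C_small_eq. intros e He.
  destruct (H1 (e/2)%R) as (T1 & _ & K1); [lra|]. destruct (H2 (e/2)%R) as (T2 & _ & K2); [lra|].
  specialize (K1 _ (Rmax_l T1 T2)). specialize (K2 _ (Rmax_r T1 T2)).
  eapply Rle_trans; [apply (Cmod_triangle_sub _ (CInt F 0 (Rmax T1 T2)))|].
  rewrite Cmod_sub_sym in K1. lra.
Qed.

Lemma II_is F l : is_II F l -> II F = l.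
Proof. intros H. apply (is_II_unique F); auto. unfold II. apply epsilon_spec. now exists l. Qed.

Lemma dominated_tail F K a b : dominated F K -> (0 <= a <= b)%R -> (Cmod (CInt F a b) <= K * (Dprim b - Dprim a))%R.
Proof.
  intros [Hc HD] Hab. apply (is_CInt_norm F (fun t => K * Dom t)%R a b); [lra| | |].
  - intros; apply HD; lra.
  - apply CInt_correct_le; [lra|]. intros; apply Hc; lra.
  - apply (is_RInt_scal (V := R_NormedModule)), Dom_int.
Qed.

Lemma dominated_pos F K : dominated F K -> (0 <= K)%R.
Proof.
  intros [_ H]. specialize (H 0%R (Rle_refl _)). pose proof (Dom_pos 0 (Rle_refl _)).
  pose proof (Cmod_ge_0 (F 0%R)). destruct (Rle_dec 0 K); auto. nra.
Qed.

Lemma II_cauchy_ex F : (forall e, (0 < e)%R -> exists T0, forall a b, (T0 <= a <= b)%R -> (0 <= a)%R -> (Cmod (CInt F 0 b - CInt F 0 a) < e)%R) ->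
  exists l, is_II F l.
Proof.
  intros H.
  destruct (proj1 (filterlim_locally_cauchy (U := C_R_CompleteNormedModule) (F := Rbar_locally p_infty) (fun T => CInt F 0 T))) as (l & Hl).
  { intros e. destruct (H e (cond_pos e)) as (T0 & K).
    exists (fun x => Rmax T0 0 < x)%R. split. { now exists (Rmax T0 0). }
    intros u v Hu Hv. pose proof (Rmax_l T0 0). pose proof (Rmax_r T0 0).
    apply Cmod_ball. destruct (Rle_dec u v).
    - apply K; lra.
    - rewrite Cmod_sub_sym. apply K; lra. }
  exists l. intros e He.
  apply (filterlim_C_iff (Rbar_locally p_infty)) with (e := e) in Hl; auto.
  destruct Hl as (M & HM). exists (Rmax 0 (M + 1))%R. split; [apply Rmax_l|].
  intros T HT. apply HM. pose proof (Rmax_r 0 (M+1)). lra.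
Qed.

Lemma dominated_ex F K : dominated F K -> is_II F (II F).
Proof.
  intros H. destruct (II_cauchy_ex F) as (l & Hl); [|now rewrite (II_is F l)].
  intros e He. pose proof (dominated_pos _ _ H) as HK.
  destruct (Dprim_cauchy (e / (K + 1))%R) as (T0 & HT0 & HT); [apply Rdiv_lt_0_compat; lra|].
  exists T0. intros a b Hab Ha.
  replace (CInt F 0 b - CInt F 0 a) with (CInt F a b).
  2:{ rewrite (CInt_Chasles_le F 0 a b); [ring|lra|]. intros; apply H; lra. }
  eapply Rle_lt_trans; [apply (dominated_tail F K); auto; lra|].
  specialize (HT a b Hab). pose proof (Dprim_bound a b ltac:(lra)).
  apply (Rmult_lt_compat_l (K + 1)) in HT; [|lra].
  replace ((K + 1) * (e / (K + 1)))%R with e in HT by (field; lra). nra.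
Qed.

Lemma is_II_bound F l B : is_II F l -> (forall T, (0 <= T)%R -> (Cmod (CInt F 0 T) <= B)%R) -> (Cmod l <= B)%R.
Proof.
  intros H HB. apply Rnot_lt_le. intros N.
  destruct (H (Cmod l - B)%R) as (T & HT & K); [lra|]. specialize (K T (Rle_refl _)).
  specialize (HB T HT). rewrite Cmod_sub_sym in K. generalize (Cmod_triangle_rev l (CInt F 0 T)). lra.
Qed.

Lemma II_bound F K : dominated F K -> (Cmod (II F) <= 6 * K)%R.
Proof.
  intros H. apply (is_II_bound F); [now apply (dominated_ex F K)|].
  intros T HT. eapply Rle_trans; [apply (dominated_tail F K); auto; lra|].
  pose proof (Dprim_bound 0 T ltac:(lra)). pose proof (dominated_pos _ _ H). nra.
Qed.

Lemma is_II_plus F G l m : (forall t, (0 <= t)%R -> ccont F t) -> (forall t, (0 <= t)%R -> ccont G t) ->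
  is_II F l -> is_II G m -> is_II (fun t => F t + G t) (l + m).
Proof.
  intros HF HG H1 H2 e He.
  destruct (H1 (e/2)%R) as (T1 & P1 & K1); [lra|]. destruct (H2 (e/2)%R) as (T2 & _ & K2); [lra|].
  exists (Rmax T1 T2). split; [eapply Rle_trans; [apply P1|apply Rmax_l]|].
  intros T HT. specialize (K1 T (Rle_trans _ _ _ (Rmax_l _ _) HT)). specialize (K2 T (Rle_trans _ _ _ (Rmax_r _ _) HT)).
  assert (HT0 : (0 <= T)%R) by (eapply Rle_trans; [apply P1|]; eapply Rle_trans; [apply Rmax_l|apply HT]).
  rewrite CInt_plus by (rewrite Rmin_left, Rmax_right by lra; intros; auto; try apply HF; try apply HG; lra).
  replace (CInt F 0 T + CInt G 0 T - (l + m)) with ((CInt F 0 T - l) + (CInt G 0 T - m)) by ring.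
  eapply Rle_lt_trans; [apply Cmod_triangle|]. lra.
Qed.

Lemma is_II_scal c F l : (forall t, (0 <= t)%R -> ccont F t) -> is_II F l -> is_II (fun t => c * F t) (c * l).
Proof.
  intros HF H e He. assert (Hc : (0 < Cmod c + 1)%R) by (generalize (Cmod_ge_0 c); lra).
  destruct (H (e / (Cmod c + 1))%R) as (T & HT & K); [apply Rdiv_lt_0_compat; lra|].
  exists T. split; auto. intros T' HT'. specialize (K T' HT').
  rewrite CInt_scal by (rewrite Rmin_left, Rmax_right by lra; intros; apply HF; lra). replace (c * CInt F 0 T' - c * l) with (c * (CInt F 0 T' - l)) by ring.
  rewrite Cmod_mult.
  apply (Rmult_lt_compat_l (Cmod c + 1)) in K; [|lra].
  replace ((Cmod c + 1) * (e / (Cmod c + 1)))%R with e in K by (field; lra).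
  generalize (Cmod_ge_0 (CInt F 0 T' - l)). nra.
Qed.

Lemma is_II_ext F G l : (forall t, (0 <= t)%R -> F t = G t) -> is_II F l -> is_II G l.
Proof.
  intros E H e He. destruct (H e He) as (T & HT & K). exists T; split; auto. intros T' HT'.
  rewrite <- (CInt_ext F G); auto. intros t. rewrite Rmin_left by lra. intros; apply E; lra.
Qed.

Lemma II_ext F G K : dominated F K -> (forall t, (0 <= t)%R -> F t = G t) -> II F = II G.
Proof.
  intros H E. symmetry. apply II_is. eapply is_II_ext; [exact E|]. eapply dominated_ex, H.
Qed.

Lemma dominated_plus F G K L : dominated F K -> dominated G L -> dominated (fun t => F t + G t) (K + L).
Proof.
  intros [H1 H2] [H3 H4]. split. intros; apply ccont_plus; auto.
  intros t Ht. eapply Rle_trans; [apply Cmod_triangle|]. specialize (H2 t Ht). specialize (H4 t Ht). lra.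
Qed.

Lemma dominated_scal c F K : dominated F K -> dominated (fun t => c * F t) (Cmod c * K).
Proof.
  intros [H1 H2]. split. intros; apply ccont_mult; auto; apply ccont_const.
  intros t Ht. rewrite Cmod_mult, Rmult_assoc. apply Rmult_le_compat_l; auto. apply Cmod_ge_0.
Qed.

Lemma II_plus F G K L : dominated F K -> dominated G L -> II (fun t => F t + G t) = II F + II G.
Proof. intros H1 H2. apply II_is, is_II_plus; try apply H1; try apply H2; eapply dominated_ex; eauto. Qed.

Lemma II_scal c F K : dominated F K -> II (fun t => c * F t) = c * II F.
Proof. intros H. apply II_is, is_II_scal; try apply H. eapply dominated_ex; eauto. Qed.

(** Conditional convergence is kept: of the contour integrals in [is_inv_laplace], and of the ray
    integral in [is_laplace], nothing is known beyond the existence of this limit. *)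
Lemma is_RInt_gen_is_II F l : is_RInt_gen (V := C_R_NormedModule) F (at_point 0%R) (Rbar_locally p_infty) l -> is_II F l.
Proof.
  intros H e He.
  specialize (H (fun y => (Cmod (y - l) < e)%R)).
  destruct H as [Q1 Q2 HQ1 [M HM] HQ].
  - apply locally_C_iff. now exists e.
  - exists (Rmax 0 (M + 1)). split; [apply Rmax_l|]. intros T HT.
    pose proof (Rmax_r 0 (M+1)).
    destruct (HQ 0%R T) as (y & Hy1 & Hy2); [exact HQ1|apply HM; lra|].
    simpl in Hy1. rewrite (is_CInt_unique F 0 T y Hy1). exact Hy2.
Qed.

Lemma is_II_is_RInt_gen F l : (forall t, (0 <= t)%R -> ccont F t) -> is_II F l ->
  is_RInt_gen (V := C_R_NormedModule) F (at_point 0%R) (Rbar_locally p_infty) l.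
Proof.
  intros Hc H P HP. apply locally_C_iff in HP as (d & Hd & HP).
  destruct (H d Hd) as (T0 & HT0 & K).
  apply (Filter_prod _ _ _ (fun x => x = 0%R) (fun T => T0 < T)%R).
  - reflexivity.
  - now exists T0.
  - intros x T -> HT. exists (CInt F 0 T). split; simpl.
    + apply CInt_correct_le; [lra|]. intros; apply Hc; lra.
    + apply HP, K. lra.
Qed.

(** * Goursat's theorem on rectangles *)

Lemma pair_RtoC (x y : R) : (x, y) = RtoC x + Ci * RtoC y.
Proof. apply injective_projections; simpl; ring. Qed.

Lemma ccont_hor (x y : R) : ccont (fun t => (t, y)) x.
Proof.
  apply (ccont_ext (fun t => RtoC t + Ci * RtoC y)); [intros; now rewrite <- pair_RtoC|].
  apply ccont_plus; [|apply ccont_const]. apply ccont_RtoC, continuity_pt_id.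
Qed.

Lemma ccont_vert (x y : R) : ccont (fun t => (x, t)) y.
Proof.
  apply (ccont_ext (fun t => RtoC x + Ci * RtoC t)); [intros; now rewrite <- pair_RtoC|].
  apply ccont_plus; [apply ccont_const|]. apply ccont_mult; [apply ccont_const|]. apply ccont_RtoC, continuity_pt_id.
Qed.

Lemma deriv_hor (x y : R) : deriv_RC (fun t => (t, y)) x 1.
Proof.
  apply (deriv_RC_ext (fun t => Ci * RtoC y + RtoC t * 1)).
  - intros. rewrite pair_RtoC. ring.
  - apply deriv_RC_id_mult.
Qed.

Lemma deriv_vert (x y : R) : deriv_RC (fun t => (x, t)) y Ci.
Proof.
  apply (deriv_RC_ext (fun t => RtoC x + RtoC t * Ci)).
  - intros. rewrite pair_RtoC. ring.
  - apply deriv_RC_id_mult.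
Qed.

Definition in_rect (x1 x2 y1 y2 x y : R) : Prop := (Rmin x1 x2 <= x <= Rmax x1 x2)%R /\ (Rmin y1 y2 <= y <= Rmax y1 y2)%R.

Definition rectI (f : C -> C) (x1 x2 y1 y2 : R) : C :=
  CInt (fun x => f (x, y1)) x1 x2 + Ci * CInt (fun y => f (x2, y)) y1 y2
  - CInt (fun x => f (x, y2)) x1 x2 - Ci * CInt (fun y => f (x1, y)) y1 y2.

Definition rect_cont f x1 x2 y1 y2 := forall x y, in_rect x1 x2 y1 y2 x y -> contCC f (x, y).

Lemma rect_cont_hor f x1 x2 y1 y2 y : rect_cont f x1 x2 y1 y2 -> (Rmin y1 y2 <= y <= Rmax y1 y2)%R ->
  forall t, (Rmin x1 x2 <= t <= Rmax x1 x2)%R -> ccont (fun x => f (x, y)) t.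
Proof.
  intros H Hy t Ht. apply (ccont_comp f (fun x => (x, y))); [apply ccont_hor|]. apply H. now split.
Qed.

Lemma rect_cont_vert f x1 x2 y1 y2 x : rect_cont f x1 x2 y1 y2 -> (Rmin x1 x2 <= x <= Rmax x1 x2)%R ->
  forall t, (Rmin y1 y2 <= t <= Rmax y1 y2)%R -> ccont (fun y => f (x, y)) t.
Proof.
  intros H Hy t Ht. apply (ccont_comp f (fun y => (x, y))); [apply ccont_vert|]. apply H. now split.
Qed.

Lemma Rminmax_l a b : (Rmin a b <= a <= Rmax a b)%R.
Proof. split; [apply Rmin_l|apply Rmax_l]. Qed.
Lemma Rminmax_r a b : (Rmin a b <= b <= Rmax a b)%R.
Proof. split; [apply Rmin_r|apply Rmax_r]. Qed.

Lemma rectI_split_x f x1 xm x2 y1 y2 : (x1 <= xm <= x2)%R -> rect_cont f x1 x2 y1 y2 ->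
  rectI f x1 x2 y1 y2 = rectI f x1 xm y1 y2 + rectI f xm x2 y1 y2.
Proof.
  intros Hx Hc. unfold rectI.
  assert (K : forall y, (Rmin y1 y2 <= y <= Rmax y1 y2)%R ->
     CInt (fun x => f (x, y)) x1 x2 = CInt (fun x => f (x, y)) x1 xm + CInt (fun x => f (x, y)) xm x2).
  { intros y Hy. apply CInt_Chasles_le; auto. intros t Ht.
    apply (rect_cont_hor f x1 x2 y1 y2); auto. rewrite Rmin_left, Rmax_right; lra. }
  rewrite (K y1 (Rminmax_l _ _)), (K y2 (Rminmax_r _ _)). ring.
Qed.

Lemma rectI_split_y f x1 x2 y1 ym y2 : (y1 <= ym <= y2)%R -> rect_cont f x1 x2 y1 y2 ->
  rectI f x1 x2 y1 y2 = rectI f x1 x2 y1 ym + rectI f x1 x2 ym y2.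
Proof.
  intros Hx Hc. unfold rectI.
  assert (K : forall x, (Rmin x1 x2 <= x <= Rmax x1 x2)%R ->
     CInt (fun y => f (x, y)) y1 y2 = CInt (fun y => f (x, y)) y1 ym + CInt (fun y => f (x, y)) ym y2).
  { intros y Hy. apply CInt_Chasles_le; auto. intros t Ht.
    apply (rect_cont_vert f x1 x2 y1 y2); auto. rewrite Rmin_left, Rmax_right; lra. }
  rewrite (K x1 (Rminmax_l _ _)), (K x2 (Rminmax_r _ _)). ring.
Qed.

Lemma rect_cont_sub f x1 x2 y1 y2 a b c d : (x1 <= a <= b)%R -> (b <= x2)%R -> (y1 <= c <= d)%R -> (d <= y2)%R ->
  rect_cont f x1 x2 y1 y2 -> rect_cont f a b c d.
Proof.
  intros Ha Hb Hc Hd H x y [Hx Hy]. apply H.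
  rewrite Rmin_left, Rmax_right in Hx, Hy by lra.
  split; rewrite Rmin_left, Rmax_right; lra.
Qed.

Lemma rectI_primitive f F x1 x2 y1 y2 : (x1 <= x2)%R -> (y1 <= y2)%R ->
  (forall z, deriv_CC F z (f z)) -> (forall z, contCC f z) -> rectI f x1 x2 y1 y2 = 0.
Proof.
  intros Hx Hy HF Hf. unfold rectI.
  assert (Kx : forall y, CInt (fun x => f (x, y)) x1 x2 = F (x2, y) - F (x1, y)).
  { intros y. apply is_CInt_unique. apply (CInt_FTC (fun x => F (x, y))); auto.
    - intros t _. rewrite <- (Cmult_1_l (f (t, y))). apply (deriv_RC_comp F (fun x => (x, y))); [apply deriv_hor|apply HF].
    - intros t _. apply (ccont_comp f (fun x => (x, y))); [apply ccont_hor|apply Hf]. }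
  assert (Ky : forall x, Ci * CInt (fun y => f (x, y)) y1 y2 = F (x, y2) - F (x, y1)).
  { intros x.
    assert (Kc : forall t, ccont (fun y => f (x, y)) t).
    { intros t. apply (ccont_comp f (fun y => (x, y))); [apply ccont_vert|apply Hf]. }
    rewrite <- CInt_scal by auto.
    apply is_CInt_unique. apply (CInt_FTC (fun y => F (x, y))); auto.
    - intros t _. apply (deriv_RC_comp F (fun y => (x, y))); [apply deriv_vert|apply HF].
    - intros t _. apply ccont_mult; auto. apply ccont_const. }
  rewrite !Kx, !Ky. ring.
Qed.

Lemma deriv_CC_quad (a l c z : C) : deriv_CC (fun z => a * (z - c) + l / 2 * (z - c) * (z - c)) z (a + l * (z - c)).
Proof.
  intros e He. assert (Hl : (0 < Cmod (l / 2) + 1)%R) by (generalize (Cmod_ge_0 (l/2)); lra).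
  exists (e / (Cmod (l / 2) + 1))%R. split; [apply Rdiv_lt_0_compat; lra|].
  intros h Hh. match goal with |- (Cmod ?X <= _)%R => replace X with (l / 2 * h * h) end.
  2: { field. }
  rewrite !Cmod_mult. apply Rmult_le_compat_r; [apply Cmod_ge_0|].
  apply (Rmult_lt_compat_l (Cmod (l / 2) + 1)) in Hh; [|lra].
  replace ((Cmod (l / 2) + 1) * (e / (Cmod (l / 2) + 1)))%R with e in Hh by (field; lra).
  generalize (Cmod_ge_0 h). nra.
Qed.

Lemma rectI_ext f g x1 x2 y1 y2 : (forall z, f z = g z) -> rectI f x1 x2 y1 y2 = rectI g x1 x2 y1 y2.
Proof.
  intros E. unfold rectI.
  rewrite (CInt_ext (fun x => f (x, y1)) (fun x => g (x, y1))), (CInt_ext (fun x => f (x, y2)) (fun x => g (x, y2))),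
    (CInt_ext (fun y => f (x1, y)) (fun y => g (x1, y))), (CInt_ext (fun y => f (x2, y)) (fun y => g (x2, y)));
    auto.
Qed.

Lemma rectI_plus f g x1 x2 y1 y2 : rect_cont f x1 x2 y1 y2 -> rect_cont g x1 x2 y1 y2 ->
  rectI (fun z => f z + g z) x1 x2 y1 y2 = rectI f x1 x2 y1 y2 + rectI g x1 x2 y1 y2.
Proof.
  intros Hf Hg. unfold rectI.
  rewrite !CInt_plus; try (apply (rect_cont_hor _ x1 x2 y1 y2); auto using Rminmax_l, Rminmax_r);
   try (apply (rect_cont_vert _ x1 x2 y1 y2); auto using Rminmax_l, Rminmax_r).
  ring.
Qed.

Lemma rectI_bound f x1 x2 y1 y2 K : (x1 <= x2)%R -> (y1 <= y2)%R -> rect_cont f x1 x2 y1 y2 ->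
  (forall x y, in_rect x1 x2 y1 y2 x y -> (Cmod (f (x, y)) <= K)%R) ->
  (Cmod (rectI f x1 x2 y1 y2) <= 2 * K * ((x2 - x1) + (y2 - y1)))%R.
Proof.
  intros Hx Hy Hc HK. unfold rectI.
  assert (Kx : forall y, (Rmin y1 y2 <= y <= Rmax y1 y2)%R -> (Cmod (CInt (fun x => f (x, y)) x1 x2) <= K * (x2 - x1))%R).
  { intros y H. apply CInt_bound; auto; intros t Ht.
    - apply (rect_cont_hor _ x1 x2 y1 y2); auto. rewrite Rmin_left, Rmax_right; lra.
    - apply HK. split; auto. rewrite Rmin_left, Rmax_right; lra. }
  assert (Ky : forall x, (Rmin x1 x2 <= x <= Rmax x1 x2)%R -> (Cmod (CInt (fun y => f (x, y)) y1 y2) <= K * (y2 - y1))%R).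
  { intros x H. apply CInt_bound; auto; intros t Ht.
    - apply (rect_cont_vert _ x1 x2 y1 y2); auto. rewrite Rmin_left, Rmax_right; lra.
    - apply HK. split; auto. rewrite Rmin_left, Rmax_right; lra. }
  unfold Cminus. eapply Rle_trans; [apply Cmod_triangle4|].
  rewrite !Cmod_opp, !Cmod_mult, Cmod_Ci.
  pose proof (Kx y1 (Rminmax_l _ _)). pose proof (Kx y2 (Rminmax_r _ _)).
  pose proof (Ky x1 (Rminmax_l _ _)). pose proof (Ky x2 (Rminmax_r _ _)). lra.
Qed.

Section Bisection.
Variables (f : C -> C) (X Y W L : R).
Hypothesis HW : (0 <= W)%R.
Hypothesis HL : (0 <= L)%R.
Hypothesis Hf : forall x y, in_rect X (X + W) Y (Y + L) x y -> exists l, deriv_CC f (x, y) l.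

Let A (x y w h : R) : R := Cmod (rectI f x (x + w) y (y + h)).

Definition half_x (x y w h : R) : R := if Rle_dec (A x y w h / 2) (A x y (w / 2) h) then x else (x + w / 2)%R.
Definition half_y (x y w h : R) : R := if Rle_dec (A x y w h / 2) (A x y w (h / 2)) then y else (y + h / 2)%R.

(** The rectangle of stage n has sides W / 2^n and L / 2^n, so its lower left corner determines it.
    A step halves the width and then the height, each time keeping a half that carries at least half
    of the integral; it loses a factor 4 in all. *)
Fixpoint corner (n : nat) : R * R :=
  match n with
  | O => (X, Y)
  | S n => let x := fst (corner n) in let y := snd (corner n) in
           let w := (W / 2 ^ n)%R in let h := (L / 2 ^ n)%R in
           let x' := half_x x y w h in
           (x', half_y x' y (w / 2) h)
  end.

Lemma bis_cont : rect_cont f X (X + W) Y (Y + L).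
Proof. intros x y H. destruct (Hf x y H) as [l Hl]. eapply deriv_CC_cont, Hl. Qed.

Lemma half_x_spec x y w h : (0 <= w)%R -> (0 <= h)%R -> (X <= x)%R -> (x + w <= X + W)%R -> (Y <= y)%R -> (y + h <= Y + L)%R ->
  (A x y w h / 2 <= A (half_x x y w h) y (w / 2) h)%R /\ (x <= half_x x y w h)%R /\ (half_x x y w h + w / 2 <= x + w)%R.
Proof.
  intros. unfold half_x. destruct Rle_dec as [E|E]. { lra. }
  split; [|lra]. unfold A in *.
  rewrite (rectI_split_x f x (x + w / 2) (x + w)) in * by (try lra; apply (rect_cont_sub f X (X + W) Y (Y + L)); try lra; apply bis_cont).
  replace (x + w / 2 + w / 2)%R with (x + w)%R by lra.
  pose proof (Cmod_triangle (rectI f x (x + w / 2) y (y + h)) (rectI f (x + w / 2) (x + w) y (y + h))). lra.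
Qed.

Lemma half_y_spec x y w h : (0 <= w)%R -> (0 <= h)%R -> (X <= x)%R -> (x + w <= X + W)%R -> (Y <= y)%R -> (y + h <= Y + L)%R ->
  (A x y w h / 2 <= A x (half_y x y w h) w (h / 2))%R /\ (y <= half_y x y w h)%R /\ (half_y x y w h + h / 2 <= y + h)%R.
Proof.
  intros. unfold half_y. destruct Rle_dec as [E|E]. { lra. }
  split; [|lra]. unfold A in *.
  rewrite (rectI_split_y f x (x + w) y (y + h / 2) (y + h)) in * by (try lra; apply (rect_cont_sub f X (X + W) Y (Y + L)); try lra; apply bis_cont).
  replace (y + h / 2 + h / 2)%R with (y + h)%R by lra.
  pose proof (Cmod_triangle (rectI f x (x + w) y (y + h / 2)) (rectI f x (x + w) (y + h / 2) (y + h))). lra.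
Qed.

Lemma pow2_pos n : (0 < 2 ^ n)%R.
Proof. apply pow_lt; lra. Qed.

Lemma half_div a n : (a / 2 ^ n / 2 = a / 2 ^ (S n))%R.
Proof. simpl. field. apply Rgt_not_eq, pow2_pos. Qed.

Lemma corner_spec n : let x := fst (corner n) in let y := snd (corner n) in
  (X <= x)%R /\ (x + W / 2 ^ n <= X + W)%R /\ (Y <= y)%R /\ (y + L / 2 ^ n <= Y + L)%R /\
  (A X Y W L / 4 ^ n <= A x y (W / 2 ^ n) (L / 2 ^ n))%R.
Proof.
  induction n as [|n IH]; intros x y.
  - unfold x, y; simpl. rewrite !Rdiv_1_r. lra.
  - destruct IH as (I1 & I2 & I3 & I4 & I5).
    set (x0 := fst (corner n)) in *. set (y0 := snd (corner n)) in *.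
    assert (Hw : (0 <= W / 2 ^ n)%R) by (apply Rdiv_le_0_compat; [lra|apply pow2_pos]).
    assert (Hh : (0 <= L / 2 ^ n)%R) by (apply Rdiv_le_0_compat; [lra|apply pow2_pos]).
    destruct (half_x_spec x0 y0 (W / 2 ^ n) (L / 2 ^ n)) as (J1 & J2 & J3); auto.
    assert (Ex : x = half_x x0 y0 (W / 2 ^ n) (L / 2 ^ n)) by reflexivity.
    rewrite <- Ex in *.
    destruct (half_y_spec x y0 (W / 2 ^ n / 2) (L / 2 ^ n)) as (K1 & K2 & K3); try lra.
    assert (Ey : y = half_y x y0 (W / 2 ^ n / 2) (L / 2 ^ n)) by reflexivity.
    rewrite <- Ey in *. rewrite <- !half_div.
    repeat split; try lra.
    replace (A X Y W L / 4 ^ S n)%R with (A X Y W L / 4 ^ n / 4)%R; [lra|].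
    simpl. field. apply pow_nonzero. lra.
Qed.

Lemma corner_mono n m : (fst (corner n) <= fst (corner (n + m)))%R /\ (fst (corner (n + m)) + W / 2 ^ (n + m) <= fst (corner n) + W / 2 ^ n)%R
  /\ (snd (corner n) <= snd (corner (n + m)))%R /\ (snd (corner (n + m)) + L / 2 ^ (n + m) <= snd (corner n) + L / 2 ^ n)%R.
Proof.
  induction m as [|m IH]. { rewrite Nat.add_0_r. lra. }
  rewrite Nat.add_succ_r.
  destruct (corner_spec (n + m)) as (I1 & I2 & I3 & I4 & _). simpl corner.
  set (x0 := fst (corner (n + m))) in *. set (y0 := snd (corner (n + m))) in *.
  assert (Hw : (0 <= W / 2 ^ (n + m))%R) by (apply Rdiv_le_0_compat; [lra|apply pow2_pos]).
  assert (Hh : (0 <= L / 2 ^ (n + m))%R) by (apply Rdiv_le_0_compat; [lra|apply pow2_pos]).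
  destruct (half_x_spec x0 y0 (W / 2 ^ (n + m)) (L / 2 ^ (n + m))) as (J1 & J2 & J3); auto.
  cbn [fst snd].
  set (x := half_x x0 y0 (W / 2 ^ (n + m)) (L / 2 ^ (n + m))) in *.
  destruct (half_y_spec x y0 (W / 2 ^ (n + m) / 2) (L / 2 ^ (n + m))) as (K1 & K2 & K3); try lra.
  rewrite <- !half_div. lra.
Qed.

Lemma nested_limit (u : nat -> R) (B : R) :
  (forall n m, (u n <= u (n + m)%nat)%R /\ (u (n + m)%nat + B / 2 ^ (n + m) <= u n + B / 2 ^ n)%R) -> (0 <= B)%R ->
  exists l, forall n, (u n <= l <= u n + B / 2 ^ n)%R.
Proof.
  intros H HB.
  assert (HP : forall n, (0 <= B / 2 ^ n)%R) by (intros; apply Rdiv_le_0_compat; [lra|apply pow2_pos]).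
  assert (K : forall n m, (u m <= u n + B / 2 ^ n)%R).
  { intros n m. destruct (Nat.le_gt_cases n m).
    - destruct (H n (m - n)%nat) as [_ J]. replace (n + (m - n))%nat with m in J by lia. specialize (HP m). lra.
    - destruct (H m (n - m)%nat) as [J _]. replace (m + (n - m))%nat with n in J by lia. specialize (HP n). lra. }
  destruct (completeness (fun v => exists n, v = u n)) as (l & Hl1 & Hl2).
  - exists (u 0%nat + B / 2 ^ 0)%R. intros v (n & ->). apply K.
  - exists (u 0%nat). now exists 0%nat.
  - exists l. intros n. split. apply Hl1; now exists n. apply Hl2. intros v (m & ->). apply K.
Qed.

(** At the common point of the nested rectangles f is affine up to a small multiple of the distance.
    The affine part has a primitive and integrates to 0; the rest contributes at most (e / B) times
    diameter times perimeter, which is of order 4^(-n) and cancels the factor lost by bisection. B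
    is chosen to make the final bound e. *)
Lemma goursat_aux : rectI f X (X + W) Y (Y + L) = 0.
Proof.
  destruct (nested_limit (fun n => fst (corner n)) W) as (x & Hx); auto.
  { intros n m. destruct (corner_mono n m) as (? & ? & ? & ?). auto. }
  destruct (nested_limit (fun n => snd (corner n)) L) as (y & Hy); auto.
  { intros n m. destruct (corner_mono n m) as (? & ? & ? & ?). auto. }
  destruct (Hf x y) as (l & Hl).
  { specialize (Hx 0%nat). specialize (Hy 0%nat). simpl in Hx, Hy. rewrite Rdiv_1_r in *.
    split; rewrite Rmin_left, Rmax_right; lra. }
  apply Cmod_small_eq. intros e He.
  set (B := (2 * (W + L) * (W + L) + 1)%R). assert (HB : (0 < B)%R) by (unfold B; nra).
  destruct (Hl (e / B)%R) as (d & Hd & K); [apply Rdiv_lt_0_compat; lra|].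
  assert (Hn : exists n, ((W + L) / 2 ^ n < d)%R).
  { destruct (Rle_lt_or_eq_dec 0 (W + L)) as [P|P]; [lra| |].
    - destruct (pow_lt_1_zero (/ 2)) with (y := (d / (W + L))%R) as (N & HN).
      + rewrite Rabs_pos_eq; lra.
      + apply Rdiv_lt_0_compat; lra.
      + exists N. specialize (HN N (Nat.le_refl _)). rewrite pow_inv, Rabs_pos_eq in HN.
        2: { apply Rlt_le, Rinv_0_lt_compat, pow2_pos. }
        apply (Rmult_lt_compat_l (W + L)) in HN; auto.
        replace ((W + L) * (d / (W + L)))%R with d in HN by (field; lra). exact HN.
    - exists 0%nat. rewrite <- P. unfold Rdiv. rewrite Rmult_0_l. lra. }
  destruct Hn as (n & Hn).
  destruct (corner_spec n) as (I1 & I2 & I3 & I4 & I5). specialize (Hx n). specialize (Hy n). simpl in Hx, Hy.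
  set (x0 := fst (corner n)) in *. set (y0 := snd (corner n)) in *.
  set (w := (W / 2 ^ n)%R) in *. set (h := (L / 2 ^ n)%R) in *.
  assert (Hw : (0 <= w)%R) by (apply Rdiv_le_0_compat; [lra|apply pow2_pos]).
  assert (Hh : (0 <= h)%R) by (apply Rdiv_le_0_compat; [lra|apply pow2_pos]).
  assert (Hwh : ((W + L) / 2 ^ n = w + h)%R) by (unfold w, h; field; apply Rgt_not_eq, pow2_pos).
  rewrite Hwh in Hn.
  set (z := (x, y) : C) in *.
  set (lin := fun z' => f z + l * (z' - z)).
  assert (Clin : forall z', contCC lin z').
  { intros z' e' He'. assert (Hc : (0 < Cmod l + 1)%R) by (generalize (Cmod_ge_0 l); lra).
    exists (e' / (Cmod l + 1))%R. split; [apply Rdiv_lt_0_compat; lra|]. intros z'' H.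
    unfold lin. replace (f z + l * (z'' - z) - (f z + l * (z' - z))) with (l * (z'' - z')) by ring.
    rewrite Cmod_mult. apply (Rmult_lt_compat_l (Cmod l + 1)) in H; [|lra].
    replace ((Cmod l + 1) * (e' / (Cmod l + 1)))%R with e' in H by (field; lra).
    generalize (Cmod_ge_0 (z'' - z')). nra. }
  assert (Cf : rect_cont f x0 (x0 + w) y0 (y0 + h)).
  { apply (rect_cont_sub f X (X + W) Y (Y + L)); try lra. apply bis_cont. }
  assert (Cd : rect_cont (fun z' => f z' + - lin z') x0 (x0 + w) y0 (y0 + h)).
  { intros x' y' H' e' He'. destruct (Cf x' y' H' (e' / 2)%R) as (d1 & D1 & K1); [lra|].
    destruct (Clin (x', y') (e' / 2)%R) as (d2 & D2 & K2); [lra|].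
    exists (Rmin d1 d2). split; [now apply Rmin_glb_lt|]. intros z' Hz'.
    specialize (K1 z' (Rlt_le_trans _ _ _ Hz' (Rmin_l _ _))). specialize (K2 z' (Rlt_le_trans _ _ _ Hz' (Rmin_r _ _))).
    replace (f z' + - lin z' - (f (x', y') + - lin (x', y'))) with ((f z' - f (x', y')) + - (lin z' - lin (x', y'))) by ring.
    eapply Rle_lt_trans; [apply Cmod_triangle|]. rewrite Cmod_opp. lra. }
  assert (E1 : rectI f x0 (x0 + w) y0 (y0 + h) = rectI (fun z' => f z' + - lin z') x0 (x0 + w) y0 (y0 + h)).
  { transitivity (rectI (fun z' => (f z' + - lin z') + lin z') x0 (x0 + w) y0 (y0 + h)).
    - apply rectI_ext. intros. ring.
    - etransitivity; [apply (rectI_plus (fun z' => f z' + - lin z') lin); auto; intros ? ? _; apply Clin|].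
      rewrite (rectI_primitive lin (fun z' => f z * (z' - z) + l / 2 * (z' - z) * (z' - z))); [ring|lra|lra| |apply Clin].
      intros z'. apply deriv_CC_quad. }
  assert (E2 : (A x0 y0 w h <= 2 * (e / B * (w + h)) * (w + h))%R).
  { unfold A. rewrite E1.
    replace (2 * (e / B * (w + h)) * (w + h))%R with (2 * (e / B * (w + h)) * ((x0 + w - x0) + (y0 + h - y0)))%R by ring.
    apply rectI_bound; try lra; auto.
    intros x' y' [Hx' Hy']. rewrite Rmin_left, Rmax_right in Hx', Hy' by lra.
    assert (M : (Cmod ((x', y') - z) <= w + h)%R).
    { eapply Rle_trans; [apply Cmod_le_Re_Im|]. unfold z, Re, Im; simpl.
      apply Rplus_le_compat; apply Rabs_le; lra. }
    specialize (K ((x', y') - z)). rewrite Cadd_sub in K.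
    replace (f (x', y') + - lin (x', y')) with (f (x', y') - f z - ((x', y') - z) * l) by (unfold lin; ring).
    eapply Rle_trans; [apply K; lra|]. apply Rmult_le_compat_l; auto.
    apply Rlt_le, Rdiv_lt_0_compat; lra. }
  change (A X Y W L <= e)%R.
  pose proof (Rle_trans _ _ _ I5 E2) as E3.
  replace (2 * (e / B * (w + h)) * (w + h))%R with (e * (2 * (W + L) * (W + L) / B) / 4 ^ n)%R in E3.
  2: { rewrite <- Hwh. replace 4%R with (2 * 2)%R by ring. rewrite Rpow_mult_distr. field. split; [apply Rgt_not_eq, pow2_pos|lra]. }
  apply (Rmult_le_compat_r (4 ^ n)) in E3; [|apply pow_le; lra].
  unfold Rdiv in E3. rewrite !(Rmult_assoc _ (/ 4 ^ n)), Rinv_l, !Rmult_1_r in E3 by (apply pow_nonzero; lra).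
  eapply Rle_trans; [apply E3|].
  replace e with (e * 1)%R at 2 by ring. apply Rmult_le_compat_l; [lra|].
  apply (Rmult_le_reg_r B); auto. rewrite Rmult_assoc, Rinv_l by lra. unfold B. lra.
Qed.
End Bisection.

Lemma goursat_le f x1 x2 y1 y2 : (x1 <= x2)%R -> (y1 <= y2)%R ->
  (forall x y, in_rect x1 x2 y1 y2 x y -> exists l, deriv_CC f (x, y) l) -> rectI f x1 x2 y1 y2 = 0.
Proof.
  intros Hx Hy H. pose proof (goursat_aux f x1 y1 (x2 - x1) (y2 - y1)) as G.
  replace (x1 + (x2 - x1))%R with x2 in G by ring. replace (y1 + (y2 - y1))%R with y2 in G by ring.
  apply G; auto; lra.
Qed.

(** Exchanging two opposite sides changes the sign of the integral. Unordered sides are needed by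
    [primQ_deriv], where heights and increments have either sign. *)
Lemma goursat f x1 x2 y1 y2 :
  (forall x y, in_rect x1 x2 y1 y2 x y -> exists l, deriv_CC f (x, y) l) -> rectI f x1 x2 y1 y2 = 0.
Proof.
  intros H.
  assert (Hc : rect_cont f x1 x2 y1 y2).
  { intros x y Hxy. destruct (H x y Hxy) as [l Hl]. eapply deriv_CC_cont, Hl. }
  assert (Sx : rectI f x2 x1 y1 y2 = - rectI f x1 x2 y1 y2).
  { unfold rectI. rewrite (CInt_swap (fun x => f (x, y1)) x1 x2), (CInt_swap (fun x => f (x, y2)) x1 x2); [ring| |];
    apply (rect_cont_hor f x1 x2 y1 y2); auto using Rminmax_l, Rminmax_r. }
  assert (Sy : rectI f x1 x2 y2 y1 = - rectI f x1 x2 y1 y2).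
  { unfold rectI. rewrite (CInt_swap (fun y => f (x1, y)) y1 y2), (CInt_swap (fun y => f (x2, y)) y1 y2); [ring| |];
    apply (rect_cont_vert f x1 x2 y1 y2); auto using Rminmax_l, Rminmax_r. }
  assert (Sxy : rectI f x2 x1 y2 y1 = rectI f x1 x2 y1 y2).
  { unfold rectI. rewrite (CInt_swap (fun y => f (x1, y)) y1 y2), (CInt_swap (fun y => f (x2, y)) y1 y2),
    (CInt_swap (fun x => f (x, y1)) x1 x2), (CInt_swap (fun x => f (x, y2)) x1 x2); [ring| | | |];
    solve [apply (rect_cont_vert f x1 x2 y1 y2); auto using Rminmax_l, Rminmax_r
          |apply (rect_cont_hor f x1 x2 y1 y2); auto using Rminmax_l, Rminmax_r]. }
  assert (O : forall z : C, - z = 0 -> z = 0). { intros z Hz. replace z with (- - z) by ring. rewrite Hz. ring. }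
  unfold in_rect in H.
  destruct (Rle_dec x1 x2), (Rle_dec y1 y2).
  - apply goursat_le; auto.
  - apply O. rewrite <- Sy. apply goursat_le; auto; [lra|]. intros x y Hxy. apply H. unfold in_rect in Hxy. rewrite (Rmin_comm y1), (Rmax_comm y1). auto.
  - apply O. rewrite <- Sx. apply goursat_le; auto; [lra|]. intros x y Hxy. apply H. unfold in_rect in Hxy. rewrite (Rmin_comm x1), (Rmax_comm x1). auto.
  - rewrite <- Sxy. apply goursat_le; try lra. intros x y Hxy. apply H. unfold in_rect in Hxy. rewrite (Rmin_comm x1), (Rmax_comm x1), (Rmin_comm y1), (Rmax_comm y1). auto.
Qed.

(** * Primitives on the neighborhood *)

Lemma CInt_near F a b c K : (forall t, (Rmin a b <= t <= Rmax a b)%R -> ccont F t) ->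
  (forall t, (Rmin a b <= t <= Rmax a b)%R -> (Cmod (F t - c) <= K)%R) ->
  (Cmod (CInt F a b - RtoC (b - a) * c) <= K * Rabs (b - a))%R.
Proof.
  assert (M : forall a b, (a <= b)%R -> (forall t, (a <= t <= b)%R -> ccont F t) ->
    (forall t, (a <= t <= b)%R -> (Cmod (F t - c) <= K)%R) ->
    (Cmod (CInt F a b - RtoC (b - a) * c) <= K * (b - a))%R).
  { clear a b. intros a b Hab HF HK.
    assert (E : CInt (fun t => F t + - c) a b = CInt F a b - RtoC (b - a) * c).
    { rewrite CInt_plus, CInt_const; try ring; rewrite Rmin_left, Rmax_right by lra; auto.
      intros; apply ccont_const. }
    rewrite <- E. apply CInt_bound; auto. intros; apply ccont_plus; auto; apply ccont_const. }
  intros HF HK. destruct (Rle_dec a b) as [H|H].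
  - rewrite Rmin_left, Rmax_right in HF, HK by lra. rewrite Rabs_pos_eq by lra. auto.
  - rewrite (CInt_swap F b a) by (rewrite Rmin_comm, Rmax_comm; auto).
    rewrite Rmin_right, Rmax_left in HF, HK by lra.
    replace (- CInt F b a - RtoC (b - a) * c) with (- (CInt F b a - RtoC (a - b) * c)).
    2: { rewrite !RtoC_minus. ring. }
    rewrite Cmod_opp, Rabs_minus_sym, Rabs_pos_eq by lra. apply M; auto; lra.
Qed.

Definition open_dom (H : C -> Prop) : Prop :=
  forall z, H z -> exists r, (0 < r)%R /\ forall z', (Cmod (z' - z) < r)%R -> H z'.
(** This shape takes the place of convexity: a path along the real axis and then vertically stays in
    the domain, and so do the rectangles between two such paths. Neighborhoods of minus infinity and
    their closures have it. *)
Definition down_dom (H : C -> Prop) : Prop :=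
  forall x y x' y' : R, H (x, y) -> (x' <= x)%R -> (Rabs y' <= Rabs y)%R -> H (x', y').
Definition hol (H : C -> Prop) (q : C -> C) : Prop := forall z, H z -> exists l, deriv_CC q z l.

Lemma hol_cont H q z : hol H q -> H z -> contCC q z.
Proof. intros Hq Hz. destruct (Hq z Hz) as [l Hl]. eapply deriv_CC_cont, Hl. Qed.

(* Integral along the path w0 -> Re z -> z, which stays in H when H is down_dom. *)
Definition primQ (w0 : R) (q : C -> C) (z : C) : C :=
  CInt (fun x => q (x, 0%R)) w0 (Re z) + Ci * CInt (fun y => q (Re z, y)) 0 (Im z).

Section Primitive.
Variables (H : C -> Prop) (w0 : R) (q : C -> C).
Hypothesis Ho : open_dom H.
Hypothesis Hd : down_dom H.
Hypothesis H0 : H (RtoC w0).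
Hypothesis Hq : hol H q.

Lemma Rmax_cases a b : (Rmax a b = a \/ Rmax a b = b)%R.
Proof. unfold Rmax; destruct Rle_dec; auto. Qed.

(** Goursat on the rectangle between the real axis and height Im z replaces the increment of the
    path by a horizontal step at that height followed by a vertical one. Both stay near z, where q
    is nearly constant. *)
Lemma primQ_deriv z : H z -> deriv_CC (primQ w0 q) z (q z).
Proof.
  intros Hz e He. destruct z as [x y].
  destruct (Ho _ Hz) as (r & Hr & Kr).
  destruct (hol_cont H q _ Hq Hz (e / 2)%R) as (d & Hdd & Kd); [lra|].
  exists (Rmin r d). split; [now apply Rmin_glb_lt|]. intros [h1 h2] Hh.
  pose proof (Rlt_le_trans _ _ _ Hh (Rmin_l _ _)) as Hh1.
  pose proof (Rlt_le_trans _ _ _ Hh (Rmin_r _ _)) as Hh2.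
  assert (B1 : (Rabs h1 <= Cmod (h1, h2))%R) by apply (re_le_Cmod (h1, h2)).
  assert (B2 : (Rabs h2 <= Cmod (h1, h2))%R) by apply (Im_le_Cmod (h1, h2)).
  assert (Bm : forall a b, (Rabs a <= Rabs h1)%R -> (Rabs b <= Rabs h2)%R -> (Cmod ((x + a, y + b)%R - (x, y)) <= Cmod (h1, h2))%R).
  { intros a b Ha Hb. replace ((x + a, y + b)%R - (x, y)) with ((a, b) : C).
    2: { apply injective_projections; simpl; ring. }
    unfold Cmod; simpl. apply sqrt_le_1_alt. rewrite !Rmult_1_r.
    assert (Q : forall u v, (Rabs u <= Rabs v)%R -> (u * u <= v * v)%R).
    { intros u v Huv. apply Rsqr_le_abs_1 in Huv. exact Huv. }
    apply Rplus_le_compat; apply Q; assumption. }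
  assert (HB : forall a b, (Rabs a <= Rabs h1)%R -> (Rabs b <= Rabs h2)%R -> H (x + a, y + b)%R).
  { intros a b Ha Hb. apply Kr. eapply Rle_lt_trans; [apply Bm; auto|]. auto. }
  assert (Z0 : forall u, (Rabs 0 <= Rabs u)%R) by (intros; rewrite Rabs_R0; apply Rabs_pos).
  assert (HR : forall x' y', (Rmin x (x + h1) <= x' <= Rmax x (x + h1))%R -> (Rmin 0 y <= y' <= Rmax 0 y)%R -> H (x', y')).
  { intros x' y' Hx' Hy'. assert (E : exists a, (Rabs a <= Rabs h1)%R /\ Rmax x (x + h1) = (x + a)%R).
    { destruct (Rmax_cases x (x + h1)) as [E|E]; rewrite E. exists 0%R. split; auto; lra. exists h1. split; [lra|lra]. }
    destruct E as (a & Ha & E). apply (Hd (x + a)%R (y + 0)%R x' y'); [apply HB; auto| |].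
    - rewrite <- E. tauto.
    - rewrite Rplus_0_r. unfold Rmin, Rmax in Hy'. repeat destruct Rle_dec in Hy'; unfold Rabs; repeat destruct Rcase_abs; lra. }
  assert (G : rectI q x (x + h1) 0 y = 0).
  { apply goursat. intros x' y' [Hx' Hy']. apply Hq, HR; auto. }
  assert (Cx : forall x', (x' <= Rmax w0 (x + Rabs h1))%R -> ccont (fun x => q (x, 0%R)) x').
  { intros x' Hx'. apply (ccont_comp q (fun x => (x, 0%R))); [apply ccont_hor|].
    apply (hol_cont H); auto. destruct (Rmax_cases w0 (x + Rabs h1)) as [E|E]; rewrite E in Hx'.
    - apply (Hd w0 0%R x' 0%R); [exact H0|lra|apply Rle_refl].
    - apply (Hd (x + Rabs h1)%R (y + 0)%R x' 0%R); auto. apply HB; auto. rewrite Rabs_Rabsolu; lra. }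
  assert (Cy : forall y', (Rmin 0 (y + h2) <= y' <= Rmax 0 (y + h2))%R \/ (Rmin 0 y <= y' <= Rmax 0 y)%R -> ccont (fun y => q ((x + h1)%R, y)) y').
  { intros y' Hy'. apply (ccont_comp q (fun y => ((x + h1)%R, y))); [apply ccont_vert|].
    apply (hol_cont H); auto. destruct Hy' as [Hy'|Hy'].
    - apply (Hd (x + h1)%R (y + h2)%R (x + h1)%R y'); [apply HB; lra|lra|].
      unfold Rmin, Rmax in Hy'. repeat destruct Rle_dec in Hy'; unfold Rabs; repeat destruct Rcase_abs; lra.
    - apply HR; auto using Rminmax_r. }
  unfold primQ. simpl. unfold Re, Im; simpl.
  assert (Ab : (h1 <= Rabs h1)%R) by apply Rle_abs.
  assert (E1 : CInt (fun x => q (x, 0%R)) w0 (x + h1) = CInt (fun x => q (x, 0%R)) w0 x + CInt (fun x => q (x, 0%R)) x (x + h1)).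
  { pose proof (Rmax_r w0 (x + Rabs h1)). pose proof (Rmax_l w0 (x + Rabs h1)). pose proof (Rabs_pos h1).
    apply is_CInt_unique. apply is_CInt_Chasles with x; apply CInt_correct; intros t [_ Ht]; apply Cx;
      (eapply Rle_trans; [apply Ht|]); apply Rmax_lub; lra. }
  assert (E2 : CInt (fun y => q ((x + h1)%R, y)) 0 (y + h2) = CInt (fun y => q ((x + h1)%R, y)) 0 y + CInt (fun y => q ((x + h1)%R, y)) y (y + h2)).
  { assert (I1 : is_CInt (fun y => q ((x + h1)%R, y)) 0 y (CInt (fun y => q ((x + h1)%R, y)) 0 y)) by (apply CInt_correct; auto).
    assert (I2 : is_CInt (fun y => q ((x + h1)%R, y)) 0 (y + h2) (CInt (fun y => q ((x + h1)%R, y)) 0 (y + h2))) by (apply CInt_correct; auto).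
    pose proof (is_CInt_Chasles _ _ _ _ _ _ (is_CInt_swap _ _ _ _ I1) I2) as I3.
    rewrite (is_CInt_unique _ _ _ _ I3). ring. }
  rewrite E1, E2.
  unfold rectI in G.
  match goal with |- (Cmod ?X <= _)%R => replace X with
    ((CInt (fun x => q (x, y)) x (x + h1) - RtoC (x + h1 - x) * q (x, y))
     + Ci * (CInt (fun y => q ((x + h1)%R, y)) y (y + h2) - RtoC (y + h2 - y) * q (x, y)))
  end.
  2: { match type of G with ?U = _ => transitivity (U + ((CInt (fun x => q (x, y)) x (x + h1) - RtoC (x + h1 - x) * q (x, y))
     + Ci * (CInt (fun y => q ((x + h1)%R, y)) y (y + h2) - RtoC (y + h2 - y) * q (x, y)))) end.
       - rewrite G. ring.
       - rewrite (pair_RtoC h1 h2). replace (x + h1 - x)%R with h1 by ring. replace (y + h2 - y)%R with h2 by ring. ring. }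
  eapply Rle_trans; [apply Cmod_triangle|]. rewrite Cmod_mult, Cmod_Ci, Rmult_1_l.
  assert (N1 : (Cmod (CInt (fun x => q (x, y)) x (x + h1) - RtoC (x + h1 - x) * q (x, y)) <= e / 2 * Rabs (x + h1 - x))%R).
  { apply CInt_near.
    - intros t Ht. apply (ccont_comp q (fun x => (x, y))); [apply ccont_hor|]. apply (hol_cont H); auto.
      apply HR; auto using Rminmax_r.
    - intros t Ht. left. apply Kd. replace t with (x + (t - x))%R by ring. replace y with (y + 0)%R at 1 by ring.
      eapply Rle_lt_trans; [apply Bm; auto|auto].
      unfold Rmin, Rmax in Ht. repeat destruct Rle_dec in Ht; unfold Rabs; repeat destruct Rcase_abs; lra. }
  assert (N2 : (Cmod (CInt (fun y => q ((x + h1)%R, y)) y (y + h2) - RtoC (y + h2 - y) * q (x, y)) <= e / 2 * Rabs (y + h2 - y))%R).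
  { apply CInt_near.
    - intros t Ht. apply (ccont_comp q (fun y => ((x + h1)%R, y))); [apply ccont_vert|]. apply (hol_cont H); auto.
      replace t with (y + (t - y))%R by ring. apply HB; [lra|].
      unfold Rmin, Rmax in Ht. repeat destruct Rle_dec in Ht; unfold Rabs; repeat destruct Rcase_abs; lra.
    - intros t Ht. left. apply Kd. replace t with (y + (t - y))%R by ring.
      eapply Rle_lt_trans; [apply Bm; [lra|]|auto].
      unfold Rmin, Rmax in Ht. repeat destruct Rle_dec in Ht; unfold Rabs; repeat destruct Rcase_abs; lra. }
  replace (x + h1 - x)%R with h1 in * by ring. replace (y + h2 - y)%R with h2 in * by ring.
  nra.
Qed.

Lemma primQ_w0 : primQ w0 q (RtoC w0) = 0.
Proof. unfold primQ. simpl. rewrite !CInt_point. ring. Qed.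

Lemma primQ_cont z : H z -> contCC (primQ w0 q) z.
Proof. intros Hz. eapply deriv_CC_cont, primQ_deriv, Hz. Qed.

Lemma deriv_line (z d : C) t : deriv_RC (fun t => z + RtoC t * d) t d.
Proof. apply deriv_RC_id_mult. Qed.

Lemma ccont_line (z d : C) t : ccont (fun t => z + RtoC t * d) t.
Proof. eapply deriv_RC_cont, deriv_line. Qed.

Lemma line_int (z d : C) T : (0 <= T)%R -> (forall t, (0 <= t <= T)%R -> H (z + RtoC t * d)) ->
  CInt (fun t => d * q (z + RtoC t * d)) 0 T = primQ w0 q (z + RtoC T * d) - primQ w0 q z.
Proof.
  intros HT HH. replace (primQ w0 q z) with (primQ w0 q (z + RtoC 0 * d)).
  2: { f_equal. ring. }
  apply is_CInt_unique. apply (CInt_FTC (fun t => primQ w0 q (z + RtoC t * d))); auto.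
  - intros t Ht. apply (deriv_RC_comp (primQ w0 q) (fun t => z + RtoC t * d)); [apply deriv_line|].
    apply primQ_deriv. auto.
  - intros t Ht. apply ccont_mult; [apply ccont_const|]. apply (ccont_comp q (fun t => z + RtoC t * d)); [apply ccont_line|].
    apply (hol_cont H); auto.
Qed.

Lemma primQ_variation (z d : C) K : (forall t, (0 <= t <= 1)%R -> H (z + RtoC t * d)) ->
  (forall t, (0 <= t <= 1)%R -> (Cmod (q (z + RtoC t * d)) <= K)%R) ->
  (Cmod (primQ w0 q (z + d) - primQ w0 q z) <= Cmod d * K)%R.
Proof.
  intros HH HK.
  pose proof (mvt_RC (fun t => primQ w0 q (z + RtoC t * d)) (fun t => d * q (z + RtoC t * d)) 0 1 (Cmod d * K) Rle_0_1) as M.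
  cbv beta in M. rewrite Rminus_0_r, Rmult_1_r in M.
  replace (z + 1 * d) with (z + d) in M by ring. replace (z + 0 * d) with z in M by ring.
  apply M.
  - intros t Ht. apply (deriv_RC_comp (primQ w0 q) (fun t => z + RtoC t * d)); [apply deriv_line|].
    apply primQ_deriv. auto.
  - intros t Ht. rewrite Cmod_mult. apply Rmult_le_compat_l; auto. apply Cmod_ge_0.
Qed.

(** * Line integrals that run along the border *)

Section Closure.
Variable cl : C -> Prop.
Hypothesis Hcl : forall z, H z -> cl z.
Hypothesis Hshift : forall z d, cl z -> (0 < d)%R -> H (z - RtoC d).
Hypothesis Hqcl : forall z, cl z -> forall e, (0 < e)%R -> exists d, (0 < d)%R /\
  forall z', cl z' -> (Cmod (z' - z) < d)%R -> (Cmod (q z' - q z) < e)%R.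

(** On a segment in the closure q is continuous only relative to the closure, while [ccont] looks at
    both sides of the parameter. Freezing the parameter outside [0, T] turns one into the other
    without changing the integral. *)
Definition clamp (T t : R) : R := Rmax 0 (Rmin t T).

Lemma clamp_in T t : (0 <= T)%R -> (0 <= clamp T t <= T)%R.
Proof. intros. unfold clamp. split; [apply Rmax_l|]. apply Rmax_lub; auto. apply Rmin_r. Qed.

Lemma clamp_id T t : (0 <= t <= T)%R -> clamp T t = t.
Proof. intros. unfold clamp. rewrite Rmin_left, Rmax_right; lra. Qed.

Lemma clamp_lip T t t' : (Rabs (clamp T t' - clamp T t) <= Rabs (t' - t))%R.
Proof. unfold clamp, Rmax, Rmin. repeat destruct Rle_dec; unfold Rabs; repeat destruct Rcase_abs; lra. Qed.

Lemma line_dist (z d : C) (s t : R) : (Cmod ((z + RtoC s * d) - (z + RtoC t * d)) = Rabs (s - t) * Cmod d)%R.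
Proof.
  replace ((z + RtoC s * d) - (z + RtoC t * d)) with (RtoC (s - t) * d) by (rewrite RtoC_minus; ring).
  now rewrite Cmod_mult, Cmod_R.
Qed.

(** A primitive is available only inside H. Moved to the left by s > 0, the segment enters H; by
    compactness q changes little under the move, uniformly along the segment, so the integrals
    converge as s tends to 0. *)
Lemma line_int_closure (z d : C) T : (0 <= T)%R -> (forall t, (0 <= t <= T)%R -> cl (z + RtoC t * d)) ->
  forall e, (0 < e)%R -> exists d0, (0 < d0)%R /\ forall s, (0 < s < d0)%R ->
  (Cmod (CInt (fun t => d * q (z + RtoC t * d))%C 0 T
    - (primQ w0 q (z + RtoC T * d - RtoC s) - primQ w0 q (z - RtoC s))) < e)%R.
Proof.
  intros HT HH e He.
  set (B := (Cmod d * T + 1)%R). assert (HB : (0 < B)%R) by (unfold B; generalize (Cmod_ge_0 d); nra).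
  set (e1 := (e / (2 * B))%R). assert (He1 : (0 < e1)%R) by (apply Rdiv_lt_0_compat; lra).
  (* A point of the segment at parameter distance below dl, then moved by s < dl, is displaced by
     less than (|d| + 1) dl, hence the radius. *)
  set (good := fun t (dl : posreal) => (0 <= t <= T)%R -> forall z', cl z' ->
     (Cmod (z' - (z + RtoC t * d)) < 2 * (Cmod d + 1) * dl)%R -> (Cmod (q z' - q (z + RtoC t * d)%C) < e1 / 2)%R).
  set (delta := fun t => epsilon (inhabits (mkposreal 1 Rlt_0_1)) (good t)).
  assert (Hm : (0 < Cmod d + 1)%R) by (generalize (Cmod_ge_0 d); lra).
  assert (Hdelta : forall t, (0 <= t <= T)%R -> good t (delta t)).
  { intros t Ht. apply epsilon_spec. destruct (Hqcl _ (HH t Ht) (e1 / 2)%R) as (d1 & Hd1 & K); [lra|].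
    assert (P : (0 < d1 / (2 * (Cmod d + 1)))%R) by (apply Rdiv_lt_0_compat; lra).
    exists (mkposreal _ P). intros _ z' Hz' Hz2. apply K; auto. simpl in Hz2.
    replace (2 * (Cmod d + 1) * (d1 / (2 * (Cmod d + 1))))%R with d1 in Hz2 by (field; lra). auto. }
  (* The gauge comes under a double negation; this is harmless because the inequality to be proved
     is attacked through its negation. *)
  destruct (compactness_value_1d 0 T delta) as (dd & Hdd).
  exists dd. split; [apply cond_pos|]. intros s Hs.
  assert (U : forall t, (0 <= t <= T)%R -> (Cmod (q (z + RtoC t * d - RtoC s)%C - q (z + RtoC t * d)%C) < e1)%R).
  { intros t Ht. apply Rnot_le_lt. intros N. apply (Hdd t Ht). intros (u & Hu & Hu1 & Hu2).
    apply Rle_not_lt in N. apply N. clear N.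
    assert (Ab : (Rabs (t - u) * Cmod d <= Cmod d * delta u)%R).
    { rewrite Rmult_comm. apply Rmult_le_compat_l; [apply Cmod_ge_0|lra]. }
    pose proof (cond_pos (delta u)). pose proof (cond_pos dd). pose proof (Cmod_ge_0 d).
    assert (K1 : (Cmod (q (z + RtoC t * d - RtoC s)%C - q (z + RtoC u * d)%C) < e1 / 2)%R).
    { apply (Hdelta u Hu Hu). apply Hcl, Hshift; auto; lra.
      replace (z + RtoC t * d - RtoC s - (z + RtoC u * d)) with ((z + RtoC t * d - (z + RtoC u * d)) + - RtoC s) by ring.
      eapply Rle_lt_trans; [apply Cmod_triangle|]. rewrite line_dist, Cmod_opp, Cmod_R, (Rabs_pos_eq s) by lra. nra. }
    assert (K2 : (Cmod (q (z + RtoC t * d)%C - q (z + RtoC u * d)%C) < e1 / 2)%R).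
    { apply (Hdelta u Hu Hu). apply HH; lra. rewrite line_dist. nra. }
    eapply Rle_lt_trans; [apply (Cmod_triangle_sub _ (q (z + RtoC u * d)))|].
    rewrite (Cmod_sub_sym (q (z + RtoC u * d))). lra. }
  assert (HS : forall t, (0 <= t <= T)%R -> H ((z - RtoC s) + RtoC t * d)).
  { intros t Ht. replace ((z - RtoC s) + RtoC t * d) with (z + RtoC t * d - RtoC s) by ring. apply Hshift; auto; lra. }
  pose proof (line_int (z - RtoC s) d T HT HS) as L.
  replace (z - RtoC s + RtoC T * d) with (z + RtoC T * d - RtoC s) in L by ring.
  rewrite <- L.
  set (F1 := fun t => d * q (z + RtoC (clamp T t) * d)).
  set (F2 := fun t => d * q (z - RtoC s + RtoC (clamp T t) * d)).
  rewrite (CInt_ext _ F1). 2: { intros t. rewrite Rmin_left, Rmax_right by lra. intros Ht. unfold F1. rewrite clamp_id by lra. auto. }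
  rewrite (CInt_ext (fun t => d * q (z - RtoC s + RtoC t * d)) F2). 2: { intros t. rewrite Rmin_left, Rmax_right by lra. intros Ht. unfold F2. rewrite clamp_id by lra. auto. }
  assert (C1 : forall t, ccont F1 t).
  { intros t. apply ccont_mult; [apply ccont_const|]. intros e' He'.
    destruct (Hqcl _ (HH _ (clamp_in T t HT)) e' He') as (d1 & Hd1 & K).
    exists (d1 / (Cmod d + 1))%R. split; [apply Rdiv_lt_0_compat; lra|]. intros t' Ht'.
    apply K; [apply HH, clamp_in; auto|]. rewrite line_dist.
    apply (Rmult_lt_compat_r (Cmod d + 1)) in Ht'; [|lra].
    replace (d1 / (Cmod d + 1) * (Cmod d + 1))%R with d1 in Ht' by (field; lra).
    pose proof (clamp_lip T t t'). pose proof (Cmod_ge_0 d). pose proof (Rabs_pos (t' - t)). nra. }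
  assert (C2 : forall t, ccont F2 t).
  { intros t. apply ccont_mult; [apply ccont_const|].
    apply (ccont_comp q (fun t => z - RtoC s + RtoC (clamp T t) * d)).
    - intros e' He'. exists (e' / (Cmod d + 1))%R. split; [apply Rdiv_lt_0_compat; lra|]. intros t' Ht'. rewrite line_dist.
      apply (Rmult_lt_compat_r (Cmod d + 1)) in Ht'; [|lra].
      replace (e' / (Cmod d + 1) * (Cmod d + 1))%R with e' in Ht' by (field; lra).
      pose proof (clamp_lip T t t'). pose proof (Cmod_ge_0 d). pose proof (Rabs_pos (t' - t)). nra.
    - apply (hol_cont H); auto. apply HS, clamp_in; auto. }
  replace (CInt F1 0 T - CInt F2 0 T) with (CInt (fun t => F1 t + - (1) * F2 t) 0 T).
  2: { rewrite CInt_plus, CInt_scal; auto; [ring|]. intros. apply ccont_mult; auto. apply ccont_const. }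
  eapply Rle_lt_trans; [apply (CInt_bound _ 0 T (Cmod d * e1)); auto|].
  - intros. apply ccont_plus; auto. apply ccont_mult; auto. apply ccont_const.
  - intros t Ht. unfold F1, F2. rewrite clamp_id by auto.
    replace (d * q (z + RtoC t * d) + - (1) * (d * q (z - RtoC s + RtoC t * d)))
      with (d * (q (z + RtoC t * d) - q (z + RtoC t * d - RtoC s))).
    2: { replace (z - RtoC s + RtoC t * d) with (z + RtoC t * d - RtoC s) by ring. ring. }
    rewrite Cmod_mult. apply Rmult_le_compat_l; [apply Cmod_ge_0|]. rewrite Cmod_sub_sym. left. auto.
  - rewrite Rminus_0_r. unfold e1. apply (Rmult_lt_reg_r (2 * B)); [lra|].
    replace (Cmod d * (e / (2 * B)) * T * (2 * B))%R with (e * (Cmod d * T))%R by (field; lra).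
    unfold B. assert (0 <= Cmod d * T)%R by (apply Rmult_le_pos; [apply Cmod_ge_0|lra]). nra.
Qed.

(** The three legs are moved to the left by the same s, and the differences of [primQ] at the moved
    ends telescope. Only the last point has to lie in H, because continuity of the primitive is used
    there and at the base point. *)
Lemma laplace_path (w1 v : C) T : (0 <= T)%R -> cl (RtoC w0) ->
  (forall t, (0 <= t <= 1)%R -> cl (RtoC w0 + RtoC t * (RtoC (Re w1) - RtoC w0))) ->
  (forall t, (0 <= t <= 1)%R -> cl (RtoC (Re w1) + RtoC t * (w1 - RtoC (Re w1)))) ->
  (forall t, (0 <= t <= T)%R -> cl (w1 + RtoC t * v)) -> H (w1 + RtoC T * v) ->
  seg_int q (RtoC w0) (RtoC (Re w1)) + seg_int q (RtoC (Re w1)) w1 + CInt (fun t => v * q (w1 + RtoC t * v)) 0 T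
  = primQ w0 q (w1 + RtoC T * v).
Proof.
  intros HT Hw0 A1 A2 A3 HT2. apply C_small_eq. intros e He.
  destruct (line_int_closure _ _ 1 Rle_0_1 A1 (e / 6)%R) as (d1 & D1 & K1); [lra|].
  destruct (line_int_closure _ _ 1 Rle_0_1 A2 (e / 6)%R) as (d2 & D2 & K2); [lra|].
  destruct (line_int_closure _ _ T HT A3 (e / 6)%R) as (d3 & D3 & K3); [lra|].
  destruct (primQ_cont _ HT2 (e / 6)%R) as (d4 & D4 & K4); [lra|].
  destruct (primQ_cont _ H0 (e / 6)%R) as (d5 & D5 & K5); [lra|].
  pose (s := (Rmin d1 (Rmin d2 (Rmin d3 (Rmin d4 d5))) / 2)%R).
  assert (Hs : (0 < s)%R) by (apply Rdiv_lt_0_compat; [repeat apply Rmin_glb_lt; lra|lra]).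
  assert (S1 : (s < d1 /\ s < d2 /\ s < d3 /\ s < d4 /\ s < d5)%R).
  { unfold s in *. pose proof (Rmin_l d1 (Rmin d2 (Rmin d3 (Rmin d4 d5)))). pose proof (Rmin_r d1 (Rmin d2 (Rmin d3 (Rmin d4 d5)))).
    pose proof (Rmin_l d2 (Rmin d3 (Rmin d4 d5))). pose proof (Rmin_r d2 (Rmin d3 (Rmin d4 d5))).
    pose proof (Rmin_l d3 (Rmin d4 d5)). pose proof (Rmin_r d3 (Rmin d4 d5)).
    pose proof (Rmin_l d4 d5). pose proof (Rmin_r d4 d5). lra. }
  specialize (K1 s ltac:(lra)). specialize (K2 s ltac:(lra)). specialize (K3 s ltac:(lra)).
  assert (K4' : (Cmod (primQ w0 q (w1 + RtoC T * v - RtoC s) - primQ w0 q (w1 + RtoC T * v)) < e / 6)%R).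
  { apply K4. replace (w1 + RtoC T * v - RtoC s - (w1 + RtoC T * v)) with (- RtoC s) by ring.
    rewrite Cmod_opp, Cmod_R, Rabs_pos_eq; lra. }
  assert (K5' : (Cmod (primQ w0 q (RtoC w0 - RtoC s) - primQ w0 q (RtoC w0)) < e / 6)%R).
  { apply K5. replace (RtoC w0 - RtoC s - RtoC w0) with (- RtoC s) by ring.
    rewrite Cmod_opp, Cmod_R, Rabs_pos_eq; lra. }
  rewrite primQ_w0 in K5'.
  replace (RtoC w0 + RtoC 1 * (RtoC (Re w1) - RtoC w0)) with (RtoC (Re w1)) in K1 by ring.
  replace (RtoC (Re w1) + RtoC 1 * (w1 - RtoC (Re w1))) with w1 in K2 by ring.
  unfold seg_int. fold (CInt (fun t => (RtoC (Re w1) - RtoC w0) * q (RtoC w0 + RtoC t * (RtoC (Re w1) - RtoC w0))) 0 1).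
  fold (CInt (fun t => (w1 - RtoC (Re w1)) * q (RtoC (Re w1) + RtoC t * (w1 - RtoC (Re w1)))) 0 1).
  set (I1 := CInt (fun t => (RtoC (Re w1) - RtoC w0) * q (RtoC w0 + RtoC t * (RtoC (Re w1) - RtoC w0))) 0 1) in *.
  set (I2 := CInt (fun t => (w1 - RtoC (Re w1)) * q (RtoC (Re w1) + RtoC t * (w1 - RtoC (Re w1)))) 0 1) in *.
  set (I3 := CInt (fun t => v * q (w1 + RtoC t * v)) 0 T) in *.
  set (Qa := primQ w0 q (RtoC w0 - RtoC s)) in *.
  set (Qb := primQ w0 q (RtoC (Re w1) - RtoC s)) in *.
  set (Qc := primQ w0 q (w1 - RtoC s)) in *.
  set (Qd := primQ w0 q (w1 + RtoC T * v - RtoC s)) in *.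
  set (Qe := primQ w0 q (w1 + RtoC T * v)) in *.
  replace (I1 + I2 + I3 - Qe) with ((I1 - (Qb - Qa)) + (I2 - (Qc - Qb)) + (I3 - (Qd - Qc)) + ((Qd - Qe) - (Qa - 0))) by ring.
  eapply Rle_trans; [apply Cmod_triangle4|].
  pose proof (Cmod_triangle (Qd - Qe) (- (Qa - 0))). rewrite Cmod_opp in *.
  replace (Qd - Qe - (Qa - 0)) with (Qd - Qe + - (Qa - 0)) by ring. lra.
Qed.

End Closure.
End Primitive.

(** * Geometry of neighborhoods of minus infinity *)

Lemma Carg_abs (z : C) : Rabs (Carg z) = acos (Re z / Cmod z).
Proof.
  unfold Carg. pose proof (acos_bound (Re z / Cmod z)).
  destruct Rle_dec; [|rewrite Rabs_Ropp]; apply Rabs_pos_eq; lra.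
Qed.

Lemma Cmod_sq (z : C) : (Cmod z * Cmod z = Re z * Re z + Im z * Im z)%R.
Proof. pose proof (Cmod2_alt z). simpl in H. lra. Qed.

Lemma Cminus_iff (w0 z : C) (th : R) : (0 <= th <= PI / 2)%R ->
  (Defs.Cminus w0 th z <-> (Rabs (Im (w0 - z)) * cos th < Re (w0 - z) * sin th)%R).
Proof.
  intros Hth. unfold Defs.Cminus. set (u := w0 - z).
  pose proof PI_RGT_0 as HPI.
  assert (Hc : (0 <= cos th)%R) by (apply cos_ge_0; lra).
  assert (Hs : (0 <= sin th)%R) by (apply sin_ge_0; lra).
  pose proof (sin2_cos2 th) as SC. unfold Rsqr in SC.
  pose proof (Cmod_sq u) as SQ. pose proof (Cmod_ge_0 u) as Hu.
  pose proof (Rabs_pos (Im u)) as HI.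
  assert (HA : (Rabs (Im u) * Rabs (Im u) = Im u * Im u)%R) by (rewrite <- Rabs_mult; apply Rabs_pos_eq, Rle_0_sqr).
  rewrite Carg_abs. split.
  - intros [Hn Hlt]. apply Cmod_gt_0 in Hn.
    assert (Hr : (-1 <= Re u / Cmod u <= 1)%R).
    { apply Rabs_le_between. unfold Rdiv. rewrite Rabs_mult, Rabs_inv, (Rabs_pos_eq (Cmod u)) by lra.
      apply (Rmult_le_reg_r (Cmod u)); auto. rewrite Rmult_assoc, Rinv_l, Rmult_1_r by lra.
      rewrite Rmult_1_l. apply re_le_Cmod. }
    pose proof (acos_bound (Re u / Cmod u)).
    assert (L : (cos th < Re u / Cmod u)%R).
    { rewrite <- (cos_acos (Re u / Cmod u)) by lra. apply cos_decreasing_1; lra. }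
    apply (Rmult_lt_compat_r (Cmod u)) in L; auto.
    replace (Re u / Cmod u * Cmod u)%R with (Re u) in L by (field; lra).
    assert (P0 : (0 <= cos th * Cmod u)%R) by (apply Rmult_le_pos; lra).
    assert (P : (0 < Re u)%R) by lra.
    assert (L3 : ((cos th * Cmod u) * (cos th * Cmod u) < Re u * Re u)%R).
    { apply Rmult_le_0_lt_compat; auto. }
    apply Rsqr_incrst_0; unfold Rsqr; [|apply Rmult_le_pos; lra|apply Rmult_le_pos; lra].
    replace (cos th * Cmod u * (cos th * Cmod u))%R with ((Cmod u * Cmod u) * (cos th * cos th))%R in L3 by ring.
    rewrite SQ in L3.
    replace (Rabs (Im u) * cos th * (Rabs (Im u) * cos th))%R with ((Rabs (Im u) * Rabs (Im u)) * (cos th * cos th))%R by ring.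
    replace (Re u * sin th * (Re u * sin th))%R with ((Re u * Re u) * (sin th * sin th))%R by ring.
    replace (sin th * sin th)%R with (1 - cos th * cos th)%R by lra. rewrite HA. lra.
  - intros L.
    assert (P : (0 < Re u * sin th)%R) by nra.
    assert (P1 : (0 < sin th)%R) by (destruct Hs as [|E]; auto; rewrite <- E in P; lra).
    assert (P2 : (0 < Re u)%R) by nra.
    assert (Hn : (0 < Cmod u)%R). { apply Rlt_le_trans with (Re u); auto. eapply Rle_trans; [apply Rle_abs|apply re_le_Cmod]. }
    split; [now apply Cmod_gt_0|].
    assert (L2 : (Cmod u * cos th < Re u)%R).
    { apply Rsqr_incrst_0; unfold Rsqr; [|apply Rmult_le_pos; lra|lra].
      assert (L3 : ((Rabs (Im u) * cos th) * (Rabs (Im u) * cos th) < (Re u * sin th) * (Re u * sin th))%R).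
      { apply Rmult_le_0_lt_compat; auto; apply Rmult_le_pos; lra. }
      replace (Cmod u * cos th * (Cmod u * cos th))%R with (Cmod u * Cmod u * (cos th * cos th))%R by ring.
      rewrite SQ.
      replace (Rabs (Im u) * cos th * (Rabs (Im u) * cos th))%R with ((Rabs (Im u) * Rabs (Im u)) * (cos th * cos th))%R in L3 by ring.
      replace (Re u * sin th * (Re u * sin th))%R with ((Re u * Re u) * (sin th * sin th))%R in L3 by ring.
      replace (sin th * sin th)%R with (1 - cos th * cos th)%R in L3 by lra. rewrite HA in L3. lra. }
    apply Rnot_le_lt. intros N.
    assert (Hr : (-1 <= Re u / Cmod u <= 1)%R).
    { apply Rabs_le_between. unfold Rdiv. rewrite Rabs_mult, Rabs_inv, (Rabs_pos_eq (Cmod u)) by lra.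
      apply (Rmult_le_reg_r (Cmod u)); auto. rewrite Rmult_assoc, Rinv_l, Rmult_1_r by lra.
      rewrite Rmult_1_l. apply re_le_Cmod. }
    pose proof (acos_bound (Re u / Cmod u)).
    assert (M : (Re u / Cmod u <= cos th)%R).
    { rewrite <- (cos_acos (Re u / Cmod u)) by lra. apply cos_decr_1; lra. }
    apply (Rmult_le_compat_r (Cmod u)) in M; [|lra].
    replace (Re u / Cmod u * Cmod u)%R with (Re u) in M by (field; lra). lra.
Qed.

(** The one fact about neighborhoods from which openness, [down_dom] and dilation follow: each point
    lies in a cone with real vertex c that is contained in H, and the cone is a linear inequality
    with coefficients in [0, 1]. *)
Lemma nbhd_sector (H : C -> Prop) z : nbhd_minfty H -> H z ->
  exists c cs sn : R, H (RtoC c) /\ (0 <= cs <= 1)%R /\ (0 <= sn <= 1)%R /\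
    (forall x y : R, (Rabs y * cs < (c - x) * sn)%R -> H (x, y)) /\ (Rabs (Im z) * cs < (c - Re z) * sn)%R.
Proof.
  intros [_ HN] Hz. apply HN in Hz as (c & th & Hc & (Hth & Hincl & _) & Hz).
  pose proof PI_RGT_0.
  exists c, (cos th), (sin th). repeat split; auto.
  - apply cos_ge_0; lra.
  - apply COS_bound.
  - apply sin_ge_0; lra.
  - apply SIN_bound.
  - intros x y Hxy. apply Hincl. apply Cminus_iff; auto. simpl. replace (0 + - y)%R with (- y)%R by ring. rewrite Rabs_Ropp. exact Hxy.
  - apply Cminus_iff in Hz; auto. unfold Cminus, Cplus, Copp, RtoC, Re, Im in Hz; simpl in Hz.
    replace (0 + - snd z)%R with (- snd z)%R in Hz by ring. rewrite Rabs_Ropp in Hz. exact Hz.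
Qed.

Lemma nbhd_open (H : C -> Prop) : nbhd_minfty H -> open_dom H.
Proof.
  intros HN z Hz. destruct (nbhd_sector H z HN Hz) as (c & cs & sn & _ & Hcs & Hsn & K & L).
  exists (((c - Re z) * sn - Rabs (Im z) * cs) / 2)%R. split; [lra|].
  intros [x y] Hz'. apply K.
  assert (B1 : (Rabs (x - Re z) <= Cmod ((x, y) - z))%R) by apply (re_le_Cmod ((x, y) - z)).
  assert (B2 : (Rabs (y - Im z) <= Cmod ((x, y) - z))%R) by apply (Im_le_Cmod ((x, y) - z)).
  set (m := Cmod ((x, y) - z)) in *.
  assert (B3 : (Rabs y <= Rabs (Im z) + m)%R).
  { replace y with (Im z + (y - Im z))%R by ring. eapply Rle_trans; [apply Rabs_triang|]. lra. }
  apply Rabs_le_between in B1.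
  assert (Hm : (0 <= m)%R) by apply Cmod_ge_0.
  assert (Rabs y * cs <= Rabs (Im z) * cs + m)%R by nra.
  assert ((c - x) * sn >= (c - Re z) * sn - m)%R by nra. lra.
Qed.

Lemma nbhd_down (H : C -> Prop) : nbhd_minfty H -> down_dom H.
Proof.
  intros HN x y x' y' Hz Hx Hy. destruct (nbhd_sector H _ HN Hz) as (c & cs & sn & _ & Hcs & Hsn & K & L).
  apply K. simpl in L. unfold Re, Im in L; simpl in L. nra.
Qed.

(** A homothety of centre -1 and ratio s >= 1 maps every cone with vertex c <= -1 into itself,
    because it moves the vertex to the left. *)
Lemma nbhd_dilate (H : C -> Prop) : nbhd_minfty H -> (forall w, H w -> (Re w <= -1)%R) ->
  forall x y s : R, H (x, y) -> (1 <= s)%R -> H ((-1 + s * (x + 1))%R, (s * y)%R).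
Proof.
  intros HN HL x y s Hz Hs. destruct (nbhd_sector H _ HN Hz) as (c & cs & sn & Hc & Hcs & Hsn & K & L).
  apply HL in Hc. simpl in Hc. apply K. unfold Re, Im in L; simpl in L.
  rewrite Rabs_mult, (Rabs_pos_eq s) by lra.
  assert (s * (Rabs y * cs) < s * ((c - x) * sn))%R by (apply Rmult_lt_compat_l; lra).
  assert (0 <= (s - 1) * (-1 - c) * sn)%R by (apply Rmult_le_pos; [apply Rmult_le_pos; simpl in *; lra|lra]).
  nra.
Qed.

Lemma closureC_iff A z : closureC A z <-> forall e, (0 < e)%R -> exists w, (Cmod (w - z) < e)%R /\ A w.
Proof.
  split.
  - intros Hc e He. apply Hc. apply locally_C_iff. exists e. auto.
  - intros Hc U HU. apply locally_C_iff in HU as (d & Hd & K). destruct (Hc d Hd) as (w & Hw & Aw). exists w; auto.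
Qed.

Lemma closure_incl (A : C -> Prop) z : A z -> closureC A z.
Proof. intros HA U HU. exists z. split; auto. now apply locally_singleton. Qed.

Lemma closure_down (H : C -> Prop) : down_dom H -> down_dom (closureC H).
Proof.
  intros Hd x y x' y' Hz Hx Hy. rewrite closureC_iff in *. intros e He.
  destruct (Hz e He) as ([u v] & Huv & HH).
  pose proof (re_le_Cmod ((u, v) - (x, y))) as B1. pose proof (Im_le_Cmod ((u, v) - (x, y))) as B2.
  unfold Re, Im in B1, B2; simpl in B1, B2.
  assert (Q : forall p q : R, (Rabs p <= Rabs (u + - x))%R -> (Rabs q <= Rabs (v + - y))%R -> (Cmod (p, q) <= Cmod ((u, v) - (x, y)))%R).
  { intros p q Hp Hq. unfold Cmod; simpl. apply sqrt_le_1_alt. rewrite !Rmult_1_r.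
    apply Rplus_le_compat; apply Rsqr_le_abs_1; assumption. }
  (* shrink the height of (u,v) when needed *)
  exists ((x' + (u - x))%R, if Rle_dec (Rabs y') (Rabs v) then y' else (if Rle_dec 0 y' then Rabs v else - Rabs v)%R).
  split.
  - eapply Rle_lt_trans; [|apply Huv].
    match goal with |- (Cmod (?a - ?b) <= _)%R => replace (a - b) with ((u + - x)%R, (snd a - y')%R) by (apply injective_projections; simpl; ring) end.
    simpl. apply Q; [lra|].
    assert (T : (Rabs y - Rabs v <= Rabs (v + - y))%R).
    { replace (v + - y)%R with (- (y - v))%R by ring. rewrite Rabs_Ropp. apply Rabs_triang_inv. }
    destruct Rle_dec as [C1|C1]. { rewrite Rminus_diag, Rabs_R0. apply Rabs_pos. }
    destruct Rle_dec as [C2|C2].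
    + rewrite (Rabs_pos_eq y') in * by lra. rewrite Rabs_left1; lra.
    + rewrite (Rabs_left1 y') in * by lra. rewrite Rabs_pos_eq; lra.
  - apply (Hd u v); [auto|lra|]. destruct Rle_dec as [C1|C1]; auto.
    destruct Rle_dec; rewrite ?Rabs_Ropp, Rabs_Rabsolu; lra.
Qed.

(** A point of H close to a border point may be slightly too low for [down_dom]. A dilation of ratio
    s just above 1 makes it high enough, and moves it to the left by at most d / 2; the
    approximation itself costs less than the other d / 2. *)
Lemma closure_shift (H : C -> Prop) : nbhd_minfty H -> (forall w, H w -> (Re w <= -1)%R) ->
  forall (z : C) (d : R), closureC H z -> (0 < d)%R -> H (z - RtoC d).
Proof.
  intros HN HL [x y] d Hz Hdd. rewrite closureC_iff in Hz.
  replace ((x, y) - RtoC d) with (((x - d)%R, y) : C) by (apply injective_projections; simpl; ring).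
  pose proof (nbhd_down H HN) as Hd.
  destruct (Req_dec y 0) as [->|Hy].
  - destruct (Hz d Hdd) as ([u v] & Huv & HH).
    apply (Hd u v); auto. 2: rewrite Rabs_R0; apply Rabs_pos.
    pose proof (re_le_Cmod ((u, v) - (x, 0%R))) as B1. unfold Re in B1; simpl in B1. apply Rabs_le_between in B1. lra.
  - assert (Py : (0 < Rabs y)%R) by now apply Rabs_pos_lt.
    set (B := (Rabs x + 2)%R). assert (HB : (2 <= B)%R) by (unfold B; generalize (Rabs_pos x); lra).
    set (e := Rmin (Rmin 1 (d / 2)) (Rmin (Rabs y / 2) (d * Rabs y / (4 * B)))%R).
    assert (He : (0 < e)%R). { repeat apply Rmin_glb_lt; try lra. apply Rdiv_lt_0_compat; nra. }
    destruct (Hz e He) as ([u v] & Huv & HH).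
    pose proof (re_le_Cmod ((u, v) - (x, y))) as B1. pose proof (Im_le_Cmod ((u, v) - (x, y))) as B2.
    unfold Re, Im in B1, B2; simpl in B1, B2.
    assert (e1 : (e <= 1 /\ e <= d / 2 /\ e <= Rabs y / 2 /\ e <= d * Rabs y / (4 * B))%R).
    { unfold e. pose proof (Rmin_l (Rmin 1 (d / 2)) (Rmin (Rabs y / 2) (d * Rabs y / (4 * B)))%R).
      pose proof (Rmin_r (Rmin 1 (d / 2)) (Rmin (Rabs y / 2) (d * Rabs y / (4 * B)))%R).
      pose proof (Rmin_l 1 (d / 2)). pose proof (Rmin_r 1 (d / 2)).
      pose proof (Rmin_l (Rabs y / 2) (d * Rabs y / (4 * B))). pose proof (Rmin_r (Rabs y / 2) (d * Rabs y / (4 * B))). lra. }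
    destruct e1 as (e1 & e2 & e3 & e4).
    assert (T : (Rabs y - Rabs v <= e)%R).
    { apply Rle_trans with (Rabs (v + - y)); [|lra]. replace (v + - y)%R with (- (y - v))%R by ring. rewrite Rabs_Ropp. apply Rabs_triang_inv. }
    set (s := (1 + e / (Rabs y / 2))%R).
    assert (Hse : (s * Rabs v >= Rabs y)%R).
    { unfold s. assert (Rabs y / 2 <= Rabs v)%R by lra.
      assert (e / (Rabs y / 2) * Rabs v >= e)%R.
      { apply Rle_ge. apply Rle_trans with (e / (Rabs y / 2) * (Rabs y / 2))%R; [right; field; lra|].
        apply Rmult_le_compat_l; auto. apply Rlt_le, Rdiv_lt_0_compat; lra. }
      lra. }
    assert (Hs1 : (1 <= s)%R). { unfold s. assert (0 < e / (Rabs y / 2))%R by (apply Rdiv_lt_0_compat; lra). lra. }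
    pose proof (nbhd_dilate H HN HL u v s HH Hs1) as G.
    apply (Hd _ _ _ _ G).
    2: { rewrite Rabs_mult, (Rabs_pos_eq s) by lra. lra. }
    assert (D1 : ((s - 1) * B <= d / 2)%R).
    { unfold s. replace (1 + e / (Rabs y / 2) - 1)%R with (e / (Rabs y / 2))%R by ring.
      apply (Rmult_le_compat_r (2 * B / Rabs y)) in e4. 2: { apply Rdiv_le_0_compat; lra. }
      replace (d * Rabs y / (4 * B) * (2 * B / Rabs y))%R with (d / 2)%R in e4 by (field; lra).
      replace (e / (Rabs y / 2) * B)%R with (e * (2 * B / Rabs y))%R by (field; lra). auto. }
    assert (D2 : (- (u + 1) <= B)%R).
    { unfold B. assert (Rabs (u + - x) < 1)%R by lra. apply Rabs_lt_between in H0. pose proof (Rle_abs (- x)). rewrite Rabs_Ropp in *. lra. }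
    assert (Hul : (u + 1 <= 0)%R). { apply HL in HH. unfold Re in HH; simpl in HH. lra. }
    assert (Rabs (u + - x) < d / 2)%R by lra. apply Rabs_lt_between in H0.
    nra.
Qed.

(** The definition describes the border only. If a point left of it were missing, the supremum of
    the horizontal slice at that height would be a border point, hence equal to rho, yet no larger
    than the abscissa of the missing point. *)
Lemma exact_log_region a k H0 : exact_log_nbhd a k H0 -> exists rho : R -> R,
  convex_Rplus rho /\ (exists Y, (0 < Y)%R /\ forall y, (Y <= y)%R -> rho y = (a - k * ln y)%R) /\
  forall x y : R, (x < rho (Rabs y))%R -> H0 (x, y).
Proof.
  intros (HN & Hk & rho & Hconv & Hb & HY). exists rho. split; auto. split; auto.
  intros x y Hxy. apply NNPP. intros N.
  pose proof (nbhd_down _ HN) as Hd. pose proof (nbhd_open _ HN) as Ho.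
  assert (HE : exists x1, H0 (x1, y)).
  { destruct HN as [HN1 _]. pose proof PI_RGT_0.
    destruct (HN1 (PI / 4)%R) as ([u v] & _ & Hi); [lra|].
    exists (u - Rabs (v - y) - 1)%R. apply Hi. apply Cminus_iff; [lra|].
    unfold Re, Im; simpl. fold (v - y)%R. rewrite cos_PI4, sin_PI4.
    assert (0 < 1 / sqrt 2)%R by (apply Rdiv_lt_0_compat; [lra|apply sqrt_lt_R0; lra]).
    apply Rmult_lt_compat_r; auto. lra. }
  destruct HE as (x1 & Hx1).
  destruct (completeness (fun x' => H0 (x', y))) as (s & Hs1 & Hs2).
  - exists x. intros x' Hx'. apply Rnot_lt_le. intros L. apply N. apply (Hd x' y); auto; lra.
  - now exists x1.
  - assert (Hsx : (s <= x)%R). { apply Hs2. intros x' Hx'. apply Rnot_lt_le. intros L. apply N. apply (Hd x' y); auto; lra. }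
    assert (NS : ~ H0 (s, y)).
    { intros HS. destruct (Ho _ HS) as (r & Hr & K). assert (H0 ((s + r / 2)%R, y)).
      { apply K. replace (((s + r / 2)%R, y) - (s, y)) with (RtoC (r / 2)) by (apply injective_projections; simpl; ring).
        rewrite Cmod_R, Rabs_pos_eq; lra. }
      specialize (Hs1 _ H). lra. }
    assert (B : borderC H0 (s, y)).
    { split; [|now apply closure_incl]. apply closureC_iff. intros e He.
      destruct (classic (exists x', H0 (x', y) /\ (s - e < x')%R)) as [(x' & Hx' & L)|M].
      - exists (x', y). split; auto. specialize (Hs1 _ Hx').
        replace ((x', y) - (s, y)) with (RtoC (x' - s)) by (apply injective_projections; simpl; ring).
        rewrite Cmod_R, Rabs_left1; lra.
      - exfalso. assert (s <= s - e)%R; [|lra]. apply Hs2. intros x' Hx'. apply Rnot_lt_le. intros L. apply M. now exists x'. }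
    apply Hb in B. unfold Re, Im in B; simpl in B. lra.
Qed.

(** For y in [0, Y] the point Y is the convex combination of y and 2Y with weight s = Y / (2Y - y)
    >= 1/2 on y, so rho Y bounds rho y from below. *)
Lemma convex_bounded_below rho Y : (0 < Y)%R -> convex_Rplus rho -> exists m, forall y, (0 <= y <= Y)%R -> (m <= rho y)%R.
Proof.
  intros HY Hc. exists (- (2 * (Rabs (rho Y) + Rabs (rho (2 * Y)%R))))%R. intros y Hy.
  set (s := (Y / (2 * Y - y))%R).
  assert (Hs : (1 / 2 <= s <= 1)%R).
  { unfold s. split; apply (Rmult_le_reg_r (2 * Y - y)); try lra; unfold Rdiv; rewrite ?(Rmult_assoc Y), ?Rinv_l by lra; lra. }
  specialize (Hc y (2 * Y)%R s). replace (s * y + (1 - s) * (2 * Y))%R with Y in Hc by (unfold s; field; lra).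
  specialize (Hc ltac:(lra) ltac:(lra) ltac:(lra)).
  pose proof (Rabs_pos (rho Y)). pose proof (Rabs_pos (rho (2 * Y)%R)).
  pose proof (Rle_abs (- rho Y)). pose proof (Rle_abs (rho (2 * Y)%R)). rewrite Rabs_Ropp in *.
  assert ((1 - s) * rho (2 * Y)%R <= Rabs (rho (2 * Y)%R))%R by nra.
  destruct (Rle_dec 0 (rho y)); nra.
Qed.

Definition Xc (w0 k sl eta : R) : R := (w0 - k / 2 * ln (1 + sl * sl * (eta * eta)))%R.

(** Three ranges of heights, each with its own argument: near 0 a disc around w0, beyond Y the
    explicit logarithm, in between the lower bound of rho. The last two need [sl] large, and its two
    exponential summands serve them in turn. *)
Lemma curve_in (a k : R) H (w0 : R) : (0 < k)%R -> log_nbhd a k H -> H (RtoC w0) ->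
  exists sl, (1 <= sl)%R /\ forall eta : R, H (Xc w0 k sl eta, eta).
Proof.
  intros Hk [HN (H0 & Hex & Hi)] Hw0.
  pose proof (nbhd_down _ HN) as Hd. pose proof (nbhd_open _ HN) as Ho.
  destruct (exact_log_region _ _ _ Hex) as (rho & Hc & (Y & HY & Hlog) & Hreg).
  destruct (convex_bounded_below rho Y HY Hc) as (m & Hm).
  destruct (Ho _ Hw0) as (r & Hr & Kr).
  set (r' := (r / 2)%R).
  set (sl := (1 + exp ((w0 - a) / k) + exp ((w0 - m) / k) / r')%R).
  assert (P1 : (0 < exp ((w0 - a) / k))%R) by apply exp_pos.
  assert (P2 : (0 < exp ((w0 - m) / k) / r')%R) by (apply Rdiv_lt_0_compat; [apply exp_pos|unfold r'; lra]).
  assert (HS : (1 <= sl)%R) by (unfold sl; lra).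
  exists sl. split; auto. intros eta.
  assert (L0 : (0 <= ln (1 + sl * sl * (eta * eta)))%R).
  { rewrite <- ln_1. apply ln_le; [lra|]. assert (0 <= sl * sl * (eta * eta))%R; [|lra]. apply Rmult_le_pos; nra. }
  assert (L1 : (eta <> 0)%R -> (Xc w0 k sl eta < w0 - k * ln (sl * Rabs eta))%R).
  { intros He. assert (0 < Rabs eta)%R by now apply Rabs_pos_lt.
    assert (E : (ln (sl * sl * (eta * eta)) = 2 * ln (sl * Rabs eta))%R).
    { replace (sl * sl * (eta * eta))%R with ((sl * Rabs eta) * (sl * Rabs eta))%R.
      rewrite ln_mult; try nra. replace (sl * Rabs eta * (sl * Rabs eta))%R with (sl * sl * (Rabs eta * Rabs eta))%R by ring.
      rewrite <- Rabs_mult. rewrite (Rabs_pos_eq (eta * eta)); auto. apply Rle_0_sqr. }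
    unfold Xc. assert (ln (sl * sl * (eta * eta)) < ln (1 + sl * sl * (eta * eta)))%R.
    { apply ln_increasing; [|lra]. apply Rmult_lt_0_compat; [nra|]. apply Rlt_0_sqr; auto. }
    rewrite E in H2. nra. }
  assert (Hx : (Xc w0 k sl eta <= w0)%R) by (unfold Xc; nra).
  destruct (Rle_dec (Rabs eta) r') as [C1|C1].
  - apply (Hd w0 eta); auto; [|lra]. apply Kr.
    replace ((w0, eta) - RtoC w0) with (Ci * RtoC eta) by (apply injective_projections; simpl; ring).
    rewrite Cmod_mult, Cmod_Ci, Cmod_R. unfold r' in C1. lra.
  - assert (Hr' : (0 < r')%R) by (unfold r'; lra).
    assert (Hne : eta <> 0%R). { intros ->. apply C1. rewrite Rabs_R0. lra. }
    specialize (L1 Hne). apply Hi, Hreg.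
    destruct (Rle_dec Y (Rabs eta)) as [C2|C2].
    + rewrite Hlog by auto. eapply Rlt_trans; [apply L1|].
      rewrite ln_mult by lra.
      assert ((w0 - a) / k < ln sl)%R.
      { rewrite <- (ln_exp ((w0 - a) / k)). apply ln_increasing; auto. unfold sl. lra. }
      apply (Rmult_lt_compat_l k) in H1; auto. replace (k * ((w0 - a) / k))%R with (w0 - a)%R in H1 by (field; lra). lra.
    + eapply Rlt_le_trans; [|apply Hm; split; [apply Rabs_pos|lra]]. eapply Rlt_trans; [apply L1|].
      assert ((w0 - m) / k < ln (sl * Rabs eta))%R.
      { rewrite <- (ln_exp ((w0 - m) / k)). apply ln_increasing; [apply exp_pos|].
        apply Rlt_le_trans with (sl * r')%R; [|apply Rmult_le_compat_l; lra].
        unfold sl. replace (exp ((w0 - m) / k)) with (exp ((w0 - m) / k) / r' * r')%R at 1 by (field; lra). apply Rmult_lt_compat_r; auto. lra. }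
      apply (Rmult_lt_compat_l k) in H1; auto. replace (k * ((w0 - m) / k))%R with (w0 - m)%R in H1 by (field; lra). lra.
Qed.

(** * A family of logarithmic neighborhoods *)

(* The border of Hlog is its tangent at height 1 below that height, so that logbd is convex. *)
Definition tangent (A K t y : R) : R := (A - K * ln t - K * y / t)%R.
Definition logbd (A K y : R) : R := if Rle_dec y 1 then (A - K * y)%R else (A - K - K * ln y)%R.
Definition Hlog (A K : R) (z : C) : Prop := (Re z < logbd A K (Rabs (Im z)))%R.

Lemma ln_le_sub1 x : (0 < x)%R -> (ln x <= x - 1)%R.
Proof.
  intros Hx. pose proof (exp_ineq1_le (ln x)). rewrite exp_ln in H by auto. lra.
Qed.

Lemma exp_pow_nat n x : exp (INR n * x) = (exp x ^ n)%R.
Proof.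
  induction n as [|n IH]; [simpl; rewrite Rmult_0_l; apply exp_0|].
  rewrite S_INR, Rmult_plus_distr_r, exp_plus, IH, Rmult_1_l. simpl. ring.
Qed.

Lemma logbd_tangent A K y : logbd A K y = tangent A K (Rmax 1 y) y.
Proof.
  unfold logbd, tangent. destruct Rle_dec.
  - rewrite Rmax_left by lra. rewrite ln_1. field.
  - rewrite Rmax_right by lra. field. lra.
Qed.

(** From ln u <= u - 1. Thus [logbd] is the upper envelope of its tangents at heights t >= 1, which
    gives at once convexity, the Lipschitz constant K, and cones inside [Hlog]. *)
Lemma tangent_le A K t y : (0 < K)%R -> (0 <= y)%R -> (1 <= t)%R -> (tangent A K t y <= logbd A K y)%R.
Proof.
  intros HK Hy Ht. unfold logbd, tangent. destruct Rle_dec.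
  - assert (1 - / t <= ln t)%R.
    { pose proof (ln_le_sub1 (/ t) ltac:(apply Rinv_0_lt_compat; lra)). rewrite ln_Rinv in H by lra. lra. }
    assert (0 < / t <= 1)%R. { split. apply Rinv_0_lt_compat; lra. rewrite <- Rinv_1. apply Rinv_le_contravar; lra. }
    assert (y * (1 - / t) <= 1 * (1 - / t))%R by (apply Rmult_le_compat_r; lra).
    unfold Rdiv. nra.
  - pose proof (ln_le_sub1 (y / t) ltac:(apply Rdiv_lt_0_compat; lra)). unfold Rdiv in *.
    rewrite ln_mult, ln_Rinv in H by (try apply Rinv_0_lt_compat; lra).
    rewrite (Rmult_assoc K). nra.
Qed.

Lemma logbd_convex A K : (0 < K)%R -> convex_Rplus (logbd A K).
Proof.
  intros HK x y s Hx Hy Hs. rewrite logbd_tangent. set (t := Rmax 1 (s * x + (1 - s) * y)).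
  assert (Ht : (1 <= t)%R) by apply Rmax_l.
  pose proof (tangent_le A K t x HK Hx Ht). pose proof (tangent_le A K t y HK Hy Ht).
  replace (tangent A K t (s * x + (1 - s) * y)) with (s * tangent A K t x + (1 - s) * tangent A K t y)%R
    by (unfold tangent; field; lra).
  apply Rplus_le_compat; apply Rmult_le_compat_l; lra.
Qed.

Lemma logbd_lip A K x y : (0 < K)%R -> (0 <= x)%R -> (0 <= y)%R -> (logbd A K x - logbd A K y <= K * Rabs (x - y))%R.
Proof.
  intros HK Hx Hy. rewrite (logbd_tangent A K x). set (t := Rmax 1 x).
  assert (Ht : (1 <= t)%R) by apply Rmax_l.
  pose proof (tangent_le A K t y HK Hy Ht).
  assert (tangent A K t x - tangent A K t y <= K * Rabs (x - y))%R; [|lra].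
  unfold tangent. replace (A - K * ln t - K * x / t - (A - K * ln t - K * y / t))%R with (K * ((y - x) / t))%R by (field; lra).
  apply Rmult_le_compat_l; [lra|]. rewrite Rabs_minus_sym.
  apply Rle_trans with (Rabs (y - x) / t)%R.
  - apply Rmult_le_compat_r; [|apply Rle_abs]. apply Rlt_le, Rinv_0_lt_compat; lra.
  - apply (Rmult_le_reg_r t); [lra|]. unfold Rdiv. rewrite Rmult_assoc, Rinv_l by lra.
    pose proof (Rabs_pos (y - x)). nra.
Qed.

Lemma Hlog_open A K : (0 < K)%R -> open_dom (Hlog A K).
Proof.
  intros HK z Hz. unfold Hlog in *. set (g := (logbd A K (Rabs (Im z)) - Re z)%R).
  assert (Hg : (0 < g)%R) by (unfold g; lra).
  exists (g / (1 + K))%R. split; [apply Rdiv_lt_0_compat; lra|]. intros z' Hz'.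
  pose proof (re_le_Cmod (z' - z)) as B1. pose proof (Im_le_Cmod (z' - z)) as B2.
  assert (B3 : (Rabs (Rabs (Im z) - Rabs (Im z')) <= Cmod (z' - z))%R).
  { eapply Rle_trans; [apply Rabs_triang_inv2|]. rewrite Rabs_minus_sym. exact B2. }
  pose proof (logbd_lip A K (Rabs (Im z)) (Rabs (Im z')) HK (Rabs_pos _) (Rabs_pos _)) as L.
  apply (Rmult_lt_compat_r (1 + K)) in Hz'; [|lra]. replace (g / (1 + K) * (1 + K))%R with g in Hz' by (field; lra).
  change (Re (z' - z)) with (Re z' - Re z)%R in B1. apply Rabs_le_between in B1. unfold g in Hz'. nra.
Qed.

Lemma Hlog_border A K z : (0 < K)%R -> (borderC (Hlog A K) z <-> Re z = logbd A K (Rabs (Im z))).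
Proof.
  intros HK. destruct z as [x y]. unfold borderC. rewrite !closureC_iff. split.
  - intros [H1 H2]. destruct (Rtotal_order x (logbd A K (Rabs y))) as [L|[E|L]]; auto; exfalso.
    + destruct (Hlog_open A K HK (x, y) L) as (r & Hr & K1). destruct (H2 r Hr) as (w & Hw & N). apply N, K1, Hw.
    + set (g := (x - logbd A K (Rabs y))%R). assert (Hg : (0 < g)%R) by (unfold g; lra).
      destruct (H1 (g / (1 + K))%R) as (z' & Hz' & Hin); [apply Rdiv_lt_0_compat; lra|].
      pose proof (re_le_Cmod (z' - (x, y))) as B1. pose proof (Im_le_Cmod (z' - (x, y))) as B2.
      assert (B3 : (Rabs (Rabs (Im z') - Rabs y) <= Cmod (z' - (x, y)))%R).
      { eapply Rle_trans; [apply Rabs_triang_inv2|]. exact B2. }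
      pose proof (logbd_lip A K (Rabs (Im z')) (Rabs y) HK (Rabs_pos _) (Rabs_pos _)) as L1.
      apply (Rmult_lt_compat_r (1 + K)) in Hz'; [|lra]. replace (g / (1 + K) * (1 + K))%R with g in Hz' by (field; lra).
      change (Re (z' - (x, y))) with (Re z' - x)%R in B1. apply Rabs_le_between in B1. unfold Hlog in Hin. unfold g in Hz'. nra.
  - unfold Re, Im; simpl. intros E. split; intros e He.
    + exists ((x - e / 2)%R, y). split.
      * replace (((x - e / 2)%R, y) - (x, y)) with (RtoC (- (e / 2))) by (apply injective_projections; simpl; ring).
        rewrite Cmod_R, Rabs_Ropp, Rabs_pos_eq; lra.
      * unfold Hlog, Re, Im; simpl. lra.
    + exists (x, y). split. { replace ((x, y) - (x, y)) with (RtoC 0) by (apply injective_projections; simpl; ring). now rewrite Cmod_0. }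
      unfold Hlog, Re, Im; simpl. lra.
Qed.

(* the tangent of the border at height t meets the real axis at A - K ln t *)
Lemma Hlog_biggest A K t : (0 < K)%R -> (1 <= t)%R ->
  biggest_angle (Hlog A K) (RtoC (A - K * ln t)) (atan (t / K)).
Proof.
  intros HK Ht. set (th := atan (t / K)). set (c := (A - K * ln t)%R).
  assert (Hth : (0 < th < PI / 2)%R).
  { split. rewrite <- atan_0. apply atan_increasing. apply Rdiv_lt_0_compat; lra. apply atan_bound. }
  assert (Hcos : (0 < cos th)%R) by (apply cos_gt_0; lra).
  assert (Htan : (sin th = t / K * cos th)%R).
  { rewrite <- (tan_atan (t / K)). fold th. unfold tan. field. lra. }
  split; [lra|]. split.
  - intros [x y] Hz. apply Cminus_iff in Hz; [|lra]. unfold Re, Im in Hz; simpl in Hz.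
    replace (0 + - y)%R with (- y)%R in Hz by ring. rewrite Rabs_Ropp, Htan in Hz.
    rewrite <- Rmult_assoc in Hz. apply Rmult_lt_reg_r in Hz; auto.
    unfold Hlog, Re, Im; simpl. eapply Rlt_le_trans; [|apply (tangent_le A K t); auto; apply Rabs_pos].
    unfold tangent. fold c. apply (Rmult_lt_compat_r (K / t)) in Hz; [|apply Rdiv_lt_0_compat; lra].
    replace ((c + - x) * (t / K) * (K / t))%R with (c - x)%R in Hz by (field; lra).
    replace (K * Rabs y / t)%R with (Rabs y * (K / t))%R by (field; lra). lra.
  - intros th' Hth' Hi. apply Rnot_lt_le. intros L.
    (* The point of tangency at height t: it is on the border, hence outside the open set, but any
       wider cone would contain it. *)
    specialize (Hi ((c - K)%R, t)). assert (N : Hlog A K ((c - K)%R, t)).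
    { apply Hi. apply Cminus_iff; auto. unfold Re, Im; simpl. replace (0 + - t)%R with (- t)%R by ring.
      rewrite Rabs_Ropp, Rabs_pos_eq by lra. replace (c + - (c - K))%R with K by ring.
      assert (0 < sin (th' - th))%R by (apply sin_gt_0; lra).
      rewrite sin_minus, Htan in H. apply (Rmult_lt_reg_r (cos th)); auto.
      apply (Rmult_lt_compat_l K) in H; auto. rewrite Rmult_0_r in H.
      replace (K * (sin th' * cos th - cos th' * (t / K * cos th)))%R with (K * sin th' * cos th - t * cos th' * cos th)%R in H by (field; lra).
      lra. }
    unfold Hlog, Re, Im in N; simpl in N. rewrite Rabs_pos_eq in N by lra.
    rewrite logbd_tangent, Rmax_right in N by lra. unfold tangent in N. fold c in N.
    replace (K * t / t)%R with K in N by (field; lra). lra.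
Qed.

Lemma logbd_0 A K : logbd A K 0 = A.
Proof. unfold logbd. destruct Rle_dec; lra. Qed.

Lemma Hlog_real A K t : (0 < K)%R -> (1 < t)%R -> Hlog A K (RtoC (A - K * ln t)).
Proof.
  intros HK Ht. unfold Hlog, Re, Im; simpl. rewrite Rabs_R0, logbd_0.
  assert (0 < ln t)%R. { rewrite <- ln_1. apply ln_increasing; lra. } nra.
Qed.

Lemma Hlog_nbhd A K : (0 < K)%R -> nbhd_minfty (Hlog A K).
Proof.
  intros HK. split.
  - intros th Hth. set (t := Rmax 2 (K * tan th)).
    assert (Ht : (2 <= t)%R) by apply Rmax_l.
    exists (RtoC (A - K * ln t)). split. apply Hlog_real; lra.
    intros [x y] Hz. apply (Hlog_biggest A K t HK ltac:(lra)). apply Cminus_iff in Hz; [|lra].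
    pose proof (atan_bound (t / K)) as Hb.
    assert (Hle : (th <= atan (t / K))%R).
    { rewrite <- (atan_tan th) by lra. assert (tan th <= t / K)%R.
      { apply (Rmult_le_reg_l K); auto. replace (K * (t / K))%R with t by (field; lra). apply Rmax_r. }
      destruct H as [H|H]; [left; now apply atan_increasing|rewrite H; lra]. }
    apply Cminus_iff; [lra|].
    pose proof (cos_decr_1 th (atan (t / K))). pose proof (sin_incr_1 th (atan (t / K))).
    assert (0 <= cos (atan (t / K)))%R by (apply cos_ge_0; lra).
    assert (0 <= sin th)%R by (apply sin_ge_0; lra).
    assert (cos (atan (t / K)) <= cos th)%R by (apply H; lra).
    assert (sin th <= sin (atan (t / K)))%R by (apply H0; lra).
    set (u := RtoC (A - K * ln t) - (x, y)) in *.
    pose proof (Rabs_pos (Im u)).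
    assert (Rabs (Im u) * cos (atan (t / K)) <= Rabs (Im u) * cos th)%R by (apply Rmult_le_compat_l; lra).
    assert (0 <= Re u)%R. { destruct (Rle_dec 0 (Re u)); auto. exfalso. assert (0 <= Rabs (Im u) * cos th)%R by (apply Rmult_le_pos; lra). nra. }
    assert (Re u * sin th <= Re u * sin (atan (t / K)))%R by (apply Rmult_le_compat_l; lra). lra.
  - intros [x y]. split.
    + intros Hz. unfold Hlog, Re, Im in Hz; simpl in Hz.
      assert (HT : exists t, (1 < t)%R /\ (x < tangent A K t (Rabs y))%R).
      { rewrite logbd_tangent in Hz. destruct (Rle_dec (Rabs y) 1) as [C1|C1].
        (* The tangent at height 1 meets the real axis at A, a border point and so no admissible
           vertex. Touching slightly higher costs at most half of the gap g. *)
        - rewrite Rmax_left in Hz by lra. set (g := (tangent A K 1 (Rabs y) - x)%R).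
          assert (Hg : (0 < g)%R) by (unfold g; lra).
          exists (1 + g / (2 * K))%R. assert (P : (0 < g / (2 * K))%R) by (apply Rdiv_lt_0_compat; lra).
          split; [lra|]. unfold tangent.
          pose proof (ln_le_sub1 (1 + g / (2 * K)) ltac:(lra)) as L.
          assert (K * ln (1 + g / (2 * K)) <= g / 2)%R.
          { apply Rle_trans with (K * (g / (2 * K)))%R; [apply Rmult_le_compat_l; lra|right; field; lra]. }
          assert (K * Rabs y / (1 + g / (2 * K)) <= K * Rabs y)%R.
          { apply (Rmult_le_reg_r (1 + g / (2 * K))); [lra|]. unfold Rdiv at 1. rewrite Rmult_assoc, Rinv_l by lra.
            assert (0 <= K * Rabs y)%R by (apply Rmult_le_pos; [lra|apply Rabs_pos]). nra. }
          assert (E : g = (A - K * 0 - K * Rabs y / 1 - x)%R) by (unfold g, tangent; rewrite ln_1; reflexivity).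
          rewrite Rdiv_1_r in E. lra.
        - exists (Rabs y). rewrite Rmax_right in Hz by lra. split; [lra|auto]. }
      destruct HT as (t & Ht & Hx).
      exists (A - K * ln t)%R, (atan (t / K)). split; [now apply Hlog_real|]. split; [apply Hlog_biggest; auto; lra|].
      pose proof (atan_bound (t / K)) as Hb.
      assert (0 < atan (t / K))%R. { rewrite <- atan_0. apply atan_increasing. apply Rdiv_lt_0_compat; lra. }
      apply Cminus_iff; [lra|]. unfold Re, Im; simpl. replace (0 + - y)%R with (- y)%R by ring. rewrite Rabs_Ropp.
      assert (Hcos : (0 < cos (atan (t / K)))%R) by (apply cos_gt_0; lra).
      assert (Htan : (sin (atan (t / K)) = t / K * cos (atan (t / K)))%R).
      { rewrite <- (tan_atan (t / K)) at 2. unfold tan. field. lra. }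
      rewrite Htan, <- Rmult_assoc. apply Rmult_lt_compat_r; auto.
      unfold tangent in Hx. apply (Rmult_lt_reg_r (K / t)); [apply Rdiv_lt_0_compat; lra|].
      replace ((A - K * ln t + - x) * (t / K) * (K / t))%R with (A - K * ln t - x)%R by (field; lra).
      replace (Rabs y * (K / t))%R with (K * Rabs y / t)%R by (field; lra). lra.
    + intros (c & th & _ & (_ & Hi & _) & Hz). now apply Hi.
Qed.

Lemma Hlog_exact A K : (0 < K)%R -> exact_log_nbhd (A - K) K (Hlog A K).
Proof.
  intros HK. split; [now apply Hlog_nbhd|]. split; auto. exists (logbd A K).
  split; [now apply logbd_convex|]. split; [intros; now apply Hlog_border|].
  exists 2%R. split; [lra|]. intros y Hy. unfold logbd. destruct Rle_dec; lra.
Qed.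

Lemma Hlog_log A K : (0 < K)%R -> log_nbhd (A - K) K (Hlog A K).
Proof. intros HK. split; [now apply Hlog_nbhd|]. exists (Hlog A K). split; [now apply Hlog_exact|]. now intros z. Qed.

(** With v = - Re z and E = e^(v / (16 k)), type 16 k gives |Im z| <= E, and v <= 16 k E always;
    hence |z|^4 <= N E^4, while the exponential is E^(-8). The remaining E^(-4) is at most 4 k / v,
    small once A is far to the left. *)
Lemma Hlog_small k delta B : (0 < k)%R -> (0 < delta)%R -> exists A, forall z, Hlog A (16 * k) z ->
  (Cmod z ^ 4 * exp (Re z / (2 * k)) <= delta)%R /\ (Re z <= - B)%R.
Proof.
  intros Hk Hdl.
  set (N := (8 * ((16 * k) ^ 4 + 1))%R).
  assert (HN : (8 <= N)%R). { unfold N. assert (0 <= (16 * k) ^ 4)%R by (apply pow_le; lra). lra. }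
  set (V := Rmax (Rabs B) (4 * k * N / delta)).
  assert (HV0 : (0 <= V)%R) by (eapply Rle_trans; [apply Rabs_pos|apply Rmax_l]).
  exists (- V - 1)%R. intros z Hz. unfold Hlog in Hz. set (x := Re z) in *. set (y := Rabs (Im z)) in *.
  assert (Hy : (0 <= y)%R) by apply Rabs_pos.
  set (A := (- V - 1)%R) in *.
  assert (HxA : (x < A)%R).
  { eapply Rlt_le_trans; [apply Hz|]. unfold logbd. destruct Rle_dec; [nra|].
    assert (0 < ln y)%R by (rewrite <- ln_1; apply ln_increasing; lra). nra. }
  assert (HB : (x <= - B)%R). { pose proof (Rle_abs B). pose proof (Rmax_l (Rabs B) (4 * k * N / delta)). unfold A, V in HxA. lra. }
  split; auto.
  set (v := (- x)%R). assert (Hv : (V < v)%R) by (unfold v, A in *; lra).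
  set (E := exp (v / (16 * k))).
  assert (HE : (0 < E)%R) by apply exp_pos.
  assert (HyE : (y <= E)%R).
  { unfold E. destruct (Rle_dec y 1) as [C1|C1].
    - eapply Rle_trans; [apply C1|]. rewrite <- exp_0 at 1. apply exp_le. apply Rdiv_le_0_compat; lra.
    - rewrite <- (exp_ln y) by lra. apply exp_le. unfold logbd in Hz. destruct Rle_dec; [lra|].
      apply (Rmult_le_reg_l (16 * k)); [lra|]. replace (16 * k * (v / (16 * k)))%R with v by (field; lra). unfold v, A in *. lra. }
  assert (HvE : (v <= 16 * k * E)%R).
  { unfold E. pose proof (exp_ineq1_le (v / (16 * k))). apply (Rmult_le_compat_l (16 * k)) in H; [|lra].
    replace (16 * k * (1 + v / (16 * k)))%R with (16 * k + v)%R in H by (field; lra). lra. }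
  assert (Hx2 : exp (x / (2 * k)) = (/ (E ^ 8))%R).
  { unfold E. rewrite <- exp_pow_nat, <- exp_Ropp. f_equal. unfold v. simpl. field. lra. }
  assert (Hm : (Cmod z <= v + y)%R).
  { eapply Rle_trans; [apply Cmod_le_Re_Im|]. fold x. fold y. rewrite (Rabs_left1 x) by (unfold A in HxA; lra). unfold v. lra. }
  assert (H4 : (Cmod z ^ 4 <= N * E ^ 4)%R).
  { apply Rle_trans with ((v + y) ^ 4)%R. { apply pow_incr. split; auto. apply Cmod_ge_0. }
    assert (v ^ 4 <= (16 * k * E) ^ 4)%R by (apply pow_incr; lra).
    assert (y ^ 4 <= E ^ 4)%R by (apply pow_incr; lra).
    assert ((v + y) ^ 4 <= 8 * (v ^ 4 + y ^ 4))%R.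
    { assert (Q : forall a b : R, ((a + b) ^ 2 <= 2 * (a ^ 2 + b ^ 2))%R) by (intros a b; pose proof (pow2_ge_0 (a - b)); lra).
      replace ((v + y) ^ 4)%R with (((v + y) ^ 2) ^ 2)%R by ring.
      apply Rle_trans with ((2 * (v ^ 2 + y ^ 2)) ^ 2)%R. apply pow_incr. split; [apply pow2_ge_0|apply Q].
      pose proof (Q (v ^ 2) (y ^ 2))%R. nra. }
    rewrite Rpow_mult_distr in H. unfold N. nra. }
  rewrite Hx2. apply Rle_trans with (N * E ^ 4 * / E ^ 8)%R.
  { apply Rmult_le_compat_r; auto. apply Rlt_le, Rinv_0_lt_compat, pow_lt, HE. }
  replace (N * E ^ 4 * / E ^ 8)%R with (N / E ^ 4)%R by (field; lra).
  apply (Rmult_le_reg_r (E ^ 4)); [apply pow_lt, HE|]. unfold Rdiv. rewrite Rmult_assoc, Rinv_l by (apply pow_nonzero; lra).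
  assert (HE4 : (v / (4 * k) <= E ^ 4)%R).
  { unfold E. rewrite <- exp_pow_nat. pose proof (exp_ineq1_le (INR 4 * (v / (16 * k)))).
    replace (v / (4 * k))%R with (INR 4 * (v / (16 * k)))%R by (simpl; field; lra). lra. }
  assert (4 * k * N / delta < v)%R. { eapply Rle_lt_trans; [apply Rmax_r|apply Hv]. }
  apply Rle_trans with (delta * (v / (4 * k)))%R; [|apply Rmult_le_compat_l; lra].
  apply (Rmult_lt_compat_r (delta / (4 * k))) in H; [|apply Rdiv_lt_0_compat; lra].
  replace (4 * k * N / delta * (delta / (4 * k)))%R with N in H by (field; lra).
  replace (v * (delta / (4 * k)))%R with (delta * (v / (4 * k)))%R in H by (field; lra). lra.
Qed.

(** * Laplace integrals along a logarithmic curve *)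

Definition Fint (c dc : R -> C) (q : C -> C) (p : C) (t : R) : C := q (c t) * dc t * Cexp (- (p * c t)).
Definition Lap (c dc : R -> C) (q : C -> C) (p : C) : C := II (Fint c dc q p).

Lemma Fint_mod c dc q p t : Cmod (Fint c dc q p t) = (Cmod (q (c t)) * Cmod (dc t) * exp (- Re (p * c t)))%R.
Proof. unfold Fint. rewrite !Cmod_mult, Cmod_Cexp. reflexivity. Qed.

Section Generic.
Variables (c dc : R -> C).
Hypothesis Hc : forall t, ccont c t.
Hypothesis Hdc : forall t, ccont dc t.

Lemma Fint_cont q p t : ccont (fun t => q (c t)) t -> ccont (Fint c dc q p) t.
Proof.
  intros Hq. unfold Fint. apply ccont_mult. now apply ccont_mult. apply ccont_Cexp, ccont_opp, ccont_mult; auto. apply ccont_const.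
Qed.

Lemma Fint_dom q p K : (forall t, (0 <= t)%R -> ccont (fun t => q (c t)) t) ->
  (forall t, (0 <= t)%R -> (Cmod (q (c t)) * Cmod (dc t) * exp (- Re (p * c t)) <= K * Dom t)%R) ->
  dominated (Fint c dc q p) K.
Proof. intros Hq HK. split. intros t Ht; apply Fint_cont; auto. intros t Ht. rewrite Fint_mod. auto. Qed.

Lemma Lap_ext q q' p K : dominated (Fint c dc q p) K -> (forall t, (0 <= t)%R -> q (c t) = q' (c t)) ->
  Lap c dc q p = Lap c dc q' p.
Proof. intros H E. apply (II_ext _ _ K H). intros t Ht. unfold Fint. now rewrite E. Qed.

Lemma Lap_plus q q' p K K' : dominated (Fint c dc q p) K -> dominated (Fint c dc q' p) K' ->
  Lap c dc (fun w => q w + q' w) p = Lap c dc q p + Lap c dc q' p.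
Proof.
  intros H H'. unfold Lap. rewrite <- (II_plus _ _ K K' H H'). symmetry.
  apply (II_ext _ _ (K + K')); [now apply dominated_plus|]. intros. unfold Fint. ring.
Qed.

Lemma Lap_scal a q p K : dominated (Fint c dc q p) K -> Lap c dc (fun w => a * q w) p = a * Lap c dc q p.
Proof.
  intros H. unfold Lap. rewrite <- (II_scal a _ K H). symmetry.
  apply (II_ext _ _ (Cmod a * K)); [now apply dominated_scal|]. intros. unfold Fint. ring.
Qed.

Lemma Rmax_exp_le (u v : R) : (exp u * Rmax 1 (exp v) <= exp u + exp (u + v))%R.
Proof.
  rewrite exp_plus. pose proof (exp_pos u). pose proof (exp_pos v).
  unfold Rmax. destruct Rle_dec; nra.
Qed.

(** The weight is required at the two points p and p' only: [Rmax_exp_le] turns the factor max(1, .)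
    of [Cexp_bound1] into the sum of the two exponentials. The estimate thus holds up to the cut,
    where no disc around p is available. *)
Lemma Lap_lip q p p' A A' K : dominated (Fint c dc q p) A -> dominated (Fint c dc q p') A' ->
  (forall t, (0 <= t)%R -> (Cmod (q (c t)) * Cmod (dc t) * Cmod (c t) * (exp (- Re (p * c t)) + exp (- Re (p' * c t))) <= K * Dom t)%R) ->
  (Cmod (Lap c dc q p' - Lap c dc q p) <= 6 * K * Cmod (p' - p))%R.
Proof.
  intros HA HA' HK. unfold Lap.
  replace (II (Fint c dc q p') - II (Fint c dc q p)) with (II (fun t => Fint c dc q p' t + - (1) * Fint c dc q p t)).
  2: { rewrite (II_plus _ _ A' (Cmod (- (1)) * A)), (II_scal _ _ A); auto; [ring|now apply dominated_scal]. }
  replace (6 * K * Cmod (p' - p))%R with (6 * (K * Cmod (p' - p)))%R by ring.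
  apply II_bound. split.
  { intros t Ht. apply ccont_plus; [now apply HA'|]. apply ccont_mult; [apply ccont_const|now apply HA]. }
  intros t Ht. specialize (HK t Ht).
  replace (Fint c dc q p' t + - (1) * Fint c dc q p t) with (q (c t) * dc t * (Cexp (- (p * c t)) * (Cexp (- ((p' - p) * c t)) - 1))).
  2: { unfold Fint. replace (- (p' * c t)) with (- (p * c t) + - ((p' - p) * c t)) by ring. rewrite Cexp_add. ring. }
  rewrite !Cmod_mult, Cmod_Cexp.
  pose proof (Cexp_bound1 (- ((p' - p) * c t))) as B. rewrite Cmod_opp, Cmod_mult in B.
  pose proof (Rmax_exp_le (Re (- (p * c t))) (Re (- ((p' - p) * c t)))) as M.
  replace (Re (- (p * c t)) + Re (- ((p' - p) * c t)))%R with (- Re (p' * c t))%R in M.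
  2: { unfold Re. simpl. ring. }
  change (Re (- (p * c t))) with (- Re (p * c t))%R in *.
  set (E := exp (- Re (p * c t))) in *. set (E' := exp (- Re (p' * c t))) in *.
  set (R1 := Rmax 1 (exp (Re (- ((p' - p) * c t))))) in *.
  pose proof (Cmod_ge_0 (q (c t))). pose proof (Cmod_ge_0 (dc t)). pose proof (Cmod_ge_0 (c t)). pose proof (Cmod_ge_0 (p' - p)).
  assert (HE : (0 < E)%R) by apply exp_pos.
  apply Rle_trans with (Cmod (q (c t)) * Cmod (dc t) * (Cmod (p' - p) * Cmod (c t) * (E + E')))%R.
  - apply Rmult_le_compat_l; [apply Rmult_le_pos; auto|].
    apply Rle_trans with (E * (Cmod (p' - p) * Cmod (c t) * R1))%R; [apply Rmult_le_compat_l; lra|].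
    replace (E * (Cmod (p' - p) * Cmod (c t) * R1))%R with (Cmod (p' - p) * Cmod (c t) * (E * R1))%R by ring.
    apply Rmult_le_compat_l; auto. apply Rmult_le_pos; auto.
  - replace (Cmod (q (c t)) * Cmod (dc t) * (Cmod (p' - p) * Cmod (c t) * (E + E')))%R
      with (Cmod (q (c t)) * Cmod (dc t) * Cmod (c t) * (E + E') * Cmod (p' - p))%R by ring.
    replace (K * Cmod (p' - p) * Dom t)%R with (K * Dom t * Cmod (p' - p))%R by ring.
    apply Rmult_le_compat_r; auto.
Qed.

Lemma Lap_taylor q p p' A A' A1 K : dominated (Fint c dc q p) A -> dominated (Fint c dc q p') A' ->
  dominated (Fint c dc (fun w => - w * q w) p) A1 ->
  (forall t, (0 <= t)%R -> (Cmod (q (c t)) * Cmod (dc t) * Cmod (c t) ^ 2 * (exp (- Re (p * c t)) + exp (- Re (p' * c t))) <= K * Dom t)%R) ->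
  (Cmod (Lap c dc q p' - Lap c dc q p - (p' - p) * Lap c dc (fun w => - w * q w)%C p) <= 6 * K * Cmod (p' - p) ^ 2)%R.
Proof.
  intros HA HA' HA1 HK. unfold Lap.
  set (F1 := Fint c dc (fun w => - w * q w)%C p) in *.
  replace (II (Fint c dc q p') - II (Fint c dc q p) - (p' - p) * II F1)
    with (II (fun t => (Fint c dc q p' t + - (1) * Fint c dc q p t) + - (p' - p) * F1 t)).
  2: { rewrite (II_plus (fun t => Fint c dc q p' t + - (1) * Fint c dc q p t) (fun t => - (p' - p) * F1 t) (A' + Cmod (- (1)) * A) (Cmod (- (p' - p)) * A1)), (II_plus _ _ A' (Cmod (- (1)) * A)), (II_scal _ _ A), (II_scal _ _ A1); auto; [ring| | |];
       try (now apply dominated_scal). apply dominated_plus; auto. now apply dominated_scal. }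
  replace (6 * K * Cmod (p' - p) ^ 2)%R with (6 * (K * Cmod (p' - p) ^ 2))%R by ring.
  apply II_bound. split.
  { intros t Ht. apply ccont_plus; [apply ccont_plus; [now apply HA'|apply ccont_mult; [apply ccont_const|now apply HA]]|apply ccont_mult; [apply ccont_const|now apply HA1]]. }
  intros t Ht. specialize (HK t Ht).
  replace (Fint c dc q p' t + - (1) * Fint c dc q p t + - (p' - p) * F1 t)
    with (q (c t) * dc t * (Cexp (- (p * c t)) * (Cexp (- ((p' - p) * c t)) - 1 - - ((p' - p) * c t)))).
  2: { unfold F1, Fint. replace (- (p' * c t)) with (- (p * c t) + - ((p' - p) * c t)) by ring. rewrite Cexp_add. ring. }
  rewrite !Cmod_mult, Cmod_Cexp.
  pose proof (Cexp_bound2 (- ((p' - p) * c t))) as B. rewrite Cmod_opp, Cmod_mult in B.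
  pose proof (Rmax_exp_le (Re (- (p * c t))) (Re (- ((p' - p) * c t)))) as M.
  replace (Re (- (p * c t)) + Re (- ((p' - p) * c t)))%R with (- Re (p' * c t))%R in M.
  2: { unfold Re. simpl. ring. }
  change (Re (- (p * c t))) with (- Re (p * c t))%R in *.
  set (E := exp (- Re (p * c t))) in *. set (E' := exp (- Re (p' * c t))) in *.
  set (R1 := Rmax 1 (exp (Re (- ((p' - p) * c t))))) in *.
  pose proof (Cmod_ge_0 (q (c t))). pose proof (Cmod_ge_0 (dc t)).
  assert (HE : (0 < E)%R) by apply exp_pos.
  rewrite Rpow_mult_distr in B.
  pose proof (pow2_ge_0 (Cmod (c t))) as Q1. pose proof (pow2_ge_0 (Cmod (p' - p))) as Q2.
  set (U := (Cmod (c t) ^ 2)%R) in *. set (V := (Cmod (p' - p) ^ 2)%R) in *.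
  apply Rle_trans with (Cmod (q (c t)) * Cmod (dc t) * (V * U * (E + E')))%R.
  - apply Rmult_le_compat_l; [apply Rmult_le_pos; auto|].
    apply Rle_trans with (E * (V * U * R1))%R; [apply Rmult_le_compat_l; lra|].
    replace (E * (V * U * R1))%R with (V * U * (E * R1))%R by ring.
    apply Rmult_le_compat_l; auto. apply Rmult_le_pos; auto.
  - replace (Cmod (q (c t)) * Cmod (dc t) * (V * U * (E + E')))%R with (Cmod (q (c t)) * Cmod (dc t) * U * (E + E') * V)%R by ring.
    replace (K * V * Dom t)%R with (K * Dom t * V)%R by ring.
    apply Rmult_le_compat_r; auto.
Qed.
End Generic.

(* s = 1 and s = -1 give the upper and the lower branch; the former serves Im p < 0, the latter Im p > 0. *)
Definition cur (w0 k sl s eta : R) : C := (Xc w0 k sl eta, (s * eta)%R).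
Definition dcur (k sl s eta : R) : C := ((- (k * (sl * sl * eta) / (1 + sl * sl * (eta * eta))))%R, s).

(** e^(lam eta) is the square root of 1 + eta^2, a lower bound for |c(eta)|. On this scale both
    |c|^(-m) and e^(-tc) are bounded by exponentials of multiples of [lam]. *)
Definition lam (eta : R) : R := (ln (1 + eta * eta) / 2)%R.

Lemma lam_pos eta : (0 <= lam eta)%R.
Proof. unfold lam. assert (0 <= ln (1 + eta * eta))%R; [|lra]. rewrite <- ln_1. apply ln_le; nra. Qed.

Lemma Dom_ge_inv x : (0 <= x)%R -> (/ (1 + x * x) <= Dom x)%R.
Proof.
  intros Hx. unfold Dom. assert (0 <= x / (1 + x * x) * exp (- (ln (1 + x * x) / 8)))%R; [|lra].
  apply Rmult_le_pos; [|apply Rlt_le, exp_pos]. apply Rdiv_le_0_compat; nra.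
Qed.

(** The left side is (1 + x^2)^(-5/8), of order x^(-5/4). On [0, 1] the first term of [Dom] is
    enough; beyond, (1 + x^2)^(-1/2) <= 2 x / (1 + x^2) leads to the second. *)
Lemma exp_lam_dom x : (0 <= x)%R -> (exp (- (5 / 4 * lam x)) <= 2 * Dom x)%R.
Proof.
  intros Hx. destruct (Rle_dec x 1).
  - apply Rle_trans with 1%R.
    + rewrite <- exp_0. apply exp_le. pose proof (lam_pos x). lra.
    + pose proof (Dom_ge_inv x Hx). assert (/ 2 <= / (1 + x * x))%R by (apply Rinv_le_contravar; nra). lra.
  - assert (E : exp (- (5 / 4 * lam x)) = (exp (- lam x) * exp (- (ln (1 + x * x) / 8)))%R).
    { rewrite <- exp_plus. f_equal. unfold lam. field. }
    rewrite E. unfold Dom. pose proof (exp_pos (- (ln (1 + x * x) / 8))) as P.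
    assert (Q : (exp (- lam x) <= 2 * (x / (1 + x * x)))%R).
    { assert (E2 : (exp (- lam x) * exp (- lam x) = / (1 + x * x))%R).
      { rewrite <- exp_plus. replace (- lam x + - lam x)%R with (- ln (1 + x * x))%R by (unfold lam; field). rewrite exp_Ropp, exp_ln; auto. nra. }
      apply Rsqr_incr_0_var; unfold Rsqr. 2: { apply Rmult_le_pos; [lra|]. apply Rdiv_le_0_compat; nra. }
      rewrite E2. apply (Rmult_le_reg_r ((1 + x * x) * (1 + x * x))); [nra|].
      replace (/ (1 + x * x) * ((1 + x * x) * (1 + x * x)))%R with (1 + x * x)%R by (field; nra).
      replace (2 * (x / (1 + x * x)) * (2 * (x / (1 + x * x))) * ((1 + x * x) * (1 + x * x)))%R with (4 * x * x)%R by (field; nra).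
      nra. }
    assert (0 < / (1 + x * x))%R by (apply Rinv_0_lt_compat; nra). nra.
Qed.

Lemma exp_lin_dom a : (0 < a)%R -> exists C, (0 <= C)%R /\ forall x, (0 <= x)%R -> (exp (- (a * x)) <= C * Dom x)%R.
Proof.
  intros Ha. exists (1 + 4 / (a * a))%R. assert (0 < 4 / (a * a))%R by (apply Rdiv_lt_0_compat; nra). split; [lra|]. intros x Hx.
  apply Rle_trans with ((1 + 4 / (a * a)) * / (1 + x * x))%R.
  2: { apply Rmult_le_compat_l; [lra|]. now apply Dom_ge_inv. }
  apply (Rmult_le_reg_r (1 + x * x)); [nra|]. rewrite Rmult_assoc, Rinv_l, Rmult_1_r by nra.
  rewrite exp_Ropp. apply (Rmult_le_reg_l (exp (a * x))); [apply exp_pos|].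
  rewrite <- Rmult_assoc, Rinv_r, Rmult_1_l by (apply Rgt_not_eq, exp_pos).
  assert (E : (exp (a * x) = exp (a * x / 2) * exp (a * x / 2))%R) by (rewrite <- exp_plus; f_equal; field).
  pose proof (exp_ineq1_le (a * x / 2)) as I. assert (0 <= a * x)%R by (apply Rmult_le_pos; lra).
  assert (J : (1 <= exp (a * x))%R). { pose proof (exp_ineq1_le (a * x)). lra. }
  assert (J2 : (a * x / 2 * (a * x / 2) <= exp (a * x))%R). { rewrite E. apply Rmult_le_compat; lra. }
  assert (J3 : (x * x <= 4 / (a * a) * exp (a * x))%R).
  { apply Rle_trans with (4 / (a * a) * (a * x / 2 * (a * x / 2)))%R; [right; field; lra|]. apply Rmult_le_compat_l; lra. }
  nra.
Qed.

(** * Estimates on the two branches *)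

Section Curve.
Variables (w0 k sl : R).
Hypothesis Hw0 : (w0 <= -1)%R.
Hypothesis Hk : (0 < k)%R.
Hypothesis HS : (1 <= sl)%R.

Lemma SS_pos eta : (0 <= sl * sl * (eta * eta))%R.
Proof. apply Rmult_le_pos; nra. Qed.

Lemma Xc_le eta : (Xc w0 k sl eta <= w0)%R.
Proof.
  unfold Xc. assert (0 <= ln (1 + sl * sl * (eta * eta)))%R.
  { rewrite <- ln_1. pose proof (SS_pos eta). apply ln_le; lra. } nra.
Qed.

Lemma Xc_even s eta : (s * s = 1)%R -> Xc w0 k sl (s * eta) = Xc w0 k sl eta.
Proof. intros Hs. unfold Xc. replace (s * eta * (s * eta))%R with (s * s * (eta * eta))%R by ring. rewrite Hs, Rmult_1_l. reflexivity. Qed.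

Lemma Xc_derive eta : is_derive (Xc w0 k sl) eta (- (k * (sl * sl * eta) / (1 + sl * sl * (eta * eta))))%R.
Proof.
  pose proof (SS_pos eta). unfold Xc. auto_derive; [lra|]. field. lra.
Qed.

Lemma cur_deriv s eta : deriv_RC (cur w0 k sl s) eta (dcur k sl s eta).
Proof.
  apply is_derive_deriv_RC.
  - apply Xc_derive.
  - unfold cur, dcur, Im; simpl. auto_derive; auto. ring.
Qed.

Lemma cur_cont s eta : ccont (cur w0 k sl s) eta.
Proof. eapply deriv_RC_cont, cur_deriv. Qed.

Lemma dcur_cont s eta : ccont (dcur k sl s) eta.
Proof.
  apply (ccont_ext (fun eta => RtoC (- (k * (sl * sl * eta) / (1 + sl * sl * (eta * eta)))) + Ci * RtoC s)).
  { intros. unfold dcur. now rewrite <- pair_RtoC. }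
  apply ccont_plus; [|apply ccont_const]. apply ccont_RtoC.
  apply derivable_continuous_pt. eexists. apply is_derive_Reals. auto_derive; [|reflexivity].
  pose proof (SS_pos eta). lra.
Qed.

Lemma sgn_abs s : (s * s = 1)%R -> Rabs s = 1%R.
Proof. intros Hs. unfold Rabs. destruct Rcase_abs; nra. Qed.

Lemma dcur_bound s eta : (s * s = 1)%R -> (Cmod (dcur k sl s eta) <= k * sl + 1)%R.
Proof.
  intros Hs. eapply Rle_trans; [apply Cmod_le_Re_Im|]. unfold dcur, Re, Im; simpl. rewrite (sgn_abs s) by auto.
  apply Rplus_le_compat_r. rewrite Rabs_Ropp. pose proof (SS_pos eta).
  unfold Rdiv. rewrite Rabs_mult, (Rabs_pos_eq (/ _)) by (apply Rlt_le, Rinv_0_lt_compat; lra).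
  apply (Rmult_le_reg_r (1 + sl * sl * (eta * eta))); [lra|]. rewrite Rmult_assoc, Rinv_l, Rmult_1_r by lra.
  rewrite !Rabs_mult, (Rabs_pos_eq k), (Rabs_pos_eq sl) by lra.
  assert (Rabs eta * Rabs eta = eta * eta)%R by (rewrite <- Rabs_mult; apply Rabs_pos_eq, Rle_0_sqr).
  assert (sl * Rabs eta <= 1 + sl * sl * (eta * eta))%R.
  { rewrite <- H0. pose proof (pow2_ge_0 (sl * Rabs eta - 1)). nra. }
  replace (k * (sl * sl * Rabs eta))%R with (k * sl * (sl * Rabs eta))%R by ring.
  apply Rmult_le_compat_l; auto. apply Rmult_le_pos; lra.
Qed.

Lemma cur_mod_ge s eta : (s * s = 1)%R -> (exp (lam eta) <= Cmod (cur w0 k sl s eta))%R.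
Proof.
  intros Hs. apply Rsqr_incr_0_var; [|apply Cmod_ge_0]. unfold Rsqr.
  rewrite Cmod_sq, <- exp_plus. replace (lam eta + lam eta)%R with (ln (1 + eta * eta)) by (unfold lam; field).
  rewrite exp_ln by nra. unfold cur, Re, Im; simpl. pose proof (Xc_le eta).
  replace (s * eta * (s * eta))%R with (s * s * (eta * eta))%R by ring. rewrite Hs. nra.
Qed.

Lemma cur_mod_ge1 s eta : (s * s = 1)%R -> (1 <= Cmod (cur w0 k sl s eta))%R.
Proof.
  intros Hs. eapply Rle_trans; [|apply cur_mod_ge; auto]. pose proof (exp_ineq1_le (lam eta)). pose proof (lam_pos eta). lra.
Qed.

Lemma cur_neq_0 s eta : (s * s = 1)%R -> cur w0 k sl s eta <> 0.
Proof. intros Hs. apply Cmod_gt_0. pose proof (cur_mod_ge1 s eta Hs). lra. Qed.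

Lemma Xc_ge eta : (- Xc w0 k sl eta <= Rabs w0 + k * ln sl + k * lam eta)%R.
Proof.
  unfold Xc, lam. assert (ln (1 + sl * sl * (eta * eta)) <= 2 * ln sl + ln (1 + eta * eta))%R.
  { replace (2 * ln sl)%R with (ln sl + ln sl)%R by ring. rewrite <- ln_mult, <- ln_mult by nra. apply ln_le; nra. }
  pose proof (Rle_abs (- w0)). rewrite Rabs_Ropp in *. nra.
Qed.

Lemma Re_p_cur p s eta : Re (p * cur w0 k sl s eta) = (Re p * Xc w0 k sl eta - s * Im p * eta)%R.
Proof. unfold cur, Re, Im; simpl. ring. Qed.

(** On the branch - Re z is at most a constant plus k lam, so e^(-Re (pz)) is at most a constant
    times e^(k tau lam). Against |z|^(-m) <= e^(-m lam) the condition on tau leaves e^(-5/4 lam),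
    which [Dom] dominates. No decay is taken from Im p, so the cut is included. *)
Lemma exp_bdry (p : C) (s tau eta : R) (m : nat) : (s * s = 1)%R -> (0 <= eta)%R -> (Re p <= tau)%R -> (0 <= tau)%R -> (s * Im p <= 0)%R ->
  (k * tau <= INR m - 5 / 4)%R ->
  (exp (- Re (p * cur w0 k sl s eta)) / Cmod (cur w0 k sl s eta) ^ m <= 2 * exp (tau * (Rabs w0 + k * ln sl)) * Dom eta)%R.
Proof.
  intros Hs He Hp Ht Hi Hm.
  pose proof (cur_mod_ge s eta Hs) as HC. pose proof (exp_pos (lam eta)) as HP.
  assert (HCm : (exp (INR m * lam eta) <= Cmod (cur w0 k sl s eta) ^ m)%R).
  { rewrite exp_pow_nat. apply pow_incr. lra. }
  apply Rle_trans with (exp (- Re (p * cur w0 k sl s eta)) * / exp (INR m * lam eta))%R.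
  { apply Rmult_le_compat_l; [apply Rlt_le, exp_pos|]. apply Rinv_le_contravar; auto. apply exp_pos. }
  rewrite <- exp_Ropp, <- exp_plus.
  apply Rle_trans with (exp (tau * (Rabs w0 + k * ln sl)) * exp (- (5 / 4 * lam eta)))%R.
  - rewrite <- exp_plus. apply exp_le. rewrite Re_p_cur. pose proof (Xc_ge eta) as HX. pose proof (Xc_le eta). pose proof (lam_pos eta).
    assert (- (Re p * Xc w0 k sl eta) <= tau * (- Xc w0 k sl eta))%R by nra.
    assert (tau * (- Xc w0 k sl eta) <= tau * (Rabs w0 + k * ln sl + k * lam eta))%R by (apply Rmult_le_compat_l; lra).
    nra.
  - pose proof (exp_lam_dom eta He). pose proof (exp_pos (tau * (Rabs w0 + k * ln sl))). nra.
Qed.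

(** Off the real axis e^(-a eta) beats any power of |c| and any e^(B |Re c|), the latter being a
    power of eta. A third of the exponent absorbs the polynomial, a third the logarithm, through ln
    u <= ln A + u / A with A large, and the last third is left for [Dom]. *)
Lemma exp_interior (s a B : R) (N : nat) : (s * s = 1)%R -> (0 < a)%R -> (0 <= B)%R -> exists C, (0 <= C)%R /\ forall eta, (0 <= eta)%R ->
  (Cmod (cur w0 k sl s eta) ^ N * exp (B * Rabs (Xc w0 k sl eta)) * exp (- (a * eta)) <= C * Dom eta)%R.
Proof.
  intros Hs Ha HB.
  destruct (exp_lin_dom (a / 3) ltac:(lra)) as (C1 & HC1 & K1).
  set (b := (a / (3 * (INR N + 1)))%R). pose proof (pos_INR N) as HN.
  assert (Hb : (0 < b)%R) by (apply Rdiv_lt_0_compat; lra).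
  set (B' := (B + INR N)%R).
  set (A := (1 + 3 * B' * k * sl / a)%R).
  assert (HB' : (0 <= B')%R) by (unfold B'; lra).
  assert (HA : (1 <= A)%R). { unfold A. assert (0 <= 3 * B' * k * sl / a)%R; [|lra]. apply Rdiv_le_0_compat; [|lra]. repeat apply Rmult_le_pos; lra. }
  set (C2 := ((1 + / b) ^ N * exp (B' * (Rabs w0 + k * (ln A + 1))))%R).
  assert (HC2 : (0 <= C2)%R). { apply Rmult_le_pos; [|apply Rlt_le, exp_pos]. apply pow_le. assert (0 < / b)%R by now apply Rinv_0_lt_compat. lra. }
  exists (C2 * C1)%R. split; [now apply Rmult_le_pos|]. intros eta He.
  pose proof (Xc_le eta) as HX0.
  assert (HX : (Rabs (Xc w0 k sl eta) <= Rabs w0 + k * ln (1 + sl * eta))%R).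
  { rewrite Rabs_left1 by lra. unfold Xc.
    assert (ln (1 + sl * sl * (eta * eta)) <= 2 * ln (1 + sl * eta))%R.
    { replace (2 * ln (1 + sl * eta))%R with (ln (1 + sl * eta) + ln (1 + sl * eta))%R by ring.
      assert (0 <= sl * eta)%R by (apply Rmult_le_pos; lra). rewrite <- ln_mult by lra. apply ln_le; nra. }
    pose proof (Rle_abs (- w0)). rewrite Rabs_Ropp in *. nra. }
  assert (HL : (ln (1 + sl * eta) <= ln A + (1 + sl * eta) / A)%R).
  { assert (0 <= sl * eta)%R by (apply Rmult_le_pos; lra).
    pose proof (ln_le_sub1 ((1 + sl * eta) / A) ltac:(apply Rdiv_lt_0_compat; lra)).
    unfold Rdiv in *. rewrite ln_mult, ln_Rinv in H0 by (try apply Rinv_0_lt_compat; lra). lra. }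
  assert (HBL : (B' * (k * ((1 + sl * eta) / A)) <= B' * k + a / 3 * eta)%R).
  { replace (B' * (k * ((1 + sl * eta) / A)))%R with (B' * k * / A + B' * k * sl * / A * eta)%R by (field; lra).
    apply Rplus_le_compat.
    - assert (/ A <= 1)%R by (rewrite <- Rinv_1; apply Rinv_le_contravar; lra). assert (0 <= B' * k)%R by (apply Rmult_le_pos; lra). nra.
    - apply Rmult_le_compat_r; auto. apply (Rmult_le_reg_r A); [lra|]. rewrite Rmult_assoc, Rinv_l by lra.
      unfold A. replace (a / 3 * (1 + 3 * B' * k * sl / a))%R with (a / 3 + B' * k * sl)%R by (field; lra). lra. }
  assert (HXB : (B' * Rabs (Xc w0 k sl eta) <= B' * (Rabs w0 + k * (ln A + 1)) + a / 3 * eta)%R).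
  { apply Rle_trans with (B' * (Rabs w0 + k * (ln A + (1 + sl * eta) / A)))%R; [apply Rmult_le_compat_l; nra|]. lra. }
  assert (HM : (Cmod (cur w0 k sl s eta) <= exp (Rabs (Xc w0 k sl eta)) * ((1 + / b) * exp (b * eta)))%R).
  { eapply Rle_trans; [apply Cmod_le_Re_Im|]. unfold cur, Re, Im; simpl fst; simpl snd.
    rewrite Rabs_mult, (sgn_abs s), Rmult_1_l, (Rabs_pos_eq eta) by auto.
    pose proof (exp_ineq1_le (Rabs (Xc w0 k sl eta))). pose proof (Rabs_pos (Xc w0 k sl eta)).
    pose proof (exp_ineq1_le (b * eta)). assert (0 <= b * eta)%R by (apply Rmult_le_pos; lra).
    assert (1 + eta <= (1 + / b) * exp (b * eta))%R.
    { assert (eta = / b * (b * eta))%R by (field; lra).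
      assert (0 < / b)%R by now apply Rinv_0_lt_compat. rewrite H3 at 1. nra. }
    nra. }
  assert (HMN : (Cmod (cur w0 k sl s eta) ^ N <= exp (INR N * Rabs (Xc w0 k sl eta)) * ((1 + / b) ^ N * exp (a / 3 * eta)))%R).
  { eapply Rle_trans; [apply pow_incr; split; [apply Cmod_ge_0|apply HM]|].
    rewrite !Rpow_mult_distr, <- !exp_pow_nat.
    apply Rmult_le_compat_l; [apply Rlt_le, exp_pos|]. apply Rmult_le_compat_l.
    - apply pow_le. assert (0 < / b)%R by now apply Rinv_0_lt_compat. lra.
    - apply exp_le. rewrite <- Rmult_assoc. apply Rmult_le_compat_r; auto.
      unfold b. apply (Rmult_le_reg_r (3 * (INR N + 1))); [lra|]. replace (INR N * (a / (3 * (INR N + 1))) * (3 * (INR N + 1)))%R with (INR N * a)%R by (field; lra). nra. }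
  apply Rle_trans with (exp (INR N * Rabs (Xc w0 k sl eta)) * ((1 + / b) ^ N * exp (a / 3 * eta)) * exp (B * Rabs (Xc w0 k sl eta)) * exp (- (a * eta)))%R.
  { apply Rmult_le_compat_r; [apply Rlt_le, exp_pos|]. apply Rmult_le_compat_r; [apply Rlt_le, exp_pos|]. auto. }
  replace (exp (INR N * Rabs (Xc w0 k sl eta)) * ((1 + / b) ^ N * exp (a / 3 * eta)) * exp (B * Rabs (Xc w0 k sl eta)) * exp (- (a * eta)))%R
    with ((1 + / b) ^ N * (exp (INR N * Rabs (Xc w0 k sl eta)) * exp (B * Rabs (Xc w0 k sl eta)) * exp (a / 3 * eta) * exp (- (a * eta))))%R by ring.
  rewrite <- !exp_plus.
  apply Rle_trans with ((1 + / b) ^ N * (exp (B' * (Rabs w0 + k * (ln A + 1))) * exp (- (a / 3 * eta))))%R.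
  - apply Rmult_le_compat_l. { apply pow_le. assert (0 < / b)%R by now apply Rinv_0_lt_compat. lra. }
    rewrite <- exp_plus. apply exp_le. unfold B' in *. lra.
  - unfold C2. rewrite <- Rmult_assoc, (Rmult_assoc _ C1). apply Rmult_le_compat_l; auto.
Qed.

Definition CF (s : R) (q : C -> C) (p : C) : R -> C := Fint (cur w0 k sl s) (dcur k sl s) q p.
Definition CL (s : R) (q : C -> C) (p : C) : C := Lap (cur w0 k sl s) (dcur k sl s) q p.

Definition curve_cont (s : R) (q : C -> C) : Prop := forall t, (0 <= t)%R -> ccont (fun t => q (cur w0 k sl s t)) t.
(** Two regimes: polynomial growth along the branch is allowed where s Im p < 0, whereas
    [decay_bound] is what the estimates up to the cut consume. *)
Definition poly_bound (s : R) (q : C -> C) (M : R) (N : nat) : Prop :=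
  (0 <= M)%R /\ forall t, (0 <= t)%R -> (Cmod (q (cur w0 k sl s t)) <= M * Cmod (cur w0 k sl s t) ^ N)%R.
Definition decay_bound (s : R) (q : C -> C) (M : R) (m : nat) : Prop :=
  (0 <= M)%R /\ forall t, (0 <= t)%R -> (Cmod (q (cur w0 k sl s t)) <= M / Cmod (cur w0 k sl s t) ^ m)%R.

Lemma kS1_pos : (0 < k * sl + 1)%R.
Proof. nra. Qed.

Lemma poly_bound_opp_id s q M N : poly_bound s q M N -> poly_bound s (fun w => - w * q w) M (S N).
Proof.
  intros [HM H]. split; auto. intros t Ht. rewrite Cmod_mult, Cmod_opp. simpl.
  specialize (H t Ht). pose proof (Cmod_ge_0 (cur w0 k sl s t)). nra.
Qed.

Lemma curve_cont_opp_id s q : curve_cont s q -> curve_cont s (fun w => - w * q w).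
Proof. intros H t Ht. apply ccont_mult; [apply ccont_opp, cur_cont|now apply H]. Qed.

Lemma interior_dom s q M N (a B : R) : (s * s = 1)%R -> (0 < a)%R -> (0 <= B)%R -> curve_cont s q -> poly_bound s q M N ->
  exists K, (0 <= K)%R /\ forall p, (s * Im p <= - a)%R -> (Rabs (Re p) <= B)%R -> dominated (CF s q p) K.
Proof.
  intros Hs Ha HB Hq [HM HN]. destruct (exp_interior s a B N Hs Ha HB) as (C & HC & K).
  pose proof kS1_pos as HkS.
  exists (M * (k * sl + 1) * C)%R. split. { apply Rmult_le_pos; auto. apply Rmult_le_pos; lra. }
  intros p Hi Hr. apply Fint_dom; auto; try apply cur_cont; try apply dcur_cont.
  intros t Ht. specialize (K t Ht). specialize (HN t Ht).
  assert (E : (exp (- Re (p * cur w0 k sl s t)) <= exp (B * Rabs (Xc w0 k sl t)) * exp (- (a * t)))%R).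
  { rewrite <- exp_plus. apply exp_le. rewrite Re_p_cur. pose proof (Rle_abs (- (Re p * Xc w0 k sl t))).
    rewrite Rabs_Ropp, Rabs_mult in H. pose proof (Rabs_pos (Xc w0 k sl t)). nra. }
  pose proof (dcur_bound s t Hs). pose proof (Cmod_ge_0 (q (cur w0 k sl s t))). pose proof (Cmod_ge_0 (dcur k sl s t)).
  pose proof (exp_pos (- Re (p * cur w0 k sl s t))).
  apply Rle_trans with (M * Cmod (cur w0 k sl s t) ^ N * (k * sl + 1) * (exp (B * Rabs (Xc w0 k sl t)) * exp (- (a * t))))%R.
  - apply Rmult_le_compat; try lra. apply Rmult_le_pos; auto. apply Rmult_le_compat; auto.
  - replace (M * Cmod (cur w0 k sl s t) ^ N * (k * sl + 1) * (exp (B * Rabs (Xc w0 k sl t)) * exp (- (a * t))))%R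
      with (M * (k * sl + 1) * (Cmod (cur w0 k sl s t) ^ N * exp (B * Rabs (Xc w0 k sl t)) * exp (- (a * t))))%R by ring.
    rewrite (Rmult_assoc _ C). apply Rmult_le_compat_l; auto. apply Rmult_le_pos; lra.
Qed.

Lemma interior_dom1 s q M N p : (s * s = 1)%R -> (s * Im p < 0)%R -> curve_cont s q -> poly_bound s q M N -> exists K, dominated (CF s q p) K.
Proof.
  intros Hs Hp Hq HN. destruct (interior_dom s q M N (- (s * Im p)) (Rabs (Re p)) Hs) as (K & _ & HK); auto; [lra|apply Rabs_pos|].
  exists K. apply HK; lra.
Qed.

Lemma CL_deriv s q M N p : (s * s = 1)%R -> (s * Im p < 0)%R -> curve_cont s q -> poly_bound s q M N ->
  deriv_CC (CL s q) p (CL s (fun w => - w * q w) p).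
Proof.
  intros Hs Hp Hq HN. set (a := (- (s * Im p) / 2)%R). assert (Ha : (0 < a)%R) by (unfold a; lra).
  set (B := (Rabs (Re p) + a)%R). assert (HB : (0 <= B)%R) by (unfold B; generalize (Rabs_pos (Re p)); lra).
  destruct (interior_dom s q M N a B) as (K0 & _ & D0); auto.
  destruct (interior_dom s _ _ _ a B Hs Ha HB (curve_cont_opp_id _ _ Hq) (poly_bound_opp_id _ _ _ _ HN)) as (K1 & _ & D1).
  destruct (interior_dom s _ _ _ a B Hs Ha HB (curve_cont_opp_id _ _ (curve_cont_opp_id _ _ Hq)) (poly_bound_opp_id _ _ _ _ (poly_bound_opp_id _ _ _ _ HN))) as (K2 & _ & D2).
  apply (quad_deriv_CC _ _ _ a (6 * (K2 + K2))); auto. intros h Hh.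
  assert (Hpa : (s * Im p <= - a)%R) by (unfold a; lra).
  assert (HpB : (Rabs (Re p) <= B)%R) by (unfold B; lra).
  assert (Hi : (s * Im (p + h) <= - a)%R).
  { change (Im (p + h)) with (Im p + Im h)%R. pose proof (Im_le_Cmod h). pose proof (Rle_abs (s * Im h)).
    rewrite Rabs_mult, (sgn_abs s) in H0 by auto. unfold a in *. lra. }
  assert (Hr : (Rabs (Re (p + h)) <= B)%R).
  { change (Re (p + h)) with (Re p + Re h)%R. eapply Rle_trans; [apply Rabs_triang|]. pose proof (re_le_Cmod h). unfold B. lra. }
  replace (Cmod h ^ 2)%R with (Cmod (p + h - p) ^ 2)%R by (rewrite Cadd_sub'; auto).
  replace h with (p + h - p) at 2 by ring.
  apply (Lap_taylor _ _ q p (p + h) K0 K0 K1 (K2 + K2)); [apply D0; auto|apply D0; auto|apply D1; auto|].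
  intros t Ht. pose proof (proj2 (D2 p Hpa HpB) t Ht) as E1. pose proof (proj2 (D2 (p + h) Hi Hr) t Ht) as E2.
  unfold CF in E1, E2. rewrite Fint_mod, !Cmod_mult, !Cmod_opp in E1, E2. rewrite <- Rsqr_pow2. unfold Rsqr. lra.
Qed.

Lemma bdry_dom s q M m (p : C) tau : (s * s = 1)%R -> curve_cont s q -> decay_bound s q M m ->
  (Re p <= tau)%R -> (0 <= tau)%R -> (s * Im p <= 0)%R -> (k * tau <= INR m - 5 / 4)%R ->
  dominated (CF s q p) (M * (k * sl + 1) * (2 * exp (tau * (Rabs w0 + k * ln sl)))).
Proof.
  intros Hs Hq [HM HN] Hr Ht Hi Hm. pose proof kS1_pos as HkS.
  apply Fint_dom; auto; try apply cur_cont; try apply dcur_cont.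
  intros t Ht'. specialize (HN t Ht'). pose proof (exp_bdry p s tau t m Hs Ht' Hr Ht Hi Hm) as K.
  pose proof (dcur_bound s t Hs). pose proof (Cmod_ge_0 (q (cur w0 k sl s t))). pose proof (Cmod_ge_0 (dcur k sl s t)).
  pose proof (exp_pos (- Re (p * cur w0 k sl s t))).
  apply Rle_trans with (M / Cmod (cur w0 k sl s t) ^ m * (k * sl + 1) * exp (- Re (p * cur w0 k sl s t)))%R.
  - apply Rmult_le_compat_r; [lra|]. apply Rmult_le_compat; auto.
  - replace (M / Cmod (cur w0 k sl s t) ^ m * (k * sl + 1) * exp (- Re (p * cur w0 k sl s t)))%R
      with (M * (k * sl + 1) * (exp (- Re (p * cur w0 k sl s t)) / Cmod (cur w0 k sl s t) ^ m))%R by (unfold Rdiv; ring).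
    rewrite (Rmult_assoc (M * (k * sl + 1)) _ (Dom t)). apply Rmult_le_compat_l; auto. apply Rmult_le_pos; lra.
Qed.

Lemma decay_opp_id s q M m : (s * s = 1)%R -> decay_bound s q M (S m) -> decay_bound s (fun w => - w * q w) M m.
Proof.
  intros Hs [HM H]. split; auto. intros t Ht. rewrite Cmod_mult, Cmod_opp. specialize (H t Ht).
  pose proof (cur_mod_ge1 s t Hs) as HC. pose proof (pow_lt (Cmod (cur w0 k sl s t)) m ltac:(lra)).
  apply Rle_trans with (Cmod (cur w0 k sl s t) * (M / Cmod (cur w0 k sl s t) ^ S m))%R.
  - apply Rmult_le_compat_l; lra.
  - right. simpl. field. lra.
Qed.

(* Up to the cut, Lipschitz continuity costs one power of decay, differentiability two. *)
Lemma CL_lip s q M m (tau : R) : (s * s = 1)%R -> curve_cont s q -> decay_bound s q M (S m) ->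
  (0 <= tau)%R -> (k * tau <= INR m - 5 / 4)%R -> exists K, forall p p' : C,
  (Re p <= tau)%R -> (Re p' <= tau)%R -> (s * Im p <= 0)%R -> (s * Im p' <= 0)%R ->
  (Cmod (CL s q p' - CL s q p) <= K * Cmod (p' - p))%R.
Proof.
  intros Hs Hq HN Ht Hm.
  set (K := (M * (k * sl + 1) * (2 * exp (tau * (Rabs w0 + k * ln sl))))%R).
  exists (6 * (K + K))%R. intros p p' Hr Hr' Hi Hi'.
  assert (Hm' : (k * tau <= INR (S m) - 5 / 4)%R) by (rewrite S_INR; lra).
  apply (Lap_lip _ _ q p p' K K).
  - apply (bdry_dom s q M (S m) p tau); auto.
  - apply (bdry_dom s q M (S m) p' tau); auto.
  - intros t H.
    pose proof (proj2 (bdry_dom s _ M m p tau Hs (curve_cont_opp_id _ _ Hq) (decay_opp_id _ _ _ _ Hs HN) Hr Ht Hi Hm) t H) as E1.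
    pose proof (proj2 (bdry_dom s _ M m p' tau Hs (curve_cont_opp_id _ _ Hq) (decay_opp_id _ _ _ _ Hs HN) Hr' Ht Hi' Hm) t H) as E2.
    unfold CF in E1, E2. rewrite Fint_mod, !Cmod_mult, !Cmod_opp in E1, E2. fold K in E1, E2. lra.
Qed.

Lemma CL_deriv_real s q M m (tau t : R) : (s * s = 1)%R -> curve_cont s q -> decay_bound s q M (S (S m)) ->
  (0 <= tau)%R -> (k * tau <= INR m - 5 / 4)%R -> (t < tau)%R ->
  deriv_RC (fun t => CL s q (RtoC t)) t (CL s (fun w => - w * q w) (RtoC t)).
Proof.
  intros Hs Hq HN Ht Hm Htt.
  set (K := (M * (k * sl + 1) * (2 * exp (tau * (Rabs w0 + k * ln sl))))%R).
  apply (quad_deriv_RC _ _ _ (tau - t) (6 * (K + K))); [lra|]. intros h Hh.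
  pose proof (Rle_abs h).
  assert (Hm' : (k * tau <= INR (S m) - 5 / 4)%R) by (rewrite S_INR; lra).
  assert (Hm'' : (k * tau <= INR (S (S m)) - 5 / 4)%R) by (rewrite S_INR; lra).
  assert (I0 : forall u : R, (s * Im (RtoC u) <= 0)%R) by (intros; simpl; lra).
  assert (R0 : forall u : R, Re (RtoC u) = u) by reflexivity.
  replace (Rabs h ^ 2)%R with (Cmod (RtoC (t + h) - RtoC t) ^ 2)%R.
  2: { rewrite <- RtoC_minus, Cmod_R. f_equal. f_equal. ring. }
  replace (RtoC h) with (RtoC (t + h) - RtoC t) by (rewrite RtoC_plus; ring).
  apply (Lap_taylor _ _ q (RtoC t) (RtoC (t + h)) K K K).
  - apply (bdry_dom s q M (S (S m)) (RtoC t) tau); auto; rewrite R0; lra.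
  - apply (bdry_dom s q M (S (S m)) (RtoC (t + h)) tau); auto; rewrite R0; lra.
  - apply (bdry_dom s _ M (S m) (RtoC t) tau Hs (curve_cont_opp_id _ _ Hq) (decay_opp_id _ _ _ _ Hs HN)); auto; rewrite R0; lra.
  - intros u Hu.
    assert (HN2 : decay_bound s (fun w => - w * (- w * q w)) M m) by (apply (decay_opp_id s _ _ _ Hs), (decay_opp_id s _ _ _ Hs), HN).
    assert (HQ2 : curve_cont s (fun w => - w * (- w * q w))) by (apply (curve_cont_opp_id s), (curve_cont_opp_id s), Hq).
    pose proof (proj2 (bdry_dom s _ M m (RtoC t) tau Hs HQ2 HN2 ltac:(rewrite R0; lra) Ht (I0 _) Hm) u Hu) as E1.
    pose proof (proj2 (bdry_dom s _ M m (RtoC (t + h)) tau Hs HQ2 HN2 ltac:(rewrite R0; lra) Ht (I0 _) Hm) u Hu) as E2.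
    unfold CF in E1, E2. rewrite Fint_mod, !Cmod_mult, !Cmod_opp in E1, E2. fold K in E1, E2. rewrite <- Rsqr_pow2. unfold Rsqr. lra.
Qed.

End Curve.

(** * Independence of the path *)

Lemma lin_exp_small (a b c : R) : (0 <= a)%R -> (0 <= b)%R -> (0 < c)%R -> forall e, (0 < e)%R -> exists T0, (1 <= T0)%R /\
  forall T, (T0 <= T)%R -> ((a + b * T) * exp (- (c * T)) < e)%R.
Proof.
  intros Ha Hb Hc e He. set (N := (4 * (a + b) / (c * c))%R).
  assert (HN : (0 <= N)%R) by (apply Rdiv_le_0_compat; nra).
  exists (1 + N / e)%R. assert (0 <= N / e)%R by (apply Rdiv_le_0_compat; lra). split; [lra|]. intros T HT.
  assert (HcT : (0 < c * T)%R) by (apply Rmult_lt_0_compat; lra).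
  assert (HE : ((c * T) * (c * T) / 4 <= exp (c * T))%R).
  { replace (exp (c * T)) with (exp (c * T / 2) * exp (c * T / 2))%R by (rewrite <- exp_plus; f_equal; field).
    pose proof (exp_ineq1_le (c * T / 2)). nra. }
  rewrite exp_Ropp. apply (Rmult_lt_reg_r (exp (c * T))); [apply exp_pos|].
  rewrite Rmult_assoc, Rinv_l, Rmult_1_r by (apply Rgt_not_eq, exp_pos).
  apply Rle_lt_trans with ((a + b) * T)%R; [nra|].
  apply Rlt_le_trans with (e * (c * T * (c * T) / 4))%R; [|apply Rmult_le_compat_l; lra].
  assert (N < e * T)%R.
  { apply (Rmult_lt_reg_r (/ e)); [now apply Rinv_0_lt_compat|]. replace (e * T * / e)%R with T by (field; lra). unfold Rdiv in *. lra. }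
  assert (E : (a + b = N * (c * c / 4))%R) by (unfold N; field; lra). rewrite E.
  replace (e * (c * T * (c * T) / 4))%R with ((e * T) * (c * c / 4) * T)%R by field.
  apply Rmult_lt_compat_r; [lra|]. apply Rmult_lt_compat_r; auto. nra.
Qed.

(** Membership in H is asked only far along the ray, since a ray that is admissible for the Laplace
    transform may start on the border. *)
Definition ray_lim (H : C -> Prop) (Q : C -> C) (z v l : C) : Prop :=
  forall e, (0 < e)%R -> exists T0, (0 <= T0)%R /\ forall T, (T0 <= T)%R -> H (z + RtoC T * v) /\ (Cmod (Q (z + RtoC T * v)%C - l) < e)%R.

Section Cauchy.
Variables (H : C -> Prop) (w0 k sl : R).
Hypothesis Hk : (0 < k)%R.
Hypothesis HS : (1 <= sl)%R.
Hypothesis Ho : open_dom H.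
Hypothesis Hd : down_dom H.
Hypothesis HL : forall w, H w -> (Re w <= -1)%R.
Hypothesis Hw0 : H (RtoC w0).
Hypothesis HC : forall eta : R, H (Xc w0 k sl eta, eta).

Lemma w0_le : (w0 <= -1)%R.
Proof. exact (HL _ Hw0). Qed.

Lemma cur_in s eta : (s * s = 1)%R -> H (cur w0 k sl s eta).
Proof. intros Hs. unfold cur. rewrite <- (Xc_even w0 k sl s eta Hs). apply HC. Qed.

Lemma cur_0 s : cur w0 k sl s 0 = RtoC w0.
Proof. unfold cur, Xc. apply injective_projections; simpl; [|ring]. rewrite !Rmult_0_r, Rplus_0_r, ln_1. ring. Qed.

Lemma H_cont_curve s q : (s * s = 1)%R -> hol H q -> curve_cont w0 k sl s q.
Proof.
  intros Hs Hq t _. apply (ccont_comp q (cur w0 k sl s)); [now apply cur_cont|].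
  apply (hol_cont H); auto. now apply cur_in.
Qed.

(** A logarithm grows more slowly than any linear function: to the left of the curve there is a cone
    of every slope with vertex on the real axis. This is how rays of all directions with Re v < 0
    eventually enter H. *)
Lemma wide mu : (0 < mu)%R -> exists x0, (x0 <= 0)%R /\ forall y, (x0 - mu * Rabs y <= Xc w0 k sl y)%R.
Proof.
  intros Hmu. set (A := (1 + k * sl / mu)%R).
  assert (HA0 : (0 < k * sl / mu)%R) by (apply Rdiv_lt_0_compat; nra).
  assert (HA : (1 <= A)%R) by (unfold A; lra).
  exists (- (Rabs w0 + k * (ln A + 1)))%R.
  assert (0 <= ln A)%R by (rewrite <- ln_1; apply ln_le; lra).
  split. { pose proof (Rabs_pos w0). nra. }
  intros y. unfold Xc. set (t := Rabs y). assert (Ht : (0 <= t)%R) by apply Rabs_pos.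
  assert (Hy2 : (y * y = t * t)%R) by (unfold t; rewrite <- Rabs_mult; symmetry; apply Rabs_pos_eq, Rle_0_sqr).
  rewrite Hy2.
  assert (0 <= sl * t)%R by (apply Rmult_le_pos; lra).
  assert (ln (1 + sl * sl * (t * t)) <= 2 * ln (1 + sl * t))%R.
  { replace (2 * ln (1 + sl * t))%R with (ln (1 + sl * t) + ln (1 + sl * t))%R by ring.
    rewrite <- ln_mult by lra. apply ln_le; nra. }
  assert (HLn : (ln (1 + sl * t) <= ln A + (1 + sl * t) / A)%R).
  { pose proof (ln_le_sub1 ((1 + sl * t) / A) ltac:(apply Rdiv_lt_0_compat; lra)).
    unfold Rdiv in *. rewrite ln_mult, ln_Rinv in H3 by (try apply Rinv_0_lt_compat; lra). lra. }
  assert (k * ((1 + sl * t) / A) <= k + mu * t)%R.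
  { replace (k * ((1 + sl * t) / A))%R with (k * / A + k * sl * / A * t)%R by (field; lra).
    apply Rplus_le_compat.
    - assert (/ A <= 1)%R by (rewrite <- Rinv_1; apply Rinv_le_contravar; lra). nra.
    - apply Rmult_le_compat_r; auto. apply (Rmult_le_reg_r A); [lra|]. rewrite Rmult_assoc, Rinv_l by lra.
      unfold A. replace (mu * (1 + k * sl / mu))%R with (mu + k * sl)%R by (field; lra). lra. }
  pose proof (Rle_abs (- w0)). rewrite Rabs_Ropp in *.
  assert (k * ln (1 + sl * t) <= k * (ln A + (1 + sl * t) / A))%R by (apply Rmult_le_compat_l; lra).
  assert (k / 2 * ln (1 + sl * sl * (t * t)) <= k / 2 * (2 * ln (1 + sl * t)))%R by (apply Rmult_le_compat_l; lra).
  lra.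
Qed.

Lemma left_in x y : (x <= Xc w0 k sl y)%R -> H (x, y).
Proof. intros Hx. apply (Hd (Xc w0 k sl y) y x y); auto. lra. Qed.

Section OneP.
Variables (q : C -> C) (M : R) (p : C).
Hypothesis Hq : hol H q.
Hypothesis HM : forall z, H z -> (Cmod (q z) <= M)%R.

Definition lapf (z : C) : C := q z * Cexp (- (p * z)).

Lemma M_pos : (0 <= M)%R.
Proof. eapply Rle_trans; [apply Cmod_ge_0|apply (HM _ Hw0)]. Qed.

Lemma hol_Cexp_lin : hol H (fun z => Cexp (- (p * z))).
Proof.
  intros z _. eexists. refine (deriv_CC_ext_loc _ _ _ _ 1 Rlt_0_1 _ (deriv_Cexp_lin (- p) z)). intros. f_equal. ring.
Qed.

Lemma lapf_hol : hol H lapf.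
Proof.
  intros z Hz. destruct (Hq z Hz) as [l Hl]. destruct (hol_Cexp_lin z Hz) as [m Hm].
  eexists. apply (deriv_CC_mult q (fun z => Cexp (- (p * z)))); eauto.
Qed.

Let Q := primQ w0 lapf.

Lemma lapf_bound z : H z -> (Cmod (lapf z) <= M * exp (- Re (p * z)))%R.
Proof.
  intros Hz. unfold lapf. rewrite Cmod_mult, Cmod_Cexp. apply Rmult_le_compat_r; [apply Rlt_le, exp_pos|]. auto.
Qed.

Lemma Cmod_convex (a b : C) (s : R) : (0 <= s <= 1)%R -> (Cmod (a + RtoC s * (b - a)) <= Cmod a + Cmod b)%R.
Proof.
  intros Hs. replace (a + RtoC s * (b - a)) with (RtoC (1 - s) * a + RtoC s * b) by (rewrite RtoC_minus; ring).
  eapply Rle_trans; [apply Cmod_triangle|]. rewrite !Cmod_mult, !Cmod_R, !Rabs_pos_eq by lra.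
  pose proof (Cmod_ge_0 a). pose proof (Cmod_ge_0 b). nra.
Qed.

(** Points of equal parameter T on the two rays are joined by a segment. Its directions are convex
    combinations of v1 and v2, so for T large it lies in H and the integrand on it is O(e^(-c' T)),
    while its length is only O(T). *)
Lemma ray_diff (z1 v1 z2 v2 : C) : (Re v1 < 0)%R -> (0 < Re (p * v1))%R -> (Re v2 < 0)%R -> (0 < Re (p * v2))%R ->
  forall e, (0 < e)%R -> exists T0, (0 <= T0)%R /\ forall T, (T0 <= T)%R ->
  H (z1 + RtoC T * v1) /\ H (z2 + RtoC T * v2) /\ (Cmod (Q (z2 + RtoC T * v2)%C - Q (z1 + RtoC T * v1)%C) < e)%R.
Proof.
  intros N1 P1 N2 P2 e He.
  set (c := Rmin (- Re v1) (- Re v2)). assert (Hc : (0 < c)%R) by (apply Rmin_glb_lt; lra).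
  set (c' := Rmin (Re (p * v1)) (Re (p * v2))). assert (Hc' : (0 < c')%R) by (apply Rmin_glb_lt; lra).
  set (R0 := (Cmod z1 + Cmod z2)%R). set (V := (Cmod v1 + Cmod v2)%R).
  pose proof (Cmod_ge_0 z1) as G1. pose proof (Cmod_ge_0 z2) as G2. pose proof (Cmod_ge_0 v1) as G3. pose proof (Cmod_ge_0 v2) as G4.
  pose proof (Cmod_ge_0 p) as G5.
  assert (HR : (0 <= R0)%R) by (unfold R0; lra). assert (HV : (0 <= V)%R) by (unfold V; lra).
  set (mu := (c / (2 * (V + 1)))%R). assert (Hmu : (0 < mu)%R) by (apply Rdiv_lt_0_compat; lra).
  assert (HmuV : (mu * V <= c / 2)%R).
  { apply Rle_trans with (mu * (V + 1))%R; [nra|]. right. unfold mu. field. lra. }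
  destruct (wide mu Hmu) as (x0 & Hx0 & Wd).
  pose proof M_pos as HM0.
  destruct (lin_exp_small (R0 * (M * exp (Cmod p * R0))) (V * (M * exp (Cmod p * R0))) c') with (e := e) as (T1 & HT1 & K1); auto.
  { apply Rmult_le_pos; auto. apply Rmult_le_pos; auto. apply Rlt_le, exp_pos. }
  { apply Rmult_le_pos; auto. apply Rmult_le_pos; auto. apply Rlt_le, exp_pos. }
  set (T2 := (2 * (R0 + mu * R0 - x0) / c)%R).
  exists (Rmax T1 T2). split. { eapply Rle_trans; [|apply Rmax_l]. lra. }
  intros T HT. pose proof (Rle_trans _ _ _ (Rmax_l _ _) HT) as HTa. pose proof (Rle_trans _ _ _ (Rmax_r _ _) HT) as HTb.
  specialize (K1 T HTa).
  assert (HTc : (R0 + mu * R0 - x0 <= c / 2 * T)%R).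
  { apply (Rmult_le_compat_l (c / 2)) in HTb; [|lra]. unfold T2 in HTb. replace (c / 2 * (2 * (R0 + mu * R0 - x0) / c))%R with (R0 + mu * R0 - x0)%R in HTb by (field; lra). lra. }
  set (a := z1 + RtoC T * v1). set (b := z2 + RtoC T * v2).
  assert (E : forall s, a + RtoC s * (b - a) = (z1 + RtoC s * (z2 - z1)) + RtoC T * (v1 + RtoC s * (v2 - v1))).
  { intros s. unfold a, b. ring. }
  assert (Hin : forall s, (0 <= s <= 1)%R -> H (a + RtoC s * (b - a))).
  { intros s Hs. rewrite E. set (zs := z1 + RtoC s * (z2 - z1)). set (vs := v1 + RtoC s * (v2 - v1)).
    pose proof (Cmod_convex z1 z2 s Hs) as B1. fold zs R0 in B1. pose proof (Cmod_convex v1 v2 s Hs) as B2. fold vs V in B2.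
    assert (Hvs : (Re vs <= - c)%R).
    { change (Re vs) with (Re v1 + (s * (Re v2 - Re v1) - 0 * (Im v2 - Im v1)))%R.
      pose proof (Rmin_l (- Re v1) (- Re v2)). pose proof (Rmin_r (- Re v1) (- Re v2)). fold c in H0, H1. nra. }
    replace (zs + RtoC T * vs) with ((Re zs + T * Re vs)%R, (Im zs + T * Im vs)%R).
    2: { apply injective_projections; unfold Re, Im; simpl; ring. }
    apply left_in. eapply Rle_trans; [|apply Wd].
    pose proof (re_le_Cmod zs) as C1. pose proof (Rle_abs (Re zs)). pose proof (Im_le_Cmod zs). pose proof (Im_le_Cmod vs).
    assert (Rabs (Im zs + T * Im vs) <= R0 + T * V)%R.
    { eapply Rle_trans; [apply Rabs_triang|]. rewrite Rabs_mult, (Rabs_pos_eq T) by lra. apply Rplus_le_compat; [lra|]. apply Rmult_le_compat_l; lra. }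
    assert (mu * Rabs (Im zs + T * Im vs) <= mu * (R0 + T * V))%R by (apply Rmult_le_compat_l; lra).
    assert (T * Re vs <= T * (- c))%R by (apply Rmult_le_compat_l; lra).
    assert (T * (mu * V) <= T * (c / 2))%R by (apply Rmult_le_compat_l; lra). lra. }
  split. { replace a with (a + RtoC 0 * (b - a)) by ring. apply Hin; lra. }
  split. { replace b with (a + RtoC 1 * (b - a)) by ring. apply Hin; lra. }
  replace (Q b) with (Q (a + (b - a))) by (f_equal; ring).
  eapply Rle_lt_trans; [apply (primQ_variation H w0 lapf Ho Hd Hw0 lapf_hol a (b - a) (M * (exp (Cmod p * R0) * exp (- (c' * T))))); auto|].
  - intros s Hs. eapply Rle_trans; [apply lapf_bound; auto|]. apply Rmult_le_compat_l; auto.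
    rewrite <- exp_plus. apply exp_le. rewrite E.
    set (zs := z1 + RtoC s * (z2 - z1)). set (vs := v1 + RtoC s * (v2 - v1)).
    pose proof (Cmod_convex z1 z2 s Hs) as B1. fold zs R0 in B1.
    replace (Re (p * (zs + RtoC T * vs))) with (Re (p * zs) + T * (Re (p * v1) + s * (Re (p * v2) - Re (p * v1))))%R.
    2: { unfold vs, Re; simpl. ring. }
    assert (c' <= Re (p * v1) + s * (Re (p * v2) - Re (p * v1)))%R.
    { pose proof (Rmin_l (Re (p * v1)) (Re (p * v2))). pose proof (Rmin_r (Re (p * v1)) (Re (p * v2))). fold c' in H0, H1. nra. }
    assert (T * c' <= T * (Re (p * v1) + s * (Re (p * v2) - Re (p * v1))))%R by (apply Rmult_le_compat_l; lra).
    pose proof (re_le_Cmod (p * zs)). rewrite Cmod_mult in H2. pose proof (Rle_abs (- Re (p * zs))). rewrite Rabs_Ropp in H3.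
    assert (Cmod p * Cmod zs <= Cmod p * R0)%R by (apply Rmult_le_compat_l; lra). lra.
  - assert (Hba : (Cmod (b - a) <= R0 + V * T)%R).
    { unfold a, b. replace (z2 + RtoC T * v2 - (z1 + RtoC T * v1)) with ((z2 + - z1) + RtoC T * (v2 + - v1)) by ring.
      eapply Rle_trans; [apply Cmod_triangle|]. rewrite Cmod_mult, Cmod_R, (Rabs_pos_eq T) by lra.
      pose proof (Cmod_triangle z2 (- z1)). pose proof (Cmod_triangle v2 (- v1)). rewrite !Cmod_opp in *. unfold R0, V. nra. }
    eapply Rle_lt_trans; [apply Rmult_le_compat_r; [|apply Hba]|].
    + apply Rmult_le_pos; auto. apply Rmult_le_pos; apply Rlt_le, exp_pos.
    + replace ((R0 + V * T) * (M * (exp (Cmod p * R0) * exp (- (c' * T)))))%R with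
       ((R0 * (M * exp (Cmod p * R0)) + V * (M * exp (Cmod p * R0)) * T) * exp (- (c' * T)))%R by ring. auto.
Qed.

Lemma CF_int s T : (s * s = 1)%R -> (0 <= T)%R -> CInt (CF w0 k sl s q p) 0 T = Q (cur w0 k sl s T).
Proof.
  intros Hs HT. transitivity (Q (cur w0 k sl s T) - Q (cur w0 k sl s 0)).
  - apply is_CInt_unique. apply (CInt_FTC (fun t => Q (cur w0 k sl s t))); auto.
    + intros t Ht. replace (CF w0 k sl s q p t) with (dcur k sl s t * lapf (cur w0 k sl s t)) by (unfold CF, Fint, lapf; ring).
      apply (deriv_RC_comp Q (cur w0 k sl s)); [apply cur_deriv; auto|]. apply (primQ_deriv H); auto. apply lapf_hol. now apply cur_in.
    + intros t Ht. apply Fint_cont; try (intros; now apply cur_cont); try (intros; now apply dcur_cont). apply H_cont_curve; auto; lra.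
  - rewrite cur_0. unfold Q. rewrite primQ_w0. ring.
Qed.

Lemma poly0 s : (s * s = 1)%R -> poly_bound w0 k sl s q M 0.
Proof. intros Hs. split; [apply M_pos|]. intros t _. simpl. rewrite Rmult_1_r. now apply HM, cur_in. Qed.

Lemma curve_lim s : (s * s = 1)%R -> (s * Im p < 0)%R ->
  forall e, (0 < e)%R -> exists T0, (0 <= T0)%R /\ forall T, (T0 <= T)%R -> (Cmod (Q (cur w0 k sl s T) - CL w0 k sl s q p) < e)%R.
Proof.
  intros Hs Hp e He.
  destruct (interior_dom1 w0 k sl w0_le Hk HS s q M 0 p Hs Hp (H_cont_curve s q Hs Hq) (poly0 s Hs)) as (K & HK).
  destruct (dominated_ex _ _ HK e He) as (T0 & HT0 & L). exists T0. split; auto. intros T HT.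
  rewrite <- (CF_int s T Hs) by lra. apply L; auto.
Qed.

(* the ray from x0 with direction (-mu, s) stays at the same height as the curve *)
Lemma curve_ray s : (s * s = 1)%R -> (s * Im p < 0)%R -> exists (x0 : R) (v : C),
  (Re v < 0)%R /\ (0 < Re (p * v))%R /\ (forall t, (0 <= t)%R -> H (RtoC x0 + RtoC t * v)) /\
  forall e, (0 < e)%R -> exists T0, (0 <= T0)%R /\ forall T, (T0 <= T)%R -> (Cmod (Q (cur w0 k sl s T) - Q (RtoC x0 + RtoC T * v)%C) < e)%R.
Proof.
  intros Hs Hp. set (a := (- (s * Im p))%R). assert (Ha : (0 < a)%R) by (unfold a; lra).
  pose proof (Rabs_pos (Re p)) as Hrp.
  set (mu := (a / (2 * (Rabs (Re p) + 1)))%R). assert (Hmu : (0 < mu)%R) by (apply Rdiv_lt_0_compat; lra).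
  assert (HmuR : (mu * Rabs (Re p) <= a / 2)%R).
  { apply Rle_trans with (mu * (Rabs (Re p) + 1))%R; [nra|]. right. unfold mu. field. lra. }
  destruct (wide mu Hmu) as (x0 & Hx0 & Wd). pose proof M_pos as HM0.
  exists x0, ((- mu)%R, s). split; [simpl; lra|]. split.
  { unfold Re; simpl. fold (Re p) (Im p). pose proof (Rle_abs (Re p)). unfold a in *. nra. }
  assert (E : forall t, RtoC x0 + RtoC t * ((- mu)%R, s) = ((x0 - mu * t)%R, (s * t)%R)).
  { intros. apply injective_projections; simpl; ring. }
  assert (Hsa : Rabs s = 1%R) by now apply sgn_abs.
  assert (Wt : forall t, (0 <= t)%R -> (x0 - mu * t <= Xc w0 k sl t)%R).
  { intros t Ht. specialize (Wd t). rewrite (Rabs_pos_eq t) in Wd by auto. auto. }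
  split.
  { intros t Ht. rewrite E. apply left_in. rewrite (Xc_even w0 k sl s t Hs). auto. }
  intros e He.
  set (B := (M * exp (Rabs (Re p) * - x0))%R). assert (HB : (0 <= B)%R) by (apply Rmult_le_pos; auto; apply Rlt_le, exp_pos).
  destruct (lin_exp_small (- x0 * B) (mu * B) (a / 2)) with (e := e) as (T1 & HT1 & K1); auto; try nra.
  exists T1. split; [lra|]. intros T HT. specialize (K1 T HT). rewrite E.
  specialize (Wt T ltac:(lra)). pose proof (Xc_le w0 k sl Hk T) as HX. pose proof w0_le as Hw.
  set (L := (Xc w0 k sl T - (x0 - mu * T))%R).
  replace (cur w0 k sl s T) with (((x0 - mu * T)%R, (s * T)%R) + RtoC L).
  2: { unfold cur, L. apply injective_projections; simpl; ring. }
  assert (E2 : forall t, ((x0 - mu * T)%R, (s * T)%R) + RtoC t * RtoC L = ((x0 - mu * T + t * L)%R, (s * T)%R)).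
  { intros. apply injective_projections; simpl; ring. }
  assert (HL0 : (0 <= L)%R) by (unfold L; lra).
  assert (Hin : forall t, (0 <= t <= 1)%R -> H (((x0 - mu * T)%R, (s * T)%R) + RtoC t * RtoC L)).
  { intros t Ht. rewrite E2. apply left_in. rewrite (Xc_even w0 k sl s T Hs). assert (t * L <= 1 * L)%R by (apply Rmult_le_compat_r; lra). unfold L in *. lra. }
  eapply Rle_lt_trans; [apply (primQ_variation H w0 lapf Ho Hd Hw0 lapf_hol _ _ (B * exp (- (a / 2 * T)))); auto|].
  - intros t Ht. eapply Rle_trans; [apply lapf_bound; auto|]. unfold B. rewrite Rmult_assoc. apply Rmult_le_compat_l; auto.
    rewrite <- exp_plus. apply exp_le. rewrite E2. unfold Re at 1; simpl. fold (Re p) (Im p).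
    assert (0 <= t * L <= L)%R by nra.
    assert (- (Re p * (x0 - mu * T + t * L)) <= Rabs (Re p) * (- x0 + mu * T))%R.
    { eapply Rle_trans; [apply Rle_abs|]. rewrite Rabs_Ropp, Rabs_mult. apply Rmult_le_compat_l; auto. rewrite Rabs_left1; unfold L in *; lra. }
    assert (Rabs (Re p) * (mu * T) <= a / 2 * T)%R by nra. unfold a in *. lra.
  - rewrite Cmod_R, Rabs_pos_eq by auto.
    assert (L <= - x0 + mu * T)%R by (unfold L; lra).
    apply Rle_lt_trans with ((- x0 + mu * T) * (B * exp (- (a / 2 * T))))%R.
    + apply Rmult_le_compat_r; auto. apply Rmult_le_pos; auto. apply Rlt_le, exp_pos.
    + replace ((- x0 + mu * T) * (B * exp (- (a / 2 * T))))%R with ((- x0 * B + mu * B * T) * exp (- (a / 2 * T)))%R by ring. auto.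
Qed.

Lemma ray_lim_curve s z v : (s * s = 1)%R -> (s * Im p < 0)%R -> (Re v < 0)%R -> (0 < Re (p * v))%R ->
  ray_lim H Q z v (CL w0 k sl s q p).
Proof.
  intros Hs Hp Hv Hpv e He.
  destruct (curve_ray s Hs Hp) as (x0 & v0 & N0 & P0 & _ & K0).
  destruct (K0 (e / 3)%R) as (T1 & HT1 & L1); [lra|].
  destruct (curve_lim s Hs Hp (e / 3)%R) as (T2 & HT2 & L2); [lra|].
  destruct (ray_diff (RtoC x0) v0 z v N0 P0 Hv Hpv (e / 3)%R) as (T3 & HT3 & L3); [lra|].
  exists (Rmax T1 (Rmax T2 T3)). split. { eapply Rle_trans; [apply HT1|apply Rmax_l]. }
  intros T HT. pose proof (Rmax_l T1 (Rmax T2 T3)). pose proof (Rmax_r T1 (Rmax T2 T3)). pose proof (Rmax_l T2 T3). pose proof (Rmax_r T2 T3).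
  specialize (L1 T ltac:(lra)). specialize (L2 T ltac:(lra)). destruct (L3 T ltac:(lra)) as (I1 & I2 & L3').
  split; auto.
  rewrite Cmod_sub_sym in L1.
  pose proof (Cmod_triangle_sub (Q (z + RtoC T * v)) (Q (RtoC x0 + RtoC T * v0)) (CL w0 k sl s q p)).
  pose proof (Cmod_triangle_sub (Q (RtoC x0 + RtoC T * v0)) (Q (cur w0 k sl s T)) (CL w0 k sl s q p)). lra.
Qed.

(** The half-line ]-oo, w0] serves all p with Re p < 0, in particular the real ones, which lie on
    the edge of both half planes. [Rabs] keeps the curve in H for every real parameter, as two-sided
    continuity wants. *)
Definition ncur (t : R) : C := RtoC (w0 - Rabs t).
Definition ndcur (t : R) : C := - (1).
Definition NF : R -> C := Fint ncur ndcur q p.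

Lemma ncur_cont t : ccont ncur t.
Proof.
  apply ccont_RtoC. apply continuity_pt_minus; [apply continuity_pt_const; now intros ? ?|apply Rcontinuity_abs].
Qed.

Lemma ncur_in t : H (ncur t).
Proof. apply (Hd w0 0%R (w0 - Rabs t)%R 0%R); [exact Hw0|pose proof (Rabs_pos t); lra|apply Rle_refl]. Qed.

Lemma NF_dom : (Re p < 0)%R -> exists K, dominated NF K.
Proof.
  intros Hp. destruct (exp_lin_dom (- Re p) ltac:(lra)) as (K & HK & L).
  exists (M * K)%R. apply Fint_dom; try (intros; apply ncur_cont); try (intros; apply ccont_const).
  - intros t _. apply (ccont_comp q ncur); [apply ncur_cont|]. apply (hol_cont H); auto. apply ncur_in.
  - intros t Ht. unfold ndcur. rewrite Cmod_opp, Cmod_1, Rmult_1_r, Rmult_assoc. specialize (L t Ht).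
    apply Rmult_le_compat; [apply Cmod_ge_0|apply Rlt_le, exp_pos|apply HM, ncur_in|].
    eapply Rle_trans; [|apply L]. apply exp_le. unfold ncur. rewrite Rabs_pos_eq by auto.
    unfold Re; simpl. fold (Re p) (Im p). pose proof w0_le. nra.
Qed.

Lemma ray_lim_neg z v : (Re p < 0)%R -> (Re v < 0)%R -> (0 < Re (p * v))%R -> ray_lim H Q z v (Lap ncur ndcur q p).
Proof.
  intros Hp Hv Hpv e He.
  destruct (NF_dom Hp) as (K & HK). destruct (dominated_ex _ _ HK (e / 2)%R) as (T1 & HT1 & L1); [lra|].
  destruct (ray_diff (RtoC w0) (- (1)) z v) with (e := (e / 2)%R) as (T2 & HT2 & L2); auto; try lra.
  { simpl. lra. } { unfold Re; simpl. fold (Re p) (Im p). lra. }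
  exists (Rmax T1 T2). split. { eapply Rle_trans; [apply HT1|apply Rmax_l]. }
  intros T HT. pose proof (Rmax_l T1 T2). pose proof (Rmax_r T1 T2).
  specialize (L1 T ltac:(lra)). destruct (L2 T ltac:(lra)) as (I1 & I2 & L2'). split; auto.
  assert (E : CInt NF 0 T = Q (RtoC w0 + RtoC T * - (1))).
  { pose proof (line_int H w0 lapf Ho Hd Hw0 lapf_hol (RtoC w0) (- (1)) T ltac:(lra)) as LI.
    fold Q in LI. unfold Q in LI at 2. rewrite primQ_w0 in LI.
    transitivity (Q (RtoC w0 + RtoC T * - (1)) - 0); [|ring]. rewrite <- LI.
    - apply CInt_ext. intros t. rewrite Rmin_left, Rmax_right by lra. intros Ht. unfold NF, Fint, lapf, ncur, ndcur.
      rewrite Rabs_pos_eq by lra. replace (RtoC w0 + RtoC t * - (1)) with (RtoC (w0 - t)) by (rewrite RtoC_minus; ring). ring.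
    - intros t Ht. replace (RtoC w0 + RtoC t * - (1)) with (ncur t). apply ncur_in. unfold ncur. rewrite Rabs_pos_eq by lra. rewrite RtoC_minus. ring. }
  rewrite E in L1.
  pose proof (Cmod_triangle_sub (Q (z + RtoC T * v)) (Q (RtoC w0 + RtoC T * - (1))) (Lap ncur ndcur q p)). unfold Lap in *. fold NF in *. lra.
Qed.

Lemma ray_lim_unique (z v l m : C) : ray_lim H Q z v l -> ray_lim H Q z v m -> l = m.
Proof.
  intros H1 H2. apply C_small_eq. intros e He.
  destruct (H1 (e / 2)%R) as (T1 & _ & L1); [lra|]. destruct (H2 (e / 2)%R) as (T2 & _ & L2); [lra|].
  destruct (L1 _ (Rmax_l T1 T2)) as [_ K1]. destruct (L2 _ (Rmax_r T1 T2)) as [_ K2].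
  rewrite Cmod_sub_sym in K1.
  pose proof (Cmod_triangle_sub l (Q (z + RtoC (Rmax T1 T2) * v)) m). lra.
Qed.

End OneP.

Definition LT (q : C -> C) (p : C) : C :=
  if Rlt_dec (Re p) 0 then Lap (ncur) ndcur q p else if Rlt_dec (Im p) 0 then CL w0 k sl 1 q p else CL w0 k sl (-1) q p.

Lemma slit_cases p : slit p -> (Re p < 0)%R \/ exists s : R, (s * s = 1)%R /\ (s * Im p < 0)%R.
Proof.
  intros Hp. destruct (Rlt_dec (Re p) 0); [now left|right].
  destruct (Rtotal_order (Im p) 0) as [L|[E|L]].
  - exists 1%R. lra.
  - exfalso. apply Hp. split; auto. lra.
  - exists (-1)%R. lra.
Qed.

Section LTprop.
Variables (q : C -> C) (M : R).
Hypothesis Hq : hol H q.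
Hypothesis HM : forall z, H z -> (Cmod (q z) <= M)%R.

Lemma LT_neg p : (Re p < 0)%R -> LT q p = Lap ncur ndcur q p.
Proof. intros Hp. unfold LT. destruct Rlt_dec; auto. lra. Qed.

(** Where the descriptions overlap, both are the limit of one and the same primitive along the ray
    from w0 in direction -1, and such a limit is unique. *)
Lemma LT_curve s p : (s * s = 1)%R -> (s * Im p < 0)%R -> LT q p = CL w0 k sl s q p.
Proof.
  intros Hs Hp. unfold LT. destruct Rlt_dec as [N|N].
  - apply (ray_lim_unique q p (RtoC w0) (- (1))).
    + apply (ray_lim_neg q M); auto; unfold Re; simpl; fold (Re p) (Im p); lra.
    + apply (ray_lim_curve q M); auto; unfold Re; simpl; fold (Re p) (Im p); lra.
  - assert (Cs : (s = 1 \/ s = -1)%R) by (assert ((s - 1) * (s + 1) = 0)%R by lra; apply Rmult_integral in H0; lra).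
    destruct Rlt_dec, Cs as [-> | ->]; auto; lra.
Qed.

Lemma LT_ray p z v : slit p -> (Re v < 0)%R -> (0 < Re (p * v))%R -> ray_lim H (primQ w0 (lapf q p)) z v (LT q p).
Proof.
  intros Hp Hv Hpv. destruct (slit_cases p Hp) as [N|(s & Hs & N)].
  - rewrite LT_neg by auto. now apply (ray_lim_neg q M).
  - rewrite (LT_curve s) by auto. now apply (ray_lim_curve q M).
Qed.
End LTprop.

End Cauchy.

(** * Iterated primitives and their boundary values *)

Definition relcont (cl : C -> Prop) (q : C -> C) : Prop :=
  forall z, cl z -> forall e, (0 < e)%R -> exists d, (0 < d)%R /\
  forall z', cl z' -> (Cmod (z' - z) < d)%R -> (Cmod (q z' - q z) < e)%R.

Lemma relcont_mult cl f g : relcont cl f -> relcont cl g -> relcont cl (fun z => f z * g z).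
Proof.
  intros H1 H2 z Hz e He.
  pose (A := (Cmod (f z) + Cmod (g z) + 1)%R).
  assert (HA : (1 <= A)%R) by (unfold A; generalize (Cmod_ge_0 (f z)) (Cmod_ge_0 (g z)); lra).
  pose (r := Rmin 1 (e / (2 * A))).
  assert (Hr : (0 < r)%R) by (apply Rmin_glb_lt; [lra|apply Rdiv_lt_0_compat; lra]).
  destruct (H1 z Hz r Hr) as (d1 & Hd1 & K1). destruct (H2 z Hz r Hr) as (d2 & Hd2 & K2).
  exists (Rmin d1 d2). split; [now apply Rmin_glb_lt|]. intros t' Hcl Ht'.
  specialize (K1 t' Hcl (Rlt_le_trans _ _ _ Ht' (Rmin_l _ _))).
  specialize (K2 t' Hcl (Rlt_le_trans _ _ _ Ht' (Rmin_r _ _))).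
  replace (f t' * g t' - f z * g z)
    with ((f t' - f z) * (g t' - g z) + (f t' - f z) * g z + f z * (g t' - g z)) by ring.
  eapply Rle_lt_trans; [apply Cmod_triangle|].
  eapply Rle_lt_trans; [apply Rplus_le_compat_r, Cmod_triangle|].
  rewrite !Cmod_mult.
  assert (R1 : (r <= 1)%R) by apply Rmin_l.
  assert (R2 : (r * (2 * A) <= e)%R).
  { eapply Rle_trans; [apply Rmult_le_compat_r; [lra|apply Rmin_r]|]. right. field. lra. }
  generalize (Cmod_ge_0 (f z)) (Cmod_ge_0 (g z)) (Cmod_ge_0 (f t' - f z)) (Cmod_ge_0 (g t' - g z)).
  intros. unfold A in *.
  assert (Cmod (f t' - f z) * Cmod (g t' - g z) <= r * 1)%R by (apply Rmult_le_compat; lra).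
  assert (Cmod (f t' - f z) * Cmod (g z) <= r * Cmod (g z))%R by (apply Rmult_le_compat_r; lra).
  assert (Cmod (f z) * Cmod (g t' - g z) <= Cmod (f z) * r)%R by (apply Rmult_le_compat_l; lra).
  nra.
Qed.

Lemma E0_hol H g : E0 H g -> hol H g.
Proof. intros (H1 & _) z Hz. destruct (H1 z Hz) as [l Hl]. exists l. now apply deriv_CC_is_derive. Qed.

(** The hypothesis on g controls limits along H only. Two points of the closure are compared through
    a point of H so close to the second one that g hardly differs there. *)
Lemma E0_relcont H g : E0 H g -> relcont (closureC H) g.
Proof.
  intros (_ & _ & H3) z Hz e He.
  assert (K : forall z, closureC H z -> forall e, (0 < e)%R -> exists d, (0 < d)%R /\
    forall z', H z' -> (Cmod (z' - z) < d)%R -> (Cmod (g z' - g z) < e)%R).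
  { intros y Hy e' He'. specialize (H3 y Hy (fun w => (Cmod (w - g y) < e')%R)).
    destruct (proj1 (locally_C_iff y (fun x => H x -> (Cmod (g x - g y) < e')%R))) as (d & Hd & K).
    - apply H3. apply locally_C_iff. now exists e'.
    - exists d. split; auto. }
  destruct (K z Hz (e / 2)%R) as (d & Hd & L); [lra|]. exists (d / 2)%R. split; [lra|].
  intros z' Hz' Hlt. destruct (K z' Hz' (e / 2)%R) as (d' & Hd' & L'); [lra|].
  rewrite closureC_iff in Hz'. destruct (Hz' (Rmin d' (d / 2))) as (y & Hy & HHy); [apply Rmin_glb_lt; lra|].
  specialize (L' y HHy (Rlt_le_trans _ _ _ Hy (Rmin_l _ _))).
  assert (Hyz : (Cmod (y - z) < d)%R).
  { pose proof (Cmod_triangle_sub y z' z). pose proof (Rlt_le_trans _ _ _ Hy (Rmin_r _ _)). lra. }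
  specialize (L y HHy Hyz). rewrite Cmod_sub_sym in L'. pose proof (Cmod_triangle_sub (g z') (g y) (g z)). lra.
Qed.

Lemma slit_left p t : slit p -> (0 <= t)%R -> slit (p + RtoC t * - (1)).
Proof.
  intros Hp Ht [E1 E2]. apply Hp. unfold Re, Im in *; simpl in *. lra.
Qed.

(** The difference of two primitives is constant on a horizontal half-line going left, which never
    meets the cut, and it tends to 0 there. *)
Lemma prim_unique h f1 f2 : is_prim_minfty h f1 -> is_prim_minfty h f2 -> forall p, slit p -> f1 p = f2 p.
Proof.
  intros [D1 L1] [D2 L2] p Hp. apply C_small_eq. intros e He.
  destruct (L1 (e / 2)%R) as (A1 & K1); [lra|]. destruct (L2 (e / 2)%R) as (A2 & K2); [lra|].
  set (T := (Rabs (Re p) + Rabs A1 + Rabs A2 + 1)%R).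
  pose proof (Rabs_pos (Re p)). pose proof (Rabs_pos A1). pose proof (Rabs_pos A2).
  pose proof (Rle_abs (Re p)). pose proof (Rle_abs (- A1)). pose proof (Rle_abs (- A2)). rewrite Rabs_Ropp in *.
  assert (HT : (0 <= T)%R) by (unfold T; lra).
  set (c := fun t => p + RtoC t * - (1)).
  pose proof (mvt_RC (fun t => f1 (c t) + - (1) * f2 (c t)) (fun t => - (1) * h (c t) + - (1) * (- (1) * h (c t))) 0 T 0 HT) as M.
  cbv beta in M. assert (c0 : c 0%R = p) by (unfold c; ring).
  assert (M' : (Cmod (f1 (c T) + - (1) * f2 (c T) - (f1 (c 0%R) + - (1) * f2 (c 0%R))) <= 0 * (T - 0))%R).
  { apply M.
    - intros t Ht. apply deriv_RC_plus.
      + apply (deriv_RC_comp f1 c); [apply deriv_RC_id_mult|]. apply deriv_CC_is_derive, D1. apply slit_left; tauto.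
      + apply deriv_RC_scal. apply (deriv_RC_comp f2 c); [apply deriv_RC_id_mult|]. apply deriv_CC_is_derive, D2. apply slit_left; tauto.
    - intros t Ht. match goal with |- (Cmod ?X <= _)%R => replace X with (RtoC 0) by ring end. rewrite Cmod_0. lra. }
  rewrite c0 in M'.
  assert (S1 : slit (c T)) by (apply slit_left; auto).
  assert (RT : Re (c T) = (Re p - T)%R) by (unfold c, Re; simpl; ring).
  specialize (K1 _ S1 ltac:(rewrite RT; unfold T; lra)). specialize (K2 _ S1 ltac:(rewrite RT; unfold T; lra)).
  replace (f1 p - f2 p) with ((f1 (c T) - f2 (c T)) - (f1 (c T) + - (1) * f2 (c T) - (f1 p + - (1) * f2 p))) by ring.
  unfold Cminus at 1. eapply Rle_trans; [apply Cmod_triangle|]. rewrite Cmod_opp.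
  pose proof (Cmod_triangle (f1 (c T)) (- f2 (c T))). rewrite Cmod_opp in *. unfold Cminus in *. lra.
Qed.

Lemma prim_spec h f : is_prim_minfty h f -> is_prim_minfty h (prim h).
Proof. intros Hf. unfold prim. apply epsilon_spec. now exists f. Qed.

Lemma is_prim_ext h h' f : (forall p, slit p -> h p = h' p) -> is_prim_minfty h f -> is_prim_minfty h' f.
Proof. intros E [D L]. split; auto. intros p Hp. rewrite <- E by auto. auto. Qed.

Lemma hol_inv_sub (H : C -> Prop) (b : C) : (forall z, H z -> (1 <= Cmod (z - b))%R) -> hol H (fun z => / (z - b)).
Proof.
  intros Hb z Hz. specialize (Hb z Hz). set (u := z - b) in *.
  assert (Hu : u <> 0) by (apply Cmod_gt_0; lra).
  exists (- / (u * u)). apply (quad_deriv_CC _ _ _ (1/2) 2); [lra|]. intros h Hh.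
  replace (z + h - b) with (u + h) by (unfold u; ring). fold u.
  assert (Huh : (1 / 2 <= Cmod (u + h))%R).
  { pose proof (Cmod_triangle_rev u (- h)). rewrite Cmod_opp in H0. replace (u - - h) with (u + h) in H0 by ring. lra. }
  assert (Hn2 : u + h <> 0) by (apply Cmod_gt_0; lra).
  replace (/ (u + h) - / u - h * - / (u * u)) with ((h * h) * / (u * u * (u + h))) by (field; auto).
  rewrite Cmod_mult, Cmod_mult, Cmod_inv, !Cmod_mult by (repeat apply Cmult_neq_0; auto).
  rewrite <- Rsqr_pow2. unfold Rsqr. rewrite Rmult_comm. apply Rmult_le_compat_r. { apply Rle_0_sqr. }
  replace 2%R with (/ (1 / 2))%R by field. apply Rinv_le_contravar; [lra|].
  apply Rle_trans with (1 * 1 * (1 / 2))%R; [lra|]. repeat apply Rmult_le_compat; lra.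
Qed.

(** * The Laplace transform and its primitives as branch integrals *)

Section Main.
Variables (H : C -> Prop) (w0 k sl : R) (g : C -> C) (M : R).
Hypothesis Hk : (0 < k)%R.
Hypothesis HS : (1 <= sl)%R.
Hypothesis HN : nbhd_minfty H.
Hypothesis HL : forall w, H w -> (Re w <= -1)%R.
Hypothesis Hw0 : H (RtoC w0).
Hypothesis HC : forall eta : R, H (Xc w0 k sl eta, eta).
Hypothesis Hg : E0 H g.
Hypothesis HM : forall z, H z -> (Cmod (g z) <= M)%R.

Let Ho : open_dom H := nbhd_open H HN.
Let Hd : down_dom H := nbhd_down H HN.
Let Hgh : hol H g := E0_hol H g Hg.

Lemma adm_ray p : slit p -> exists (x0 : R) (v : C), (Re v < 0)%R /\ (0 < Re (p * v))%R /\ forall t, (0 <= t)%R -> H (RtoC x0 + RtoC t * v).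
Proof.
  intros Hp. destruct (slit_cases p Hp) as [N|(s & Hs & N)].
  - exists w0, (- (1)). split; [simpl; lra|]. split; [unfold Re; simpl; fold (Re p) (Im p); lra|].
    intros t Ht. replace (RtoC w0 + RtoC t * - (1)) with ((w0 - t)%R, 0%R).
    2: { apply injective_projections; simpl; ring. }
    apply (Hd w0 0%R); [exact Hw0|lra|lra].
  - destruct (curve_ray H w0 k sl Hk HS Ho Hd HL Hw0 HC g M p Hgh HM s Hs N) as (x0 & v & ? & ? & ? & _). now exists x0, v.
Qed.

Lemma is_laplace_LT p : slit p -> is_laplace H w0 g p (LT w0 k sl g p).
Proof.
  intros Hp. destruct (adm_ray p Hp) as (x0 & v & Hv & Hpv & Hin).
  set (f := lapf g p). set (Q := primQ w0 f).
  pose proof (lapf_hol H g p Hgh) as Hf. fold f in Hf.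
  pose proof (LT_ray H w0 k sl Hk HS Ho Hd HL Hw0 HC g M Hgh HM p (RtoC x0) v Hp Hv Hpv) as RL. fold f Q in RL.
  exists (RtoC x0), v, (LT w0 k sl g p - Q (RtoC x0)).
  split. { intros t Ht. apply closure_incl. auto. }
  split; auto. split; auto. split.
  - unfold is_ray_int. apply is_II_is_RInt_gen.
    + intros t Ht. apply ccont_mult; [apply ccont_const|]. apply (ccont_comp f (fun t => RtoC x0 + RtoC t * v)); [apply ccont_line|].
      apply (hol_cont H); auto.
    + intros e He. destruct (RL e He) as (T0 & HT0 & K). exists T0. split; auto. intros T HT.
      destruct (K T HT) as [_ K'].
      pose proof (line_int H w0 f Ho Hd Hw0 Hf (RtoC x0) v T ltac:(lra)) as LI.
      change (Cmod (CInt (fun t => v * f (RtoC x0 + RtoC t * v))%C 0 T - (LT w0 k sl g p - Q (RtoC x0))) < e)%R.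
      rewrite LI by (intros; apply Hin; lra). fold Q.
      match goal with |- (Cmod ?X < _)%R => replace X with (Q (RtoC x0 + RtoC T * v) - LT w0 k sl g p) by ring end. exact K'.
  - change (Re (RtoC x0)) with x0.
    assert (E2 : seg_int f (RtoC x0) (RtoC x0) = 0).
    { unfold seg_int. fold (CInt (fun t => (RtoC x0 - RtoC x0) * f (RtoC x0 + RtoC t * (RtoC x0 - RtoC x0))) 0 1).
      rewrite (CInt_ext _ (fun _ => 0)). rewrite CInt_const. ring. intros. ring. }
    assert (E1 : seg_int f (RtoC w0) (RtoC x0) = Q (RtoC x0)).
    { unfold seg_int. fold (CInt (fun t => (RtoC x0 - RtoC w0) * f (RtoC w0 + RtoC t * (RtoC x0 - RtoC w0))) 0 1).
      assert (Hx0 : H (RtoC x0)). { replace (RtoC x0) with (RtoC x0 + RtoC 0 * v) by ring. apply Hin; lra. }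
      rewrite (line_int H w0 f Ho Hd Hw0 Hf (RtoC w0) (RtoC x0 - RtoC w0) 1 Rle_0_1).
      - rewrite primQ_w0. unfold Q. replace (RtoC w0 + RtoC 1 * (RtoC x0 - RtoC w0)) with (RtoC x0) by ring. ring.
      - intros t Ht. replace (RtoC w0 + RtoC t * (RtoC x0 - RtoC w0)) with ((w0 + t * (x0 - w0))%R, 0%R).
        2: { apply injective_projections; simpl; ring. }
        destruct (Rle_dec w0 x0).
        + apply (Hd x0 0%R); [exact Hx0| |lra]. assert (t * (x0 - w0) <= 1 * (x0 - w0))%R by (apply Rmult_le_compat_r; lra). lra.
        + apply (Hd w0 0%R); [exact Hw0| |lra]. assert (0 <= t * (w0 - x0))%R by (apply Rmult_le_pos; lra). lra. }
    fold (lapf g p). change (LT w0 k sl g p = seg_int f (RtoC w0) (RtoC x0) + seg_int f (RtoC x0) (RtoC x0) + (LT w0 k sl g p - Q (RtoC x0))).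
    rewrite E1, E2. ring.
Qed.

(** For any admissible path, even one along the border, [laplace_path] identifies the truncated
    integral with the primitive at w1 + T v, whose limit [LT_ray] gives. Hence the choice made by
    [epsilon] in [laplace] has only one possible outcome. *)
Lemma is_laplace_unique p l : slit p -> is_laplace H w0 g p l -> l = LT w0 k sl g p.
Proof.
  intros Hp (w1 & v & l2 & Hcl & Hv & Hpv & Hint & ->).
  set (f := lapf g p). set (Q := primQ w0 f).
  pose proof (lapf_hol H g p Hgh) as Hf. fold f in Hf.
  pose proof (LT_ray H w0 k sl Hk HS Ho Hd HL Hw0 HC g M Hgh HM p w1 v Hp Hv Hpv) as RL. fold f Q in RL.
  apply is_RInt_gen_is_II in Hint.
  pose proof (closure_down H Hd) as Hcd.
  assert (Hw1 : closureC H w1). { replace w1 with (w1 + RtoC 0 * v) by ring. apply Hcl; lra. }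
  assert (Rf : relcont (closureC H) f).
  { apply relcont_mult; [now apply E0_relcont|]. intros z Hz e He. destruct (contCC_Cexp (- (p * z)) e He) as (d & Hdd & K).
    pose proof (Cmod_ge_0 p). exists (d / (Cmod p + 1))%R. split; [apply Rdiv_lt_0_compat; lra|]. intros z' _ Hz'. apply K.
    replace (- (p * z') - - (p * z)) with (- p * (z' - z)) by ring. rewrite Cmod_mult, Cmod_opp.
    apply (Rmult_lt_compat_r (Cmod p + 1)) in Hz'; [|lra]. replace (d / (Cmod p + 1) * (Cmod p + 1))%R with d in Hz' by (field; lra).
    pose proof (Cmod_ge_0 (z' - z)). nra. }
  destruct w1 as [x1 y1].
  apply C_small_eq. intros e He.
  destruct (RL (e / 2)%R) as (T1 & HT1 & L1); [lra|]. destruct (Hint (e / 2)%R) as (T2 & HT2 & L2); [lra|].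
  set (T := Rmax T1 T2). destruct (L1 T (Rmax_l _ _)) as [HHT L1']. specialize (L2 T (Rmax_r _ _)).
  assert (HT : (0 <= T)%R) by (eapply Rle_trans; [apply HT1|apply Rmax_l]).
  pose proof (laplace_path H w0 f Ho Hd Hw0 Hf (closureC H) (closure_incl H) (closure_shift H HN HL) Rf (x1, y1) v T HT (closure_incl H _ Hw0)) as LP.
  assert (Hx1 : closureC H (x1, 0%R)). { apply (Hcd x1 y1); [exact Hw1|lra|rewrite Rabs_R0; apply Rabs_pos]. }
  specialize (LP ltac:(intros t Ht; simpl Re; replace (RtoC w0 + RtoC t * (RtoC x1 - RtoC w0)) with ((w0 + t * (x1 - w0))%R, 0%R) by (apply injective_projections; simpl; ring);
     destruct (Rle_dec w0 x1); [apply (Hcd x1 0%R); [exact Hx1|nra|lra]|apply (Hcd w0 0%R); [apply closure_incl, Hw0|nra|lra]])).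
  specialize (LP ltac:(intros t Ht; simpl Re; replace (RtoC x1 + RtoC t * ((x1, y1) - RtoC x1)) with (x1, (t * y1)%R) by (apply injective_projections; simpl; ring);
     apply (Hcd x1 y1); [exact Hw1|lra|rewrite Rabs_mult, (Rabs_pos_eq t) by lra; pose proof (Rabs_pos y1); nra])).
  specialize (LP ltac:(intros t Ht; apply Hcl; lra) HHT).
  fold Q in LP.
  change (fun w => g w * Cexp (- (p * w))) with f.
  change (fun t => v * (g ((x1, y1) + RtoC t * v) * Cexp (- (p * ((x1, y1) + RtoC t * v))))) with (fun t => v * f ((x1, y1) + RtoC t * v)) in L2.
  set (s1 := seg_int f (RtoC w0) (RtoC (Re (x1, y1)))) in *. set (s2 := seg_int f (RtoC (Re (x1, y1))) (x1, y1)) in *.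
  set (I := CInt (fun t => v * f ((x1, y1) + RtoC t * v)) 0 T) in *.
  replace (s1 + s2 + l2 - LT w0 k sl g p) with ((s1 + s2 + I - LT w0 k sl g p) + - (I - l2)) by ring.
  rewrite LP. eapply Rle_trans; [apply Cmod_triangle|]. rewrite Cmod_opp. lra.
Qed.

Lemma laplace_LT p : slit p -> laplace H w0 g p = LT w0 k sl g p.
Proof.
  intros Hp. apply is_laplace_unique; auto. unfold laplace. apply epsilon_spec.
  exists (LT w0 k sl g p). now apply is_laplace_LT.
Qed.

(* Dividing by - z integrates the Laplace transform: the transform of gn n is I^n (L g). *)
Definition gn (n : nat) (w : C) : C := g w * (/ - w) ^ n.

Lemma H_mod_ge1 z : H z -> (1 <= Cmod z)%R.
Proof.
  intros Hz. apply HL in Hz. eapply Rle_trans; [|apply re_le_Cmod]. rewrite Rabs_left1; lra.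
Qed.

Lemma H_neq_0 z : H z -> z <> 0.
Proof. intros Hz. apply Cmod_gt_0. pose proof (H_mod_ge1 z Hz). lra. Qed.

Lemma inv_opp_mod z n : H z -> (Cmod ((/ - z) ^ n) = / Cmod z ^ n)%R.
Proof.
  intros Hz. pose proof (H_neq_0 z Hz).
  rewrite Cmod_pow, Cmod_inv, Cmod_opp, pow_inv; auto.
  intros E. apply H0. replace z with (- - z) by ring. rewrite E. ring.
Qed.

Lemma gn_bound n z : H z -> (Cmod (gn n z) <= M / Cmod z ^ n)%R.
Proof.
  intros Hz. unfold gn. rewrite Cmod_mult, inv_opp_mod by auto. apply Rmult_le_compat_r; auto.
  apply Rlt_le, Rinv_0_lt_compat, pow_lt. pose proof (H_mod_ge1 z Hz). lra.
Qed.

Lemma gn_bounded n z : H z -> (Cmod (gn n z) <= M)%R.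
Proof.
  intros Hz. eapply Rle_trans; [now apply gn_bound|]. pose proof (H_mod_ge1 z Hz) as H1.
  pose proof (pow_R1_Rle _ n H1). assert (0 <= M)%R by (eapply Rle_trans; [apply Cmod_ge_0|apply (HM z Hz)]).
  apply (Rmult_le_reg_r (Cmod z ^ n)); [lra|]. unfold Rdiv. rewrite Rmult_assoc, Rinv_l by lra. nra.
Qed.

Lemma hol_inv_opp : hol H (fun z => / - z).
Proof.
  intros z Hz. pose proof (H_mod_ge1 z Hz) as H1. destruct (hol_inv_sub H 0) with (z := z) as [l Hl]; auto.
  { intros y Hy. replace (y - 0) with y by ring. now apply H_mod_ge1. }
  exists (- (1) * l). refine (deriv_CC_ext_loc _ _ _ _ 1 Rlt_0_1 _ (deriv_CC_scal (- (1)) _ _ _ Hl)).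
  intros y Hy. assert (y <> 0). { apply Cmod_gt_0. pose proof (Cmod_triangle_rev z y) as T. rewrite Cmod_sub_sym in T. lra. }
  field. auto.
Qed.

Lemma hol_mult f1 f2 : hol H f1 -> hol H f2 -> hol H (fun z => f1 z * f2 z).
Proof.
  intros A B z Hz. destruct (A z Hz) as [l Hl]. destruct (B z Hz) as [m Hm]. eexists. apply deriv_CC_mult; eauto.
Qed.

Lemma hol_const (c : C) : hol H (fun _ => c).
Proof. intros z _. exists 0. apply deriv_CC_const. Qed.

Lemma hol_pow f1 n : hol H f1 -> hol H (fun z => f1 z ^ n).
Proof. intros A. induction n as [|n IH]; simpl; [apply hol_const|now apply hol_mult]. Qed.

Lemma gn_hol n : hol H (gn n).
Proof. apply hol_mult; auto. apply hol_pow, hol_inv_opp. Qed.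

Lemma gn_S n z : H z -> - z * gn (S n) z = gn n z.
Proof.
  intros Hz. unfold gn. simpl. pose proof (H_neq_0 z Hz) as Hn. field. intros E. apply Hn. replace z with (- - z) by ring. rewrite E. ring.
Qed.

Lemma Mpos : (0 <= M)%R.
Proof. eapply Rle_trans; [apply Cmod_ge_0|apply (HM _ Hw0)]. Qed.

(** The weight 1 + |z|^2 serves first and second order remainders alike. The exponential is shared
    out as e^(-at/2) for domination and two factors e^(-at/4) for the square. *)
Lemma neg_weight a : (0 < a)%R -> exists K, (0 <= K)%R /\ forall t, (0 <= t)%R -> ((1 + Cmod (ncur w0 t) ^ 2) * exp (- (a * t)) <= K * Dom t)%R.
Proof.
  intros Ha. destruct (exp_lin_dom (a / 2) ltac:(lra)) as (C1 & HC1 & K1).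
  set (B := (Rabs w0 + 2 / (a / 2))%R). assert (HB : (0 <= B)%R).
  { unfold B. pose proof (Rabs_pos w0). assert (0 < 2 / (a / 2))%R by (apply Rdiv_lt_0_compat; lra). lra. }
  exists ((1 + B * B) * C1)%R. split. { apply Rmult_le_pos; auto. nra. }
  intros t Ht.
  assert (E : (exp (- (a * t)) = exp (- (a / 2 * t)) * (/ exp (a / 4 * t) * / exp (a / 4 * t)))%R).
  { rewrite <- !exp_Ropp, <- !exp_plus. f_equal. field. }
  rewrite E. pose proof (exp_ineq1_le (a / 4 * t)) as I. assert (0 <= a / 4 * t)%R by (apply Rmult_le_pos; lra).
  set (X := exp (a / 4 * t)) in *.
  assert (HX : (1 <= X)%R) by lra.
  assert (HcX : (Cmod (ncur w0 t) <= B * X)%R).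
  { unfold ncur. rewrite Cmod_R. rewrite (Rabs_pos_eq t) by auto. eapply Rle_trans; [apply Rabs_triang|]. rewrite Rabs_Ropp, (Rabs_pos_eq t) by auto.
    unfold B. rewrite Rmult_plus_distr_r. pose proof (Rabs_pos w0). apply Rplus_le_compat; [nra|].
    assert (t = 2 / (a / 2) * (a / 4 * t))%R by (field; lra). rewrite H2 at 1. apply Rmult_le_compat_l; [|lra].
    apply Rlt_le, Rdiv_lt_0_compat; lra. }
  assert (Hc2 : (1 + Cmod (ncur w0 t) ^ 2 <= (1 + B * B) * (X * X))%R).
  { pose proof (Cmod_ge_0 (ncur w0 t)). assert (Cmod (ncur w0 t) ^ 2 <= (B * X) ^ 2)%R by (apply pow_incr; lra).
    assert (1 <= X * X)%R by nra. nra. }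
  specialize (K1 t Ht).
  assert (HXX : (X * X * (/ X * / X) = 1)%R) by (field; lra).
  assert (P : (0 <= / X * / X)%R) by (apply Rmult_le_pos; apply Rlt_le, Rinv_0_lt_compat; lra).
  pose proof (exp_pos (- (a / 2 * t))).
  apply Rle_trans with ((1 + B * B) * (X * X) * (exp (- (a / 2 * t)) * (/ X * / X)))%R.
  - apply Rmult_le_compat_r; auto. apply Rmult_le_pos; lra.
  - replace ((1 + B * B) * (X * X) * (exp (- (a / 2 * t)) * (/ X * / X)))%R with ((1 + B * B) * exp (- (a / 2 * t)) * (X * X * (/ X * / X)))%R by ring.
    rewrite HXX, Rmult_1_r, Rmult_assoc. apply Rmult_le_compat_l; auto. nra.
Qed.

Lemma Re_p_ncur p t : (0 <= t)%R -> (- Re (p * ncur w0 t) = Re p * - w0 + Re p * t)%R.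
Proof. intros Ht. unfold ncur. rewrite Rabs_pos_eq by auto. unfold Re; simpl. ring. Qed.

Section OneQ.
Variables (q : C -> C) (B : R).
Hypothesis Hq : hol H q.
Hypothesis HB : forall z, H z -> (Cmod (q z) <= B)%R.
Hypothesis HB' : forall z, H z -> (Cmod (- z * q z) <= B)%R.

Lemma hol_opp_id : hol H (fun z => - z * q z).
Proof.
  apply hol_mult; auto. intros z _. exists (- (1)). intros e He. exists 1%R. split; [lra|]. intros h _.
  match goal with |- (Cmod ?X <= _)%R => replace X with (RtoC 0) by ring end. rewrite Cmod_0.
  apply Rmult_le_pos; [lra|apply Cmod_ge_0].
Qed.

Lemma neg_deriv p : (Re p < 0)%R -> deriv_CC (Lap (ncur w0) ndcur q) p (Lap (ncur w0) ndcur (fun z => - z * q z) p).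
Proof.
  intros Hp. set (a := (- Re p / 2)%R). assert (Ha : (0 < a)%R) by (unfold a; lra).
  destruct (neg_weight a Ha) as (K & HK & W).
  pose proof (w0_le H w0 HL Hw0) as Hw. assert (HBp : (0 <= B)%R) by (eapply Rle_trans; [apply Cmod_ge_0|apply (HB _ Hw0)]).
  assert (Ee : forall p', (Re p' <= - a)%R -> forall t, (0 <= t)%R -> (exp (- Re (p' * ncur w0 t)) <= exp (- (a * t)))%R).
  { intros p' Hp' t Ht. rewrite Re_p_ncur by auto. apply exp_le. nra. }
  apply (quad_deriv_CC _ _ _ a (6 * (2 * (B * K)))); auto. intros h Hh.
  assert (R1 : (Re p <= - a)%R) by (unfold a; lra).
  assert (R2 : (Re (p + h) <= - a)%R).
  { change (Re (p + h)) with (Re p + Re h)%R. pose proof (re_le_Cmod h). pose proof (Rle_abs (Re h)). unfold a in *. lra. }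
  replace (Cmod h ^ 2)%R with (Cmod (p + h - p) ^ 2)%R by (rewrite Cadd_sub'; auto).
  replace h with (p + h - p) at 2 by ring.
  destruct (NF_dom H w0 Hd HL Hw0 q B p Hq HB Hp) as (K0 & D0).
  destruct (NF_dom H w0 Hd HL Hw0 q B (p + h) Hq HB ltac:(lra)) as (K1 & D1).
  destruct (NF_dom H w0 Hd HL Hw0 _ B p hol_opp_id HB' Hp) as (K2 & D2).
  apply (Lap_taylor (ncur w0) ndcur q p (p + h) K0 K1 K2); auto.
  intros t Ht. specialize (W t Ht). pose proof (Ee p R1 t Ht). pose proof (Ee _ R2 t Ht).
  pose proof (HB _ (ncur_in H w0 Hd Hw0 t)). pose proof (Cmod_ge_0 (q (ncur w0 t))).
  unfold ndcur. rewrite Cmod_opp, Cmod_1, Rmult_1_r.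
  pose proof (pow2_ge_0 (Cmod (ncur w0 t))). pose proof (exp_pos (- Re (p * ncur w0 t))). pose proof (exp_pos (- Re ((p + h) * ncur w0 t))).
  apply Rle_trans with (B * (Cmod (ncur w0 t) ^ 2) * (2 * exp (- (a * t))))%R.
  - apply Rmult_le_compat; try lra. apply Rmult_le_pos; lra. apply Rmult_le_compat_r; lra.
  - pose proof (exp_pos (- (a * t))).
    assert (Cmod (ncur w0 t) ^ 2 * exp (- (a * t)) <= K * Dom t)%R by lra.
    replace (2 * (B * K) * Dom t)%R with (2 * B * (K * Dom t))%R by ring.
    replace (B * Cmod (ncur w0 t) ^ 2 * (2 * exp (- (a * t))))%R with (2 * B * (Cmod (ncur w0 t) ^ 2 * exp (- (a * t))))%R by ring.
    apply Rmult_le_compat_l; lra.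
Qed.

Lemma LT_deriv p : slit p -> deriv_CC (LT w0 k sl q) p (LT w0 k sl (fun z => - z * q z) p).
Proof.
  intros Hp. destruct (slit_cases p Hp) as [N|(s & Hs & N)].
  - rewrite LT_neg by auto. apply (deriv_CC_ext_loc (Lap (ncur w0) ndcur q) _ _ _ (- Re p)); [lra| |now apply neg_deriv].
    intros z' Hz'. rewrite LT_neg; auto. pose proof (re_le_Cmod (z' - p)). change (Re (z' - p)) with (Re z' - Re p)%R in H0.
    pose proof (Rle_abs (Re z' - Re p)). lra.
  - rewrite (LT_curve H w0 k sl Hk HS Ho Hd HL Hw0 HC _ B hol_opp_id HB' s) by auto.
    apply (deriv_CC_ext_loc (CL w0 k sl s q) _ _ _ (- (s * Im p))); [lra| |].
    + intros z' Hz'. rewrite (LT_curve H w0 k sl Hk HS Ho Hd HL Hw0 HC q B Hq HB s); auto.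
      pose proof (Im_le_Cmod (z' - p)). change (Im (z' - p)) with (Im z' - Im p)%R in H0.
      pose proof (Rle_abs (s * (Im z' - Im p))). rewrite Rabs_mult, (sgn_abs s), Rmult_1_l in H1 by auto. lra.
    + apply (CL_deriv w0 k sl (w0_le H w0 HL Hw0) Hk HS s q B 0); auto.
      * now apply (H_cont_curve H).
      * eapply poly0; eauto.
Qed.

(** As the half-line lies in Re z <= -1, a factor e^(Re p) comes out of the integral; this is where
    the decay needed for a primitive vanishing at the far left is produced. *)
Lemma LT_small : forall e, (0 < e)%R -> exists A, forall p, slit p -> (Re p < A)%R -> (Cmod (LT w0 k sl q p) < e)%R.
Proof.
  intros e He. destruct (exp_lin_dom 1 Rlt_0_1) as (C1 & HC1 & K1).
  pose proof (w0_le H w0 HL Hw0) as Hw. assert (HBp : (0 <= B)%R) by (eapply Rle_trans; [apply Cmod_ge_0|apply (HB _ Hw0)]).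
  set (N := (6 * (B * C1))%R). assert (HNn : (0 <= N)%R) by (unfold N; assert (0 <= B * C1)%R by (apply Rmult_le_pos; auto); lra).
  exists (- (1 + N / e))%R. intros p _ Hp. assert (0 <= N / e)%R by (apply Rdiv_le_0_compat; lra).
  set (P := (- Re p)%R). assert (HP : (1 + N / e < P)%R) by (unfold P; lra).
  rewrite LT_neg by lra.
  apply Rle_lt_trans with (6 * (B * (exp (- P) * C1)))%R.
  - apply II_bound. apply Fint_dom; try (intros; apply ncur_cont); try (intros; apply ccont_const).
    + intros t _. apply (ccont_comp q (ncur w0)); [apply ncur_cont|]. apply (hol_cont H); auto. now apply ncur_in.
    + intros t Ht. unfold ndcur. rewrite Cmod_opp, Cmod_1, Rmult_1_r, Rmult_assoc.
      apply Rmult_le_compat; [apply Cmod_ge_0|apply Rlt_le, exp_pos|apply HB; now apply ncur_in|].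
      specialize (K1 t Ht). rewrite Rmult_1_l in K1.
      apply Rle_trans with (exp (- P) * exp (- t))%R.
      * rewrite <- exp_plus. apply exp_le. rewrite Re_p_ncur by auto. unfold P in *. nra.
      * rewrite Rmult_assoc. apply Rmult_le_compat_l; auto. apply Rlt_le, exp_pos.
  - replace (6 * (B * (exp (- P) * C1)))%R with (N * exp (- P))%R by (unfold N; ring).
    rewrite exp_Ropp. pose proof (exp_ineq1_le P).
    apply (Rmult_lt_reg_r (exp P)); [apply exp_pos|]. rewrite Rmult_assoc, Rinv_l, Rmult_1_r by (apply Rgt_not_eq, exp_pos).
    apply Rlt_le_trans with (e * (1 + P))%R; [|apply Rmult_le_compat_l; lra].
    assert (e * (N / e) = N)%R by (field; lra). nra.
Qed.
End OneQ.

Lemma LT_ext q q' p : hol H q -> (forall z, H z -> (Cmod (q z) <= M)%R) -> (forall z, H z -> q z = q' z) -> slit p -> LT w0 k sl q p = LT w0 k sl q' p.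
Proof.
  intros Hq HB E Hp. unfold LT. destruct Rlt_dec as [N|N].
  - destruct (NF_dom H w0 Hd HL Hw0 q M p Hq HB N) as (K & D). apply (Lap_ext _ _ _ _ _ _ D).
    intros. apply E. now apply ncur_in.
  - assert (C1 : forall s : R, (s * s = 1)%R -> (s * Im p < 0)%R -> CL w0 k sl s q p = CL w0 k sl s q' p).
    { intros s Hs N2. destruct (interior_dom1 w0 k sl (w0_le H w0 HL Hw0) Hk HS s q M 0 p Hs N2) as (K & D).
      - now apply (H_cont_curve H).
      - eapply poly0; eauto.
      - apply (Lap_ext _ _ _ _ _ _ D). intros. apply E. now apply cur_in. }
    destruct Rlt_dec; apply C1; try lra.
    assert (Im p <> 0%R). { intros E0. apply Hp. split; auto. lra. } lra.
Qed.

Lemma LT_gn_prim n : is_prim_minfty (LT w0 k sl (gn n)) (LT w0 k sl (gn (S n))).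
Proof.
  split.
  - intros p Hp. apply deriv_CC_is_derive.
    rewrite <- (LT_ext (fun z => - z * gn (S n) z) (gn n) p); auto.
    + apply (LT_deriv (gn (S n)) M); auto; [apply gn_hol|apply gn_bounded|].
      intros z Hz. rewrite gn_S by auto. now apply gn_bounded.
    + apply hol_opp_id, gn_hol.
    + intros z Hz. rewrite gn_S by auto. now apply gn_bounded.
    + intros z Hz. now apply gn_S.
  - apply (LT_small _ M); [apply gn_hol|apply gn_bounded].
Qed.

(** [prim] picks a function whose values are determined on the slit plane only. The induction
    therefore transports equality there, and the next primitive depends on nothing else. *)
Lemma prim_iter_LT n p : slit p -> prim_iter n (laplace H w0 g) p = LT w0 k sl (gn n) p.
Proof.
  revert p. induction n as [|n IH]; intros p Hp.
  - unfold prim_iter; simpl. rewrite laplace_LT by auto. apply LT_ext; auto.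
    intros z _. unfold gn. simpl. ring.
  - change (prim (prim_iter n (laplace H w0 g)) p = LT w0 k sl (gn (S n)) p).
    assert (P : is_prim_minfty (prim_iter n (laplace H w0 g)) (LT w0 k sl (gn (S n)))).
    { apply (is_prim_ext (LT w0 k sl (gn n))); [intros; symmetry; auto|apply LT_gn_prim]. }
    apply (prim_unique _ _ _ (prim_spec _ _ P) P p Hp).
Qed.

Definition half (s : R) (p : C) : Prop := (s * Im p < 0)%R.

Lemma half_lim_unique (s t : R) (F : C -> C) (l l' : C) : (s * s = 1)%R ->
  filterlim F (within (half s) (locally (RtoC t))) (locally l) ->
  filterlim F (within (half s) (locally (RtoC t))) (locally l') -> l = l'.
Proof.
  intros Hs H1 H2. apply C_small_eq. intros e He.
  assert (K : forall l, filterlim F (within (half s) (locally (RtoC t))) (locally l) -> exists d, (0 < d)%R /\ forall z, (Cmod (z - RtoC t) < d)%R -> half s z -> (Cmod (F z - l) < e / 2)%R).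
  { intros m Hm. apply (locally_C_iff (RtoC t) (fun z => half s z -> (Cmod (F z - m) < e / 2)%R)). apply (Hm (fun y => (Cmod (y - m) < e / 2)%R)).
    apply locally_C_iff. exists (e / 2)%R. split; [lra|auto]. }
  destruct (K l H1) as (d1 & D1 & K1). destruct (K l' H2) as (d2 & D2 & K2).
  set (d := (Rmin d1 d2 / 2)%R). assert (Hm : (0 < Rmin d1 d2)%R) by now apply Rmin_glb_lt.
  assert (Hd' : (0 < d)%R) by (unfold d; lra).
  pose (z := (t, (- s * d)%R) : C).
  assert (Hz : (Cmod (z - RtoC t) = d)%R).
  { unfold z. replace ((t, (- s * d)%R) - RtoC t) with (Ci * RtoC (- s * d)) by (apply injective_projections; simpl; ring).
    rewrite Cmod_mult, Cmod_Ci, Cmod_R, Rabs_mult, Rabs_Ropp, (sgn_abs s), (Rabs_pos_eq d) by (auto; lra). ring. }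
  assert (Hh : half s z). { unfold half, z; simpl. replace (s * (- s * d))%R with (- (s * s) * d)%R by ring. rewrite Hs. lra. }
  pose proof (Rmin_l d1 d2). pose proof (Rmin_r d1 d2).
  specialize (K1 z ltac:(rewrite Hz; unfold d; lra) Hh). specialize (K2 z ltac:(rewrite Hz; unfold d; lra) Hh).
  rewrite Cmod_sub_sym in K1. pose proof (Cmod_triangle_sub l (F z) l'). lra.
Qed.

Lemma gn_decay s n : (s * s = 1)%R -> decay_bound w0 k sl s (gn n) M n.
Proof. intros Hs. split; [apply Mpos|]. intros t _. apply gn_bound. now apply (cur_in H). Qed.

Lemma bv_lim s n t : (s * s = 1)%R -> (0 <= t)%R -> (k * t <= INR n - 5 / 2)%R ->
  filterlim (prim_iter n (laplace H w0 g)) (within (half s) (locally (RtoC t))) (locally (CL w0 k sl s (gn n) (RtoC t))).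
Proof.
  intros Hs Ht Hn.
  destruct n as [|m]. { exfalso. simpl in Hn. nra. }
  rewrite S_INR in Hn.
  (* The 5/2 is spent here: one power of decay for the Lipschitz estimate, 1/4 for the room 1/(4k)
     to the right of t, and 5/4 for integrability. *)
  destruct (CL_lip w0 k sl (w0_le H w0 HL Hw0) Hk HS s (gn (S m)) M m (t + / (4 * k)) Hs) as (K & HK).
  - apply (H_cont_curve H); auto. apply gn_hol.
  - now apply gn_decay.
  - assert (0 < / (4 * k))%R by (apply Rinv_0_lt_compat; lra). lra.
  - replace (k * (t + / (4 * k)))%R with (k * t + / 4)%R by (field; lra). lra.
  - assert (P : (0 < / (4 * k))%R) by (apply Rinv_0_lt_compat; lra).
    apply (filterlim_C_iff (within (half s) (locally (RtoC t)))). intros e He.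
    set (K' := (Rabs K + 1)%R). assert (HK' : (0 < K')%R) by (unfold K'; generalize (Rabs_pos K); lra).
    apply locally_C_iff. exists (Rmin (/ (4 * k)) (e / K')). split; [apply Rmin_glb_lt; auto; apply Rdiv_lt_0_compat; lra|].
    intros z Hz Hhz. unfold half in Hhz.
    assert (Sz : slit z). { intros [E _]. rewrite E in Hhz. lra. }
    rewrite prim_iter_LT by auto.
    rewrite (LT_curve H w0 k sl Hk HS Ho Hd HL Hw0 HC _ M (gn_hol _) (gn_bounded _) s) by auto.
    pose proof (Rlt_le_trans _ _ _ Hz (Rmin_l _ _)) as Z1. pose proof (Rlt_le_trans _ _ _ Hz (Rmin_r _ _)) as Z2.
    specialize (HK (RtoC t) z).
    eapply Rle_lt_trans; [apply HK|].
    + simpl. lra.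
    + pose proof (re_le_Cmod (z - RtoC t)). change (Re (z - RtoC t)) with (Re z - t)%R in H0. pose proof (Rle_abs (Re z - t)). lra.
    + simpl. lra.
    + lra.
    + apply (Rmult_lt_compat_l K') in Z2; auto. replace (K' * (e / K'))%R with e in Z2 by (field; lra).
      pose proof (Rle_abs K). pose proof (Cmod_ge_0 (z - RtoC t)). unfold K' in Z2. nra.
Qed.

Lemma within_ext_lim (D D' : C -> Prop) (F : C -> C) (z l : C) : (forall p, D p <-> D' p) ->
  filterlim F (within D (locally z)) (locally l) -> filterlim F (within D' (locally z)) (locally l).
Proof.
  intros E Hl P HP. specialize (Hl P HP). unfold filtermap, within in *.
  eapply filter_imp; [|exact Hl]. simpl. intros x Hx Dx. apply Hx. now apply E.
Qed.

Lemma phi_eq n t : (0 <= t)%R -> (k * t <= INR n - 5 / 2)%R ->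
  phi (laplace H w0 g) n t = CL w0 k sl 1 (gn n) (RtoC t) - CL w0 k sl (-1) (gn n) (RtoC t).
Proof.
  intros Ht Hn. unfold phi. destruct Rlt_dec; [lra|].
  assert (E1 : bv_below (prim_iter n (laplace H w0 g)) t = CL w0 k sl 1 (gn n) (RtoC t)).
  { pose proof (bv_lim 1 n t ltac:(lra) Ht Hn) as B.
    apply (within_ext_lim _ (fun p => (Im p < 0)%R)) in B. 2: { intros; unfold half; lra. }
    apply (half_lim_unique 1 t (prim_iter n (laplace H w0 g))); [lra| |].
    - apply (within_ext_lim (fun p => (Im p < 0)%R)). { intros; unfold half; lra. }
      unfold bv_below. apply epsilon_spec. eexists; exact B.
    - apply (within_ext_lim (fun p => (Im p < 0)%R)); auto. intros; unfold half; lra. }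
  assert (E2 : bv_above (prim_iter n (laplace H w0 g)) t = CL w0 k sl (-1) (gn n) (RtoC t)).
  { pose proof (bv_lim (-1) n t ltac:(lra) Ht Hn) as B.
    apply (within_ext_lim _ (fun p => (0 < Im p)%R)) in B. 2: { intros; unfold half; lra. }
    apply (half_lim_unique (-1) t (prim_iter n (laplace H w0 g))); [lra| |].
    - apply (within_ext_lim (fun p => (0 < Im p)%R)). { intros; unfold half; lra. }
      unfold bv_above. apply epsilon_spec. eexists; exact B.
    - apply (within_ext_lim (fun p => (0 < Im p)%R)); auto. intros; unfold half; lra. }
  now rewrite E1, E2.
Qed.

End Main.

(** * The jump of the branch integrals *)

Lemma Xc_mono w0 k sl (x y : R) : (0 < k)%R -> (Rabs x <= Rabs y)%R -> (Xc w0 k sl y <= Xc w0 k sl x)%R.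
Proof.
  intros Hk Hxy. unfold Xc.
  assert (x * x <= y * y)%R by (apply Rsqr_le_abs_1 in Hxy; exact Hxy).
  assert (0 <= sl * sl)%R by apply Rle_0_sqr. assert (0 <= x * x)%R by apply Rle_0_sqr.
  assert (ln (1 + sl * sl * (x * x)) <= ln (1 + sl * sl * (y * y)))%R.
  { apply ln_le. assert (0 <= sl * sl * (x * x))%R by (apply Rmult_le_pos; auto). lra.
    apply Rplus_le_compat_l, Rmult_le_compat_l; auto. }
  nra.
Qed.

Section GammaCauchy.
Variables (H : C -> Prop) (w0 k sl : R).
Hypothesis Hk : (0 < k)%R.
Hypothesis HS : (1 <= sl)%R.
Hypothesis HN : nbhd_minfty H.
Hypothesis HL : forall w, H w -> (Re w <= -1)%R.
Hypothesis Hw0 : H (RtoC w0).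
Hypothesis HC : forall eta : R, H (Xc w0 k sl eta, eta).

(** At height T the two branches are joined by horizontal segments to abscissa x0 - T and a vertical
    one between them. For real x <= 0 the exponential is at most 1 on H, so the integrand is
    O(T^(-2)) on a path of length O(T), and the difference of the branch integrals vanishes in the
    limit. *)
Lemma gamma_cauchy (q : C -> C) (C0 R0 M' x : R) : hol H q -> (x <= 0)%R -> (0 <= C0)%R ->
  (forall z, H z -> (R0 <= Cmod z)%R -> (Cmod (q z) <= C0 / Cmod z ^ 2)%R) ->
  (forall s : R, (s * s = 1)%R -> decay_bound w0 k sl s q M' 2) ->
  CL w0 k sl 1 q (RtoC x) = CL w0 k sl (-1) q (RtoC x).
Proof.
  intros Hq Hx HC0 Hdec Hdb.
  pose proof (nbhd_open H HN) as Ho. pose proof (nbhd_down H HN) as Hd.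
  pose proof (w0_le H w0 HL Hw0) as Hw.
  set (f := lapf q (RtoC x)). set (Q := primQ w0 f).
  pose proof (lapf_hol H q (RtoC x) Hq) as Hf. fold f in Hf.
  assert (Hfb : forall z, H z -> (R0 <= Cmod z)%R -> (Cmod (f z) <= C0 / Cmod z ^ 2)%R).
  { intros z Hz HR. unfold f, lapf. rewrite Cmod_mult, Cmod_Cexp. rewrite <- (Rmult_1_r (C0 / Cmod z ^ 2)).
    apply Rmult_le_compat; auto. apply Cmod_ge_0. apply Rlt_le, exp_pos.
    rewrite <- exp_0. apply exp_le. unfold Re; simpl. fold (Re z) (Im z). apply HL in Hz. nra. }
  destruct (wide w0 k sl Hk HS 1 Rlt_0_1) as (x0 & Hx0 & Wd).
  assert (Lim : forall s : R, (s * s = 1)%R -> forall e, (0 < e)%R -> exists T0, (0 <= T0)%R /\ forall T, (T0 <= T)%R -> (Cmod (Q (cur w0 k sl s T) - CL w0 k sl s q (RtoC x)) < e)%R).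
  { intros s Hs e He.
    pose proof (bdry_dom w0 k sl Hw Hk HS s q M' 2 (RtoC x) 0 Hs (H_cont_curve H w0 k sl HC s q Hs Hq) (Hdb s Hs) Hx (Rle_refl 0)) as D.
    specialize (D ltac:(simpl; lra) ltac:(simpl; lra)).
    destruct (dominated_ex _ _ D e He) as (T0 & HT0 & K). exists T0. split; auto. intros T HT.
    specialize (K T HT). rewrite (CF_int H w0 k sl Ho Hd Hw0 HC q (RtoC x) Hq s T Hs ltac:(lra)) in K. exact K. }
  apply C_small_eq. intros e He.
  destruct (Lim 1%R ltac:(lra) (e / 4)%R) as (T1 & HT1 & L1); [lra|].
  destruct (Lim (-1)%R ltac:(lra) (e / 4)%R) as (T2 & HT2 & L2); [lra|].
  set (N := (C0 * (2 * (1 + - x0) + 2))%R). assert (HNN : (0 <= N)%R) by (unfold N; apply Rmult_le_pos; lra).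
  set (T := (1 + T1 + T2 + Rabs R0 + 4 * N / e)%R).
  assert (HNe : (0 <= 4 * N / e)%R) by (apply Rdiv_le_0_compat; lra). pose proof (Rabs_pos R0). pose proof (Rle_abs R0).
  assert (HT : (1 <= T)%R) by (unfold T; lra).
  specialize (L1 T ltac:(unfold T; lra)). specialize (L2 T ltac:(unfold T; lra)).
  set (P := fun s : R => ((x0 - T)%R, (s * T)%R) : C).
  assert (WT : (x0 - T <= Xc w0 k sl T)%R). { specialize (Wd T). rewrite (Rabs_pos_eq T) in Wd by lra. lra. }
  assert (HTb : forall z, H z -> (T <= Cmod z)%R -> (Cmod (f z) <= C0 / (T * T))%R).
  { intros z Hz Hzt. eapply Rle_trans; [apply Hfb; auto; unfold T in *; lra|]. rewrite <- Rsqr_pow2. unfold Rsqr.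
    apply Rmult_le_compat_l; auto. apply Rinv_le_contravar; nra. }
  assert (Hor : forall s : R, (s * s = 1)%R -> (Cmod (Q (cur w0 k sl s T) - Q (P s)) <= (T + - x0) * (C0 / (T * T)))%R).
  { intros s Hs. set (L := (Xc w0 k sl T - (x0 - T))%R). pose proof (Xc_le w0 k sl Hk T).
    replace (cur w0 k sl s T) with (P s + RtoC L). 2: { unfold cur, P, L. apply injective_projections; simpl; ring. }
    assert (E : forall t, P s + RtoC t * RtoC L = ((x0 - T + t * L)%R, (s * T)%R)).
    { intros. unfold P. apply injective_projections; simpl; ring. }
    assert (Hin : forall t, (0 <= t <= 1)%R -> H (P s + RtoC t * RtoC L)).
    { intros t Ht. rewrite E. apply (left_in H w0 k sl Hd HC). rewrite (Xc_even w0 k sl s T Hs).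
      assert (0 <= L)%R by (unfold L; lra). assert (t * L <= 1 * L)%R by (apply Rmult_le_compat_r; lra). unfold L in *. lra. }
    eapply Rle_trans; [apply (primQ_variation H w0 f Ho Hd Hw0 Hf (P s) (RtoC L) (C0 / (T * T))); auto|].
    - intros t Ht. apply HTb; auto. rewrite E. eapply Rle_trans; [|apply Im_le_Cmod]. unfold Im; simpl.
      rewrite Rabs_mult, (sgn_abs s Hs), Rabs_pos_eq by lra. lra.
    - apply Rmult_le_compat_r. apply Rdiv_le_0_compat; nra. rewrite Cmod_R, Rabs_pos_eq; unfold L; lra. }
  assert (Ver : (Cmod (Q (P 1%R) - Q (P (-1)%R)) <= 2 * T * (C0 / (T * T)))%R).
  { replace (P 1%R) with (P (-1)%R + Ci * RtoC (2 * T)). 2: { unfold P. apply injective_projections; simpl; ring. }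
    assert (E : forall t, P (-1)%R + RtoC t * (Ci * RtoC (2 * T)) = ((x0 - T)%R, (- T + t * (2 * T))%R)).
    { intros. unfold P. apply injective_projections; simpl; ring. }
    assert (Hin : forall t, (0 <= t <= 1)%R -> H (P (-1)%R + RtoC t * (Ci * RtoC (2 * T)))).
    { intros t Ht. rewrite E. apply (left_in H w0 k sl Hd HC).
      eapply Rle_trans; [|apply (Xc_mono w0 k sl _ T Hk)]. auto. rewrite (Rabs_pos_eq T) by lra. apply Rabs_le. nra. }
    eapply Rle_trans; [apply (primQ_variation H w0 f Ho Hd Hw0 Hf (P (-1)%R) (Ci * RtoC (2 * T)) (C0 / (T * T))); auto|].
    - intros t Ht. apply HTb; auto. rewrite E. eapply Rle_trans; [|apply re_le_Cmod]. unfold Re; simpl. rewrite Rabs_left1; lra.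
    - rewrite Cmod_mult, Cmod_Ci, Cmod_R, Rabs_pos_eq by lra. lra. }
  assert (Fin : (2 * ((T + - x0) * (C0 / (T * T))) + 2 * T * (C0 / (T * T)) <= e / 4)%R).
  { apply Rle_trans with (N / T)%R.
    - unfold N. apply (Rmult_le_reg_r (T * T)); [nra|].
      replace ((2 * ((T + - x0) * (C0 / (T * T))) + 2 * T * (C0 / (T * T))) * (T * T))%R with (C0 * (2 * (T + - x0) + 2 * T))%R by (field; lra).
      replace (C0 * (2 * (1 + - x0) + 2) / T * (T * T))%R with (C0 * ((2 * (1 + - x0) + 2) * T))%R by (field; lra).
      apply Rmult_le_compat_l; auto. nra.
    - apply (Rmult_le_reg_r T); [lra|]. replace (N / T * T)%R with N by (field; lra).
      assert (4 * N / e <= T)%R by (unfold T; lra). apply (Rmult_le_compat_l (e / 4)) in H2; [|lra].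
      replace (e / 4 * (4 * N / e))%R with N in H2 by (field; lra). auto. }
  pose proof (Hor 1%R ltac:(lra)) as O1. pose proof (Hor (-1)%R ltac:(lra)) as O2.
  set (c1 := Q (cur w0 k sl 1 T)) in *. set (c2 := Q (cur w0 k sl (-1) T)) in *. set (p1 := Q (P 1%R)) in *. set (p2 := Q (P (-1)%R)) in *.
  set (l1 := CL w0 k sl 1 q (RtoC x)) in *. set (l2 := CL w0 k sl (-1) q (RtoC x)) in *.
  replace (l1 - l2) with ((- (c1 - l1)) + (c2 - l2) + ((c1 - p1) + (p1 - p2)) + (- (c2 - p2))) by ring.
  eapply Rle_trans; [apply Cmod_triangle4|]. rewrite !Cmod_opp.
  pose proof (Cmod_triangle (c1 - p1) (p1 - p2)). lra.
Qed.
End GammaCauchy.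

(** * The kernels with a pole at w *)

Section Series.
Variables (H : C -> Prop) (w0 k sl : R) (g : C -> C) (M : R).
Hypothesis Hk : (0 < k)%R.
Hypothesis HS : (1 <= sl)%R.
Hypothesis HN : nbhd_minfty H.
Hypothesis HL : forall w, H w -> (Re w <= -1)%R.
Hypothesis Hw0 : H (RtoC w0).
Hypothesis HC : forall eta : R, H (Xc w0 k sl eta, eta).
Hypothesis Hg : E0 H g.
Hypothesis HM : forall z, H z -> (Cmod (g z) <= M)%R.

Let Hw : (w0 <= -1)%R := w0_le H w0 HL Hw0.
Let Hgh : hol H g := E0_hol H g Hg.

Section FixW.
Variable w : C.
Hypothesis Wx : (Re w <= -2)%R.
Hypothesis Wstar : (Re w / 2 <= Xc w0 k sl (Rabs (Re w) + Rabs (Im w)))%R.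

(** Either the heights differ by |Re w| / 2, or the height on the curve is at most |Re w| + |Im w|;
    then [Wstar] places the curve to the right of Re w / 2, and the abscissas differ by |Re w| /
    2. *)
Lemma w_dist s eta : (s * s = 1)%R -> (- Re w / 2 <= Cmod (w - cur w0 k sl s eta))%R.
Proof.
  intros Hs. destruct (Rle_dec (- Re w / 2) (Rabs (Im (w - cur w0 k sl s eta)))) as [L|L].
  { eapply Rle_trans; [apply L|apply Im_le_Cmod]. }
  apply Rnot_le_lt in L. unfold Im, cur in L; simpl in L. fold (Im w) in L.
  assert (E : (Rabs eta <= Rabs (Re w) + Rabs (Im w))%R).
  { replace (Rabs eta) with (Rabs (s * eta)) by (rewrite Rabs_mult, (sgn_abs s Hs); ring).
    replace (s * eta)%R with (Im w + - (Im w + - (s * eta)))%R by ring. eapply Rle_trans; [apply Rabs_triang|]. rewrite Rabs_Ropp.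
    rewrite (Rabs_left1 (Re w)) by lra. lra. }
  assert (X1 : (Re w / 2 <= Xc w0 k sl eta)%R).
  { eapply Rle_trans; [apply Wstar|]. apply Xc_mono; auto. rewrite (Rabs_pos_eq (_ + _)); auto.
    pose proof (Rabs_pos (Re w)). pose proof (Rabs_pos (Im w)). lra. }
  eapply Rle_trans; [|apply re_le_Cmod]. unfold Re at 2, cur; simpl. fold (Re w).
  rewrite Rabs_left1; lra.
Qed.

Lemma w_dist1 s eta : (s * s = 1)%R -> (1 <= Cmod (w - cur w0 k sl s eta))%R.
Proof. intros Hs. pose proof (w_dist s eta Hs). lra. Qed.

Lemma w_neq s eta : (s * s = 1)%R -> w - cur w0 k sl s eta <> 0.
Proof. intros Hs. apply Cmod_gt_0. pose proof (w_dist1 s eta Hs). lra. Qed.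

Lemma w_mod1 : (1 <= Cmod w)%R.
Proof. eapply Rle_trans; [|apply re_le_Cmod]. rewrite Rabs_left1; lra. Qed.

Definition qm (m : nat) (z : C) : C := g z * (w * / z) ^ m * / (w - z).

Lemma qm_cont s m : (s * s = 1)%R -> curve_cont w0 k sl s (qm m).
Proof.
  intros Hs t Ht. unfold qm. apply ccont_mult; [apply ccont_mult|].
  - apply (H_cont_curve H); auto.
  - apply ccont_pow. apply ccont_mult; [apply ccont_const|]. apply ccont_inv; [apply cur_cont|]. now apply cur_neq_0.
  - apply ccont_inv; [|now apply w_neq]. apply ccont_minus; [apply ccont_const|apply cur_cont].
Qed.

Lemma M_pos' : (0 <= M)%R.
Proof. eapply Rle_trans; [apply Cmod_ge_0|apply (HM _ Hw0)]. Qed.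

Lemma qm_mod s m t : (s * s = 1)%R -> (Cmod (qm m (cur w0 k sl s t)) = Cmod (g (cur w0 k sl s t)) * (Cmod w ^ m / Cmod (cur w0 k sl s t) ^ m) / Cmod (w - cur w0 k sl s t))%R.
Proof.
  intros Hs. unfold qm. rewrite !Cmod_mult, Cmod_pow, Cmod_mult, !Cmod_inv; [|now apply w_neq|now apply cur_neq_0].
  rewrite Rpow_mult_distr, pow_inv. reflexivity.
Qed.

Lemma qm_decay s m : (s * s = 1)%R -> decay_bound w0 k sl s (qm m) (M * Cmod w ^ m) m.
Proof.
  intros Hs. pose proof M_pos'. pose proof w_mod1. assert (0 < Cmod w ^ m)%R by (apply pow_lt; lra).
  split; [apply Rmult_le_pos; lra|]. intros t Ht. rewrite qm_mod by auto.
  pose proof (cur_mod_ge1 w0 k sl Hw Hk s t Hs). assert (0 < Cmod (cur w0 k sl s t) ^ m)%R by (apply pow_lt; lra).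
  pose proof (w_dist1 s t Hs). pose proof (HM _ (cur_in H w0 k sl HC s t Hs)). pose proof (Cmod_ge_0 (g (cur w0 k sl s t))).
  set (U := (Cmod w ^ m / Cmod (cur w0 k sl s t) ^ m)%R).
  assert (HU : (0 < U)%R) by (apply Rdiv_lt_0_compat; lra).
  apply Rle_trans with (M * U / 1)%R; [|right; unfold U; field; lra].
  apply Rmult_le_compat; try (apply Rmult_le_pos; lra). apply Rlt_le, Rinv_0_lt_compat; lra.
  apply Rmult_le_compat_r; lra. apply Rinv_le_contravar; lra.
Qed.

(** The additional power comes from 1 / (w - z), at the price of a factor |w| + 1. It pays for
    differentiability in [Psi_deriv]; sizes are estimated with [qm_decay], where w enters as |w|^m
    alone. *)
Lemma qm_decay_S s m : (s * s = 1)%R -> decay_bound w0 k sl s (qm m) (M * Cmod w ^ m * (Cmod w + 1)) (S m).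
Proof.
  intros Hs. pose proof M_pos'. pose proof w_mod1. assert (0 < Cmod w ^ m)%R by (apply pow_lt; lra).
  split; [repeat apply Rmult_le_pos; lra|]. intros t Ht. rewrite qm_mod by auto.
  pose proof (cur_mod_ge1 w0 k sl Hw Hk s t Hs) as HC1. assert (0 < Cmod (cur w0 k sl s t) ^ m)%R by (apply pow_lt; lra).
  pose proof (w_dist1 s t Hs) as HD1. pose proof (HM _ (cur_in H w0 k sl HC s t Hs)). pose proof (Cmod_ge_0 (g (cur w0 k sl s t))).
  set (U := (Cmod w ^ m / Cmod (cur w0 k sl s t) ^ m)%R).
  assert (HU : (0 < U)%R) by (apply Rdiv_lt_0_compat; lra).
  assert (HD : (/ Cmod (w - cur w0 k sl s t) <= (Cmod w + 1) / Cmod (cur w0 k sl s t))%R).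
  { assert (HT : (Cmod (cur w0 k sl s t) <= (Cmod w + 1) * Cmod (w - cur w0 k sl s t))%R).
    { pose proof (Cmod_triangle_rev (cur w0 k sl s t) w) as T. rewrite Cmod_sub_sym in T. nra. }
    apply (Rmult_le_reg_r (Cmod (w - cur w0 k sl s t) * Cmod (cur w0 k sl s t))); [nra|].
    replace (/ Cmod (w - cur w0 k sl s t) * (Cmod (w - cur w0 k sl s t) * Cmod (cur w0 k sl s t)))%R with (Cmod (cur w0 k sl s t)) by (field; lra).
    replace ((Cmod w + 1) / Cmod (cur w0 k sl s t) * (Cmod (w - cur w0 k sl s t) * Cmod (cur w0 k sl s t)))%R with ((Cmod w + 1) * Cmod (w - cur w0 k sl s t))%R by (field; lra). auto. }
  apply Rle_trans with (M * U * ((Cmod w + 1) / Cmod (cur w0 k sl s t)))%R; [|right; unfold U; simpl; field; lra].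
  apply Rmult_le_compat; auto; try (apply Rmult_le_pos; lra). apply Rlt_le, Rinv_0_lt_compat; lra.
  apply Rmult_le_compat_r; lra.
Qed.

(* On the branch, d/dt (e^(t (w - z)) qm m) = (- w)^m e^(t (w - z)) gn m, so Psi is a primitive of the terms of the series. *)
Definition Psi (s : R) (m : nat) (t : R) : C := Cexp (RtoC t * w) * CL w0 k sl s (qm m) (RtoC t).

(** The source of convergence of the series: its right side shows how the exponential pays for
    |w|^m. The 12 is the mass 6 of [Dom] times the 2 of [exp_lam_dom]. *)
Lemma Psi_bound s m t : (s * s = 1)%R -> (0 <= t)%R -> (k * t <= INR m - 5 / 4)%R ->
  (Cmod (Psi s m t) <= 12 * M * (k * sl + 1) * (Cmod w ^ m * exp (t * (Re w + Rabs w0 + k * ln sl))))%R.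
Proof.
  intros Hs Ht Hm. unfold Psi. rewrite Cmod_mult, Cmod_Cexp, re_scal_l.
  assert (D : dominated (CF w0 k sl s (qm m) (RtoC t)) (M * Cmod w ^ m * (k * sl + 1) * (2 * exp (t * (Rabs w0 + k * ln sl))))).
  { apply (bdry_dom w0 k sl Hw Hk HS s (qm m) _ m (RtoC t) t Hs (qm_cont s m Hs) (qm_decay s m Hs)); auto; simpl; lra. }
  apply II_bound in D. unfold CL, Lap. unfold CF in D.
  apply Rle_trans with (exp (t * Re w) * (6 * (M * Cmod w ^ m * (k * sl + 1) * (2 * exp (t * (Rabs w0 + k * ln sl))))))%R.
  { apply Rmult_le_compat_l; auto. apply Rlt_le, exp_pos. }
  right. replace (t * (Re w + Rabs w0 + k * ln sl))%R with (t * Re w + t * (Rabs w0 + k * ln sl))%R by ring. rewrite exp_plus. ring.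
Qed.

Lemma Psi_deriv s n t : (s * s = 1)%R -> (3 <= n)%nat -> (k * t <= INR n - 5 / 2)%R ->
  deriv_RC (Psi s n) t (RtoC (-1) ^ n * w ^ n * Cexp (RtoC t * w) * CL w0 k sl s (gn g n) (RtoC t)).
Proof.
  intros Hs Hn Hm. destruct n as [|m]; [lia|].
  assert (HINR : (3 <= INR (S m))%R) by (apply le_INR in Hn; simpl INR at 1 in Hn; lra).
  rewrite S_INR in *.
  (* The boundary estimates want tau >= 0, but t may be negative, as in [jump_const]. *)
  set (tau := Rmax 0 (t + / (4 * k))). assert (P : (0 < / (4 * k))%R) by (apply Rinv_0_lt_compat; lra).
  assert (Htau : (0 <= tau)%R) by apply Rmax_l.
  assert (Hkt : (k * tau <= INR m - 5 / 4)%R).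
  { unfold tau. destruct (Rmax_cases 0 (t + / (4 * k))) as [E|E]; rewrite E; [lra|].
    replace (k * (t + / (4 * k)))%R with (k * t + / 4)%R by (field; lra). lra. }
  assert (Htt : (t < tau)%R). { apply Rlt_le_trans with (t + / (4 * k))%R; [lra|apply Rmax_r]. }
  pose proof (CL_deriv_real w0 k sl Hw Hk HS s (qm (S m)) _ m tau t Hs (qm_cont s _ Hs) (qm_decay_S s _ Hs) Htau Hkt Htt) as D.
  pose proof (deriv_RC_mult _ _ _ _ _ (deriv_Cexp_line w t) D) as D2.
  assert (Hkt' : (k * tau <= INR (S m) - 5 / 4)%R) by (rewrite S_INR; lra).
  assert (D1 : exists K, dominated (CF w0 k sl s (qm (S m)) (RtoC t)) K).
  { eexists. apply (bdry_dom w0 k sl Hw Hk HS s _ _ (S m) (RtoC t) tau Hs (qm_cont s _ Hs) (qm_decay s _ Hs)); auto; simpl; lra. }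
  assert (D1' : exists K, dominated (CF w0 k sl s (fun z => - z * qm (S m) z) (RtoC t)) K).
  { eexists. apply (bdry_dom w0 k sl Hw Hk HS s _ _ (S m) (RtoC t) tau Hs (curve_cont_opp_id _ _ _ _ _ (qm_cont s _ Hs))
      (decay_opp_id w0 k sl Hw Hk s _ _ _ Hs (qm_decay_S s _ Hs))); auto; simpl; lra. }
  destruct D1 as (K1 & D1). destruct D1' as (K2 & D1').
  assert (E : RtoC (-1) ^ (S m) * w ^ (S m) * Cexp (RtoC t * w) * CL w0 k sl s (gn g (S m)) (RtoC t)
    = w * Cexp (RtoC t * w) * CL w0 k sl s (qm (S m)) (RtoC t) + Cexp (RtoC t * w) * CL w0 k sl s (fun z => - z * qm (S m) z) (RtoC t)).
  { assert (E1 : RtoC (-1) ^ (S m) * w ^ (S m) * CL w0 k sl s (gn g (S m)) (RtoC t)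
      = w * CL w0 k sl s (qm (S m)) (RtoC t) + CL w0 k sl s (fun z => - z * qm (S m) z) (RtoC t)).
    { unfold CL. rewrite <- (Lap_scal _ _ w _ _ K1 D1).
      rewrite <- (Lap_plus _ _ (fun z => w * qm (S m) z) (fun z => - z * qm (S m) z) (RtoC t) (Cmod w * K1) K2); auto.
      2: { pose proof (dominated_scal w _ _ D1) as D3. destruct D3 as [D3 D4]. split.
           - intros u Hu. eapply ccont_ext; [|now apply D3]. intros v. unfold CF, Fint. ring.
           - intros u Hu. specialize (D4 u Hu). eapply Rle_trans; [|apply D4]. right. f_equal. unfold CF, Fint. ring. }
      assert (D5 : exists K, dominated (CF w0 k sl s (gn g (S m)) (RtoC t)) K).
      { eexists. apply (bdry_dom w0 k sl Hw Hk HS s _ M (S m) (RtoC t) tau Hs); auto; try (simpl; lra).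
        - apply (H_cont_curve H); auto. now apply gn_hol.
        - now apply (gn_decay H). }
      destruct D5 as (K5 & D5). rewrite <- (Lap_scal _ _ (RtoC (-1) ^ (S m) * w ^ (S m)) _ _ K5 D5).
      pose proof (dominated_scal (RtoC (-1) ^ (S m) * w ^ (S m)) _ _ D5) as D6.
      eapply (Lap_ext _ _ _ _ _ _).
      { instantiate (1 := (Cmod (RtoC (-1) ^ S m * w ^ S m) * K5)%R). destruct D6 as [D3 D4]. split.
           - intros u Hu. eapply ccont_ext; [|now apply D3]. intros v. unfold CF, Fint. ring.
           - intros u Hu. specialize (D4 u Hu). eapply Rle_trans; [|apply D4]. right. f_equal. unfold CF, Fint. ring. }
      intros u Hu. unfold gn, qm. set (z := cur w0 k sl s u).
      assert (Hz : z <> 0) by (now apply cur_neq_0). assert (Hzw : w - z <> 0) by (now apply w_neq).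
      assert (Ez : (RtoC (-1) ^ S m * w ^ S m * (/ - z) ^ S m = (w * / z) ^ S m)).
      { rewrite <- !Cpow_mult_l. f_equal. field. auto. }
      transitivity (g z * (RtoC (-1) ^ S m * w ^ S m * (/ - z) ^ S m)); [ring|].
      rewrite Ez. set (V := (w * / z) ^ S m). field. auto. }
    transitivity (Cexp (RtoC t * w) * (RtoC (-1) ^ (S m) * w ^ (S m) * CL w0 k sl s (gn g (S m)) (RtoC t))); [ring|].
    rewrite E1. ring. }
  rewrite E. exact D2.
Qed.

End FixW.
End Series.

(** * The telescoping series *)

Lemma hol_plus (H : C -> Prop) f1 f2 : hol H f1 -> hol H f2 -> hol H (fun z => f1 z + f2 z).
Proof.
  intros A B z Hz. destruct (A z Hz) as [l Hl]. destruct (B z Hz) as [m Hm]. eexists. apply deriv_CC_plus; eauto.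
Qed.

Lemma m1_sq n : RtoC (-1) ^ n * RtoC (-1) ^ n = 1.
Proof. rewrite <- Cpow_mult_l. replace (RtoC (-1) * RtoC (-1)) with (RtoC 1). apply Cpow_1_l. rewrite <- RtoC_mult. f_equal. ring. Qed.

Section Series.
Variables (H : C -> Prop) (w0 k sl : R) (g : C -> C) (M : R).
Hypothesis Hk : (0 < k)%R.
Hypothesis HS : (1 <= sl)%R.
Hypothesis HN : nbhd_minfty H.
Hypothesis HL : forall w, H w -> (Re w <= -1)%R.
Hypothesis Hw0 : H (RtoC w0).
Hypothesis HC : forall eta : R, H (Xc w0 k sl eta, eta).
Hypothesis Hg : E0 H g.
Hypothesis HM : forall z, H z -> (Cmod (g z) <= M)%R.

Let Hw : (w0 <= -1)%R := w0_le H w0 HL Hw0.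
Let Hgh : hol H g := E0_hol H g Hg.
Let HMp : (0 <= M)%R := Mpos H w0 g M Hw0 HM.

Lemma CL_gn_cont s m t : (s * s = 1)%R -> (3 <= m)%nat -> (k * t <= INR m - 5 / 2)%R -> ccont (fun t => CL w0 k sl s (gn g m) (RtoC t)) t.
Proof.
  intros Hs Hm Ht. destruct m as [|j]; [lia|].
  assert (HINR : (3 <= INR (S j))%R) by (apply le_INR in Hm; simpl INR at 1 in Hm; lra).
  rewrite S_INR in *. assert (P : (0 < / (4 * k))%R) by (apply Rinv_0_lt_compat; lra).
  set (tau := Rmax 0 (t + / (4 * k))).
  assert (Htau : (0 <= tau)%R) by apply Rmax_l.
  assert (Hkt : (k * tau <= INR j - 5 / 4)%R).
  { unfold tau. destruct (Rmax_cases 0 (t + / (4 * k))) as [E|E]; rewrite E; [lra|].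
    replace (k * (t + / (4 * k)))%R with (k * t + / 4)%R by (field; lra). lra. }
  assert (Htt : (t + / (4 * k) <= tau)%R) by apply Rmax_r.
  destruct (CL_lip w0 k sl Hw Hk HS s (gn g (S j)) M j tau Hs) as (K & HK); auto.
  { apply (H_cont_curve H); auto. now apply gn_hol. } { now apply (gn_decay H). }
  intros e He. set (K' := (Rabs K + 1)%R). assert (HK' : (0 < K')%R) by (unfold K'; generalize (Rabs_pos K); lra).
  exists (Rmin (/ (4 * k)) (e / K')). split; [apply Rmin_glb_lt; auto; apply Rdiv_lt_0_compat; lra|].
  intros t' Ht'. pose proof (Rlt_le_trans _ _ _ Ht' (Rmin_l _ _)) as Z1. pose proof (Rlt_le_trans _ _ _ Ht' (Rmin_r _ _)) as Z2.
  pose proof (Rle_abs (t' - t)).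
  eapply Rle_lt_trans; [apply HK; simpl; lra|]. rewrite <- RtoC_minus, Cmod_R.
  apply (Rmult_lt_compat_l K') in Z2; auto. replace (K' * (e / K'))%R with e in Z2 by (field; lra).
  pose proof (Rle_abs K). pose proof (Rabs_pos (t' - t)). unfold K' in Z2. nra.
Qed.

Section FixW.
Variable w : C.
Hypothesis Wx : (Re w <= -2)%R.
Hypothesis Wstar : (Re w / 2 <= Xc w0 k sl (Rabs (Re w) + Rabs (Im w)))%R.

Let Psiw := Psi w0 k sl g w.
Let qmw := qm g w.

Definition Psi_jump (m : nat) (t : R) : C := Psiw 1 m t - Psiw (-1) m t.

Lemma Psi_jump_int m a b : (3 <= m)%nat -> (0 <= a <= b)%R -> (k * b <= INR m - 5 / 2)%R ->
  is_CInt (fun t => phi (laplace H w0 g) m t * w ^ m * Cexp (w * RtoC t)) a b (RtoC (-1) ^ m * (Psi_jump m b - Psi_jump m a)).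
Proof.
  intros Hm Hab Hb.
  set (f := fun s t => RtoC (-1) ^ m * w ^ m * Cexp (RtoC t * w) * CL w0 k sl s (gn g m) (RtoC t)).
  assert (Kt : forall t, (a <= t <= b)%R -> (k * t <= INR m - 5 / 2)%R) by (intros; nra).
  assert (F : is_CInt (fun t => f 1%R t + - (1) * f (-1)%R t) a b (Psi_jump m b - Psi_jump m a)).
  { apply (CInt_FTC (Psi_jump m)); [lra| |].
    - intros t Ht. apply (deriv_RC_ext (fun t => Psiw 1 m t + - (1) * Psiw (-1) m t)). { intros; unfold Psi_jump; ring. }
      apply deriv_RC_plus; [|apply deriv_RC_scal]; apply (Psi_deriv H w0 k sl g M); auto; lra.
    - intros t Ht. assert (Cf : forall s : R, (s * s = 1)%R -> ccont (f s) t).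
      { intros s Hs. unfold f. apply ccont_mult; [apply ccont_mult; [apply ccont_const|]|now apply CL_gn_cont; auto].
        eapply deriv_RC_cont, deriv_Cexp_line. }
      apply ccont_plus; [apply Cf; lra|]. apply ccont_mult; [apply ccont_const|apply Cf; lra]. }
  eapply is_CInt_ext; [|apply (is_CInt_scal (RtoC (-1) ^ m)), F].
  intros t Ht. rewrite Rmin_left, Rmax_right in Ht by lra. cbv beta.
  rewrite (phi_eq H w0 k sl g M) by (auto; try lra; apply Kt; lra).
  unfold f. replace (w * RtoC t) with (RtoC t * w) by ring.
  match goal with |- _ = ?X => replace X with (RtoC (-1) ^ m * RtoC (-1) ^ m * X) end.
  2: { rewrite m1_sq. ring. }
  ring.
Qed.

Lemma tn_S j : tn k (S j) = ((2 * INR j + 1) * / (2 * k))%R.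
Proof. unfold tn. rewrite S_INR. field. lra. Qed.

Lemma k_tn_S j : (k * tn k (S j) = INR j + 1 / 2)%R.
Proof. rewrite tn_S. field. lra. Qed.

Lemma tn_S_pos j : (0 < tn k (S j))%R.
Proof. rewrite tn_S. apply Rmult_lt_0_compat. pose proof (pos_INR j). lra. apply Rinv_0_lt_compat; lra. Qed.

Lemma tn_S_mono j : (tn k (S j) <= tn k (S (S j)))%R.
Proof. rewrite !tn_S, S_INR. apply Rmult_le_compat_r; [apply Rlt_le, Rinv_0_lt_compat; lra|lra]. Qed.

Lemma INR_add3 n : INR (n + 3) = (INR n + 3)%R.
Proof. rewrite plus_INR. simpl. ring. Qed.

Lemma int_term_S j : int_term k (laplace H w0 g) (S j) w =
  Psi_jump (S j + 3) (tn k (S (S j))) - Psi_jump (S j + 3) (tn k (S j)).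
Proof.
  unfold int_term. pose proof (tn_S_pos j). pose proof (tn_S_mono j).
  assert (E := Psi_jump_int (S j + 3) (tn k (S j)) (tn k (S (S j))) ltac:(lia) ltac:(lra)
    ltac:(rewrite k_tn_S, INR_add3, S_INR; lra)).
  apply is_CInt_unique in E. unfold CInt in E. rewrite E. rewrite Cmult_assoc, m1_sq. ring.
Qed.

(** The first interval starts at t_0 = - 1/(2k) < 0. On its negative part [phi] is 0 by convention,
    so the telescoping begins at 0 and not at t_0. *)
Lemma int_term_0 : int_term k (laplace H w0 g) 0 w = Psi_jump 3 (tn k 1) - Psi_jump 3 0.
Proof.
  unfold int_term. pose proof (tn_S_pos 0).
  assert (E := Psi_jump_int 3 0 (tn k 1) ltac:(lia) ltac:(lra) ltac:(rewrite k_tn_S; simpl; lra)).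
  assert (N : (tn k 0 < 0)%R). { unfold tn. simpl. apply (Rmult_lt_reg_r k); auto. unfold Rdiv. rewrite Rmult_assoc, Rinv_l by lra. lra. }
  assert (E0 : is_CInt (fun t => phi (laplace H w0 g) 3 t * w ^ 3 * Cexp (w * RtoC t)) (tn k 0) 0 (RtoC (0 - tn k 0) * 0)).
  { apply is_CInt_ext with (fun _ => 0).
    - intros t Ht. rewrite Rmin_left, Rmax_right in Ht by lra. unfold phi. destruct Rlt_dec; [ring|lra].
    - rewrite <- CInt_const. apply CInt_correct. intros; apply ccont_const. }
  pose proof (is_CInt_unique _ _ _ _ (is_CInt_Chasles _ _ _ _ _ _ E0 E)) as E1. unfold CInt in E1.
  change (0 + 3)%nat with 3%nat. rewrite E1. rewrite Cmult_0_r, Cplus_0_l, Cmult_assoc, m1_sq. ring.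
Qed.

(** Because (w/z - 1) / (w - z) = 1/z, the pole at w cancels in the difference of consecutive
    kernels and a multiple of [gn] remains. *)
Lemma Psi_step s m t : (s * s = 1)%R -> (0 <= t)%R -> (k * t <= INR m - 5 / 4)%R ->
  Psiw s (S m) t - Psiw s m t = RtoC (-1) ^ (S m) * w ^ m * Cexp (RtoC t * w) * CL w0 k sl s (gn g (S m)) (RtoC t).
Proof.
  intros Hs Ht Hm. assert (Hm' : (k * t <= INR (S m) - 5 / 4)%R) by (rewrite S_INR; lra).
  assert (D1 : exists K, dominated (CF w0 k sl s (qmw (S m)) (RtoC t)) K).
  { eexists. apply (bdry_dom w0 k sl Hw Hk HS s _ _ (S m) (RtoC t) t Hs (qm_cont H w0 k sl g Hk HL Hw0 HC Hg w Wx Wstar s _ Hs)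
     (qm_decay H w0 k sl g M Hk HL Hw0 HC HM w Wx Wstar s _ Hs)); auto; simpl; lra. }
  assert (D2 : exists K, dominated (CF w0 k sl s (qmw m) (RtoC t)) K).
  { eexists. apply (bdry_dom w0 k sl Hw Hk HS s _ _ m (RtoC t) t Hs (qm_cont H w0 k sl g Hk HL Hw0 HC Hg w Wx Wstar s _ Hs)
     (qm_decay H w0 k sl g M Hk HL Hw0 HC HM w Wx Wstar s _ Hs)); auto; simpl; lra. }
  destruct D1 as (K1 & D1). destruct D2 as (K2 & D2).
  assert (D3 : exists K, dominated (CF w0 k sl s (gn g (S m)) (RtoC t)) K).
  { eexists. apply (bdry_dom w0 k sl Hw Hk HS s _ M (S m) (RtoC t) t Hs); auto; try (simpl; lra).
    apply (H_cont_curve H); auto. now apply gn_hol. now apply (gn_decay H). }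
  destruct D3 as (K3 & D3).
  assert (E : CL w0 k sl s (qmw (S m)) (RtoC t) - CL w0 k sl s (qmw m) (RtoC t) = RtoC (-1) ^ (S m) * w ^ m * CL w0 k sl s (gn g (S m)) (RtoC t)).
  { unfold CL, Lap.
    transitivity (II (fun u => CF w0 k sl s (qmw (S m)) (RtoC t) u + - (1) * CF w0 k sl s (qmw m) (RtoC t) u)).
    - rewrite (II_plus _ _ K1 (Cmod (- (1)) * K2)), (II_scal _ _ K2); auto; [unfold CF; ring|now apply dominated_scal].
    - transitivity (II (fun u => (RtoC (-1) ^ (S m) * w ^ m) * CF w0 k sl s (gn g (S m)) (RtoC t) u)); [|apply (II_scal _ _ K3); auto].
      apply (II_ext _ _ (K1 + Cmod (- (1)) * K2)). { apply dominated_plus; auto. now apply dominated_scal. }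
      intros u Hu. unfold CF, Fint. set (z := cur w0 k sl s u).
      assert (Hz : z <> 0) by (now apply cur_neq_0). assert (Hzw : w - z <> 0) by (now apply (w_neq w0 k sl Hk w Wx Wstar)).
      assert (E1 : qmw (S m) z + - (1) * qmw m z = RtoC (-1) ^ (S m) * w ^ m * gn g (S m) z).
      { unfold qmw, qm, gn.
        assert (Ez : RtoC (-1) ^ S m * w ^ m * (/ - z) ^ S m = (w * / z) ^ m * / z).
        { transitivity ((RtoC (-1) * (/ - z)) * ((RtoC (-1) * w * / - z) ^ m)).
          - rewrite !Cpow_mult_l. simpl. ring.
          - replace (RtoC (-1) * w * / - z) with (w * / z) by (field; auto). field. auto. }
        transitivity (g z * (RtoC (-1) ^ S m * w ^ m * (/ - z) ^ S m)); [|ring].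
        rewrite Ez. rewrite Cpow_S. set (V := (w * / z) ^ m). field. auto. }
      transitivity ((qmw (S m) z + - (1) * qmw m z) * dcur k sl s u * Cexp (- (RtoC t * z))); [ring|].
      rewrite E1. ring. }
  unfold Psiw, Psi. fold qmw.
  transitivity (Cexp (RtoC t * w) * (CL w0 k sl s (qmw (S m)) (RtoC t) - CL w0 k sl s (qmw m) (RtoC t))); [ring|].
  rewrite E. ring.
Qed.

Lemma jump_term_S j : jump_term k (laplace H w0 g) (S j) w =
  Psi_jump (j + 4) (tn k (S j)) - Psi_jump (j + 3) (tn k (S j)).
Proof.
  unfold jump_term. pose proof (tn_S_pos j) as Ht. pose proof (k_tn_S j) as Hkt.
  rewrite (phi_eq H w0 k sl g M); auto; [|lra|rewrite INR_add3, S_INR; lra].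
  assert (St : forall s : R, (s * s = 1)%R -> Psiw s (j + 4) (tn k (S j)) - Psiw s (j + 3) (tn k (S j)) =
    RtoC (-1) ^ (j + 4) * w ^ (j + 3) * Cexp (RtoC (tn k (S j)) * w) * CL w0 k sl s (gn g (j + 4)) (RtoC (tn k (S j)))).
  { intros s Hs. replace (j + 4)%nat with (S (j + 3)) by lia. apply Psi_step; auto; [lra|]. rewrite INR_add3. lra. }
  unfold Psi_jump. replace (S j + 3)%nat with (j + 4)%nat by lia. replace (S j + 2)%nat with (j + 3)%nat by lia.
  set (t := tn k (S j)) in *.
  transitivity ((Psiw 1 (j + 4) t - Psiw 1 (j + 3) t) - (Psiw (-1) (j + 4) t - Psiw (-1) (j + 3) t)); [|ring].
  rewrite !St by lra. replace (w * RtoC t) with (RtoC t * w) by ring. ring.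
Qed.

Definition step_ratio : R := exp ((Re w + Rabs w0 + k * ln sl) / (2 * k)).
Hypothesis WU : (Cmod w ^ 4 * step_ratio <= 1 / 2)%R.

Definition Psi_const : R := (12 * M * (k * sl + 1))%R.

Lemma Psi_const_pos : (0 <= Psi_const)%R.
Proof. unfold Psi_const. assert (0 <= M * (k * sl + 1))%R by (apply Rmult_le_pos; auto; nra). lra. Qed.

(** The exponential at this t is [step_ratio] to the power 2j + 1, and |w|^m <= |w|^(4 (2j + 1))
    since |w| >= 1 and m <= j + 4; at j = 0, m = 4 the exponent 4 is attained. The exponent S j
    rather than j leaves a factor 2 for the two branches. *)
Lemma Psi_tn_bound s m j : (s * s = 1)%R -> (j + 3 <= m <= j + 4)%nat -> (Cmod (Psiw s m (tn k (S j))) <= Psi_const * (1 / 2) ^ S j)%R.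
Proof.
  intros Hs Hm. pose proof (tn_S_pos j) as Ht. pose proof (k_tn_S j) as Hkt. pose proof Psi_const_pos as HCp.
  assert (HI : (INR j + 3 <= INR m)%R). { rewrite <- INR_add3. apply le_INR. lia. }
  eapply Rle_trans; [apply (Psi_bound H w0 k sl g M); auto; lra|]. fold Psi_const.
  apply Rmult_le_compat_l; auto.
  assert (E : exp (tn k (S j) * (Re w + Rabs w0 + k * ln sl)) = (step_ratio ^ (2 * j + 1))%R).
  { unfold step_ratio. rewrite <- exp_pow_nat. f_equal. rewrite tn_S, plus_INR, mult_INR. simpl. field. lra. }
  rewrite E. pose proof (w_mod1 w Wx) as HW1.
  assert (HU : (0 < step_ratio)%R) by apply exp_pos.
  apply Rle_trans with ((Cmod w ^ 4) ^ (2 * j + 1) * step_ratio ^ (2 * j + 1))%R.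
  - apply Rmult_le_compat_r; [apply pow_le; lra|]. rewrite <- pow_mult. apply Rle_pow; auto. lia.
  - rewrite <- Rpow_mult_distr.
    apply Rle_trans with ((1 / 2) ^ (2 * j + 1))%R.
    + apply pow_incr. split; auto. apply Rmult_le_pos; [apply pow_le; lra|lra].
    + replace (2 * j + 1)%nat with (S j + j)%nat by lia. rewrite pow_add.
      assert (0 < (1 / 2) ^ S j)%R by (apply pow_lt; lra).
      assert ((1 / 2) ^ j <= 1)%R. { pose proof (pow_incr (1 / 2) 1 j ltac:(lra)) as P1. rewrite pow1 in P1. exact P1. }
      nra.
Qed.

Lemma Psi_jump_tn_bound m j : (j + 3 <= m <= j + 4)%nat -> (Cmod (Psi_jump m (tn k (S j))) <= Psi_const * (1 / 2) ^ j)%R.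
Proof.
  intros Hm. unfold Psi_jump, Cminus. eapply Rle_trans; [apply Cmod_triangle|]. rewrite Cmod_opp.
  pose proof (Psi_tn_bound 1 m j ltac:(lra) Hm). pose proof (Psi_tn_bound (-1) m j ltac:(lra) Hm). simpl in *. lra.
Qed.

(* Since (w/z)^3 - 1 and - c/(z - w - c) - 1 both vanish at z = w, the kernel (w/z)^3/(z - w) differs
   from - poisson_kernel by a function holomorphic on H, whose two branch integrals agree. *)
Let c : R := (- (2 * Re w))%R.
Let b : C := w + RtoC c.

(** The point b is the mirror image of w in the imaginary axis. On that axis c / ((z - w) (z - b))
    is, up to sign, 2 |Re w| / ((Re w)^2 + (Im z - Im w)^2), the Poisson kernel of the half plane
    without its normalisation; its mass does not depend on w. *)
Definition poisson_kernel (z : C) : C := g z * (RtoC c * (/ (z - w) * / (z - b))).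
(** The quotient ((w/z)^3 - 1) / (z - w) is written out as a geometric sum, so that no pole at w is
    left; the pole b has positive real part and is away from H. The terms - 1/z and 1/(z - b) cancel
    to first order at infinity. *)
Definition q3_regular (z : C) : C := g z * (- (w * w * (/ (z - 0)) ^ 3 + w * (/ (z - 0)) ^ 2 + / (z - 0)) + / (z - b)).

Lemma zb_re z : (Re z <= -1)%R -> (Re (z - b) <= Re w)%R.
Proof. intros Hz. unfold b, c. change (Re z - (Re w + - (2 * Re w)) <= Re w)%R. lra. Qed.

Lemma zb_mod z : (Re z <= -1)%R -> (1 <= Cmod (z - b))%R.
Proof. intros Hz. pose proof (zb_re z Hz). eapply Rle_trans; [|apply re_le_Cmod]. rewrite Rabs_left1; lra. Qed.

Lemma q3_regular_hol : hol H q3_regular.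
Proof.
  apply hol_mult; auto.
  assert (I0 : hol H (fun z => / (z - 0))).
  { apply hol_inv_sub. intros z Hz. replace (z - 0) with z by ring. now apply (H_mod_ge1 H). }
  apply hol_plus.
  - assert (P : hol H (fun z => - (1) * (w * w * (/ (z - 0)) ^ 3 + w * (/ (z - 0)) ^ 2 + / (z - 0)))).
    { apply (hol_mult H (fun _ => - (1))); [apply hol_const|]. apply hol_plus; auto. apply hol_plus.
      - apply (hol_mult H (fun _ => w * w)); [apply hol_const|now apply (hol_pow H (fun z => / (z - 0)))].
      - apply (hol_mult H (fun _ => w)); [apply hol_const|now apply (hol_pow H (fun z => / (z - 0)))]. }
    intros z Hz. destruct (P z Hz) as [l Hl]. exists l. apply (deriv_CC_ext_loc _ _ z l 1 Rlt_0_1) with (2 := Hl). intros; ring.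
  - apply hol_inv_sub. intros z Hz. apply zb_mod. now apply HL.
Qed.

Lemma q3_split z : (Re z <= -1)%R -> z - w <> 0 -> q3_regular z = g z * ((w * / z) ^ 3 * / (z - w)) + poisson_kernel z.
Proof.
  intros Hz Hn. pose proof (zb_mod z Hz) as Hb.
  assert (Hb0 : z - b <> 0) by (apply Cmod_gt_0; lra).
  assert (Hz0 : z <> 0). { apply Cmod_gt_0. eapply Rlt_le_trans; [|apply re_le_Cmod]. rewrite Rabs_left1; lra. }
  assert (Eb : z - b = (z - w) - RtoC c) by (unfold b; ring).
  unfold q3_regular, poisson_kernel. replace (z - 0) with z by ring.
  rewrite Eb in *. field. repeat split; auto.
Qed.

Lemma c_pos : (4 <= c)%R.
Proof. unfold c. lra. Qed.

(** In the form given by [q3_split] both summands share the factor 1/(z - w), and what multiplies it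
    is O(1/|z|) by itself; together this is the quadratic decay that [gamma_cauchy] wants. *)
Lemma q3_regular_decay : exists C0 R0, (0 <= C0)%R /\ forall z, H z -> (R0 <= Cmod z)%R -> (Cmod (q3_regular z) <= C0 / Cmod z ^ 2)%R.
Proof.
  pose proof c_pos as Hc. pose proof (w_mod1 w Wx) as HW1.
  exists (M * (2 * Cmod w ^ 3 + 4 * c))%R, (2 * Cmod w + 2 * Cmod b)%R.
  assert (HW3 : (0 <= Cmod w ^ 3)%R) by (apply pow_le; lra).
  split. { apply Rmult_le_pos; auto. lra. }
  intros z Hz HR. pose proof (HL z Hz) as Hre. pose proof (H_mod_ge1 H HL z Hz) as Hz1. pose proof (Cmod_ge_0 b).
  assert (D1 : (Cmod z / 2 <= Cmod (z - w))%R). { pose proof (Cmod_triangle_rev z w). lra. }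
  assert (D2 : (Cmod z / 2 <= Cmod (z - b))%R). { pose proof (Cmod_triangle_rev z b). lra. }
  assert (N1 : z - w <> 0) by (apply Cmod_gt_0; lra). assert (N2 : z - b <> 0) by (apply Cmod_gt_0; lra).
  assert (N0 : z <> 0) by (apply Cmod_gt_0; lra).
  rewrite q3_split by auto. unfold poisson_kernel.
  replace (g z * ((w * / z) ^ 3 * / (z - w)) + g z * (RtoC c * (/ (z - w) * / (z - b)))) with (g z * (((w * / z) ^ 3 + RtoC c * / (z - b)) * / (z - w))) by ring.
  rewrite !Cmod_mult. unfold Rdiv. rewrite Rmult_assoc. apply Rmult_le_compat; [apply Cmod_ge_0|apply Rmult_le_pos; apply Cmod_ge_0|now apply HM|].
  rewrite (Cmod_inv (z - w)) by auto.
  assert (T1 : (Cmod ((w * / z) ^ 3 + RtoC c * / (z - b)) <= (Cmod w ^ 3 + 2 * c) / Cmod z)%R).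
  { eapply Rle_trans; [apply Cmod_triangle|]. rewrite Cmod_pow, !Cmod_mult, !Cmod_inv, Cmod_R, Rpow_mult_distr, Rabs_pos_eq by (auto; lra).
    unfold Rdiv. rewrite Rmult_plus_distr_r. apply Rplus_le_compat.
    - apply Rmult_le_compat_l; auto. rewrite pow_inv. apply Rinv_le_contravar; [lra|]. simpl. nra.
    - rewrite (Rmult_comm 2 c), Rmult_assoc. apply Rmult_le_compat_l; [lra|].
      apply Rle_trans with (/ (Cmod z / 2))%R; [apply Rinv_le_contravar; lra|right; field; lra]. }
  assert (T2 : (/ Cmod (z - w) <= 2 / Cmod z)%R).
  { apply Rle_trans with (/ (Cmod z / 2))%R; [apply Rinv_le_contravar; lra|right; field; lra]. }
  apply Rle_trans with ((Cmod w ^ 3 + 2 * c) / Cmod z * (2 / Cmod z))%R.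
  - apply Rmult_le_compat; auto. apply Cmod_ge_0. apply Rlt_le, Rinv_0_lt_compat; lra.
  - right. simpl. field. lra.
Qed.

Lemma poisson_decay s : (s * s = 1)%R -> decay_bound w0 k sl s poisson_kernel (M * (c * ((Cmod w + 1) * (Cmod b + 1)))) 2.
Proof.
  intros Hs. pose proof c_pos as Hc. pose proof (Cmod_ge_0 w). pose proof (Cmod_ge_0 b).
  split. { repeat apply Rmult_le_pos; auto; lra. }
  intros t Ht. unfold poisson_kernel. set (z := cur w0 k sl s t).
  assert (Hz : H z) by now apply cur_in.
  pose proof (H_mod_ge1 H HL z Hz) as Hz1. pose proof (zb_mod z (HL z Hz)) as Hb1.
  pose proof (w_dist1 w0 k sl Hk w Wx Wstar s t Hs) as Hd1. fold z in Hd1. rewrite Cmod_sub_sym in Hd1.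
  assert (N1 : z - w <> 0) by (apply Cmod_gt_0; lra). assert (N2 : z - b <> 0) by (apply Cmod_gt_0; lra).
  rewrite !Cmod_mult, !Cmod_inv, Cmod_R, (Rabs_pos_eq c) by (auto; lra).
  assert (Q : forall a : C, (1 <= Cmod (z - a))%R -> (/ Cmod (z - a) <= (Cmod a + 1) / Cmod z)%R).
  { intros a Ha. pose proof (Cmod_triangle_rev z a). pose proof (Cmod_ge_0 a).
    apply (Rmult_le_reg_r (Cmod (z - a) * Cmod z)); [nra|].
    replace (/ Cmod (z - a) * (Cmod (z - a) * Cmod z))%R with (Cmod z) by (field; lra).
    replace ((Cmod a + 1) / Cmod z * (Cmod (z - a) * Cmod z))%R with ((Cmod a + 1) * Cmod (z - a))%R by (field; lra). nra. }
  apply Rle_trans with (M * (c * ((Cmod w + 1) / Cmod z * ((Cmod b + 1) / Cmod z))))%R; [|right; simpl; field; lra].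
  apply Rmult_le_compat; [apply Cmod_ge_0| |now apply HM|].
  - apply Rmult_le_pos; [lra|]. apply Rmult_le_pos; apply Rlt_le, Rinv_0_lt_compat; lra.
  - apply Rmult_le_compat_l; [lra|]. apply Rmult_le_compat; try (apply Rlt_le, Rinv_0_lt_compat; lra); now apply Q.
Qed.

Lemma poisson_cont s : (s * s = 1)%R -> curve_cont w0 k sl s poisson_kernel.
Proof.
  intros Hs t Ht. unfold poisson_kernel. apply ccont_mult; [apply (H_cont_curve H); auto|].
  apply ccont_mult; [apply ccont_const|].
  assert (Hz : H (cur w0 k sl s t)) by now apply cur_in.
  apply ccont_mult; apply ccont_inv; try (apply ccont_minus; [apply cur_cont|apply ccont_const]).
  - pose proof (w_dist1 w0 k sl Hk w Wx Wstar s t Hs). rewrite Cmod_sub_sym in H0. apply Cmod_gt_0; lra.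
  - pose proof (zb_mod _ (HL _ Hz)). apply Cmod_gt_0; lra.
Qed.

(** The primitive is an arctangent, whose variation is at most PI <= 4 wherever w lies. *)
Lemma poisson_int s T : (s * s = 1)%R -> (0 <= T)%R ->
  exists I, is_RInt (fun t => (- Re w) / (Re w * Re w + (s * t - Im w) * (s * t - Im w)))%R 0 T I /\ (I <= 4)%R.
Proof.
  intros Hs HT. set (P := fun t => (s * atan ((s * t - Im w) / (- Re w)))%R).
  exists (P T - P 0%R)%R. split.
  - apply (is_RInt_derive (V := R_CompleteNormedModule) P (fun t => (- Re w) / (Re w * Re w + (s * t - Im w) * (s * t - Im w)))%R).
    + intros t _. unfold P. auto_derive; [lra|].
      assert (0 <= (s * t - Im w) * (s * t - Im w))%R by apply Rle_0_sqr.
      assert (0 < Re w * Re w)%R by nra.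
      set (v := (s * t - Im w)%R) in *. replace (s * t + - Im w)%R with v by (unfold v; ring).
      replace (s * (s * 1 * / - Re w * / (1 + v * / - Re w * (v * / - Re w * 1))))%R with ((s * s) * (/ - Re w * / (1 + v * / - Re w * (v * / - Re w))))%R by (rewrite ?Rmult_1_r; ring).
      rewrite Hs. field. repeat split; try lra; apply Rgt_not_eq; nra.
    + intros t _. apply continuity_pt_filterlim. apply derivable_continuous_pt. eexists. apply is_derive_Reals.
      auto_derive; [|reflexivity]. assert (0 <= (s * t - Im w) * (s * t - Im w))%R by apply Rle_0_sqr. unfold Rminus in *. nra.
  - unfold P. pose proof (atan_bound ((s * T - Im w) / (- Re w))). pose proof (atan_bound ((s * 0 - Im w) / (- Re w))).
    pose proof PI_4. assert (Cs : (s = 1 \/ s = -1)%R) by (assert (E : ((s - 1) * (s + 1) = 0)%R) by lra; apply Rmult_integral in E; lra).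
    destruct Cs as [-> | ->]; lra.
Qed.

(** By [w_dist], c <= 4 |z - w|, hence |z - b| <= 5 |z - w| and the kernel is at most 5 c / |z -
    b|^2, with |z - b|^2 at least the denominator of [poisson_int]. With c = 2 |Re w| this gives 10,
    and the mass 4 gives 40. *)
Lemma poisson_CL_bound s : (s * s = 1)%R -> (Cmod (CL w0 k sl s poisson_kernel (RtoC 0)) <= 40 * (M * (k * sl + 1)))%R.
Proof.
  intros Hs. pose proof c_pos as Hc.
  pose proof (bdry_dom w0 k sl Hw Hk HS s poisson_kernel _ 2 (RtoC 0) 0 Hs (poisson_cont s Hs) (poisson_decay s Hs)) as D.
  specialize (D ltac:(simpl; lra) ltac:(lra) ltac:(simpl; lra) ltac:(simpl; lra)).
  apply (is_II_bound (CF w0 k sl s poisson_kernel (RtoC 0))). { eapply dominated_ex, D. }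
  intros T HT. destruct (poisson_int s T Hs HT) as (I & HI & HI4).
  set (A := (10 * (M * (k * sl + 1)))%R).
  assert (HA : (0 <= A)%R). { unfold A. assert (0 <= M * (k * sl + 1))%R by (apply Rmult_le_pos; auto; nra). lra. }
  apply Rle_trans with (A * I)%R; [|unfold A in *; nra].
  apply (is_CInt_norm (CF w0 k sl s poisson_kernel (RtoC 0)) (fun t => A * ((- Re w) / (Re w * Re w + (s * t - Im w) * (s * t - Im w))))%R 0 T); auto.
  2: { apply CInt_correct_le; auto. intros u Hu; apply D; lra. }
  2: { apply (is_RInt_scal (V := R_NormedModule)), HI. }
  intros t Ht. unfold CF. rewrite Fint_mod.
  replace (exp (- Re (RtoC 0 * cur w0 k sl s t))) with 1%R. 2: { rewrite <- exp_0. f_equal. unfold Re; simpl. ring. }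
  rewrite Rmult_1_r. unfold poisson_kernel. set (z := cur w0 k sl s t).
  assert (Hz : H z) by now apply cur_in.
  pose proof (zb_mod z (HL z Hz)) as Hb1. pose proof (zb_re z (HL z Hz)) as Hbr.
  pose proof (w_dist w0 k sl Hk w Wx Wstar s t Hs) as Hd1. fold z in Hd1. rewrite Cmod_sub_sym in Hd1.
  assert (N1 : z - w <> 0) by (apply Cmod_gt_0; lra). assert (N2 : z - b <> 0) by (apply Cmod_gt_0; lra).
  rewrite !Cmod_mult, !Cmod_inv, Cmod_R, (Rabs_pos_eq c) by (auto; lra).
  assert (T5 : (Cmod (z - b) <= 5 * Cmod (z - w))%R).
  { replace (z - b) with ((z - w) + - RtoC c) by (unfold b; ring). eapply Rle_trans; [apply Cmod_triangle|].
    rewrite Cmod_opp, Cmod_R, Rabs_pos_eq by lra. unfold c. lra. }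
  assert (T6 : (Re w * Re w + (s * t - Im w) * (s * t - Im w) <= Cmod (z - b) * Cmod (z - b))%R).
  { rewrite Cmod_sq. assert (Im (z - b) = s * t - Im w)%R as -> by (unfold z, b, cur, Im; simpl; ring). nra. }
  set (Dn := (Re w * Re w + (s * t - Im w) * (s * t - Im w))%R) in *.
  assert (HDn : (0 < Dn)%R). { unfold Dn. assert (0 <= (s * t - Im w) * (s * t - Im w))%R by apply Rle_0_sqr. nra. }
  assert (T7 : (/ Cmod (z - w) * / Cmod (z - b) <= 5 * / Dn)%R).
  { rewrite <- Rinv_mult. apply Rle_trans with (/ (Dn / 5))%R; [|right; field; lra]. apply Rinv_le_contravar; [lra|]. nra. }
  pose proof (dcur_bound k sl Hk HS s t Hs) as Hdc. pose proof (HM z Hz) as HMz. pose proof (Cmod_ge_0 (g z)). pose proof (Cmod_ge_0 (dcur k sl s t)).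
  assert (P7 : (0 <= / Cmod (z - w) * / Cmod (z - b))%R) by (apply Rmult_le_pos; apply Rlt_le, Rinv_0_lt_compat; lra).
  apply Rle_trans with (M * (c * (5 * / Dn)) * (k * sl + 1))%R; [|right; unfold A, c; field; lra].
  apply Rmult_le_compat; auto. { apply Rmult_le_pos; auto. apply Rmult_le_pos; lra. }
  apply Rmult_le_compat; auto. { apply Rmult_le_pos; lra. } apply Rmult_le_compat_l; lra.
Qed.

(** The branch integrals of [q3_regular] agree, so the jump of the kernel q_3 is that of the Poisson
    kernel, with a bound free of w. [Psi_bound] at t = 0 would leave a factor |w|^3. *)
Lemma Psi_jump_3_0_bound : (Cmod (Psi_jump 3 0) <= 80 * (M * (k * sl + 1)))%R.
Proof.
  assert (Q3 : forall s : R, (s * s = 1)%R -> exists K, dominated (CF w0 k sl s (qmw 3) (RtoC 0)) K).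
  { intros s Hs. eexists. apply (bdry_dom w0 k sl Hw Hk HS s _ _ 3 (RtoC 0) 0 Hs (qm_cont H w0 k sl g Hk HL Hw0 HC Hg w Wx Wstar s _ Hs)
     (qm_decay H w0 k sl g M Hk HL Hw0 HC HM w Wx Wstar s _ Hs)); simpl; lra. }
  assert (Qk : forall s : R, (s * s = 1)%R -> exists K, dominated (CF w0 k sl s poisson_kernel (RtoC 0)) K).
  { intros s Hs. eexists. apply (bdry_dom w0 k sl Hw Hk HS s poisson_kernel _ 2 (RtoC 0) 0 Hs (poisson_cont s Hs) (poisson_decay s Hs)); simpl; lra. }
  assert (Ez : forall (s : R) t, (s * s = 1)%R -> q3_regular (cur w0 k sl s t) = - (1) * qmw 3 (cur w0 k sl s t) + poisson_kernel (cur w0 k sl s t)).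
  { intros s t Hs. set (z := cur w0 k sl s t). assert (Hz : H z) by now apply cur_in.
    assert (N1 : w - z <> 0) by (now apply (w_neq w0 k sl Hk w Wx Wstar)).
    assert (N2 : z - w <> 0). { intros E. apply N1. replace (w - z) with (- (z - w)) by ring. rewrite E. ring. }
    rewrite q3_split by (auto; now apply HL). unfold qmw, qm. f_equal. set (V := (w * / z) ^ 3). field. auto. }
  assert (Hdb : exists M', forall s : R, (s * s = 1)%R -> decay_bound w0 k sl s q3_regular M' 2).
  { exists (M * Cmod w ^ 3 + M * (c * ((Cmod w + 1) * (Cmod b + 1))))%R. intros s Hs.
    destruct (qm_decay H w0 k sl g M Hk HL Hw0 HC HM w Wx Wstar s 3 Hs) as [A1 A2]. destruct (poisson_decay s Hs) as [B1 B2].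
    split; [lra|]. intros t Ht. rewrite Ez by auto. specialize (A2 t Ht). specialize (B2 t Ht).
    eapply Rle_trans; [apply Cmod_triangle|]. rewrite Cmod_mult, Cmod_opp, Cmod_1, Rmult_1_l.
    unfold Rdiv. rewrite Rmult_plus_distr_r. apply Rplus_le_compat; auto.
    eapply Rle_trans; [apply A2|]. apply Rmult_le_compat_l; auto.
    pose proof (cur_mod_ge1 w0 k sl Hw Hk s t Hs). apply Rinv_le_contravar; [apply pow_lt; lra|]. simpl. nra. }
  destruct Hdb as (M' & Hdb). destruct q3_regular_decay as (C0 & R0 & HC0 & Hqd).
  pose proof (gamma_cauchy H w0 k sl Hk HS HN HL Hw0 HC q3_regular C0 R0 M' 0 q3_regular_hol (Rle_refl 0) HC0 Hqd Hdb) as GC.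
  assert (Es : forall s : R, (s * s = 1)%R -> CL w0 k sl s q3_regular (RtoC 0) = - (1) * CL w0 k sl s (qmw 3) (RtoC 0) + CL w0 k sl s poisson_kernel (RtoC 0)).
  { intros s Hs. destruct (Q3 s Hs) as (K1 & D1). destruct (Qk s Hs) as (K2 & D2).
    unfold CL, Lap. change (Fint (cur w0 k sl s) (dcur k sl s) (qmw 3)) with (CF w0 k sl s (qmw 3)). change (Fint (cur w0 k sl s) (dcur k sl s) poisson_kernel) with (CF w0 k sl s poisson_kernel).
    rewrite <- (II_scal (- (1)) _ K1 D1), <- (II_plus _ _ (Cmod (- (1)) * K1) K2); auto; [|now apply dominated_scal].
    symmetry. apply (II_ext _ _ (Cmod (- (1)) * K1 + K2)). { apply dominated_plus; auto. now apply dominated_scal. }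
    intros t Ht. unfold CF, Fint. rewrite Ez by auto. ring. }
  rewrite !Es in GC by lra.
  assert (E : Psi_jump 3 0 = CL w0 k sl 1 poisson_kernel (RtoC 0) - CL w0 k sl (-1) poisson_kernel (RtoC 0)).
  { unfold Psi_jump, Psiw, Psi. fold qmw. rewrite Cmult_0_l, Cexp_0.
    set (a1 := CL w0 k sl 1 (qmw 3) (RtoC 0)) in *. set (a2 := CL w0 k sl (-1) (qmw 3) (RtoC 0)) in *.
    set (b1 := CL w0 k sl 1 poisson_kernel (RtoC 0)) in *. set (b2 := CL w0 k sl (-1) poisson_kernel (RtoC 0)) in *.
    transitivity (b1 - (- (1) * a1 + b1) - a2); [ring|]. rewrite GC. ring. }
  rewrite E. unfold Cminus. eapply Rle_trans; [apply Cmod_triangle|]. rewrite Cmod_opp.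
  pose proof (poisson_CL_bound 1 ltac:(lra)). pose proof (poisson_CL_bound (-1) ltac:(lra)). lra.
Qed.

Definition term_const : R := (100 * Psi_const)%R.

Lemma int_term_bound n : (Cmod (int_term k (laplace H w0 g) n w) <= term_const * (1 / 2) ^ n)%R.
Proof.
  pose proof Psi_const_pos. unfold term_const. destruct n as [|j].
  - rewrite int_term_0. pose proof (Psi_jump_tn_bound 3 0 ltac:(lia)) as B. pose proof Psi_jump_3_0_bound.
    unfold Cminus. eapply Rle_trans; [apply Cmod_triangle|]. rewrite Cmod_opp. simpl in *. unfold Psi_const in *. lra.
  - rewrite int_term_S. unfold Cminus. eapply Rle_trans; [apply Cmod_triangle|]. rewrite Cmod_opp.
    pose proof (Psi_jump_tn_bound (S j + 3) (S j) ltac:(lia)). pose proof (Psi_jump_tn_bound (S j + 3) j ltac:(lia)).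
    assert (P : (0 < (1 / 2) ^ j)%R) by (apply pow_lt; lra). simpl pow in *. nra.
Qed.

Lemma jump_term_bound n : (Cmod (jump_term k (laplace H w0 g) (S n) w) <= term_const * (1 / 2) ^ n)%R.
Proof.
  pose proof Psi_const_pos. unfold term_const. rewrite jump_term_S. unfold Cminus. eapply Rle_trans; [apply Cmod_triangle|]. rewrite Cmod_opp.
  pose proof (Psi_jump_tn_bound (n + 4) n ltac:(lia)). pose proof (Psi_jump_tn_bound (n + 3) n ltac:(lia)).
  assert (P : (0 < (1 / 2) ^ n)%R) by (apply pow_lt; lra). nra.
Qed.

Lemma ex_series_geom_half K : ex_series (fun n => K * (1 / 2) ^ n)%R.
Proof.
  apply (ex_series_scal (V := R_NormedModule) K (fun n => (1 / 2) ^ n)%R). apply ex_series_geom. rewrite Rabs_pos_eq; lra.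
Qed.

(** Stage 0 is taken at 0 instead of t_0, in accordance with [int_term_0]. *)
Definition telescope (n : nat) : C := Psi_jump (n + 3) (match n with O => 0%R | _ => tn k n end).

Lemma int_jump n : int_term k (laplace H w0 g) n w + jump_term k (laplace H w0 g) (S n) w = telescope (S n) - telescope n.
Proof.
  rewrite jump_term_S. unfold telescope. replace (S n + 3)%nat with (n + 4)%nat by lia. destruct n as [|j].
  - rewrite int_term_0. simpl. ring.
  - rewrite int_term_S. replace (S j + 4)%nat with (j + 5)%nat by lia. replace (S j + 3)%nat with (j + 4)%nat by lia. ring.
Qed.

(** Each series converges by its geometric bound; the sum of the two is then found from the partial
    sums [telescope (S N) - telescope 0], whose first term tends to 0. *)
Lemma series_sum : is_I1_Delta k (laplace H w0 g) w (- Psi_jump 3 0).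
Proof.
  assert (X1 : ex_series (K := C_AbsRing) (V := C_NormedModule) (fun n => int_term k (laplace H w0 g) n w)).
  { apply (ex_series_le (K := C_AbsRing) (V := C_CompleteNormedModule) _ (fun n => term_const * (1 / 2) ^ n)%R); [|apply ex_series_geom_half].
    intros n. apply int_term_bound. }
  assert (X2 : ex_series (K := C_AbsRing) (V := C_NormedModule) (fun n => jump_term k (laplace H w0 g) (S n) w)).
  { apply (ex_series_le (K := C_AbsRing) (V := C_CompleteNormedModule) _ (fun n => term_const * (1 / 2) ^ n)%R); [|apply ex_series_geom_half].
    intros n. apply jump_term_bound. }
  destruct X1 as [s1 S1]. destruct X2 as [s2 S2]. exists s1, s2. split; auto. split; auto.
  pose proof (is_series_plus _ _ _ _ S1 S2) as S3.
  refine (filterlim_locally_unique (K := C_AbsRing) (V := C_NormedModule) (F := eventually) _ _ _ _ S3).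
  apply (filterlim_C_iff eventually). intros e He.
  assert (Sm : forall N, sum_n (G := C_AbelianMonoid) (fun n => int_term k (laplace H w0 g) n w + jump_term k (laplace H w0 g) (S n) w) N = telescope (S N) - telescope 0).
  { induction N as [|N IH].
    - rewrite sum_O. apply int_jump.
    - rewrite sum_Sn, IH, int_jump. unfold plus; simpl. ring. }
  assert (HKp : (0 <= term_const)%R) by (unfold term_const; pose proof Psi_const_pos; lra).
  destruct (pow_lt_1_zero (1 / 2)) with (y := (e / (term_const + 1))%R) as (N & HNn).
  { rewrite Rabs_pos_eq; lra. } { apply Rdiv_lt_0_compat; lra. }
  exists N. intros n Hn. specialize (HNn n Hn).
  match goal with |- (Cmod (?a - ?b) < e)%R => replace (a - b) with (telescope (S n)) end.
  2: { change (telescope (S n) = sum_n (G := C_AbelianMonoid) (fun n => int_term k (laplace H w0 g) n w + jump_term k (laplace H w0 g) (S n) w) n - - Psi_jump 3 0).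
       rewrite Sm. unfold telescope at 3. simpl. ring. }
  unfold telescope. eapply Rle_lt_trans; [apply (Psi_jump_tn_bound (S n + 3) n); lia|].
  assert (P : (0 < (1 / 2) ^ n)%R) by (apply pow_lt; lra). rewrite Rabs_pos_eq in HNn by lra.
  apply (Rmult_lt_compat_l (term_const + 1)) in HNn; [|lra]. replace ((term_const + 1) * (e / (term_const + 1)))%R with e in HNn by (field; lra).
  pose proof Psi_const_pos. unfold term_const in *. nra.
Qed.

End FixW.
End Series.

(** * Uniqueness of limits along rays *)

Lemma deriv_RC_right0 (F : R -> C) t l : (forall h, (0 <= h)%R -> F (t + h)%R = 0) -> deriv_RC F t l -> l = 0.
Proof.
  intros HF HD. apply Cmod_small_eq. intros e He. destruct (HD e He) as (d & Hd & K).
  specialize (K (d / 2)%R). rewrite (Rabs_pos_eq (d / 2)) in K by lra. specialize (K ltac:(lra)).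
  rewrite HF in K by lra. pose proof (HF 0%R (Rle_refl 0)) as F0. rewrite Rplus_0_r in F0. rewrite F0 in K.
  replace (0 - 0 - RtoC (d / 2) * l) with (- (RtoC (d / 2) * l)) in K by ring.
  rewrite Cmod_opp, Cmod_mult, Cmod_R, Rabs_pos_eq in K by lra. nra.
Qed.

Lemma half_pow_small (A e : R) : (0 < e)%R -> exists n, (A * (1 / 2) ^ n <= e)%R.
Proof.
  intros He. destruct (pow_lt_1_zero (1 / 2) ltac:(rewrite Rabs_pos_eq; lra) (e / (Rabs A + 1))) as (N & HN).
  { apply Rdiv_lt_0_compat; auto. pose proof (Rabs_pos A). lra. }
  exists N. specialize (HN N (le_n N)). assert (0 < (1 / 2) ^ N)%R by (apply pow_lt; lra).
  rewrite Rabs_pos_eq in HN by lra. pose proof (Rle_abs A). pose proof (Rabs_pos A).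
  apply Rle_trans with ((Rabs A + 1) * (1 / 2) ^ N)%R; [apply Rmult_le_compat_r; lra|].
  apply (Rmult_lt_compat_l (Rabs A + 1)) in HN; [|lra].
  replace ((Rabs A + 1) * (e / (Rabs A + 1)))%R with e in HN by (field; lra). lra.
Qed.

Lemma pow_le_fact_exp n x : (0 <= x)%R -> (x ^ n <= INR (fact n) * exp x)%R.
Proof.
  intros Hx. pose proof (INR_fact_lt_0 n).
  assert (E : (x ^ n / INR (fact n) <= exp x)%R).
  { eapply Rle_trans; [|apply (exp_ge_taylor x n Hx)]. destruct n as [|n]; [simpl; lra|].
    rewrite tech5. assert (0 <= sum_f_R0 (fun k => x ^ k / INR (fact k)) n)%R; [|lra].
    apply cond_pos_sum. intros k. apply Rdiv_le_0_compat; [now apply pow_le|apply INR_fact_lt_0]. }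
  apply (Rmult_le_compat_l (INR (fact n))) in E; [|lra].
  replace (INR (fact n) * (x ^ n / INR (fact n)))%R with (x ^ n)%R in E by (field; lra). exact E.
Qed.

(** * Analytic functions on a half-line that vanish far to the right *)

Section AnalyticZero.
Variables (D : nat -> R -> C) (a r A : R).
Hypothesis Hr : (0 < r)%R.
Hypothesis HD : forall n x, (a < x)%R -> deriv_RC (D n) x (D (S n) x).
Hypothesis HA : forall n x, (a < x)%R -> (Cmod (D n x) <= A * INR (fact n) / r ^ n)%R.

(** A derivative is already determined by values on the right, so the end point b is included;
    [taylor_zero] expands precisely there. *)
Lemma all_zero b : (a < b)%R -> (forall x, (b <= x)%R -> D 0 x = 0) -> forall n x, (b <= x)%R -> D n x = 0.
Proof.
  intros Hab H0 n. induction n as [|n IH]; auto. intros x Hx.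
  apply (deriv_RC_right0 (D n) x); [|apply HD; lra]. intros h Hh. apply IH. lra.
Qed.

(** Taylor's formula at b with integral remainder, by induction on m: D n x is minus the integral of
    D (S n) over [x, b]. For n = 0 the bound is A ((b - x) / r)^m. *)
Lemma taylor_zero b m : (a < b)%R -> (forall n, D n b = 0) -> forall n x, (a < x <= b)%R ->
  (Cmod (D n x) <= A * INR (fact (n + m)) / r ^ (n + m) * ((b - x) ^ m / INR (fact m)))%R.
Proof.
  intros Hab Hb. induction m as [|m IH]; intros n x Hx.
  { rewrite Nat.add_0_r. simpl (_ ^ 0)%R. replace (INR (fact 0)) with 1%R by reflexivity. rewrite Rdiv_1_r, Rmult_1_r. apply HA. lra. }
  set (K := (A * INR (fact (n + S m)) / r ^ (n + S m))%R).
  replace (Cmod (D n x)) with (Cmod (D n b - D n x)).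
  2: { rewrite Hb. rewrite <- Cmod_opp. f_equal. ring. }
  assert (Fm : INR (fact (S m)) = ((INR m + 1) * INR (fact m))%R).
  { change (fact (S m)) with (S m * fact m)%nat. rewrite mult_INR, S_INR. reflexivity. }
  pose proof (INR_fact_neq_0 m) as F0. pose proof (pos_INR m). set (fm := INR (fact (S m))) in *. clearbody fm.
  apply (is_CInt_norm (D (S n)) (fun t => K * ((b - t) ^ m / INR (fact m)))%R x b); try lra.
  - intros t Ht. eapply Rle_trans; [apply IH; lra|]. rewrite Nat.add_succ_comm. apply Rle_refl.
  - apply CInt_FTC; try lra. intros t Ht; apply HD; lra. intros t Ht. apply (deriv_RC_cont _ _ (D (S (S n)) t)). apply HD; lra.
  - replace (K * ((b - x) ^ S m / fm))%R with (- K * ((b - b) ^ S m / fm) - (- K * ((b - x) ^ S m / fm)))%R.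
    2: { replace (b - b)%R with 0%R by ring. rewrite pow_i by lia. unfold Rdiv. ring. }
    apply (is_RInt_derive (V := R_CompleteNormedModule) (fun t => - K * ((b - t) ^ S m / fm))%R).
    + intros t _. auto_derive; auto. change (match m with 0%nat => 1 | S _ => INR m + 1 end)%R with (INR (S m)).
      rewrite Fm, S_INR. unfold Rminus. simpl pred. field. split; auto. lra.
    + intros t _. apply continuity_pt_filterlim. apply derivable_continuous_pt. eexists. apply is_derive_Reals. auto_derive; auto.
Qed.

(** Vanishing spreads to the left in steps of length r / 2, on which the Taylor bound is A / 2^m for
    every m. The radius r is the same on all of ]a, +oo[, so finitely many steps reach x. *)
Lemma analytic_zero b : (forall x, (b <= x)%R -> D 0 x = 0) -> forall x, (a < x)%R -> D 0 x = 0.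
Proof.
  intros Hb. assert (J : forall j x, (a < x)%R -> (b - INR j * (r / 2) <= x)%R -> D 0 x = 0).
  { induction j as [|j IH]; intros x Hx Hj. { apply Hb. simpl in Hj. lra. }
    destruct (Rle_dec (b - INR j * (r / 2)) x) as [L|L]; [now apply IH|]. apply Rnot_le_lt in L.
    set (b' := (b - INR j * (r / 2))%R) in *. rewrite S_INR in Hj.
    assert (Z : forall n, D n b' = 0).
    { intros n. apply (all_zero b'); try lra. intros y Hy. apply IH; lra. }
    apply Cmod_small_eq. intros e He. destruct (half_pow_small A e He) as (m & Hm).
    eapply Rle_trans; [apply (taylor_zero b' m); auto; lra|]. eapply Rle_trans; [|apply Hm].
    rewrite Nat.add_0_l. pose proof (INR_fact_lt_0 m). assert (0 < r ^ m)%R by now apply pow_lt.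
    assert (HAp : (0 <= A)%R). { pose proof (HA 0 x Hx) as B. simpl in B. pose proof (Cmod_ge_0 (D 0 x)). lra. }
    replace (A * INR (fact m) / r ^ m * ((b' - x) ^ m / INR (fact m)))%R with (A * ((b' - x) ^ m / r ^ m))%R by (field; lra).
    apply Rmult_le_compat_l; auto.
    unfold Rdiv at 1. rewrite <- pow_inv, <- Rpow_mult_distr. apply pow_incr. split.
    - apply Rmult_le_pos; [lra|]. apply Rlt_le, Rinv_0_lt_compat; lra.
    - apply (Rmult_le_reg_r r); auto. rewrite Rmult_assoc, Rinv_l by lra. unfold b' in *. lra. }
  intros x Hx. destruct (INR_unbounded ((b - x) / (r / 2))) as (j & Hj). apply (J j); auto.
  apply (Rmult_gt_compat_r (r / 2)) in Hj; [|lra]. replace ((b - x) / (r / 2) * (r / 2))%R with (b - x)%R in Hj by (field; lra). lra.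
Qed.
End AnalyticZero.

Lemma II_param_deriv (F : R -> R -> C) (F1 : R -> C) (x r K K1 : R) : (0 < r)%R ->
  (forall h, (Rabs h < r)%R -> exists K', dominated (F (x + h)%R) K') -> dominated F1 K1 ->
  (forall h t, (Rabs h < r)%R -> (0 <= t)%R -> (Cmod (F (x + h)%R t - F x t - RtoC h * F1 t) <= K * Rabs h ^ 2 * Dom t)%R) ->
  deriv_RC (fun x => II (F x)) x (II F1).
Proof.
  intros Hr HF HF1 HK. apply (quad_deriv_RC _ _ _ r (6 * K)); auto. intros h Hh.
  destruct (HF h Hh) as (K2 & D2). destruct (HF 0%R ltac:(rewrite Rabs_R0; auto)) as (K3 & D3). rewrite Rplus_0_r in D3.
  pose proof (dominated_scal (- (1)) _ _ D3) as D4. pose proof (dominated_scal (- RtoC h) _ _ HF1) as D5.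
  pose proof (dominated_plus _ _ _ _ D2 D4) as D6.
  replace (II (F (x + h)%R) - II (F x) - RtoC h * II F1) with (II (fun t => (F (x + h)%R t + - (1) * F x t) + - RtoC h * F1 t)).
  2: { pose proof (II_plus _ _ _ _ D6 D5) as Q1. pose proof (II_plus _ _ _ _ D2 D4) as Q2.
       pose proof (II_scal (- (1)) _ _ D3) as Q3. pose proof (II_scal (- RtoC h) _ _ HF1) as Q4.
       etransitivity; [exact Q1|]. etransitivity; [apply (f_equal2 Cplus); [exact Q2|exact Q4]|]. rewrite Q3. ring. }
  rewrite Rmult_assoc. apply II_bound. split. { intros t Ht. now apply (dominated_plus _ _ _ _ D6 D5). }
  intros t Ht. specialize (HK h t Hh Ht).
  replace (F (x + h)%R t + - (1) * F x t + - RtoC h * F1 t) with (F (x + h)%R t - F x t - RtoC h * F1 t) by ring. auto.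
Qed.

(** Half of the exponential is spent on the power, by u^n e^(-au/2) <= n! / (a/2)^n. These
    factorials are what [analytic_zero] asks for. *)
Lemma pow_exp_dom (a : R) : (0 < a)%R -> exists Ca, (0 <= Ca)%R /\ forall n u, (0 <= u)%R ->
  (u ^ n * exp (- (a * u)) <= Ca * (INR (fact n) / (a / 2) ^ n) * Dom u)%R.
Proof.
  intros Ha. destruct (exp_lin_dom (a / 2) ltac:(lra)) as (Ca & HC & L). exists Ca. split; auto. intros n u Hu.
  pose proof (pow_le_fact_exp n (a / 2 * u) ltac:(nra)) as E. specialize (L u Hu).
  assert (P : (0 < (a / 2) ^ n)%R) by (apply pow_lt; lra). pose proof (INR_fact_lt_0 n).
  replace (exp (- (a * u)))%R with (exp (- (a / 2 * u)) * exp (- (a / 2 * u)))%R by (rewrite <- exp_plus; f_equal; field).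
  assert (E2 : (u ^ n * exp (- (a / 2 * u)) <= INR (fact n) / (a / 2) ^ n)%R).
  { rewrite exp_Ropp. rewrite Rpow_mult_distr in E. pose proof (exp_pos (a / 2 * u)).
    apply (Rmult_le_reg_r (exp (a / 2 * u))); auto. rewrite Rmult_assoc, Rinv_l, Rmult_1_r by lra.
    apply (Rmult_le_reg_r ((a / 2) ^ n)); auto.
    replace (INR (fact n) / (a / 2) ^ n * exp (a / 2 * u) * (a / 2) ^ n)%R with (INR (fact n) * exp (a / 2 * u))%R by (field; lra).
    try lra. }
  rewrite <- Rmult_assoc. replace (Ca * (INR (fact n) / (a / 2) ^ n) * Dom u)%R with ((INR (fact n) / (a / 2) ^ n) * (Ca * Dom u))%R by ring.
  apply Rmult_le_compat; auto. apply Rmult_le_pos. now apply pow_le. apply Rlt_le, exp_pos. apply Rlt_le, exp_pos.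
Qed.

(** * Derivatives of a Cauchy integral on the positive axis *)

Section Stieltjes.
Variables (G Lam : R -> C) (K rho : R).
Hypothesis HG : dominated G K.
Hypothesis HLam : forall t, (0 <= t)%R -> ccont Lam t.
Hypothesis Hrho : (0 < rho)%R.
Hypothesis Hd : forall x t, (0 <= x)%R -> (0 <= t)%R -> (rho <= Cmod (RtoC x - Lam t))%R.

(** The n-th derivative in x of G t / (x - Lam t). The distance rho between x and the values of
    [Lam] becomes the radius of convergence, at every x >= 0. *)
Definition cauchy_integrand (n : nat) (x t : R) : C := RtoC (-1) ^ n * RtoC (INR (fact n)) * (G t * (/ (RtoC x - Lam t)) ^ S n).
Definition cauchy_deriv (n : nat) (x : R) : C := II (cauchy_integrand n x).

Lemma cauchy_integrand_dom n x : (0 <= x)%R -> dominated (cauchy_integrand n x) (INR (fact n) / rho ^ S n * K).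
Proof.
  intros Hx. split.
  - intros t Ht. unfold cauchy_integrand. apply ccont_mult; [apply ccont_const|]. apply ccont_mult; [now apply HG|].
    apply ccont_pow, ccont_inv. apply ccont_minus; [apply ccont_const|now apply HLam].
    apply Cmod_gt_0. specialize (Hd x t Hx Ht). lra.
  - intros t Ht. unfold cauchy_integrand. specialize (Hd x t Hx Ht). pose proof (proj2 HG t Ht) as B.
    rewrite !Cmod_mult, !Cmod_pow, Cmod_inv, !Cmod_R by (apply Cmod_gt_0; lra).
    rewrite (Rabs_left1 (-1)), (Rabs_pos_eq (INR _)) by (try apply pos_INR; lra).
    replace (- (-1))%R with 1%R by ring. rewrite pow1, Rmult_1_l.
    pose proof (pos_INR (fact n)). pose proof (pow_lt rho (S n) Hrho).
    rewrite pow_inv. assert (E : (/ Cmod (RtoC x - Lam t) ^ S n <= / rho ^ S n)%R).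
    { apply Rinv_le_contravar; auto. apply pow_incr. lra. }
    unfold Rdiv. rewrite !Rmult_assoc. apply Rmult_le_compat_l; auto.
    rewrite Rmult_comm. apply Rmult_le_compat; auto. apply Rlt_le, Rinv_0_lt_compat, pow_lt; lra. apply Cmod_ge_0.
Qed.

Lemma cauchy_deriv_bound n x : (0 <= x)%R -> (Cmod (cauchy_deriv n x) <= 6 * K / rho * INR (fact n) / rho ^ n)%R.
Proof.
  intros Hx. unfold cauchy_deriv. eapply Rle_trans; [apply (II_bound _ _ (cauchy_integrand_dom n x Hx))|].
  right. pose proof (pow_lt rho n Hrho). simpl. field. lra.
Qed.

(** Both estimates come from the resolvent identity 1/u - 1/v = - h / (u v), by induction on m; the
    second is the first order Taylor remainder of v^(-m). *)
Lemma inv_pow_diff (u v : C) (h : R) (m : nat) : u <> 0 -> v <> 0 -> u = v + RtoC h -> (Cmod (/ u) <= / rho)%R -> (Cmod (/ v) <= / rho)%R ->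
  (Cmod ((/ u) ^ m - (/ v) ^ m) <= INR m * Rabs h * (/ rho) ^ S m)%R /\
  (Cmod ((/ u) ^ m - (/ v) ^ m + RtoC (INR m) * RtoC h * (/ v) ^ S m) <= INR m ^ 2 * Rabs h ^ 2 * (/ rho) ^ S (S m))%R.
Proof.
  intros Hu Hv E Bu Bv. set (a := / u) in *. set (b := / v) in *. set (q := (/ rho)%R) in *.
  assert (Hq : (0 <= q)%R) by (apply Rlt_le, Rinv_0_lt_compat; auto).
  assert (Eab : a = b - RtoC h * (a * b)). { unfold a, b. rewrite E at 1. rewrite E in Hu. rewrite E. field. auto. }
  pose proof (Cmod_ge_0 a) as Ga. pose proof (Cmod_ge_0 b) as Gb. pose proof (Rabs_pos h) as Gh.
  assert (P1 : forall m, (Cmod (a ^ m - b ^ m) <= INR m * Rabs h * q ^ S m)%R).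
  { induction m0 as [|j IH]. { simpl. replace (1 - 1) with (RtoC 0) by ring. rewrite Cmod_0. lra. }
    replace (a ^ S j - b ^ S j) with (a * (a ^ j - b ^ j) + (a - b) * b ^ j) by (simpl; ring).
    replace (a - b) with (- (RtoC h * (a * b))) by (rewrite Eab at 2; ring).
    eapply Rle_trans; [apply Cmod_triangle|]. rewrite Cmod_mult, (Cmod_mult (- _)), Cmod_opp, !Cmod_mult, Cmod_pow, Cmod_R, S_INR.
    replace ((INR j + 1) * Rabs h * q ^ S (S j))%R with (q * (INR j * Rabs h * q ^ S j) + Rabs h * (q * q) * q ^ j)%R by (simpl; ring).
    apply Rplus_le_compat.
    - apply Rmult_le_compat; auto. apply Cmod_ge_0.
    - apply Rmult_le_compat; try (apply Rmult_le_pos; auto; nra). now apply pow_le.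
      apply Rmult_le_compat_l; auto. now apply Rmult_le_compat. apply pow_incr; auto. }
  split; [apply P1|]. induction m as [|j IH].
  { simpl. match goal with |- (Cmod ?x <= _)%R => replace x with (RtoC 0) by ring end. rewrite Cmod_0. lra. }
  replace (a ^ S j - b ^ S j + RtoC (INR (S j)) * RtoC h * b ^ S (S j))
    with (b * (a ^ j - b ^ j + RtoC (INR j) * RtoC h * b ^ S j) + - (RtoC h * b) * (a ^ S j - b ^ S j)).
  2: { assert (Ej : a * a ^ j = b * a ^ j - RtoC h * b * (a * a ^ j)).
       { transitivity ((b - RtoC h * (a * b)) * a ^ j); [now rewrite <- Eab|ring]. }
       rewrite S_INR, RtoC_plus. simpl. rewrite Ej at 2. ring. }
  eapply Rle_trans; [apply Cmod_triangle|]. rewrite Cmod_mult, (Cmod_mult (- _)), Cmod_opp, Cmod_mult, Cmod_R.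
  specialize (P1 (S j)). pose proof (pos_INR j). rewrite S_INR in *.
  assert (Hq3 : (0 <= q ^ S (S (S j)))%R) by (now apply pow_le).
  apply Rle_trans with (q * (INR j ^ 2 * Rabs h ^ 2 * q ^ S (S j)) + Rabs h * q * ((INR j + 1) * Rabs h * q ^ S (S j)))%R.
  - apply Rplus_le_compat; apply Rmult_le_compat; auto; try apply Cmod_ge_0. now apply Rmult_le_pos. apply Rmult_le_compat_l; auto.
  - replace (q * (INR j ^ 2 * Rabs h ^ 2 * q ^ S (S j)) + Rabs h * q * ((INR j + 1) * Rabs h * q ^ S (S j)))%R
      with ((INR j ^ 2 + INR j + 1) * (Rabs h ^ 2 * q ^ S (S (S j))))%R by (simpl; ring).
    replace ((INR j + 1) ^ 2 * Rabs h ^ 2 * q ^ S (S (S j)))%R with ((INR j + 1) ^ 2 * (Rabs h ^ 2 * q ^ S (S (S j))))%R by ring.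
    apply Rmult_le_compat_r; [apply Rmult_le_pos; auto; apply pow2_ge_0|]. nra.
Qed.

Lemma cauchy_deriv_step n x : (0 < x)%R -> deriv_RC (cauchy_deriv n) x (cauchy_deriv (S n) x).
Proof.
  intros Hx. unfold cauchy_deriv. set (m := S n).
  apply (II_param_deriv (cauchy_integrand n) (cauchy_integrand (S n) x) x x (INR (fact n) * (INR m ^ 2 * (/ rho) ^ S (S m)) * K) (INR (fact (S n)) / rho ^ S (S n) * K)); auto.
  - intros h Hh. eexists. apply cauchy_integrand_dom. apply Rabs_def2 in Hh. lra.
  - apply cauchy_integrand_dom; lra.
  - intros h t Hh Ht. apply Rabs_def2 in Hh. pose proof (Hd x t ltac:(lra) Ht) as D1. pose proof (Hd (x + h)%R t ltac:(lra) Ht) as D2.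
    set (v := RtoC x - Lam t) in *. set (u := RtoC (x + h) - Lam t) in *.
    assert (Hu : u <> 0) by (apply Cmod_gt_0; lra). assert (Hv : v <> 0) by (apply Cmod_gt_0; lra).
    destruct (inv_pow_diff u v h m Hu Hv) as [_ B].
    { unfold u, v. rewrite RtoC_plus. ring. } { rewrite Cmod_inv by auto. apply Rinv_le_contravar; lra. } { rewrite Cmod_inv by auto. apply Rinv_le_contravar; lra. }
    unfold cauchy_integrand. fold u v m.
    replace (RtoC (-1) ^ n * RtoC (INR (fact n)) * (G t * (/ u) ^ m) - RtoC (-1) ^ n * RtoC (INR (fact n)) * (G t * (/ v) ^ m) - RtoC h * (RtoC (-1) ^ m * RtoC (INR (fact m)) * (G t * (/ v) ^ S m)))
      with (RtoC (-1) ^ n * (RtoC (INR (fact n)) * (((/ u) ^ m - (/ v) ^ m + RtoC (INR m) * RtoC h * (/ v) ^ S m) * G t))).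
    2: { assert (F1 : RtoC (INR (fact m)) = RtoC (INR m) * RtoC (INR (fact n))).
         { rewrite <- RtoC_mult, <- mult_INR. reflexivity. }
         assert (F2 : RtoC (-1) ^ m = - (1) * RtoC (-1) ^ n).
         { unfold m. simpl. f_equal. apply injective_projections; simpl; ring. }
         rewrite F1, F2. generalize ((/ u) ^ m), ((/ v) ^ m), ((/ v) ^ S m). intros. ring. }
    rewrite !Cmod_mult, Cmod_pow, !Cmod_R, (Rabs_left1 (-1)), (Rabs_pos_eq (INR _)) by (try apply pos_INR; lra).
    replace (- (-1))%R with 1%R by ring. rewrite pow1, Rmult_1_l.
    pose proof (proj2 HG t Ht) as BG.
    replace (INR (fact n) * (INR m ^ 2 * (/ rho) ^ S (S m)) * K * Rabs h ^ 2 * Dom t)%R with (INR (fact n) * ((INR m ^ 2 * Rabs h ^ 2 * (/ rho) ^ S (S m)) * (K * Dom t)))%R by ring.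
    apply Rmult_le_compat_l; [apply pos_INR|]. apply Rmult_le_compat; auto; apply Cmod_ge_0.
Qed.
End Stieltjes.

(** * Derivatives of a Laplace transform on the positive axis *)

Section LaplaceReal.
Variables (f : R -> C) (B : R).
Hypothesis Hf : forall u, (0 <= u)%R -> ccont f u.
Hypothesis HB : forall u, (0 <= u)%R -> (Cmod (f u) <= B)%R.

Definition laplace_integrand (n : nat) (x u : R) : C := RtoC (- u) ^ n * (Cexp (- (RtoC x * RtoC u)) * f u).
Definition laplace_deriv (n : nat) (x : R) : C := II (laplace_integrand n x).

Lemma Cmod_exp_real (x u : R) : Cmod (Cexp (- (RtoC x * RtoC u))) = exp (- (x * u)).
Proof. rewrite Cmod_Cexp. f_equal. unfold Re; simpl. ring. Qed.

Lemma laplace_integrand_bound n x a u : (a <= x)%R -> (0 <= u)%R -> (Cmod (laplace_integrand n x u) <= B * (u ^ n * exp (- (a * u))))%R.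
Proof.
  intros Hx Hu. unfold laplace_integrand. rewrite !Cmod_mult, Cmod_pow, Cmod_R, Rabs_Ropp, (Rabs_pos_eq u), Cmod_exp_real by auto.
  specialize (HB u Hu). pose proof (Cmod_ge_0 (f u)). pose proof (pow_le u n Hu).
  assert (exp (- (x * u)) <= exp (- (a * u)))%R by (apply exp_le; nra). pose proof (exp_pos (- (x * u))).
  replace (B * (u ^ n * exp (- (a * u))))%R with (u ^ n * (exp (- (a * u)) * B))%R by ring.
  apply Rmult_le_compat_l; auto. apply Rmult_le_compat; lra.
Qed.

Lemma laplace_integrand_cont n x u : (0 <= u)%R -> ccont (laplace_integrand n x) u.
Proof.
  intros Hu. unfold laplace_integrand. apply ccont_mult; [apply ccont_pow, ccont_RtoC; apply derivable_continuous_pt; reg|].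
  apply ccont_mult; auto. apply ccont_Cexp, ccont_opp, ccont_mult; [apply ccont_const|]. apply ccont_RtoC, derivable_continuous_pt; reg.
Qed.

Lemma Bpos : (0 <= B)%R.
Proof. eapply Rle_trans; [apply Cmod_ge_0|apply (HB 0%R); lra]. Qed.

Lemma laplace_deriv_bound (a : R) : (0 < a)%R -> exists A, (0 <= A)%R /\ forall n x, (a <= x)%R ->
  dominated (laplace_integrand n x) (A * (INR (fact n) / (a / 2) ^ n)) /\ (Cmod (laplace_deriv n x) <= 6 * A * INR (fact n) / (a / 2) ^ n)%R.
Proof.
  intros Ha. destruct (pow_exp_dom a Ha) as (Ca & HC & L). pose proof Bpos. exists (B * Ca)%R. split; [now apply Rmult_le_pos|]. intros n x Hx.
  assert (D : dominated (laplace_integrand n x) (B * Ca * (INR (fact n) / (a / 2) ^ n))).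
  { split; [intros; now apply laplace_integrand_cont|]. intros u Hu. eapply Rle_trans; [apply (laplace_integrand_bound n x a u); auto|].
    specialize (L n u Hu).
    replace (B * Ca * (INR (fact n) / (a / 2) ^ n) * Dom u)%R with (B * (Ca * (INR (fact n) / (a / 2) ^ n) * Dom u))%R by ring.
    apply Rmult_le_compat_l; auto. }
  split; auto. eapply Rle_trans; [apply (II_bound _ _ D)|]. right. unfold Rdiv. ring.
Qed.

Lemma laplace_deriv_step n x : (0 < x)%R -> deriv_RC (laplace_deriv n) x (laplace_deriv (S n) x).
Proof.
  intros Hx. destruct (laplace_deriv_bound (x / 2) ltac:(lra)) as (A & HA & D). destruct (pow_exp_dom (x / 2) ltac:(lra)) as (Ca & HC & L).
  pose proof Bpos as HBp.
  unfold laplace_deriv. eapply (II_param_deriv (laplace_integrand n) (laplace_integrand (S n) x) x (x / 2) (B * (Ca * (INR (fact (S (S n))) / (x / 2 / 2) ^ S (S n))))); [lra| | |].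
  - intros h Hh. apply Rabs_def2 in Hh. eexists. apply D. lra.
  - apply D. lra.
  - intros h u Hh Hu. apply Rabs_def2 in Hh. specialize (L (S (S n)) u Hu).
    replace (laplace_integrand n (x + h)%R u - laplace_integrand n x u - RtoC h * laplace_integrand (S n) x u)
      with (RtoC (- u) ^ n * f u * (Cexp (- (RtoC x * RtoC u)) * (Cexp (- (RtoC h * RtoC u)) - 1 - - (RtoC h * RtoC u)))).
    2: { unfold laplace_integrand. replace (- (RtoC (x + h) * RtoC u)) with (- (RtoC x * RtoC u) + - (RtoC h * RtoC u)) by (rewrite RtoC_plus; ring).
         rewrite Cexp_add. simpl (_ ^ S n). rewrite RtoC_opp. ring. }
    rewrite !Cmod_mult, Cmod_pow, Cmod_R, Rabs_Ropp, (Rabs_pos_eq u), Cmod_exp_real by auto.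
    pose proof (Cexp_bound2 (- (RtoC h * RtoC u))) as E. rewrite Cmod_opp, Cmod_mult, !Cmod_R, (Rabs_pos_eq u) in E by auto.
    replace (Re (- (RtoC h * RtoC u))) with (- (h * u))%R in E by (unfold Re; simpl; ring).
    assert (M : (exp (- (x * u)) * Rmax 1 (exp (- (h * u))) <= exp (- (x / 2 * u)))%R).
    { pose proof (exp_pos (- (x * u))). destruct (Rmax_cases 1 (exp (- (h * u)))) as [R1|R1]; rewrite R1.
      - rewrite Rmult_1_r. apply exp_le. nra.
      - rewrite <- exp_plus. apply exp_le. nra. }
    specialize (HB u Hu). pose proof (Cmod_ge_0 (f u)). pose proof (pow_le u n Hu). pose proof (exp_pos (- (x * u))).
    apply Rle_trans with (u ^ n * B * ((Rabs h * u) ^ 2 * exp (- (x / 2 * u))))%R.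
    + apply Rmult_le_compat. now apply Rmult_le_pos. apply Rmult_le_pos; [lra|apply Cmod_ge_0]. apply Rmult_le_compat_l; auto.
      eapply Rle_trans; [apply Rmult_le_compat_l; [lra|apply E]|].
      replace (exp (- (x * u)) * ((Rabs h * u) ^ 2 * Rmax 1 (exp (- (h * u)))))%R with ((Rabs h * u) ^ 2 * (exp (- (x * u)) * Rmax 1 (exp (- (h * u)))))%R by ring.
      apply Rmult_le_compat_l; auto. apply pow2_ge_0.
    + replace (u ^ n * B * ((Rabs h * u) ^ 2 * exp (- (x / 2 * u))))%R with (B * Rabs h ^ 2 * (u ^ S (S n) * exp (- (x / 2 * u))))%R by (simpl; ring).
      replace (B * (Ca * (INR (fact (S (S n))) / (x / 2 / 2) ^ S (S n))) * Rabs h ^ 2 * Dom u)%R with (B * Rabs h ^ 2 * (Ca * (INR (fact (S (S n))) / (x / 2 / 2) ^ S (S n)) * Dom u))%R by ring.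
      apply Rmult_le_compat_l; auto. apply Rmult_le_pos; auto. apply pow2_ge_0.
Qed.
End LaplaceReal.

Lemma CInt_exp (x T : R) : (0 < x)%R -> (0 <= T)%R -> is_RInt (fun u => exp (- (x * u)))%R 0 T ((1 - exp (- (x * T))) / x)%R.
Proof.
  intros Hx HT. replace ((1 - exp (- (x * T))) / x)%R with (- exp (- (x * T)) / x - (- exp (- (x * 0)) / x))%R.
  2: { rewrite Rmult_0_r, Ropp_0, exp_0. field. lra. }
  apply (is_RInt_derive (V := R_CompleteNormedModule) (fun u => - exp (- (x * u)) / x)%R).
  - intros u _. auto_derive; auto. field. lra.
  - intros u _. apply continuity_pt_filterlim. apply derivable_continuous_pt. reg.
Qed.

(** No limit of f is assumed, only that f stays within e of c. The two transforms agree for large x,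
    hence for all x > 0 by analyticity. As x tends to 0, x times the Laplace transform stays within
    e of c, while x times the Cauchy integral tends to 0. *)
Lemma stieltjes_limit (G Lam f : R -> C) (K rho e x0 : R) (c : C) : dominated G K -> (forall t, (0 <= t)%R -> ccont Lam t) -> (0 < rho)%R ->
  (forall x t, (0 <= x)%R -> (0 <= t)%R -> (rho <= Cmod (RtoC x - Lam t))%R) ->
  (forall u, (0 <= u)%R -> ccont f u) -> (forall u, (0 <= u)%R -> (Cmod (f u - c) <= e)%R) ->
  (forall x, (x0 <= x)%R -> (0 < x)%R -> is_II (fun u => Cexp (- (RtoC x * RtoC u)) * f u) (II (fun t => G t * / (RtoC x - Lam t)))) ->
  (Cmod c <= e)%R.
Proof.
  intros HG HL Hrho Hd Hf He HE.
  assert (HB : forall u, (0 <= u)%R -> (Cmod (f u) <= e + Cmod c)%R).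
  { intros u Hu. replace (f u) with ((f u - c) + c) by ring. eapply Rle_trans; [apply Cmod_triangle|]. specialize (He u Hu). lra. }
  set (D := fun n x => laplace_deriv f n x - cauchy_deriv G Lam n x).
  assert (DD : forall n x, (0 < x)%R -> deriv_RC (D n) x (D (S n) x)).
  { intros n x Hx. unfold D. apply (deriv_RC_ext (fun x => laplace_deriv f n x + - (1) * cauchy_deriv G Lam n x)). { intros. ring. }
    replace (laplace_deriv f (S n) x - cauchy_deriv G Lam (S n) x) with (laplace_deriv f (S n) x + - (1) * cauchy_deriv G Lam (S n) x) by ring.
    apply deriv_RC_plus. now apply (laplace_deriv_step f (e + Cmod c)). apply deriv_RC_scal. now apply (cauchy_deriv_step G Lam K rho). }
  assert (Z : forall x, (0 < x)%R -> D 0%nat x = 0).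
  { intros x Hx. destruct (laplace_deriv_bound f (e + Cmod c) Hf HB (x / 2) ltac:(lra)) as (A & HA & P).
    (* A common radius on ]x/2, +oo[: the derivatives of the Laplace transform are controlled with
       x/4, those of the Cauchy integral with rho. *)
    set (r := Rmin (x / 2 / 2) rho). assert (Hr : (0 < r)%R) by (apply Rmin_glb_lt; lra).
    pose proof (dominated_pos _ _ HG) as HK.
    apply (analytic_zero D (x / 2) r (6 * A + 6 * K / rho)) with (b := (Rabs x0 + x)%R); auto; try lra.
    - intros n y Hy. apply DD. lra.
    - intros n y Hy. unfold D. destruct (P n y ltac:(lra)) as [_ P2]. pose proof (cauchy_deriv_bound G Lam K rho HG HL Hrho Hd n y ltac:(lra)) as P3.
      pose proof (INR_fact_lt_0 n).
      assert (I : forall z, (r <= z)%R -> (/ z ^ n <= / r ^ n)%R).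
      { intros z Hz. apply Rinv_le_contravar; [now apply pow_lt|]. apply pow_incr. lra. }
      pose proof (I _ (Rmin_l _ _)) as I1. pose proof (I _ (Rmin_r _ _)) as I2.
      unfold Cminus. eapply Rle_trans; [apply Cmod_triangle|]. rewrite Cmod_opp.
      assert (0 <= 6 * K / rho)%R by (apply Rdiv_le_0_compat; lra).
      apply Rle_trans with (6 * A * INR (fact n) * / r ^ n + 6 * K / rho * INR (fact n) * / r ^ n)%R; [|right; unfold Rdiv; ring].
      apply Rplus_le_compat.
      + eapply Rle_trans; [apply P2|]. unfold Rdiv at 1. apply Rmult_le_compat_l; auto. apply Rmult_le_pos; lra.
      + eapply Rle_trans; [apply P3|]. unfold Rdiv at 1. apply Rmult_le_compat_l; auto. apply Rmult_le_pos; lra.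
    - intros y Hy. pose proof (Rle_abs x0). pose proof (Rabs_pos x0). unfold D, laplace_deriv, cauchy_deriv.
      assert (E1 : II (laplace_integrand f 0 y) = II (fun t => G t * / (RtoC y - Lam t))).
      { apply II_is. apply (is_II_ext (fun u => Cexp (- (RtoC y * RtoC u)) * f u)). { intros. unfold laplace_integrand. simpl. ring. } apply HE; lra. }
      rewrite E1. rewrite (II_ext (cauchy_integrand G Lam 0 y) (fun t => G t * / (RtoC y - Lam t)) _ (cauchy_integrand_dom G Lam K rho HG HL Hrho Hd 0 y ltac:(lra))).
      { ring. } intros. unfold cauchy_integrand. simpl. ring. }
  apply le_epsilon. intros eps Heps.
  pose proof (dominated_pos _ _ HG) as HK. set (Q := (6 * K / rho)%R). assert (HQ : (0 <= Q)%R) by (apply Rdiv_le_0_compat; lra).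
  (* Q bounds the Cauchy integral on the whole positive axis, so at this x its product with x is at
     most eps. *)
  set (x := (eps / (Q + 1))%R). assert (Hx : (0 < x)%R) by (apply Rdiv_lt_0_compat; lra).
  assert (HS : (Cmod (laplace_deriv f 0 x) <= Q)%R).
  { specialize (Z x Hx). unfold D in Z. replace (laplace_deriv f 0 x) with (cauchy_deriv G Lam 0 x + (laplace_deriv f 0 x - cauchy_deriv G Lam 0 x)) by ring. rewrite Z, Cplus_0_r.
    eapply Rle_trans; [apply (cauchy_deriv_bound G Lam K rho HG HL Hrho Hd); lra|]. simpl. fold Q. lra. }
  (* The weight x e^(-xu) has mass 1 on [0, +oo[, so x times the transform is a mean of values of
     f. *)
  assert (Hlin : (Cmod (RtoC x * laplace_deriv f 0 x - c) <= e)%R).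
  { pose proof (laplace_deriv_bound f (e + Cmod c) Hf HB x Hx) as (A & _ & P). destruct (P 0%nat x (Rle_refl x)) as [Dm _].
    pose proof (dominated_ex _ _ Dm) as EX. fold (laplace_deriv f 0 x) in EX.
    apply le_epsilon. intros d Hdd.
    destruct (EX (d / (2 * x))%R) as (T1 & HT1 & L1); [apply Rdiv_lt_0_compat; lra|].
    destruct (lin_exp_small (Cmod c) 0 x (Cmod_ge_0 c) (Rle_refl 0) Hx (d / 2)%R ltac:(lra)) as (T2 & HT2 & L2).
    set (T := Rmax T1 T2). specialize (L1 T (Rmax_l _ _)). specialize (L2 T (Rmax_r _ _)). rewrite Rmult_0_l, Rplus_0_r in L2.
    assert (HT : (0 <= T)%R) by (eapply Rle_trans; [apply HT1|apply Rmax_l]).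
    set (I := CInt (laplace_integrand f 0 x) 0 T) in *. set (E := exp (- (x * T))) in *.
    assert (I2 : is_CInt (fun u => Cexp (- (RtoC x * RtoC u)) * (f u - c)) 0 T (I + - c * RtoC ((1 - E) / x))).
    { apply (is_CInt_ext (fun u => laplace_integrand f 0 x u + - c * RtoC (exp (- (x * u))))).
      { intros u Hu. unfold laplace_integrand. simpl. replace (Cexp (- (RtoC x * RtoC u))) with (RtoC (exp (- (x * u)))). ring.
        unfold Cexp. replace (Im (- (RtoC x * RtoC u))) with 0%R by (unfold Im; simpl; ring).
        replace (Re (- (RtoC x * RtoC u))) with (- (x * u))%R by (unfold Re; simpl; ring). rewrite cos_0, sin_0. apply injective_projections; simpl; ring. }
      apply is_CInt_plus. { apply CInt_correct_le; auto. intros u Hu. now apply Dm. }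
      apply is_CInt_scal. apply (is_RInt_ext (V := C_R_NormedModule) (fun u => (exp (- (x * u))%R, 0%R) : C)). { intros; reflexivity. }
      apply (is_RInt_fct_extend_pair (U := R_NormedModule) (V := R_NormedModule)).
      - simpl. now apply CInt_exp.
      - simpl. replace 0%R with (scal (T - 0)%R 0%R) at 2 by (apply Rmult_0_r). apply (is_RInt_const (V := R_NormedModule)). }
    assert (B2 : (Cmod (I + - c * RtoC ((1 - E) / x)) <= e * ((1 - E) / x))%R).
    { apply (is_CInt_norm (fun u => Cexp (- (RtoC x * RtoC u)) * (f u - c)) (fun u => e * exp (- (x * u)))%R 0 T); auto.
      - intros u Hu. rewrite Cmod_mult, Cmod_exp_real. specialize (He u ltac:(lra)). pose proof (exp_pos (- (x * u))). nra.
      - apply (is_RInt_scal (V := R_NormedModule)). now apply CInt_exp. }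
    assert (0 < E)%R by apply exp_pos. assert (0 <= e)%R by (eapply Rle_trans; [apply Cmod_ge_0|apply (He 0%R); lra]).
    assert (B3 : (x * (e * ((1 - E) / x)) <= e)%R). { replace (x * (e * ((1 - E) / x)))%R with (e * (1 - E))%R by (field; lra). nra. }
    replace (RtoC x * laplace_deriv f 0 x - c) with (RtoC x * (I + - c * RtoC ((1 - E) / x)) + - (RtoC x * (I - laplace_deriv f 0 x)) + - (c * RtoC E)).
    2: { unfold Rdiv. rewrite RtoC_mult, RtoC_inv, RtoC_minus by lra. field. apply Cmod_gt_0. rewrite Cmod_R, Rabs_pos_eq; lra. }
    eapply Rle_trans; [apply Cmod_triangle|]. eapply Rle_trans; [apply Rplus_le_compat_r, Cmod_triangle|].
    rewrite !Cmod_opp, !Cmod_mult, !Cmod_R, (Rabs_pos_eq x), (Rabs_pos_eq E) by lra.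
    apply (Rmult_le_compat_l x) in B2; [|lra]. apply (Rmult_lt_compat_l x) in L1; [|lra].
    replace (x * (d / (2 * x)))%R with (d / 2)%R in L1 by (field; lra). lra. }
  replace c with (RtoC x * laplace_deriv f 0 x + - (RtoC x * laplace_deriv f 0 x - c)) by ring.
  eapply Rle_trans; [apply Cmod_triangle|]. rewrite Cmod_opp, Cmod_mult, Cmod_R, Rabs_pos_eq by lra.
  assert (x * Cmod (laplace_deriv f 0 x) <= x * (Q + 1))%R by (apply Rmult_le_compat_l; lra).
  assert (x * (Q + 1) = eps)%R by (unfold x; field; lra). lra.
Qed.

(** * The inverse Laplace transform *)

Section Inverse.
Variables (H : C -> Prop) (w0 k sl : R) (g : C -> C) (M : R).
Hypothesis Hk : (0 < k)%R.
Hypothesis HS : (1 <= sl)%R.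
Hypothesis HN : nbhd_minfty H.
Hypothesis HL : forall w, H w -> (Re w <= -1)%R.
Hypothesis Hw0 : H (RtoC w0).
Hypothesis HC : forall eta : R, H (Xc w0 k sl eta, eta).
Hypothesis Hg : E0 H g.
Hypothesis HM : forall z, H z -> (Cmod (g z) <= M)%R.

Let Hw : (w0 <= -1)%R := w0_le H w0 HL Hw0.
Let Hgh : hol H g := E0_hol H g Hg.
Let Ho : open_dom H := nbhd_open H HN.
Let Hdn : down_dom H := nbhd_down H HN.

(** Enough for absolute convergence of the branch integral at every p with s Im p < 0, and stable
    under multiplication by - z, that is, under differentiation in p. *)
Definition nice (s : R) (q : C -> C) : Prop := curve_cont w0 k sl s q /\ exists B N, poly_bound w0 k sl s q B N.

Lemma nice_dom s q p : (s * s = 1)%R -> (s * Im p < 0)%R -> nice s q -> exists K, dominated (CF w0 k sl s q p) K.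
Proof. intros Hs Hp (Q1 & B & N & Q2). now apply (interior_dom1 w0 k sl Hw Hk HS s q B N). Qed.

Lemma nice_opp_id s q : nice s q -> nice s (fun z => - z * q z).
Proof.
  intros (Q1 & B & N & Q2). split; [now apply curve_cont_opp_id|]. exists B, (S N). now apply poly_bound_opp_id.
Qed.

Lemma decay_nice s q B m : (s * s = 1)%R -> curve_cont w0 k sl s q -> decay_bound w0 k sl s q B m -> nice s q.
Proof.
  intros Hs Q1 [HB Q2]. split; auto. exists B, 0%nat. split; auto. intros t Ht. simpl. rewrite Rmult_1_r.
  eapply Rle_trans; [now apply Q2|]. pose proof (cur_mod_ge1 w0 k sl Hw Hk s t Hs) as C1.
  pose proof (pow_R1_Rle _ m C1). apply (Rmult_le_reg_r (Cmod (cur w0 k sl s t) ^ m)); [lra|].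
  unfold Rdiv. rewrite Rmult_assoc, Rinv_l by lra. nra.
Qed.

Lemma nice_gn s n : (s * s = 1)%R -> nice s (gn g n).
Proof.
  intros Hs. apply (decay_nice s _ M n); auto.
  - apply (H_cont_curve H); auto. now apply gn_hol.
  - now apply (gn_decay H).
Qed.

Lemma CL_comb s q1 q2 q3 (a b p : C) : (s * s = 1)%R -> (s * Im p < 0)%R -> nice s q1 -> nice s q2 ->
  (forall t, (0 <= t)%R -> q3 (cur w0 k sl s t) = a * q1 (cur w0 k sl s t) + b * q2 (cur w0 k sl s t)) ->
  CL w0 k sl s q3 p = a * CL w0 k sl s q1 p + b * CL w0 k sl s q2 p.
Proof.
  intros Hs Hp N1 N2 E. destruct (nice_dom s q1 p Hs Hp N1) as (K1 & D1). destruct (nice_dom s q2 p Hs Hp N2) as (K2 & D2).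
  pose proof (dominated_plus _ _ _ _ (dominated_scal a _ _ D1) (dominated_scal b _ _ D2)) as D.
  transitivity (II (fun t => a * CF w0 k sl s q1 p t + b * CF w0 k sl s q2 p t)).
  - symmetry. refine (II_ext _ _ _ D _). intros t Ht. unfold CF, Fint. rewrite E by auto. ring.
  - etransitivity; [exact (II_plus _ _ _ _ (dominated_scal a _ _ D1) (dominated_scal b _ _ D2))|].
    apply f_equal2; [exact (II_scal a _ _ D1)|exact (II_scal b _ _ D2)].
Qed.

Lemma laplace_gn p : slit p -> laplace H w0 g p = LT w0 k sl (gn g 0) p.
Proof. intros Hp. exact (prim_iter_LT H w0 k sl g M Hk HS HN HL Hw0 HC Hg HM 0 p Hp). Qed.

Lemma LT_gn_deriv n p : slit p -> deriv_CC (LT w0 k sl (gn g (S n))) p (LT w0 k sl (gn g n) p).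
Proof.
  intros Hp. apply deriv_CC_is_derive. exact (proj1 (LT_gn_prim H w0 k sl g M Hk HS HN HL Hw0 HC Hg HM n) p Hp).
Qed.

Lemma LT_gn_curve n s p : (s * s = 1)%R -> (s * Im p < 0)%R -> LT w0 k sl (gn g n) p = CL w0 k sl s (gn g n) p.
Proof.
  intros Hs Hp. apply (LT_curve H w0 k sl Hk HS Ho Hdn HL Hw0 HC (gn g n) M); auto. now apply gn_hol. now apply gn_bounded.
Qed.

Lemma slit_curve s p : (s * Im p < 0)%R -> slit p.
Proof. intros Hp [E _]. rewrite E in Hp. lra. Qed.

Lemma CL_exp_deriv (w : C) s q p : (s * s = 1)%R -> (s * Im p < 0)%R -> nice s q ->
  deriv_CC (fun p => Cexp (p * w) * CL w0 k sl s q p) p (Cexp (p * w) * (w * CL w0 k sl s q p + CL w0 k sl s (fun z => - z * q z) p)).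
Proof.
  intros Hs Hp (Q1 & B & N & Q2).
  replace (Cexp (p * w) * (w * CL w0 k sl s q p + CL w0 k sl s (fun z => - z * q z) p))
    with (w * Cexp (p * w) * CL w0 k sl s q p + Cexp (p * w) * CL w0 k sl s (fun z => - z * q z) p) by ring.
  apply (deriv_CC_mult (fun p => Cexp (p * w)) (CL w0 k sl s q)); [apply deriv_Cexp_lin|].
  now apply (CL_deriv w0 k sl Hw Hk HS s q B N).
Qed.

Section FixW.
Variable w : C.
Hypothesis Wx : (Re w <= -2)%R.
Hypothesis Wstar : (Re w / 2 <= Xc w0 k sl (Rabs (Re w) + Rabs (Im w)))%R.

Let cu (s t : R) : C := cur w0 k sl s t.

Lemma nice_qm s m : (s * s = 1)%R -> nice s (qm g w m).
Proof.
  intros Hs. apply (decay_nice s _ (M * Cmod w ^ m) m); auto. now apply (qm_cont H). now apply (qm_decay H).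
Qed.

(* e^(p w) (I L g - w I^2 L g + w^2 I^3 L g) is what three integrations by parts of h(p) e^(p w) produce;
   branch_part accounts for the remainder. *)
Definition slit_part (p : C) : C := Cexp (p * w) * (LT w0 k sl (gn g 1) p + (- w * LT w0 k sl (gn g 2) p + w * w * LT w0 k sl (gn g 3) p)).
Definition branch_part (s : R) (p : C) : C := Cexp (p * w) * CL w0 k sl s (qm g w 3) p.
Definition ray_prim (s : R) (p : C) : C := slit_part p + branch_part s p.

Lemma slit_part_deriv p : slit p -> deriv_CC slit_part p (Cexp (p * w) * (LT w0 k sl (gn g 0) p + w * w * w * LT w0 k sl (gn g 3) p)).
Proof.
  intros Hp. set (L := fun n => LT w0 k sl (gn g n) p).
  replace (Cexp (p * w) * (LT w0 k sl (gn g 0) p + w * w * w * LT w0 k sl (gn g 3) p))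
    with (w * Cexp (p * w) * (L 1%nat + (- w * L 2%nat + w * w * L 3%nat)) + Cexp (p * w) * (L 0%nat + (- w * L 1%nat + w * w * L 2%nat))) by (unfold L; ring).
  apply (deriv_CC_mult (fun p => Cexp (p * w))
    (fun p => LT w0 k sl (gn g 1) p + (- w * LT w0 k sl (gn g 2) p + w * w * LT w0 k sl (gn g 3) p))); [apply deriv_Cexp_lin|].
  apply (deriv_CC_plus (LT w0 k sl (gn g 1))); [now apply LT_gn_deriv|].
  apply (deriv_CC_plus (fun p => - w * LT w0 k sl (gn g 2) p)); apply deriv_CC_scal; now apply LT_gn_deriv.
Qed.

Lemma curve_alg s t : (s * s = 1)%R -> cu s t <> 0 /\ w - cu s t <> 0 /\ - cu s t <> 0.
Proof.
  intros Hs. assert (Hz : cu s t <> 0) by now apply cur_neq_0. split; [|split]; auto. now apply w_neq.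
  intros E. apply Hz. replace (cu s t) with (- - cu s t) by ring. rewrite E. ring.
Qed.

Lemma branch_part_deriv s p : (s * s = 1)%R -> (s * Im p < 0)%R -> deriv_CC (branch_part s) p (- (w * w * w) * (Cexp (p * w) * CL w0 k sl s (gn g 3) p)).
Proof.
  intros Hs Hp. pose proof (nice_qm s 3 Hs) as NQ. pose proof (nice_gn s 3 Hs) as NG.
  replace (- (w * w * w) * (Cexp (p * w) * CL w0 k sl s (gn g 3) p))
    with (Cexp (p * w) * (w * CL w0 k sl s (qm g w 3) p + CL w0 k sl s (fun z => - z * qm g w 3 z) p)); [now apply CL_exp_deriv|].
  pose proof (CL_comb s (gn g 3) (gn g 3) (fun z => - (w * w * w) * gn g 3 z) (- (w * w * w)) 0 p Hs Hp NG NG) as E1.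
  rewrite (CL_comb s (qm g w 3) (fun z => - z * qm g w 3 z) (fun z => - (w * w * w) * gn g 3 z) w 1 p Hs Hp NQ (nice_opp_id s _ NQ)) in E1.
  - transitivity (Cexp (p * w) * (w * CL w0 k sl s (qm g w 3) p + 1 * CL w0 k sl s (fun z => - z * qm g w 3 z) p)); [ring|].
    rewrite E1; [ring|]. intros; ring.
  - intros t Ht. unfold qm, gn. destruct (curve_alg s t Hs) as (A1 & A2 & A3). unfold cu in *. set (z := cur w0 k sl s t) in *. simpl. field. auto.
Qed.

Lemma ray_prim_deriv s p : (s * s = 1)%R -> (s * Im p < 0)%R -> deriv_CC (ray_prim s) p (laplace H w0 g p * Cexp (p * w)).
Proof.
  intros Hs Hp. pose proof (slit_curve s p Hp) as Sp. pose proof (deriv_CC_plus _ _ _ _ _ (slit_part_deriv p Sp) (branch_part_deriv s p Hs Hp)) as D.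
  rewrite (laplace_gn p Sp).
  replace (LT w0 k sl (gn g 0) p * Cexp (p * w)) with
    (Cexp (p * w) * (LT w0 k sl (gn g 0) p + w * w * w * LT w0 k sl (gn g 3) p) + - (w * w * w) * (Cexp (p * w) * CL w0 k sl s (gn g 3) p)); auto.
  rewrite (LT_gn_curve 3 s p Hs Hp). ring.
Qed.

Definition ray_form (s : R) (p : C) : C := Cexp (p * w) * CL w0 k sl s (qm g w 0) p.

(** From q_(m+1) = q_m - (- w)^m [gn (S m)], used three times. Each form has its task: [ray_prim] is
    controlled down to the real point - eps, thanks to the decay of q_3, and [ray_form] is one
    integral with a pure exponential in p, fit for a Laplace transform along the ray. *)
Lemma ray_prim_form s p : (s * s = 1)%R -> (s * Im p < 0)%R -> ray_prim s p = ray_form s p.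
Proof.
  intros Hs Hp.
  assert (St : forall m, CL w0 k sl s (qm g w (S m)) p = 1 * CL w0 k sl s (qm g w m) p + - (- w) ^ m * CL w0 k sl s (gn g (S m)) p).
  { intros m. apply CL_comb; auto. now apply nice_qm. now apply nice_gn. intros t Ht.
    destruct (curve_alg s t Hs) as (A1 & A2 & A3). unfold cu in *. unfold qm, gn. set (z := cur w0 k sl s t) in *.
    assert (E : (- w) ^ m * (/ - z) ^ m = (w * / z) ^ m). { rewrite <- Cpow_mult_l. f_equal. field. auto. }
    simpl. transitivity (g z * (w * / z * (w * / z) ^ m) * / (w - z)); [ring|].
    transitivity (1 * (g z * (w * / z) ^ m * / (w - z)) + - (g z * / - z) * ((- w) ^ m * (/ - z) ^ m)); [|ring].
    rewrite E. set (X := (w * / z) ^ m). field. auto. }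
  unfold ray_prim, slit_part, branch_part, ray_form. rewrite !(LT_gn_curve _ s p Hs Hp), (St 2%nat), (St 1%nat), (St 0%nat). simpl. ring.
Qed.

(** Advancing by u ze multiplies the integrand by e^(u ze (w - z)). An upper bound of Re (ze (w -
    z)) along the branch is therefore a rate of growth for the integral. *)
Lemma growth s q (p1 ze : C) (c4 : R) : (s * s = 1)%R -> (s * Im p1 < 0)%R -> nice s q ->
  (forall t, (0 <= t)%R -> (Re (ze * (w - cu s t)) <= c4)%R) -> exists K, (0 <= K)%R /\ forall u, (0 <= u)%R ->
  (Cmod (Cexp ((p1 + RtoC u * ze) * w) * CL w0 k sl s q (p1 + RtoC u * ze)) <= K * exp (u * c4))%R.
Proof.
  intros Hs Hp Nq Hc. destruct (nice_dom s q p1 Hs Hp Nq) as (K & D). pose proof (dominated_pos _ _ D) as HK.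
  exists (exp (Re (p1 * w)) * (6 * K))%R. split. { apply Rmult_le_pos; [apply Rlt_le, exp_pos|lra]. }
  intros u Hu. rewrite Cmod_mult, Cmod_Cexp. set (p := p1 + RtoC u * ze).
  assert (D2 : dominated (CF w0 k sl s q p) (K * exp (u * (c4 - Re (ze * w))))).
  { apply Fint_dom; try (intros; apply cur_cont; auto); try (intros; apply dcur_cont; auto). apply Nq.
    intros t Ht. pose proof (proj2 D t Ht) as B. unfold CF in B. rewrite Fint_mod in B. specialize (Hc t Ht). unfold cu in Hc.
    set (z := cur w0 k sl s t) in *.
    replace (- Re (p * z))%R with (- Re (p1 * z) + u * - Re (ze * z))%R by (unfold p, Re; simpl; ring).
    replace (Re (ze * (w - z))) with (Re (ze * w) - Re (ze * z))%R in Hc by (unfold Re; simpl; ring).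
    rewrite exp_plus. rewrite <- Rmult_assoc.
    replace (K * exp (u * (c4 - Re (ze * w))) * Dom t)%R with (K * Dom t * exp (u * (c4 - Re (ze * w))))%R by ring.
    apply Rmult_le_compat; auto; try (apply Rlt_le, exp_pos).
    - apply Rmult_le_pos; [apply Rmult_le_pos; apply Cmod_ge_0|apply Rlt_le, exp_pos].
    - apply exp_le. apply Rmult_le_compat_l; lra. }
  apply II_bound in D2. unfold CL, Lap. unfold CF in D2.
  eapply Rle_trans; [apply Rmult_le_compat_l; [apply Rlt_le, exp_pos|apply D2]|]. right.
  replace (Re (p * w)) with (Re (p1 * w) + u * Re (ze * w))%R by (unfold p, Re; simpl; ring).
  replace (u * c4)%R with (u * Re (ze * w) + u * (c4 - Re (ze * w)))%R by ring. rewrite !exp_plus. ring.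
Qed.

(** After multiplication by the conjugate of ze the quantity is x conj(ze) - |ze|^2 (w - z). Up to
    height |Re w| + |Im w| its real part is large because w lies to the left of the curve; above,
    its imaginary part is, because the branch is higher than w. In both cases the contribution of x
    has the favourable sign. *)
Lemma cut_dist s (ze : C) (x t : R) : (s * s = 1)%R -> (s * Im ze < 0)%R -> (0 <= Re ze)%R -> (0 <= x)%R -> (0 <= t)%R ->
  (Cmod ze <= Cmod (RtoC x - ze * (w - cu s t)))%R.
Proof.
  intros Hs Hi Hr Hx Ht. set (A := RtoC x - ze * (w - cu s t)).
  assert (Hz : (0 < Cmod ze)%R). { apply Cmod_gt_0. intros E. rewrite E in Hi. simpl in Hi. lra. }
  apply (Rmult_le_reg_r (Cmod ze)); auto. rewrite Cmod_sq.
  assert (E : (Cmod A * Cmod ze = Cmod (A * Cconj ze))%R). { rewrite Cmod_mult. f_equal. unfold Cconj, Cmod; simpl. f_equal. ring. }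
  rewrite E. set (d := (Re ze * Re ze + Im ze * Im ze)%R). assert (Hd : (0 <= d)%R) by (unfold d; nra).
  assert (ER : Re (A * Cconj ze) = (x * Re ze - d * (Re w - Xc w0 k sl t))%R).
  { unfold A, d, cu, cur, Re, Im; simpl. ring. }
  assert (EI : Im (A * Cconj ze) = (- (x * Im ze) - d * (Im w - s * t))%R).
  { unfold A, d, cu, cur, Re, Im; simpl. ring. }
  pose proof (Rabs_pos (Im w)). pose proof (Rabs_pos (Re w)).
  destruct (Rle_dec t (Rabs (Re w) + Rabs (Im w))) as [L|L].
  - eapply Rle_trans; [|apply re_le_Cmod]. eapply Rle_trans; [|apply Rle_abs]. rewrite ER.
    assert (Xc w0 k sl (Rabs (Re w) + Rabs (Im w)) <= Xc w0 k sl t)%R by (apply Xc_mono; auto; rewrite (Rabs_pos_eq t), (Rabs_pos_eq (_ + _)); lra).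
    assert (0 <= x * Re ze)%R by (apply Rmult_le_pos; auto). nra.
  - eapply Rle_trans; [|apply Im_le_Cmod]. rewrite <- (Rmult_1_l (Rabs _)), <- (sgn_abs s Hs), <- Rabs_mult.
    eapply Rle_trans; [|apply Rle_abs]. rewrite EI.
    assert (s * Im w <= Rabs (Im w))%R by (eapply Rle_trans; [apply Rle_abs|rewrite Rabs_mult, (sgn_abs s Hs); lra]).
    rewrite (Rabs_left1 (Re w)) in * by lra.
    replace (s * (- (x * Im ze) - d * (Im w - s * t)))%R with (x * - (s * Im ze) + d * ((s * s) * t - s * Im w))%R by ring.
    rewrite Hs. assert (0 <= x * - (s * Im ze))%R by (apply Rmult_le_pos; lra). nra.
Qed.
Lemma nice_cut s (ze : C) (x : R) : (s * s = 1)%R -> (s * Im ze < 0)%R -> (0 <= Re ze)%R -> (0 <= x)%R ->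
  nice s (fun z => qm g w 0 z * / (RtoC x - ze * (w - z))).
Proof.
  intros Hs Hi Hr Hx. destruct (nice_qm s 0 Hs) as (Q1 & B & N & HB & Q2).
  assert (Hz : (0 < Cmod ze)%R). { apply Cmod_gt_0. intros E. rewrite E in Hi. simpl in Hi. lra. }
  split.
  - intros t Ht. apply ccont_mult; [now apply Q1|]. apply ccont_inv.
    + apply ccont_minus; [apply ccont_const|]. apply ccont_mult; [apply ccont_const|]. apply ccont_minus; [apply ccont_const|now apply cur_cont].
    + apply Cmod_gt_0. pose proof (cut_dist s ze x t Hs Hi Hr Hx Ht). unfold cu in *. lra.
  - exists (B * / Cmod ze)%R, N. split. { apply Rmult_le_pos; auto. apply Rlt_le, Rinv_0_lt_compat; auto. }
    intros t Ht. pose proof (cut_dist s ze x t Hs Hi Hr Hx Ht) as Dd. unfold cu in Dd.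
    rewrite Cmod_mult, Cmod_inv by (apply Cmod_gt_0; lra).
    replace (B * / Cmod ze * Cmod (cur w0 k sl s t) ^ N)%R with (B * Cmod (cur w0 k sl s t) ^ N * / Cmod ze)%R by ring.
    apply Rmult_le_compat; auto. apply Cmod_ge_0. apply Rlt_le, Rinv_0_lt_compat; lra. apply Rinv_le_contravar; lra.
Qed.

Lemma line_deriv s q (p1 ze : C) u : (s * s = 1)%R -> (s * Im p1 < 0)%R -> (s * Im ze < 0)%R -> (0 <= u)%R -> nice s q ->
  deriv_RC (fun u => Cexp ((p1 + RtoC u * ze) * w) * CL w0 k sl s q (p1 + RtoC u * ze)) u
   (ze * (Cexp ((p1 + RtoC u * ze) * w) * (w * CL w0 k sl s q (p1 + RtoC u * ze) + CL w0 k sl s (fun z => - z * q z) (p1 + RtoC u * ze)))).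
Proof.
  intros Hs H1 H2 Hu Nq.
  apply (deriv_RC_comp (fun p => Cexp (p * w) * CL w0 k sl s q p) (fun u => p1 + RtoC u * ze)); [apply deriv_RC_id_mult|].
  apply CL_exp_deriv; auto. unfold Im in *. simpl. nra.
Qed.

(** Instead of exchanging two integrals, the u-integral is computed from an explicit primitive:
    dividing q_0 by x - ze (w - z) undoes, up to sign, the derivative in u of e^(-xu) e^(p (w - z)).
    The condition on x makes this primitive O(e^(-u)). *)
Lemma stieltjes_formula s (p1 ze : C) (x c4 : R) : (s * s = 1)%R -> (s * Im p1 < 0)%R -> (s * Im ze < 0)%R -> (0 <= Re ze)%R -> (0 <= x)%R ->
  (forall t, (0 <= t)%R -> (Re (ze * (w - cu s t)) <= c4)%R) -> (c4 + 1 <= x)%R ->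
  is_II (fun u => Cexp (- (RtoC x * RtoC u)) * ray_form s (p1 + RtoC u * ze))
    (Cexp (p1 * w) * CL w0 k sl s (fun z => qm g w 0 z * / (RtoC x - ze * (w - z))) p1).
Proof.
  intros Hs Hp Hi Hr Hx Hc Hxc. pose proof (nice_cut s ze x Hs Hi Hr Hx) as Nq.
  assert (Hz : (0 < Cmod ze)%R). { apply Cmod_gt_0. intros E. rewrite E in Hi. simpl in Hi. lra. }
  set (qk := fun z => qm g w 0 z * / (RtoC x - ze * (w - z))) in *.
  set (P := fun u => Cexp (RtoC u * - RtoC x) * (Cexp ((p1 + RtoC u * ze) * w) * CL w0 k sl s qk (p1 + RtoC u * ze))).
  assert (DP : forall u, (0 <= u)%R -> deriv_RC P u (- (Cexp (- (RtoC x * RtoC u)) * ray_form s (p1 + RtoC u * ze)))).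
  { intros u Hu. pose proof (deriv_RC_mult _ _ _ _ _ (deriv_Cexp_line (- RtoC x) u) (line_deriv s qk p1 ze u Hs Hp Hi Hu Nq)) as D.
    set (p := p1 + RtoC u * ze) in *. assert (Hpi : (s * Im p < 0)%R) by (unfold p, Im in *; simpl; nra).
    replace (- (Cexp (- (RtoC x * RtoC u)) * ray_form s p)) with
     (- RtoC x * Cexp (RtoC u * - RtoC x) * (Cexp (p * w) * CL w0 k sl s qk p) + Cexp (RtoC u * - RtoC x) * (ze * (Cexp (p * w) * (w * CL w0 k sl s qk p + CL w0 k sl s (fun z => - z * qk z) p)))); auto.
    replace (- (RtoC x * RtoC u)) with (RtoC u * - RtoC x) by ring. unfold ray_form.
    pose proof (CL_comb s qk (fun z => - z * qk z) (fun z => - (1) * qm g w 0 z) (- RtoC x + ze * w) ze p Hs Hpi Nq (nice_opp_id s _ Nq)) as E1.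
    rewrite (CL_comb s (qm g w 0) (qm g w 0) (fun z => - (1) * qm g w 0 z) (- (1)) 0 p Hs Hpi (nice_qm s 0 Hs) (nice_qm s 0 Hs)) in E1.
    - transitivity (Cexp (RtoC u * - RtoC x) * Cexp (p * w) * ((- RtoC x + ze * w) * CL w0 k sl s qk p + ze * CL w0 k sl s (fun z => - z * qk z) p)); [ring|].
      rewrite <- E1; [ring|]. intros t Ht. unfold qk. pose proof (cut_dist s ze x t Hs Hi Hr Hx Ht) as Dd. unfold cu in Dd.
      set (z := cur w0 k sl s t) in *. assert (Hn : RtoC x - ze * (w - z) <> 0) by (apply Cmod_gt_0; lra).
      set (Q := qm g w 0 z). transitivity (- (Q * ((RtoC x - ze * (w - z)) * / (RtoC x - ze * (w - z))))); [rewrite Cinv_r by auto; ring|ring].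
    - intros; ring. }
  destruct (growth s qk p1 ze c4 Hs Hp Nq Hc) as (K & HK & G).
  intros e He. destruct (lin_exp_small K 0 1 HK (Rle_refl 0) Rlt_0_1 e He) as (T0 & HT0 & L). exists T0. split; [lra|]. intros T HT.
  specialize (L T HT). rewrite Rmult_0_l, Rplus_0_r, Rmult_1_l in L.
  assert (EI : CInt (fun u => Cexp (- (RtoC x * RtoC u)) * ray_form s (p1 + RtoC u * ze)) 0 T = - P T - (- P 0%R)).
  { apply is_CInt_unique. apply (CInt_FTC (fun u => - P u)); [lra| |].
    - intros u Hu. replace (Cexp (- (RtoC x * RtoC u)) * ray_form s (p1 + RtoC u * ze)) with (- (1) * - (Cexp (- (RtoC x * RtoC u)) * ray_form s (p1 + RtoC u * ze))) by ring.
      apply (deriv_RC_ext (fun u => - (1) * P u)); [intros; ring|]. apply deriv_RC_scal, DP; lra.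
    - intros u Hu. apply ccont_mult.
      + apply ccont_Cexp, ccont_opp, ccont_mult; [apply ccont_const|]. apply ccont_RtoC, derivable_continuous_pt; reg.
      + eapply deriv_RC_cont. apply (line_deriv s (qm g w 0) p1 ze u); auto; [lra|now apply nice_qm]. }
  rewrite EI. assert (P0 : P 0%R = Cexp (p1 * w) * CL w0 k sl s qk p1).
  { unfold P. replace (p1 + RtoC 0 * ze) with p1 by ring. replace (RtoC 0 * - RtoC x) with (RtoC 0) by ring. rewrite Cexp_0. ring. }
  rewrite <- P0. replace (- P T - - P 0%R - P 0%R) with (- P T) by ring. rewrite Cmod_opp. unfold P. rewrite Cmod_mult, Cmod_Cexp.
  eapply Rle_lt_trans; [|apply L]. specialize (G T ltac:(lra)).
  eapply Rle_trans; [apply Rmult_le_compat_l; [apply Rlt_le, exp_pos|apply G]|].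
  replace (Re (RtoC T * - RtoC x)) with (- (T * x))%R by (unfold Re; simpl; ring).
  replace (exp (- (T * x)) * (K * exp (T * c4)))%R with (K * (exp (- (T * x)) * exp (T * c4)))%R by ring. rewrite <- exp_plus.
  apply Rmult_le_compat_l; auto. apply exp_le. nra.
Qed.

Lemma ray_form_limit_zero s (eps : R) (ze c : C) : (s * s = 1)%R -> (s * Im ze < 0)%R -> (0 <= Re ze)%R ->
  (forall e, (0 < e)%R -> exists T0, forall T, (T0 <= T)%R -> (Cmod (ray_form s (RtoC (- eps) + RtoC T * ze) - c) < e)%R) -> c = 0.
Proof.
  intros Hs Hi Hr Hlim. apply Cmod_small_eq. intros e He. destruct (Hlim e He) as (T0 & L).
  assert (Hz : (0 < Cmod ze)%R). { apply Cmod_gt_0. intros E. rewrite E in Hi. simpl in Hi. lra. }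
  (* The base point is moved along the ray to parameter T1: from there on [ray_form] stays within e
     of c, and T1 > 0 takes p1 off the real axis. *)
  set (T1 := Rmax 1 T0). assert (HT1 : (1 <= T1)%R) by apply Rmax_l. assert (HT0 : (T0 <= T1)%R) by apply Rmax_r.
  set (p1 := RtoC (- eps) + RtoC T1 * ze).
  assert (Hp1 : (s * Im p1 < 0)%R) by (unfold p1, Im in *; simpl; nra).
  (* A slope so small that Re ze mu <= |Im ze|: the logarithmic drift of the branch to the left is
     then outweighed by its height, and Re (ze (w - z)) is bounded above. *)
  set (mu := (- (s * Im ze) / (Re ze + 1))%R). assert (Hmu : (0 < mu)%R) by (apply Rdiv_lt_0_compat; lra).
  destruct (wide w0 k sl Hk HS mu Hmu) as (x0 & Hx0 & Wd).
  set (c4 := (Re (ze * w) + Re ze * - x0)%R).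
  assert (Hc4 : forall t, (0 <= t)%R -> (Re (ze * (w - cu s t)) <= c4)%R).
  { intros t Ht. specialize (Wd t). rewrite (Rabs_pos_eq t) in Wd by auto.
    replace (Re (ze * (w - cu s t))) with (Re (ze * w) - Re ze * Xc w0 k sl t + s * Im ze * t)%R by (unfold cu, cur, Re, Im; simpl; ring).
    assert (Re ze * (x0 - mu * t) <= Re ze * Xc w0 k sl t)%R by (apply Rmult_le_compat_l; auto).
    assert (mu * (Re ze + 1) = - (s * Im ze))%R by (unfold mu; field; lra).
    assert (Re ze * mu * t <= - (s * Im ze) * t)%R by (apply Rmult_le_compat_r; nra). unfold c4. lra. }
  destruct (nice_dom s (qm g w 0) p1 Hs Hp1 (nice_qm s 0 Hs)) as (K & D).
  apply (stieltjes_limit (fun t => Cexp (p1 * w) * CF w0 k sl s (qm g w 0) p1 t) (fun t => ze * (w - cu s t))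
    (fun u => ray_form s (p1 + RtoC u * ze)) _ (Cmod ze) e (c4 + 1) c (dominated_scal (Cexp (p1 * w)) _ _ D)); auto.
  - intros t Ht. apply ccont_mult; [apply ccont_const|]. apply ccont_minus; [apply ccont_const|now apply cur_cont].
  - intros x t Hx Ht. now apply cut_dist.
  - intros u Hu. eapply deriv_RC_cont. apply (line_deriv s (qm g w 0) p1 ze u); auto. now apply nice_qm.
  - intros u Hu. replace (p1 + RtoC u * ze) with (RtoC (- eps) + RtoC (T1 + u) * ze) by (unfold p1; rewrite RtoC_plus; ring).
    apply Rlt_le, L. lra.
  - intros x Hx Hx'. pose proof (stieltjes_formula s p1 ze x c4 Hs Hp1 Hi Hr ltac:(lra) Hc4 Hx) as F.
    assert (E : II (fun t => Cexp (p1 * w) * CF w0 k sl s (qm g w 0) p1 t * / (RtoC x - ze * (w - cu s t)))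
       = Cexp (p1 * w) * CL w0 k sl s (fun z => qm g w 0 z * / (RtoC x - ze * (w - z))) p1).
    { destruct (nice_dom s _ p1 Hs Hp1 (nice_cut s ze x Hs Hi Hr ltac:(lra))) as (K2 & D2).
      etransitivity; [|exact (II_scal (Cexp (p1 * w)) _ _ D2)]. symmetry. refine (II_ext _ _ _ (dominated_scal (Cexp (p1 * w)) _ _ D2) _).
      intros t Ht. unfold CF, Fint, cu. ring. }
    rewrite E. exact F.
Qed.

(** [LT_deriv] does not apply to [gn g 0], since z g(z) may be unbounded on H. For Re p < 0 a
    Lipschitz estimate on the half-line does it; elsewhere the branch integral tolerates polynomial
    growth. *)
Lemma LT_gn0_cont p : slit p -> contCC (LT w0 k sl (gn g 0)) p.
Proof.
  intros Hp. destruct (slit_cases p Hp) as [N|(s & Hs & N)].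
  - pose proof (Mpos H w0 g M Hw0 HM) as HMp. set (a := (- Re p / 2)%R). assert (Ha : (0 < a)%R) by (unfold a; lra).
    destruct (neg_weight w0 a Ha) as (K & HK & W).
    assert (Hb : forall z, H z -> (Cmod (gn g 0 z) <= M)%R) by (intros; now apply (gn_bounded H)).
    assert (Hh : hol H (gn g 0)) by now apply gn_hol.
    assert (Lip : forall p', (Cmod (p' - p) < a)%R -> (Cmod (LT w0 k sl (gn g 0) p' - LT w0 k sl (gn g 0) p) <= 6 * (2 * (M * K)) * Cmod (p' - p))%R).
    { intros p' Hp'. pose proof (re_le_Cmod (p' - p)) as R1. change (Re (p' - p)) with (Re p' - Re p)%R in R1.
      pose proof (Rle_abs (Re p' - Re p)). assert (R2 : (Re p' <= - a)%R) by (unfold a in *; lra). assert (R3 : (Re p <= - a)%R) by (unfold a; lra).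
      rewrite !LT_neg by lra.
      destruct (NF_dom H w0 Hdn HL Hw0 (gn g 0) M p Hh Hb N) as (K1 & D1).
      destruct (NF_dom H w0 Hdn HL Hw0 (gn g 0) M p' Hh Hb ltac:(lra)) as (K2 & D2).
      refine (Lap_lip _ _ (gn g 0) p p' K1 K2 _ D1 D2 _). intros t Ht. specialize (W t Ht).
      assert (Ee : forall p', (Re p' <= - a)%R -> (exp (- Re (p' * ncur w0 t)) <= exp (- (a * t)))%R).
      { intros p2 Hp2. rewrite Re_p_ncur by auto. apply exp_le. nra. }
      pose proof (Ee p R3). pose proof (Ee p' R2). pose proof (Hb _ (ncur_in H w0 Hdn Hw0 t)) as Hq.
      unfold ndcur. rewrite Cmod_opp, Cmod_1, Rmult_1_r.
      set (c := Cmod (ncur w0 t)) in *. assert (Hc : (0 <= c)%R) by apply Cmod_ge_0.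
      pose proof (exp_pos (- Re (p * ncur w0 t))). pose proof (exp_pos (- Re (p' * ncur w0 t))). pose proof (exp_pos (- (a * t))).
      apply Rle_trans with (M * (1 + c ^ 2) * (2 * exp (- (a * t))))%R.
      - apply Rmult_le_compat; try lra. apply Rmult_le_pos; auto. apply Cmod_ge_0. apply Rmult_le_compat; auto. apply Cmod_ge_0. nra.
      - replace (2 * (M * K) * Dom t)%R with (2 * M * (K * Dom t))%R by ring.
        replace (M * (1 + c ^ 2) * (2 * exp (- (a * t))))%R with (2 * M * ((1 + c ^ 2) * exp (- (a * t))))%R by ring.
        apply Rmult_le_compat_l; lra. }
    intros e He. set (B := (6 * (2 * (M * K)) + 1)%R). assert (HB : (1 <= B)%R) by (unfold B; assert (0 <= M * K)%R by (now apply Rmult_le_pos); lra).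
    exists (Rmin a (e / B)). split; [apply Rmin_glb_lt; auto; apply Rdiv_lt_0_compat; lra|]. intros p' Hp'.
    pose proof (Rlt_le_trans _ _ _ Hp' (Rmin_l _ _)) as Z1. pose proof (Rlt_le_trans _ _ _ Hp' (Rmin_r _ _)) as Z2.
    eapply Rle_lt_trans; [now apply Lip|]. apply (Rmult_lt_compat_l B) in Z2; [|lra].
    replace (B * (e / B))%R with e in Z2 by (field; lra). pose proof (Cmod_ge_0 (p' - p)). unfold B in Z2. lra.
  - destruct (nice_gn s 0 Hs) as (Q1 & B & n & Q2).
    eapply (deriv_CC_cont _ p). apply (deriv_CC_ext_loc (CL w0 k sl s (gn g 0)) _ _ _ (- (s * Im p))); [lra| |].
    + intros z' Hz'. rewrite (LT_gn_curve 0 s); auto.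
      pose proof (Im_le_Cmod (z' - p)) as I1. change (Im (z' - p)) with (Im z' - Im p)%R in I1.
      pose proof (Rle_abs (s * (Im z' - Im p))) as I2. rewrite Rabs_mult, (sgn_abs s), Rmult_1_l in I2 by auto. lra.
    + now apply (CL_deriv w0 k sl Hw Hk HS s (gn g 0) B n).
Qed.

(** * One ray of the contour *)

Section Ray.
Variables (s eps : R) (ze : C).
Hypothesis Hs : (s * s = 1)%R.
Hypothesis Heps : (0 < eps)%R.
Hypothesis Hi : (s * Im ze < 0)%R.
Hypothesis Hr : (0 <= Re ze)%R.

Let pt (t : R) : C := RtoC (- eps) + RtoC t * ze.
Let F (t : R) : C := ze * (laplace H w0 g (pt t) * Cexp (pt t * w)).

Lemma pt_parts t : Re (pt t) = (- eps + t * Re ze)%R /\ Im (pt t) = (t * Im ze)%R.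
Proof. unfold pt, Re, Im; simpl. split; ring. Qed.

Lemma pt_slit t : slit (pt t).
Proof.
  destruct (pt_parts t) as [E1 E2]. intros [I1 R1]. rewrite E1 in R1. rewrite E2 in I1.
  apply Rmult_integral in I1. destruct I1 as [-> |I1]; [lra|]. rewrite I1 in Hi. lra.
Qed.

Lemma pt_cont t : ccont pt t.
Proof. eapply deriv_RC_cont, deriv_RC_id_mult. Qed.

Lemma ray_cont t : ccont F t.
Proof.
  apply ccont_mult; [apply ccont_const|]. apply ccont_mult.
  - apply (ccont_ext (fun t => LT w0 k sl (gn g 0) (pt t))). { intros u. symmetry. apply laplace_gn, pt_slit. }
    apply (ccont_comp (LT w0 k sl (gn g 0)) pt); [apply pt_cont|apply LT_gn0_cont, pt_slit].
  - apply ccont_Cexp, ccont_mult; [apply pt_cont|apply ccont_const].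
Qed.

Lemma pt_side t : (0 < t)%R -> (s * Im (pt t) < 0)%R.
Proof. intros Ht. destruct (pt_parts t) as [_ ->]. nra. Qed.

Lemma ray_prim_right_cont : forall e, (0 < e)%R -> exists d, (0 < d)%R /\ forall t, (0 < t < d)%R -> (Cmod (ray_prim s (pt t) - ray_prim s (pt 0)) < e)%R.
Proof.
  intros e He.
  assert (CP : ccont (fun t => slit_part (pt t)) 0).
  { apply (ccont_comp slit_part pt); [apply pt_cont|]. eapply deriv_CC_cont, slit_part_deriv, pt_slit. }
  assert (CA : ccont (fun t => Cexp (pt t * w)) 0) by (apply ccont_Cexp, ccont_mult; [apply pt_cont|apply ccont_const]).
  (* With tau = 0 this estimate asks for decay of order 3, which q_3 has; it then reaches the real
     point - eps. *)
  destruct (CL_lip w0 k sl Hw Hk HS s (qm g w 3) _ 2 0 Hs (qm_cont H w0 k sl g Hk HL Hw0 HC Hg w Wx Wstar s 3 Hs)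
    (qm_decay H w0 k sl g M Hk HL Hw0 HC HM w Wx Wstar s 3 Hs) (Rle_refl 0) ltac:(simpl; lra)) as (K & HK).
  set (c0 := CL w0 k sl s (qm g w 3) (pt 0)). set (A0 := Cexp (pt 0 * w)).
  pose proof (Cmod_ge_0 c0) as Hc0. pose proof (Cmod_ge_0 A0) as HA0. pose proof (Rabs_pos K) as HKp. pose proof (Cmod_ge_0 ze) as Hze.
  destruct (CP (e / 3)%R ltac:(lra)) as (d1 & Hd1 & L1).
  destruct (CA (Rmin 1 (e / (3 * (Cmod c0 + 1))))) as (d2 & Hd2 & L2). { apply Rmin_glb_lt; [lra|]. apply Rdiv_lt_0_compat; lra. }
  set (B := ((Cmod A0 + 1) * (Rabs K * Cmod ze) + 1)%R). assert (HB : (1 <= B)%R) by (unfold B; assert (0 <= (Cmod A0 + 1) * (Rabs K * Cmod ze))%R by (repeat apply Rmult_le_pos; lra); lra).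
  set (d3 := (e / (3 * B))%R). assert (Hd3 : (0 < d3)%R) by (apply Rdiv_lt_0_compat; lra).
  (* For t < d4 the ray has not left Re p <= 0, the range of the Lipschitz estimate. *)
  set (d4 := (eps / (Re ze + 1))%R). assert (Hd4 : (0 < d4)%R) by (apply Rdiv_lt_0_compat; lra).
  exists (Rmin (Rmin d1 d2) (Rmin d3 d4)). split; [repeat apply Rmin_glb_lt; auto|]. intros t [Ht0 Ht].
  pose proof (Rlt_le_trans _ _ _ Ht (Rmin_l _ _)) as Ta. pose proof (Rlt_le_trans _ _ _ Ht (Rmin_r _ _)) as Tb.
  pose proof (Rlt_le_trans _ _ _ Ta (Rmin_l _ _)) as T1. pose proof (Rlt_le_trans _ _ _ Ta (Rmin_r _ _)) as T2.
  pose proof (Rlt_le_trans _ _ _ Tb (Rmin_l _ _)) as T3. pose proof (Rlt_le_trans _ _ _ Tb (Rmin_r _ _)) as T4.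
  specialize (L1 t ltac:(rewrite Rminus_0_r, Rabs_pos_eq; lra)). specialize (L2 t ltac:(rewrite Rminus_0_r, Rabs_pos_eq; lra)).
  pose proof (Rlt_le_trans _ _ _ L2 (Rmin_l _ _)) as L2a. pose proof (Rlt_le_trans _ _ _ L2 (Rmin_r _ _)) as L2b.
  assert (LK : (Cmod (CL w0 k sl s (qm g w 3) (pt t) - c0) <= Rabs K * (t * Cmod ze))%R).
  { destruct (pt_parts t) as [E1 E2]. destruct (pt_parts 0) as [E3 E4].
    eapply Rle_trans; [apply HK|].
    - rewrite E3. lra.
    - rewrite E1. apply (Rmult_lt_compat_r (Re ze + 1)) in T4; [|lra]. unfold d4 in T4. replace (eps / (Re ze + 1) * (Re ze + 1))%R with eps in T4 by (field; lra). lra.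
    - rewrite E4. lra.
    - rewrite E2. nra.
    - replace (pt t - pt 0) with (RtoC t * ze) by (unfold pt; ring). rewrite Cmod_mult, Cmod_R, (Rabs_pos_eq t) by lra.
      apply Rmult_le_compat_r; [apply Rmult_le_pos; lra|apply Rle_abs]. }
  unfold ray_prim, branch_part. fold c0 A0. set (At := Cexp (pt t * w)) in *. set (ct := CL w0 k sl s (qm g w 3) (pt t)) in *.
  replace (slit_part (pt t) + At * ct - (slit_part (pt 0) + A0 * c0)) with ((slit_part (pt t) - slit_part (pt 0)) + (At * (ct - c0) + (At - A0) * c0)) by ring.
  eapply Rle_lt_trans; [apply Cmod_triangle|]. pose proof (Cmod_triangle (At * (ct - c0)) ((At - A0) * c0)) as Tr. rewrite !Cmod_mult in Tr.
  assert (HAt : (Cmod At <= Cmod A0 + 1)%R). { pose proof (Cmod_triangle_rev At A0). fold A0 in L2a. lra. }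
  assert (B1 : (Cmod At * Cmod (ct - c0) <= e / 3)%R).
  { apply Rle_trans with ((Cmod A0 + 1) * (Rabs K * (t * Cmod ze)))%R; [apply Rmult_le_compat; auto; apply Cmod_ge_0|].
    apply Rle_trans with (B * t)%R; [unfold B; nra|]. apply (Rmult_lt_compat_l B) in T3; [|lra]. unfold d3 in T3. replace (B * (e / (3 * B)))%R with (e / 3)%R in T3 by (field; lra). lra. }
  assert (B2 : (Cmod (At - A0) * Cmod c0 < e / 3)%R).
  { fold A0 in L2b. apply (Rmult_lt_compat_r (Cmod c0 + 1)) in L2b; [|lra]. replace (e / (3 * (Cmod c0 + 1)) * (Cmod c0 + 1))%R with (e / 3)%R in L2b by (field; lra).
    pose proof (Cmod_ge_0 (At - A0)). lra. }
  lra.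
Qed.

Lemma ray_int T : (0 <= T)%R -> CInt F 0 T = ray_prim s (pt T) - ray_prim s (pt 0).
Proof.
  intros HT. apply (CInt_FTC0 (fun t => ray_prim s (pt t)) F T HT).
  - intros t Ht. unfold F. apply (deriv_RC_comp (ray_prim s) pt); [apply deriv_RC_id_mult|]. apply ray_prim_deriv; auto. apply pt_side; lra.
  - intros t _. apply ray_cont.
  - apply ray_prim_right_cont.
Qed.

(** Whatever the mode of convergence, a value l of the integral means that [ray_prim] tends to l +
    [ray_prim s (pt 0)] along the ray, and [ray_form_limit_zero] leaves 0 as the only possible
    limit. *)
Lemma ray_limit l : is_II F l -> l = - ray_prim s (RtoC (- eps)).
Proof.
  intros Hl. assert (E0 : pt 0 = RtoC (- eps)) by (unfold pt; ring).
  enough (E : l + ray_prim s (pt 0) = 0) by (rewrite <- E0; replace l with (l + ray_prim s (pt 0) - ray_prim s (pt 0)) by ring; rewrite E; ring).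
  apply (ray_form_limit_zero s eps ze _ Hs Hi Hr). intros e He. destruct (Hl e He) as (T0 & HT0 & L). exists (Rmax 1 T0). intros T HT.
  pose proof (Rmax_l 1 T0). pose proof (Rmax_r 1 T0). specialize (L T ltac:(lra)). rewrite ray_int in L by lra.
  change (RtoC (- eps) + RtoC T * ze) with (pt T). rewrite <- (ray_prim_form s (pt T) Hs) by (apply pt_side; lra).
  replace (ray_prim s (pt T) - (l + ray_prim s (pt 0))) with (ray_prim s (pt T) - ray_prim s (pt 0) - l) by ring. exact L.
Qed.

Lemma ray_exists : (forall t, (0 <= t)%R -> (Re (ze * (w - cu s t)) <= -1)%R) -> is_II F (- ray_prim s (RtoC (- eps))).
Proof.
  intros Hc. assert (E0 : pt 0 = RtoC (- eps)) by (unfold pt; ring). rewrite <- E0.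
  destruct (growth s (qm g w 0) (pt 1) ze (-1) Hs (pt_side 1 ltac:(lra)) (nice_qm s 0 Hs) Hc) as (K & HK & G).
  intros e He. destruct (lin_exp_small K 0 1 HK (Rle_refl 0) Rlt_0_1 e He) as (T0 & HT0 & L). exists (T0 + 1)%R. split; [lra|]. intros T HT.
  rewrite ray_int by lra. replace (ray_prim s (pt T) - ray_prim s (pt 0) - - ray_prim s (pt 0)) with (ray_prim s (pt T)) by ring.
  rewrite ray_prim_form by (auto; apply pt_side; lra). specialize (G (T - 1)%R ltac:(lra)). specialize (L (T - 1)%R ltac:(lra)).
  replace (pt 1 + RtoC (T - 1) * ze) with (pt T) in G by (unfold pt; rewrite RtoC_minus; ring).
  eapply Rle_lt_trans; [apply G|]. eapply Rle_lt_trans; [|apply L]. right. rewrite Rmult_0_l, Rplus_0_r. f_equal. f_equal. ring.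
Qed.
End Ray.

(** By [Psi_deriv] the derivative of this jump is a multiple of the jump of the transform of
    [gn g 3], which vanishes for t <= 0 by [gamma_cauchy]: to the left of 0 there is no cut. So the
    contour may start at any - eps. *)
Lemma jump_const x : (x <= 0)%R -> branch_part 1 (RtoC x) - branch_part (-1) (RtoC x) = Psi_jump w0 k sl g w 3 0.
Proof.
  intros Hx. pose proof (Mpos H w0 g M Hw0 HM) as HMp.
  assert (E : (Cmod (Psi_jump w0 k sl g w 3 0 - Psi_jump w0 k sl g w 3 x) <= 0 * (0 - x))%R).
  { apply (mvt_RC (Psi_jump w0 k sl g w 3) (fun _ => 0)); auto.
    - intros t Ht.
      replace (RtoC 0) with (RtoC (-1) ^ 3 * w ^ 3 * Cexp (RtoC t * w) * CL w0 k sl 1 (gn g 3) (RtoC t) + - (1) * (RtoC (-1) ^ 3 * w ^ 3 * Cexp (RtoC t * w) * CL w0 k sl (-1) (gn g 3) (RtoC t))).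
      + apply (deriv_RC_ext (fun t => Psi w0 k sl g w 1 3 t + - (1) * Psi w0 k sl g w (-1) 3 t)). { intros; unfold Psi_jump; ring. }
        apply deriv_RC_plus; [|apply deriv_RC_scal]; apply (Psi_deriv H w0 k sl g M); auto; try (simpl; nra); lra.
      + rewrite (gamma_cauchy H w0 k sl Hk HS HN HL Hw0 HC (gn g 3) M 1 M t); auto; try lra; [ring|now apply gn_hol| |].
        * intros z Hz Hz1. eapply Rle_trans; [apply (gn_bound H g M); auto|]. apply Rmult_le_compat_l; auto.
          apply Rinv_le_contravar; [apply pow_lt; lra|]. simpl. nra.
        * intros s Hs. destruct (gn_decay H w0 k sl g M HL Hw0 HC HM s 3 Hs) as [_ Dc]. split; auto. intros u Hu.
          eapply Rle_trans; [now apply Dc|]. pose proof (cur_mod_ge1 w0 k sl Hw Hk s u Hs). apply Rmult_le_compat_l; auto.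
          apply Rinv_le_contravar; [apply pow_lt; lra|]. simpl. nra.
    - intros. rewrite Cmod_0. lra. }
  rewrite Rmult_0_l in E. change (branch_part 1 (RtoC x) - branch_part (-1) (RtoC x)) with (Psi_jump w0 k sl g w 3 x).
  apply C_small_eq. intros e He. rewrite Cmod_sub_sym. lra.
Qed.

Lemma gamma_adm_dir eps v : gamma_adm eps v -> (0 < eps)%R /\ (0 < Im v)%R /\ (0 <= Re v)%R.
Proof.
  intros (He & Hv & Hc). split; auto. apply Cmod_gt_0 in Hv. unfold Carg in Hc.
  pose proof (acos_bound (Re v / Cmod v)) as Hb. destruct Rle_dec as [Hi|Hi]; [|lra].
  assert (Hr : (-1 <= Re v / Cmod v <= 1)%R).
  { apply Rabs_le_between. unfold Rdiv. rewrite Rabs_mult, Rabs_inv, (Rabs_pos_eq (Cmod v)) by lra.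
    apply (Rmult_le_reg_r (Cmod v)); auto. rewrite Rmult_assoc, Rinv_l, Rmult_1_r, Rmult_1_l by lra. apply re_le_Cmod. }
  assert (Hx : (0 <= Re v / Cmod v)%R). { rewrite <- (cos_acos (Re v / Cmod v)) by lra. apply cos_ge_0; lra. }
  assert (HRe : (0 <= Re v)%R). { replace (Re v) with (Re v / Cmod v * Cmod v)%R by (field; lra). apply Rmult_le_pos; lra. }
  split; auto. destruct Hi as [Hi|Hi]; auto. exfalso.
  assert (E : Cmod v = Re v). { pose proof (Cmod_sq v) as SQ. rewrite <- Hi in SQ. apply Rsqr_inj; auto; unfold Rsqr; lra. }
  rewrite E in Hc. rewrite E in Hv. unfold Rdiv in Hc. rewrite Rinv_r, acos_1 in Hc by lra. lra.
Qed.

Lemma gamma_adm_of eps v : (0 < eps)%R -> (0 < Re v)%R -> (0 < Im v)%R -> gamma_adm eps v.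
Proof.
  intros He Hr Hi. assert (Hv : v <> 0). { intros ->. simpl in Hi. lra. }
  split; [|split]; auto. apply Cmod_gt_0 in Hv. unfold Carg. destruct Rle_dec; [|lra].
  assert (Hlt : (Re v < Cmod v)%R). { pose proof (Cmod_sq v). assert (0 < Im v * Im v)%R by (apply Rmult_lt_0_compat; auto). nra. }
  assert (Hx : (0 < Re v / Cmod v < 1)%R).
  { split; [apply Rdiv_lt_0_compat; auto|]. apply (Rmult_lt_reg_r (Cmod v)); auto. replace (Re v / Cmod v * Cmod v)%R with (Re v) by (field; lra). lra. }
  pose proof (acos_bound_lt (Re v / Cmod v) ltac:(lra)) as Hb. split; [lra|].
  apply Rnot_lt_le. intros Hgt. pose proof (cos_lt_0 _ Hgt ltac:(pose proof PI_RGT_0; lra)) as Hn. rewrite cos_acos in Hn by lra. lra.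
Qed.

(** The incoming ray lies in Im p > 0 and belongs to s = -1, the outgoing one to s = 1. The two
    values of the primitive at - eps share [slit_part], which cancels, and the jump of [branch_part]
    remains. *)
Lemma gamma_value eps v l : gamma_adm eps v -> is_gamma_int eps v (laplace H w0 g) w l -> l = 1 / (2 * Ci * PI) * (- Psi_jump w0 k sl g w 3 0).
Proof.
  intros Ha (lin & lout & Hin & Hout & ->). destruct (gamma_adm_dir eps v Ha) as (He & Hvi & Hvr).
  apply is_RInt_gen_is_II in Hin. apply is_RInt_gen_is_II in Hout.
  rewrite (ray_limit (-1) eps v ltac:(lra) He ltac:(lra) Hvr lin Hin).
  rewrite (ray_limit 1 eps (Cconj v) ltac:(lra) He ltac:(unfold Cconj, Im in *; simpl; lra) ltac:(unfold Cconj, Re in *; simpl; lra) lout Hout).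
  rewrite <- (jump_const (- eps)) by lra. unfold ray_prim, Cdiv. ring.
Qed.

Hypothesis Wk : (Re w <= - (4 * k + 4))%R.

(** With N = |Re w| + |Im w| and slope 2k / N, the term in Im w costs at most 2k. Up to height N,
    [Wstar] leaves Re w / 2 + 2k; above N the curve recedes by at most k (t - N) / N, half of what
    the slope gains. The condition Re w <= - (4k + 4) does the rest. *)
Lemma exists_dir s t : (s * s = 1)%R -> (0 <= t)%R ->
  (Re ((1%R, (- s * (2 * k / (Rabs (Re w) + Rabs (Im w))))%R) * (w - cu s t)) <= -1)%R.
Proof.
  intros Hs Ht. set (N := (Rabs (Re w) + Rabs (Im w))%R). pose proof (Rabs_pos (Im w)) as HI.
  assert (HN1 : (2 <= N)%R) by (unfold N; rewrite (Rabs_left1 (Re w)); lra).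
  set (tau := (2 * k / N)%R). assert (Htau : (0 < tau)%R) by (apply Rdiv_lt_0_compat; lra).
  replace (Re ((1%R, (- s * tau)%R) * (w - cu s t))) with (Re w - Xc w0 k sl t + tau * (s * Im w) - (s * s) * (tau * t))%R.
  2: { unfold cu, cur, Re, Im; simpl. ring. }
  rewrite Hs, Rmult_1_l.
  assert (HIm : (tau * (s * Im w) <= 2 * k)%R).
  { apply Rle_trans with (tau * N)%R; [|right; unfold tau; field; lra]. apply Rmult_le_compat_l; [lra|].
    eapply Rle_trans; [apply Rle_abs|]. rewrite Rabs_mult, (sgn_abs s Hs). unfold N. pose proof (Rabs_pos (Re w)). lra. }
  fold N in Wstar. assert (Hta : (0 <= tau * t)%R) by (apply Rmult_le_pos; lra).
  destruct (Rle_dec t N) as [L|L].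
  - assert (Xc w0 k sl N <= Xc w0 k sl t)%R by (apply Xc_mono; auto; rewrite !Rabs_pos_eq; lra). lra.
  - apply Rnot_le_lt in L.
    assert (HX : (Xc w0 k sl N - k * ((t - N) / N) <= Xc w0 k sl t)%R).
    { unfold Xc.
      assert (SN : (0 < sl * sl * (N * N))%R) by (repeat apply Rmult_lt_0_compat; lra).
      assert (E1 : (1 + sl * sl * (t * t) <= (1 + sl * sl * (N * N)) * ((t / N) * (t / N)))%R).
      { assert (1 <= t / N)%R. { apply (Rmult_le_reg_r N); [lra|]. replace (t / N * N)%R with t by (field; lra). lra. }
        replace (sl * sl * (t * t))%R with (sl * sl * (N * N) * ((t / N) * (t / N)))%R by (field; lra). nra. }
      assert (Pt : (0 < t / N)%R) by (apply Rdiv_lt_0_compat; lra).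
      assert (E2 : (ln (1 + sl * sl * (t * t)) <= ln (1 + sl * sl * (N * N)) + 2 * ((t - N) / N))%R).
      { apply Rle_trans with (ln ((1 + sl * sl * (N * N)) * ((t / N) * (t / N)))).
        - apply ln_le; auto. assert (0 <= sl * sl * (t * t))%R by (apply Rmult_le_pos; nra). lra.
        - rewrite !ln_mult by (try lra; now apply Rmult_lt_0_compat). pose proof (ln_le_sub1 (t / N) Pt).
          replace ((t - N) / N)%R with (t / N - 1)%R by (field; lra). lra. }
      assert (k / 2 * ln (1 + sl * sl * (t * t)) <= k / 2 * (ln (1 + sl * sl * (N * N)) + 2 * ((t - N) / N)))%R by (apply Rmult_le_compat_l; lra).
      lra. }
    assert (Et : (tau * t = 2 * (k * ((t - N) / N)) + 2 * k)%R) by (unfold tau; field; lra).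
    assert (0 <= k * ((t - N) / N))%R by (apply Rmult_le_pos; [lra|]; apply Rdiv_le_0_compat; lra). lra.
Qed.

Lemma inv_laplace : is_inv_laplace (laplace H w0 g) w (1 / (2 * Ci * PI) * (- Psi_jump w0 k sl g w 3 0)).
Proof.
  split; [|intros eps v l; apply gamma_value].
  set (tau := (2 * k / (Rabs (Re w) + Rabs (Im w)))%R).
  assert (Htau : (0 < tau)%R). { apply Rdiv_lt_0_compat; [lra|]. pose proof (Rabs_pos (Im w)). rewrite (Rabs_left1 (Re w)); lra. }
  set (v := (1%R, tau) : C). exists 1%R, v.
  assert (Ha : gamma_adm 1 v) by (apply gamma_adm_of; simpl; lra). split; auto.
  assert (Hray : forall (s : R) (ze : C), (s * s = 1)%R -> ze = (1%R, (- s * tau)%R) -> is_ray_int (fun p => laplace H w0 g p * Cexp (p * w)) (RtoC (- (1))) ze (- ray_prim s (RtoC (- (1))))).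
  { intros s ze Hs ->. assert (Hi : (s * Im (1%R, (- s * tau)%R) < 0)%R) by (simpl; nra). assert (Hr : (0 <= Re (1%R, (- s * tau)%R))%R) by (simpl; lra).
    apply is_II_is_RInt_gen.
    - intros t _. apply (ray_cont s 1 _ Rlt_0_1 Hi).
    - apply (ray_exists s 1 _ Hs Rlt_0_1 Hi Hr). intros t Ht. now apply exists_dir. }
  assert (G : is_gamma_int 1 v (laplace H w0 g) w ((- ray_prim 1 (RtoC (- (1))) - - ray_prim (-1) (RtoC (- (1)))) / (2 * Ci * PI))).
  { exists (- ray_prim (-1) (RtoC (- (1)))), (- ray_prim 1 (RtoC (- (1)))). split; [|split]; auto.
    - apply Hray; [lra|]. unfold v. f_equal. ring.
    - apply Hray; [lra|]. unfold v, Cconj. simpl. f_equal. ring. }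
  rewrite <- (gamma_value 1 v _ Ha G). exact G.
Qed.

End FixW.
End Inverse.

(** * Choice of the neighborhood *)

(** One smallness condition on |w|^4 e^(Re w / (2k)) yields everything. The first entry of [delta]
    brings the ratio of the series below 1/2; the second turns 1 + sl^2 N^2 <= 3 sl^2 |w|^4 into a
    bound on the logarithm in [Xc], so that the curve at height N is still right of Re w / 4. *)
Lemma Hlog_admissible (w0 k sl : R) : (0 < k)%R -> (1 <= sl)%R -> exists A, forall w, Hlog A (16 * k) w ->
  (Re w <= -2)%R /\ (Re w <= - (4 * k + 4))%R /\ (Re w / 2 <= Xc w0 k sl (Rabs (Re w) + Rabs (Im w)))%R /\
  (Cmod w ^ 4 * step_ratio w0 k sl w <= 1 / 2)%R.
Proof.
  intros Hk HS. set (c := ((Rabs w0 + k * ln sl) / (2 * k))%R).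
  set (delta := Rmin (exp (- c) / 2) (exp (2 * w0 / k) / (3 * (sl * sl)))).
  assert (HSS : (1 <= sl * sl)%R) by nra.
  assert (Hdelta : (0 < delta)%R).
  { pose proof (exp_pos (- c)). pose proof (exp_pos (2 * w0 / k)). apply Rmin_glb_lt; apply Rdiv_lt_0_compat; lra. }
  destruct (Hlog_small k delta (4 * k + 4) Hk Hdelta) as (A & HA). exists A. intros w Hw. destruct (HA w Hw) as [B1 B2].
  assert (Hx : (Re w <= -2)%R) by lra. split; auto. split; auto.
  pose proof (exp_pos (Re w / (2 * k))) as HE.
  assert (Hm : (1 <= Cmod w)%R). { eapply Rle_trans; [|apply re_le_Cmod]. rewrite Rabs_left1; lra. }
  split.
  - set (N := (Rabs (Re w) + Rabs (Im w))%R). unfold Xc.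
    assert (Hd2 : (3 * (sl * sl) * delta <= exp (2 * w0 / k))%R).
    { apply Rle_trans with (3 * (sl * sl) * (exp (2 * w0 / k) / (3 * (sl * sl))))%R; [apply Rmult_le_compat_l; [lra|apply Rmin_r]|right; field; lra]. }
    assert (HN : (N * N <= 2 * (Cmod w * Cmod w))%R).
    { rewrite Cmod_sq. unfold N. assert (Rabs (Re w) * Rabs (Re w) = Re w * Re w)%R by (rewrite <- Rabs_mult; apply Rabs_pos_eq, Rle_0_sqr).
      assert (Rabs (Im w) * Rabs (Im w) = Im w * Im w)%R by (rewrite <- Rabs_mult; apply Rabs_pos_eq, Rle_0_sqr).
      pose proof (Rle_0_sqr (Rabs (Re w) - Rabs (Im w))). unfold Rsqr in *. nra. }
    assert (H4 : (Cmod w * Cmod w <= Cmod w ^ 4)%R).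
    { replace (Cmod w ^ 4)%R with ((Cmod w * Cmod w) * (Cmod w * Cmod w))%R by ring. assert (1 <= Cmod w * Cmod w)%R by nra. nra. }
    assert (H1 : (1 + sl * sl * (N * N) <= 3 * (sl * sl) * Cmod w ^ 4)%R).
    { assert (sl * sl * (N * N) <= sl * sl * (2 * Cmod w ^ 4))%R by (apply Rmult_le_compat_l; lra). assert (1 <= Cmod w * Cmod w)%R by nra. nra. }
    assert (H2 : (Cmod w ^ 4 <= delta * exp (- (Re w / (2 * k))))%R).
    { rewrite exp_Ropp. apply (Rmult_le_reg_r (exp (Re w / (2 * k)))); auto. rewrite Rmult_assoc, Rinv_l by lra. lra. }
    assert (H3 : (1 + sl * sl * (N * N) <= exp (2 * w0 / k - Re w / (2 * k)))%R).
    { unfold Rminus. rewrite exp_plus. eapply Rle_trans; [apply H1|].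
      apply Rle_trans with (3 * (sl * sl) * (delta * exp (- (Re w / (2 * k)))))%R; [apply Rmult_le_compat_l; lra|].
      rewrite <- Rmult_assoc. apply Rmult_le_compat_r; auto. apply Rlt_le, exp_pos. }
    assert (HL : (ln (1 + sl * sl * (N * N)) <= 2 * w0 / k - Re w / (2 * k))%R).
    { rewrite <- (ln_exp (2 * w0 / k - Re w / (2 * k))). apply ln_le; auto. assert (0 <= sl * sl * (N * N))%R by (apply Rmult_le_pos; apply Rle_0_sqr). lra. }
    apply (Rmult_le_compat_l (k / 2)) in HL; [|lra].
    replace (k / 2 * (2 * w0 / k - Re w / (2 * k)))%R with (w0 - Re w / 4)%R in HL by (field; lra). lra.
  - unfold step_ratio. replace ((Re w + Rabs w0 + k * ln sl) / (2 * k))%R with (Re w / (2 * k) + c)%R by (unfold c; field; lra).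
    rewrite exp_plus, <- Rmult_assoc.
    apply Rle_trans with (delta * exp c)%R; [apply Rmult_le_compat_r; auto; apply Rlt_le, exp_pos|].
    apply Rle_trans with (exp (- c) / 2 * exp c)%R; [apply Rmult_le_compat_r; [apply Rlt_le, exp_pos|apply Rmin_l]|].
    right. rewrite exp_Ropp. field. apply Rgt_not_eq, exp_pos.
Qed.

Theorem theorem3 (a k : R) (H : C -> Prop) (w0 : R) (g : C -> C)
  (k_pos : (0 < k)%R)
  (H_log : log_nbhd a k H)
  (H_left : forall w, H w -> (Re w <= -1)%R)
  (H_w0 : H (RtoC w0))
  (g_E0 : E0 H g) :
  exists (a' k' : R) (H' : C -> Prop),
    log_nbhd a' k' H' /\
    converges_normally H' (int_term k (laplace H w0 g)) /\
    converges_normally H' (fun n => jump_term k (laplace H w0 g) (S n)) /\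
    forall w, H' w ->
      exists s, is_I1_Delta k (laplace H w0 g) w s /\
        is_inv_laplace (laplace H w0 g) w (1 / (2 * Ci * PI) * s).
Proof.
  destruct g_E0 as (G1 & (M & HM) & G2). assert (Hg : E0 H g) by (split; [|split]; eauto).
  destruct (curve_in a k H w0 k_pos H_log H_w0) as (Sc & HS & HC). pose proof (proj1 H_log) as HN.
  destruct (Hlog_admissible w0 k Sc k_pos HS) as (A & HA).
  (* Above height 1 the border of [Hlog A K] is A - K - K ln y, hence the first parameter. *)
  exists (A - 16 * k)%R, (16 * k)%R, (Hlog A (16 * k)). split; [apply Hlog_log; lra|].
  split; [|split].
  - exists (fun n => term_const k Sc M * (1 / 2) ^ n)%R. split; [apply ex_series_geom_half|].
    intros n w Hw. destruct (HA w Hw) as (B1 & B2 & B3 & B4). now apply int_term_bound.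
  - exists (fun n => term_const k Sc M * (1 / 2) ^ n)%R. split; [apply ex_series_geom_half|].
    intros n w Hw. destruct (HA w Hw) as (B1 & B2 & B3 & B4). now apply jump_term_bound.
  - intros w Hw. destruct (HA w Hw) as (B1 & B2 & B3 & B4). exists (- Psi_jump w0 k Sc g w 3 0). split.
    + now apply (series_sum H w0 k Sc g M).
    + now apply (inv_laplace H w0 k Sc g M).
Qed.
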